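(* Let $(X,\|\cdot\|)$ be a complex Banach space, let $(M_p)_{p\ge 0}$ be a sequence of positive real numbers with $M_0=1$ satisfying (M.1), (M.2) and (M.3'), and let $T\in \mathcal{D}'_{L^1}((M_p):X)$ (Beurling case, $*=(M_p)$), resp. $T\in \mathcal{D}'_{L^1}(\{M_p\}:X)$ (Roumieu case, $*=\{M_p\}$). Consider the following assertions: (i) There exist an ultradifferential operator $P(D)=\sum_{p=0}^{\infty}a_pD^p$ of class $(M_p)$, resp. of class $\{M_p\}$, and two functions $f,g\in AA(\mathbb{R}:X)$ such that $T=P(D)f+g$. (ii) For every real sequence $(b_n)$ there exist a subsequence $(a_n)$ of $(b_n)$ and a vector-valued ultradistribution $S\in\mathcal{D}'^{*}(X)$ such that $\lim_{n\to\infty}\langle T_{a_n},\varphi\rangle=\langle S,\varphi\rangle$ for all $\varphi\in\mathcal{D}^{*}$ and $\lim_{n\to\infty}\langle S_{-a_n},\varphi\rangle=\langle T,\varphi\rangle$ for all $\varphi\in\mathcal{D}^{*}$. (iii) For every real sequence $(b_n)$ there exists a subsequence $(a_n)$ of $(b_n)$ such that $\lim_{l\to\infty}\lim_{k\to\infty}\langle \tau_{-a_l}\tau_{a_k}T,\varphi\rangle=\langle T,\varphi\rangle$ for all $\varphi\in\mathcal{D}^{*}$. (iv) $T*\varphi\in AA(\mathbb{R}:X)$ for all $\varphi\in\mathcal{D}^{*}$. Then (i) $\Rightarrow$ (ii) $\Rightarrow$ (iii) $\Rightarrow$ (iv). Furthermore, if $(M_p)$ additionally satisfies (M.3), then the assertions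 (i)-(iv) are equivalent in the Beurling case.
   Context: Conditions on $(M_p)$: (M.1) $M_p^2\le M_{p+1}M_{p-1}$ for $p\in\mathbb{N}$; (M.2) there are $A,H>1$ with $M_p\le AH^p\sup_{0\le i\le p}M_iM_{p-i}$ for $p\in\mathbb{N}$; (M.3') $\sum_{p=1}^\infty M_{p-1}/M_p<\infty$; (M.3) $\sup_{p\in\mathbb{N}}\sum_{q=p+1}^\infty \frac{M_{q-1}M_{p+1}}{pM_pM_q}<\infty$. Almost automorphic functions: $AA(\mathbb{R}:X)$ is the space of continuous $f:\mathbb{R}\to X$ such that every real sequence $(b_n)$ has a subsequence $(a_n)$ for which there is a map $g:\mathbb{R}\to X$ with $\lim_n f(t+a_n)=g(t)$ and $\lim_n g(t-a_n)=f(t)$ pointwise for $t\in\mathbb{R}$. Test spaces: for compact $K\subseteq\mathbb{R}$ and $h>0$, $\mathcal{D}^{M_p,h}_K=\{\phi\in C^\infty(\mathbb{R}):\operatorname{supp}\phi\subseteq K,\ \|\phi\|_{M_p,h,K}:=\sup_{t\in K,\,p\in\mathbb{N}_0}h^p|\phi^{(p)}(t)|/M_p<\infty\}$. Put $\mathcal{D}^{(M_p)}_K=\operatorname{projlim}_{h\to\infty}\mathcal{D}^{M_p,h}_K$, $\mathcal{D}^{\{M_p\}}_K=\operatorname{indlim}_{h\to0}\mathcal{D}^{M_p,h}_K$ and $\mathcal{D}^{*}=\operatorname{indlim}_{K}\mathcal{D}^{*}_K$ over compact $K\subseteq\mathbb{R}$, where $*$ stands for $(M_p)$ (Beurling) or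 $\{M_p\}$ (Roumieu). $\mathcal{D}'^{*}(X)$ is the space of continuous linear maps $\mathcal{D}^{*}\to X$. A locally integrable function $f:\mathbb{R}\to X$ is identified with $\varphi\mapsto\int f\varphi\,dt$. Bounded ultradistributions: for $h>0$, $\mathcal{D}_{L^1}((M_p),h)$ is the Banach space of $f\in C^\infty(\mathbb{R})$ (complex-valued) with all derivatives in $L^1(\mathbb{R})$ and $\|f\|_{1,h}:=\sup_{p\in\mathbb{N}_0}h^p\|f^{(p)}\|_{L^1}/M_p<\infty$. Put $\mathcal{D}_{L^1}((M_p))=\operatorname{projlim}_{h\to+\infty}\mathcal{D}_{L^1}((M_p),h)$ and $\mathcal{D}_{L^1}(\{M_p\})=\operatorname{indlim}_{h\to0+}\mathcal{D}_{L^1}((M_p),h)$. $\mathcal{D}'_{L^1}((M_p):X)$, resp. $\mathcal{D}'_{L^1}(\{M_p\}:X)$, is the space of continuous linear maps from $\mathcal{D}_{L^1}((M_p))$, resp. $\mathcal{D}_{L^1}(\{M_p\})$, to $X$; by restriction to $\mathcal{D}^{*}$ its elements are regarded as elements of $\mathcal{D}'^{*}(X)$. Operations: for $T\in\mathcal{D}'^{*}(X)$ and $h\in\mathbb{R}$, $\tau_hT=T_h$ is defined by $\langle T_h,\varphi\rangle=\langle T,\varphi(\cdot-h)\rangle$, $\varphi\in\mathcal{D}^{*}$. For $\varphi\in\mathcal{D}^{*}$, $T*\varphi$ is the smooth $X$-valued function $(T*\varphi)(x)=\langle T,\varphi(x-\cdot)\rangle$. Ultradifferential operators: $P(D)=\sum_{p\ge0}a_pD^p$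 ($a_p\in\mathbb{C}$, $D=-i\,d/dx$) is of class $(M_p)$, resp. $\{M_p\}$, if there exist $l>0$ and $C>0$, resp. for every $l>0$ there exists $C>0$, such that $|a_p|\le Cl^p/M_p$ for all $p\in\mathbb{N}$. It acts on $\mathcal{D}'^{*}(X)$ by $\langle P(D)T,\varphi\rangle=\langle T,\sum_p(-1)^pa_pD^p\varphi\rangle$. Equality $T=P(D)f+g$ is in $\mathcal{D}'^{*}(X)$. *)

(* Defs.v *)
(* Stdlib reals with Coquelicot. *)
From Stdlib Require Import Reals List.
From Coquelicot Require Import Coquelicot.
Open Scope R_scope.

(** * Restriction of scalars

    Coquelicot integrates functions with values in modules over [R]; a complex
    Banach space is a module over [C].  [realify X] has the same points, norm
    and uniform structure as [X]; the real scalar [r] acts as [RtoC r]. *)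

Section Realify.

Variable X : CompleteNormedModule C_AbsRing.

Definition rscal (r : R) (x : X) : X := scal (RtoC r : C_AbsRing) x.

Lemma rscal_assoc (r s : R) (x : X) : rscal r (rscal s x) = rscal (mult r s) x.
Proof.
unfold rscal; rewrite scal_assoc; f_equal; symmetry; exact (RtoC_mult r s).
Qed.

Lemma rscal_one (x : X) : rscal one x = x.
Proof. exact (scal_one x). Qed.

Lemma rscal_distr_l (r : R) (x y : X) :
  rscal r (plus x y) = plus (rscal r x) (rscal r y).
Proof. exact (scal_distr_l (RtoC r : C_AbsRing) x y). Qed.

Lemma rscal_distr_r (r s : R) (x : X) :
  rscal (plus r s) x = plus (rscal r x) (rscal s x).
Proof.
refine (eq_trans _ (scal_distr_r (RtoC r : C_AbsRing) (RtoC s : C_AbsRing) x)).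
unfold rscal; f_equal; exact (RtoC_plus r s).
Qed.

Lemma norm_rscal (r : R) (x : X) : norm (rscal r x) <= abs r * norm x.
Proof.
eapply Rle_trans; [apply (norm_scal (RtoC r : C_AbsRing) x)|].
apply Req_le; f_equal; exact (Cmod_R r).
Qed.

Definition realify_ModuleSpace_mixin :=
  ModuleSpace.Mixin R_Ring X rscal
    rscal_assoc rscal_one rscal_distr_l rscal_distr_r.

Definition realify_ModuleSpace_class :=
  ModuleSpace.Class R_Ring X (AbelianGroup.class X) realify_ModuleSpace_mixin.

Definition realify_NormedModuleAux :=
  NormedModuleAux.Pack R_AbsRing X
    (NormedModuleAux.Class R_AbsRing X realify_ModuleSpace_class
       (UniformSpace.class X)) X.

Definition realify_NormedModule_mixin :=
  NormedModule.Mixin R_AbsRing realify_NormedModuleAux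
    (@norm C_AbsRing X) (@norm_factor C_AbsRing X)
    norm_triangle norm_rscal
    norm_compat1 norm_compat2
    norm_eq_zero.

Definition realify : CompleteNormedModule R_AbsRing :=
  CompleteNormedModule.Pack R_AbsRing X
    (CompleteNormedModule.Class R_AbsRing X
       (NormedModule.Class R_AbsRing X _ realify_NormedModule_mixin)
       (CompleteNormedModule.mixin _ X (CompleteNormedModule.class _ X))) X.

End Realify.

(** * Conditions on the weight sequence

    The conditions are indexed by [p = 1, 2, 3, ...]. *)

Definition condM1 (M : nat -> R) : Prop :=
  forall p, (1 <= p)%nat -> M p ^ 2 <= M (p + 1)%nat * M (p - 1)%nat.

Definition condM2 (M : nat -> R) : Prop :=
  exists A H, 1 < A /\ 1 < H /\ forall p, (1 <= p)%nat ->
    M p <= A * H ^ p *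
      real (Lub_Rbar (fun r => exists i, (i <= p)%nat /\ r = M i * M (p - i)%nat)).

Definition condM3' (M : nat -> R) : Prop :=
  ex_series (fun n => M n / M (S n)).

(* The inner sum runs over [q = p + 1 + k]. *)
Definition condM3 (M : nat -> R) : Prop :=
  exists B, forall p, (1 <= p)%nat ->
    let u k := M (p + k)%nat * M (p + 1)%nat
                 / (INR p * M p * M (p + 1 + k)%nat) in
    ex_series u /\ Series u <= B.

(** * Complex-valued functions of a real variable *)

Definition derivC (f : R -> C) (t : R) : C :=
  (Derive (fun s => Re (f s)) t, Derive (fun s => Im (f s)) t).

Definition derivC_n (p : nat) (f : R -> C) : R -> C := Nat.iter p derivC f.

Definition smooth (f : R -> C) : Prop :=
  forall p t, @ex_derive R_AbsRing C_R_NormedModule (derivC_n p f) t.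

Definition supp (f : R -> C) : R -> Prop := adherence (fun t => f t <> 0%C).

(* Used for continuous functions only, where the absolutely convergent improper
   Riemann integral is the Lebesgue integral. *)
Definition inL1 (f : R -> C) : Prop :=
  ex_RInt_gen (fun t => Cmod (f t)) (Rbar_locally m_infty) (Rbar_locally p_infty).

Definition normL1 (f : R -> C) : R :=
  RInt_gen (fun t => Cmod (f t)) (Rbar_locally m_infty) (Rbar_locally p_infty).

Definition CSeries (u : nat -> C) : C :=
  (Series (fun n => Re (u n)), Series (fun n => Im (u n))).

(** * Locally convex spaces of functions

    A space is given by its set of elements and by its neighbourhoods of 0; only
    the trace of a neighbourhood on [carrier] matters. *)

Record lcspace := LCSpace {
  carrier : (R -> C) -> Prop;
  nbhs0 : ((R -> C) -> Prop) -> Prop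
}.

Definition lincomb (a : C) (f : R -> C) (b : C) (g : R -> C) : R -> C :=
  fun t => (a * f t + b * g t)%C.

Definition abs_convex (V : (R -> C) -> Prop) : Prop :=
  forall f g a b, V f -> V g -> Cmod a + Cmod b <= 1 -> V (lincomb a f b g).

Definition normed_space (E : (R -> C) -> Prop) (N : (R -> C) -> Rbar) : lcspace :=
  let D f := E f /\ Rbar_lt (N f) p_infty in
  LCSpace D (fun U => exists eps : posreal,
                        forall f, D f -> Rbar_lt (N f) eps -> U f).

Definition projlim {I : Type} (F : I -> lcspace) : lcspace :=
  let D f := forall i, carrier (F i) f in
  LCSpace D (fun U => exists (l : list I) (V : I -> (R -> C) -> Prop),
                        (forall i, In i l -> nbhs0 (F i) (V i)) /\
                        forall f, D f -> (forall i, In i l -> V i f) -> U f).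

(* The finest locally convex topology making the inclusions of all the [F i]
   continuous. *)
Definition indlim {I : Type} (F : I -> lcspace) : lcspace :=
  let D f := exists i, carrier (F i) f in
  LCSpace D (fun U => exists V : (R -> C) -> Prop,
                        abs_convex V /\ (forall i, nbhs0 (F i) V) /\
                        forall f, D f -> V f -> U f).

(** * Test function spaces *)

Inductive udtype := Beurling | Roumieu.

Definition hlim (s : udtype) (F : posreal -> lcspace) : lcspace :=
  match s with Beurling => projlim F | Roumieu => indlim F end.

(* For empty [K] the supremum is [m_infty] and the space is {0}. *)
Definition norm_DK (M : nat -> R) (h : R) (K : R -> Prop) (f : R -> C) : Rbar :=
  Lub_Rbar (fun r => exists t p, K t /\ r = h ^ p * Cmod (derivC_n p f t) / M p).

Definition DKh (M : nat -> R) (K : R -> Prop) (h : posreal) : lcspace :=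
  normed_space (fun f => smooth f /\ included (supp f) K) (norm_DK M h K).

Definition DK (s : udtype) (M : nat -> R) (K : R -> Prop) : lcspace :=
  hlim s (DKh M K).

Definition Dspace (s : udtype) (M : nat -> R) : lcspace :=
  indlim (fun K : {K : R -> Prop | compact K} => DK s M (proj1_sig K)).

Definition norm_DL1 (M : nat -> R) (h : R) (f : R -> C) : Rbar :=
  Lub_Rbar (fun r => exists p, r = h ^ p * normL1 (derivC_n p f) / M p).

Definition DL1h (M : nat -> R) (h : posreal) : lcspace :=
  normed_space (fun f => smooth f /\ forall p, inL1 (derivC_n p f)) (norm_DL1 M h).

Definition DL1 (s : udtype) (M : nat -> R) : lcspace := hlim s (DL1h M).

(** * Vector-valued ultradistributions *)

Section Ultradistributions.

Context {X : CompleteNormedModule C_AbsRing}.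

(* Maps on a space of functions are represented by maps on all functions, whose
   values outside the space are irrelevant.  The neighbourhoods of [f] are the
   translates by [f] of the neighbourhoods of 0. *)
Definition continuous_linear (E : lcspace) (T : (R -> C) -> X) : Prop :=
  (forall f g (a b : C), carrier E f -> carrier E g ->
     T (lincomb a f b g) = plus (scal (a : C_AbsRing) (T f))
                                (scal (b : C_AbsRing) (T g))) /\
  (forall f, carrier E f -> forall W : X -> Prop, locally (T f) W ->
     nbhs0 E (fun g => W (T (fun t => (f t + g t)%C)))).

Definition regular (f : R -> X) (phi : R -> C) : X :=
  @RInt_gen (realify X) (fun t => scal (phi t : C_AbsRing) (f t))
    (Rbar_locally m_infty) (Rbar_locally p_infty).

Definition translate (h : R) (T : (R -> C) -> X) (phi : R -> C) : X :=
  T (fun t => phi (t - h)).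

Definition convol (T : (R -> C) -> X) (phi : R -> C) (x : R) : X :=
  T (fun t => phi (x - t)).

(* [D = -i d/dx]. *)
Definition Dop (p : nat) (phi : R -> C) (t : R) : C :=
  (Cpow (- Ci) p * derivC_n p phi t)%C.

Definition udo (a : nat -> C) (T : (R -> C) -> X) (phi : R -> C) : X :=
  T (fun t => CSeries (fun p => (Cpow (- RtoC 1) p * a p * Dop p phi t)%C)).

Definition udo_class (s : udtype) (M : nat -> R) (a : nat -> C) : Prop :=
  let bound l c :=
    forall p, (1 <= p)%nat -> Cmod (a p) <= c * l ^ p / M p in
  match s with
  | Beurling => exists l c, 0 < l /\ 0 < c /\ bound l c
  | Roumieu => forall l, 0 < l -> exists c, 0 < c /\ bound l c
  end.

Definition tends (u : nat -> X) (x : X) : Prop :=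
  filterlim u eventually (locally x).

Definition subseq (a b : nat -> R) : Prop :=
  exists sigma : nat -> nat,
    (forall n, (sigma n < sigma (S n))%nat) /\ forall n, a n = b (sigma n).

Definition almost_automorphic (f : R -> X) : Prop :=
  (forall t, continuous f t) /\
  forall b : nat -> R, exists a, subseq a b /\
    exists g : R -> X, forall t,
      tends (fun n => f (t + a n)) (g t) /\ tends (fun n => g (t - a n)) (f t).

(** * The four assertions *)

Definition assertion_i (s : udtype) (M : nat -> R) (T : (R -> C) -> X) : Prop :=
  exists (a : nat -> C) (f g : R -> X),
    udo_class s M a /\ almost_automorphic f /\ almost_automorphic g /\
    forall phi, carrier (Dspace s M) phi ->
      T phi = plus (udo a (regular f) phi) (regular g phi).

Definition assertion_ii (s : udtype) (M : nat -> R) (T : (R -> C) -> X) : Prop :=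
  forall b : nat -> R, exists a, subseq a b /\
    exists S : (R -> C) -> X, continuous_linear (Dspace s M) S /\
      (forall phi, carrier (Dspace s M) phi ->
         tends (fun n => translate (a n) T phi) (S phi)) /\
      (forall phi, carrier (Dspace s M) phi ->
         tends (fun n => translate (- a n) S phi) (T phi)).

(* The iterated limit includes the existence of the inner limits [y l]. *)
Definition assertion_iii (s : udtype) (M : nat -> R) (T : (R -> C) -> X) : Prop :=
  forall b : nat -> R, exists a, subseq a b /\
    forall phi, carrier (Dspace s M) phi ->
      exists y : nat -> X,
        (forall l, tends (fun k => translate (- a l) (translate (a k) T) phi) (y l)) /\
        tends y (T phi).

Definition assertion_iv (s : udtype) (M : nat -> R) (T : (R -> C) -> X) : Prop :=
  forall phi, carrier (Dspace s M) phi -> almost_automorphic (convol T phi).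

End Ultradistributions.

(* Main.v *)
(** (i) -> (ii): an almost automorphic [f] is bounded, so along a subsequence the
    integrals of the translates of [f] against a fixed test function form a Cauchy
    sequence by dominated convergence.  (ii) -> (iii) is immediate, and
    (iii) -> (iv) is (iii) applied to the translates of a reflected test function.

    (iv) -> (i): [T] is bounded for the norm of [D_{L^1}((M_p), h)] for some [h].
    Put [lam_j = 8 h M_j / M_(j+1)] and let [E_j] be the average over [[0, lam_j]]
    with density proportional to [exp (- x / lam_j)].  Then
    [(1 + lam_j d/dx) E_j] is a multiple of [1 - rho tau_(lam_j)] with
    [rho = exp (-1)], a difference operator whose inverse, a Neumann series,
    preserves almost automorphy.  The infinite convolution of the [E_j] is the
    limit in [D_{L^1}((M_p), h)] of test functions [phi_N], obtained by replacing the
    [lam_j], [j >= N], by a summable sequence decaying more slowly than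
    [M_j / M_(j+1)].  By (iv) the functions [T * phi_N] are almost automorphic, and they
    converge uniformly; undoing the difference operators gives an almost
    automorphic [f] with [T = P(D) f], where [P(D) = Prod_j (1 + lam_j d/dx)].
    Condition (M.3) is what makes [P(D)] of class [(M_p)]. *)

Require Import Defs.
From Stdlib Require Import Reals List Lra Lia Psatz FunctionalExtensionality Classical ClassicalEpsilon.
From Coquelicot Require Import Coquelicot.
From mathcomp Require all_boot all_order all_algebra all_classical all_reals all_analysis.
From mathcomp Require Rstruct Rstruct_topology.
Open Scope R_scope.

(** The limit function of an almost automorphic [f] need not be continuous, so it is kept out of
    every Riemann integral: in (i) -> (ii) only the continuous functions
    [norm (minus (f (t + b)) (f (t + c)))] are integrated, and Lebesgue's theorem enters through one
    real-valued double limit. For (iv) -> (i), the obstacle is that (iv) speaks only of compactly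
    supported functions bounded at every scale. The fundamental solution of [1 + lam_j d/dx] is
    [exp (- x / lam_j) / lam_j] on a half-line; cutting it at [lam_j] gives compact support, and the
    price is the factor [1 - rho tau], invertible since [rho < 1]. The full convolution is
    controlled only at scales comparable to [h], whence the slower tails. The constant 8 is 4 times
    2: a derivative falling on an average costs [4 / lam_j] in L1, and the spare 2 leaves bounds
    [M_p 2^(-p)], which make high orders negligible. As [rho <= 1 / 2], undoing one difference
    operator moves an [L]-Lipschitz function by at most [L lam_j], so infinitely many inversions
    converge. *)

Module LebesgueLimit.
Import mathcomp.boot.all_boot mathcomp.order.all_order mathcomp.algebra.all_algebra.
Import all_classical all_reals all_analysis measurable_realfun.
Import Order.TTheory GRing.Theory Num.Theory numFieldNormedType.Exports.
Local Open Scope classical_set_scope.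
Local Open Scope ring_scope.

(** * Dominated convergence for double sequences of continuous functions *)

Section AbstractReals.
Variable R : realType.

(** Only epsilon-delta statements cross between the two developments of real analysis; this is the
    bridge for derivatives. *)
Lemma derivable_of_difference_quotient (F : R -> R) (x l : R) :
  (forall e : R, 0 < e -> exists d : R, 0 < d /\ forall h : R, h != 0 -> `|h| < d ->
     `|(F (x + h) - F x) / h - l| < e) ->
  derivable F x 1 /\ derive1 F x = l.
Proof.
move=> dF.
have H : (fun h => h^-1 *: (F (h + x) - F x)) @ (0:R)^' --> l.
  apply/cvgrPdist_lt => e e0.
  have [d [d0 Hd]] := dF e e0.
  near=> h.
  have h0 : h != 0 by near: h; exact: nbhs_dnbhs_neq.
  have hd : `|h| < d by near: h; apply: dnbhs0_lt.
  have := Hd h h0 hd.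
  by rewrite distrC [_ *: _]mulrC (addrC x).
split.
  apply/cvg_ex; exists l.
  move: H; set f1 := fun _ => _; set f2 := fun _ => _.
  suff -> : f1 = f2 by [].
  by rewrite funeqE => h; rewrite /f1 /f2 /= [h%:A]mulr1.
by rewrite /derive1; apply: cvg_lim H.
Unshelve. all: by end_near. Qed.

Lemma continuous_of_dist (f : R -> R) :
  (forall x e : R, 0 < e -> exists d : R, 0 < d /\ forall y : R, `|y - x| < d ->
     `|f y - f x| < e) -> continuous f.
Proof.
move=> cf x; apply/cvgrPdist_lt => e e0.
have [d [d0 Hd]] := cf x e e0.
near=> y; rewrite distrC; apply: Hd; rewrite distrC; near: y.
exact: cvgr_dist_lt.
Unshelve. all: by end_near. Qed.

(** Dominated convergence is applied twice, in [m] for fixed [n] and then in [n]; the pointwise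
    limits [v n] are merely measurable. The integral of [u n m] enters as an increment of a
    primitive [F n m], so the fundamental theorem of calculus spares a comparison of the Riemann and
    Lebesgue integrals. *)
Lemma double_dominated_limit_abstract (a b B : R) (u F : nat -> nat -> R -> R)
    (v : nat -> R -> R) :
  a < b ->
  (forall n m (x e : R), 0 < e -> exists d : R, 0 < d /\ forall h : R, h != 0 -> `|h| < d ->
     `|(F n m (x + h) - F n m x) / h - u n m x| < e) ->
  (forall n m (x e : R), 0 < e -> exists d : R, 0 < d /\ forall y : R, `|y - x| < d ->
     `|u n m y - u n m x| < e) ->
  (forall n m x, 0 <= u n m x <= B) ->
  (forall n (x e : R), 0 < e -> exists N, forall m, (N <= m)%N -> `|u n m x - v n x| < e) ->
  (forall x e : R, 0 < e -> exists N, forall n, (N <= n)%N -> `|v n x| < e) ->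
  forall e : R, 0 < e -> exists N, forall n, (N <= n)%N ->
    exists K, forall m, (K <= m)%N -> F n m b - F n m a <= e.
Proof.
move=> ab dF cu uB uv v0 e e0.
have cu' n m : continuous (u n m) by apply: continuous_of_dist; exact: cu.
have dF' n m x : derivable (F n m) x 1 /\ derive1 (F n m) x = u n m x.
  by apply: derivable_of_difference_quotient; exact: dF.
have cF n m : continuous (F n m).
  move=> x; have [+ _] := dF' n m x.
  by move=> /derivable1_diffP; exact: differentiable_continuous.
pose mu := (@lebesgue_measure R).
have FTC n m : (\int[mu]_(x in `[a, b]) (u n m x)%:E = (F n m b - F n m a)%:E)%E.
  rewrite EFinB; apply: continuous_FTC2 => //.
  - exact: continuous_subspaceT.
  - split.
    + by move=> x _; have [] := dF' n m x.
    + by apply: cvg_at_right_filter; exact: cF.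
    + by apply: cvg_at_left_filter; exact: cF.
  - by move=> x _; have [] := dF' n m x.
have B0 : 0 <= B by have /andP[] := uB 0 0 0; exact: le_trans.
have iB : mu.-integrable `[a, b] (fun _ => B%:E).
  by apply: continuous_compact_integrable; [exact: segment_compact|exact: cst_continuous].
have mu_ n m : measurable_fun (`[a, b] : set R) (fun x : R => ((u n m x)%:E : \bar R)).
  by apply/measurable_EFinP; apply: measurable_funTS; exact: continuous_measurable_fun.
have cv n x : (u n ^~ x) @ \oo --> v n x.
  apply/cvgrPdist_lt => d d0; have [N HN] := uv n x d d0.
  by exists N => // m /= Nm; rewrite distrC; exact: HN.
have cv0 x : (v ^~ x) @ \oo --> (0 : R).
  apply/cvgrPdist_lt => d d0; have [N HN] := v0 x d d0.
  by exists N => // m /= Nm; rewrite sub0r normrN; exact: HN.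
have vB n x : 0 <= v n x <= B.
  apply/andP; split.
    apply: (cvgr_to_ge (cv n x)).
    by exists 0%N => // m _; have /andP[] := uB n m x.
  apply: (cvgr_to_le (cv n x)).
  by exists 0%N => // m _; have /andP[] := uB n m x.
have mv n : measurable_fun (`[a, b] : set R) (fun x : R => ((v n x)%:E : \bar R)).
  apply: (emeasurable_fun_cvg (fun m x => (u n m x)%:E)) => //.
  by move=> x _; apply: cvg_EFin; [exact: nearW|exact: cv].
have absB (r : R) : 0 <= r <= B -> (`|r%:E| <= B%:E)%E.
  by move=> /andP[r0 rB]; rewrite abse_EFin lee_fin ger0_norm.
have Icv n : (\int[mu]_(x in `[a, b]) (u n m x)%:E)%E @[m --> \oo] -->
             (\int[mu]_(x in `[a, b]) (v n x)%:E)%E.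
  have uv_ae : {ae mu, forall x : R, `[a, b]%classic x ->
      (fun m => (u n m x)%:E) @ \oo --> (v n x)%:E}.
    by apply: aeW => x _; apply: cvg_EFin; [exact: nearW|exact: cv].
  have uB_ae : {ae mu, forall (x : R) m, `[a, b]%classic x -> (`|(u n m x)%:E| <= B%:E)%E}.
    by apply: aeW => x m _; apply: absB.
  by have [] := @dominated_convergence _ _ _ (@lebesgue_measure R) _ (measurable_itv _) _ _ _ (mu_ n) (mv n) uv_ae iB uB_ae.
have Icv0 : (\int[mu]_(x in `[a, b]) (v n x)%:E)%E @[n --> \oo] --> 0%E.
  have v_ae : {ae mu, forall x : R, `[a, b]%classic x ->
      (fun n => (v n x)%:E) @ \oo --> (0 : R)%:E}.
    by apply: aeW => x _; apply: cvg_EFin; [exact: nearW|exact: cv0].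
  have vB_ae : {ae mu, forall (x : R) n, `[a, b]%classic x -> (`|(v n x)%:E| <= B%:E)%E}.
    by apply: aeW => x m _; apply: absB.
  have [_ _] := @dominated_convergence _ _ _ (@lebesgue_measure R) _ (measurable_itv _)
    _ _ _ mv (measurable_cst (0 : R)%:E) v_ae iB vB_ae.
  by rewrite integral0.
have e0' : (0%E < e%:E)%E by rewrite lte_fin.
have [N _ HN] := Icv0 _ (open_ereal_lt' e0').
exists N => n Nn.
have [K _ HK] := Icv n _ (open_ereal_lt' (HN n Nn)).
exists K => m Km.
by have := HK m Km; rewrite /= FTC lte_fin => /ltW.
Qed.
End AbstractReals.

Import Rstruct Rstruct_topology.

Lemma double_dominated_limit_primitive (a b B : R) (u F : nat -> nat -> R -> R)
    (v : nat -> R -> R) :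
  Rlt a b ->
  (forall n m x, derivable_pt_lim (F n m) x (u n m x)) ->
  (forall n m x, continuity_pt (u n m) x) ->
  (forall n m x, Rle 0 (u n m x) /\ Rle (u n m x) B) ->
  (forall n x, Un_cv (fun m => u n m x) (v n x)) ->
  (forall x, Un_cv (fun n => v n x) 0) ->
  forall e, Rlt 0 e -> exists N, forall n, le N n ->
    exists K, forall m, le K m -> Rle (F n m b - F n m a) e.
Proof.
move=> /RltP ab dF cu uB uv v0 e /RltP e0.
have [|||||N HN] := @double_dominated_limit_abstract R a b B u F v ab _ _ _ _ _ e e0.
- move=> n m x d /RltP d0; have [[r r0] Hr] := dF n m x d d0.
  exists r; split; first exact/RltP.
  by move=> h /eqP h0 /RltP hr; apply/RltP; have := Hr h h0 hr; rewrite RdivE RabsE.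
- move=> n m x d /RltP d0; have [r [r0 Hr]] := cu n m x d d0.
  exists r; split; first exact/RltP.
  move=> y /RltP yx.
  (* [continuity_pt] quantifies only over points different from [x], so [y = x] is treated apart. *)
  have [->|/eqP xy] := eqVneq y x; first by rewrite subrr normr0; apply/RltP.
  apply/RltP; rewrite -RdistE; apply: Hr; split; first by split=> // /esym.
  by rewrite /= RdistE.
- by move=> n m x; have [/RleP H1 /RleP H2] := uB n m x; apply/andP.
- move=> n x d /RltP d0; have [N HN] := uv n x d d0.
  by exists N => m /ssrnat.leP Nm; apply/RltP; rewrite -RdistE; exact: HN.
- move=> x d /RltP d0; have [N HN] := v0 x d d0.
  by exists N => m /ssrnat.leP Nm; apply/RltP; have := HN m Nm; rewrite RdistE subr0.
exists N => n /ssrnat.leP Nn; have [K HK] := HN n Nn.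
by exists K => m /ssrnat.leP Km; apply/RleP; exact: HK.
Qed.
End LebesgueLimit.

(** The primitive demanded by the Lebesgue version is the Riemann integral from [a], which vanishes
    at [a]. *)
Lemma double_dominated_limit (a b B : R) (u : nat -> nat -> R -> R) (v : nat -> R -> R) :
  a < b ->
  (forall n m x, continuous (u n m) x) ->
  (forall n m x, 0 <= u n m x <= B) ->
  (forall n x, is_lim_seq (fun m => u n m x) (v n x)) ->
  (forall x, is_lim_seq (fun n => v n x) 0) ->
  forall e, 0 < e -> exists N, forall n, (N <= n)%nat ->
    exists K, forall m, (K <= m)%nat -> RInt (u n m) a b <= e.
Proof.
intros ab cu uB uv v0 e e0.
assert (ex : forall n m c d, ex_RInt (u n m) c d).
{ intros; apply (ex_RInt_continuous (V := R_CompleteNormedModule)); intros; apply cu. }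
destruct (LebesgueLimit.double_dominated_limit_primitive a b B u
  (fun n m => RInt (u n m) a) v ab) with (e := e) as [N HN]; auto.
- intros n m x; apply is_derive_Reals.
  apply is_derive_RInt with (a := a); [|apply cu].
  apply filter_forall; intros y; apply (RInt_correct (V := R_CompleteNormedModule)), ex.
- intros n m x; apply continuity_pt_filterlim, cu.
- intros n x; apply is_lim_seq_Reals, uv.
- intros x; apply is_lim_seq_Reals, v0.
- exists N; intros n Hn; destruct (HN n Hn) as [K HK]; exists K; intros m Hm.
  specialize (HK m Hm); rewrite RInt_point in HK.
  change (RInt (u n m) a b - 0 <= e) in HK; lra.
Qed.

(** * Derivatives of complex-valued functions *)

(** [C] as a real normed module is a product of two copies of [R]: compose with the projections in
    one direction, with pairing in the other. This ties the componentwise [derivC] to the notion of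
    derivative used in [smooth]. *)
Lemma is_derive_C (f : R -> C) (t : R) (l : C) :
  @is_derive R_AbsRing C_R_NormedModule f t l <->
  is_derive (fun s => Re (f s)) t (Re l) /\ is_derive (fun s => Im (f s)) t (Im l).
Proof.
split.
- intros H; split.
  + refine (filterdiff_ext_lin _ _ _ (filterdiff_comp f (fst : R * R -> R) _ fst H _) _).
    * apply (filterdiff_linear (fst : prod_NormedModule R_AbsRing R_NormedModule R_NormedModule -> R_NormedModule)).
      apply is_linear_fst.
    * intros y; reflexivity.
  + refine (filterdiff_ext_lin _ _ _ (filterdiff_comp f (snd : R * R -> R) _ snd H _) _).
    * apply (filterdiff_linear (snd : prod_NormedModule R_AbsRing R_NormedModule R_NormedModule -> R_NormedModule)).
      apply is_linear_snd.
    * intros y; reflexivity.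
- intros [H1 H2].
  assert (H : filterdiff (fun s => ((Re (f s), Im (f s)) : C_R_NormedModule)) (locally t)
     (fun y => ((scal y (Re l), scal y (Im l)) : C_R_NormedModule))).
  { refine (filterdiff_comp_2 (fun s => Re (f s)) (fun s => Im (f s))
      (fun x y : R => ((x, y) : C_R_NormedModule)) _ _
      (fun x y : R => ((x, y) : C_R_NormedModule)) H1 H2 _).
    apply filterdiff_ext with (f := fun x => x).
    { intros [x y]; reflexivity. }
    apply filterdiff_ext_lin with (l1 := fun x => x); [apply filterdiff_id|].
    intros [x y]; reflexivity. }
  refine (filterdiff_ext_lin _ _ _ (filterdiff_ext _ _ _ _ H) _).
  + intros y; destruct (f y); reflexivity.
  + intros y; destruct l; reflexivity.
Qed.

Lemma ex_derive_C (f : R -> C) (t : R) :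
  @ex_derive R_AbsRing C_R_NormedModule f t <->
  ex_derive (fun s => Re (f s)) t /\ ex_derive (fun s => Im (f s)) t.
Proof.
split.
- intros [l Hl]; apply is_derive_C in Hl as [H1 H2]; split; eexists; eassumption.
- intros [[a Ha] [b Hb]]; exists (a, b); apply is_derive_C; split; assumption.
Qed.

Lemma derivC_n_eq (p : nat) (f : R -> C) (t : R) :
  derivC_n p f t = (Derive_n (fun s => Re (f s)) p t, Derive_n (fun s => Im (f s)) p t).
Proof.
revert t; induction p as [|p IH]; intros t.
- simpl; destruct (f t); reflexivity.
- change (derivC (derivC_n p f) t = (Derive (Derive_n (fun s => Re (f s)) p) t,
                                     Derive (Derive_n (fun s => Im (f s)) p) t)).
  unfold derivC; f_equal; apply Derive_ext; intros s; rewrite IH; reflexivity.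
Qed.

Definition smoothR (g : R -> R) : Prop := forall p t, ex_derive (Derive_n g p) t.

Lemma smooth_iff (f : R -> C) :
  smooth f <-> smoothR (fun s => Re (f s)) /\ smoothR (fun s => Im (f s)).
Proof.
assert (E : forall p t, @ex_derive R_AbsRing C_R_NormedModule (derivC_n p f) t <->
   ex_derive (Derive_n (fun s => Re (f s)) p) t /\ ex_derive (Derive_n (fun s => Im (f s)) p) t).
{ intros p t; rewrite ex_derive_C; split; intros [H1 H2]; split;
    [apply ex_derive_ext with (2 := H1)|apply ex_derive_ext with (2 := H2)|
     apply ex_derive_ext with (2 := H1)|apply ex_derive_ext with (2 := H2)];
    intros s; cbv beta;
    rewrite derivC_n_eq; reflexivity. }
split.
- intros H; split; intros p t;
    [exact (proj1 (proj1 (E p t) (H p t)))|exact (proj2 (proj1 (E p t) (H p t)))].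
- intros [H1 H2] p t; exact (proj2 (E p t) (conj (H1 p t) (H2 p t))).
Qed.

Lemma ex_derive_n_smoothR (g : R -> R) (n : nat) (t : R) : smoothR g -> ex_derive_n g n t.
Proof. intros H; destruct n; [exact I|apply H]. Qed.

Lemma smoothR_ex_derive_n (g : R -> R) : (forall n t, ex_derive_n g n t) -> smoothR g.
Proof. intros H p t; exact (H (S p) t). Qed.

Lemma Cmod_pair_le (x y : R) : Cmod (x, y) <= Rabs x + Rabs y.
Proof.
replace ((x, y) : C) with ((RtoC x + Ci * RtoC y)%C).
2:{ unfold Cplus, Cmult, Ci, RtoC; simpl; f_equal; ring. }
eapply Rle_trans; [apply Cmod_triangle|].
rewrite Cmod_mult, Cmod_Ci, !Cmod_R; lra.
Qed.

Lemma Rabs_Re_le (z : C) : Rabs (Re z) <= Cmod z.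
Proof. eapply Rle_trans; [apply Rmax_l|apply Rmax_Cmod]. Qed.

Lemma Rabs_Im_le (z : C) : Rabs (Im z) <= Cmod z.
Proof. eapply Rle_trans; [apply Rmax_r|apply Rmax_Cmod]. Qed.

Lemma smooth_lincomb (a : C) f b g : smooth f -> smooth g -> smooth (lincomb a f b g).
Proof.
rewrite !smooth_iff; intros [f1 f2] [g1 g2]; split; apply smoothR_ex_derive_n; intros n t.
- apply ex_derive_n_ext with (fun s =>
    (Re a * Re (f s) - Im a * Im (f s)) + (Re b * Re (g s) - Im b * Im (g s))).
  { intros s; unfold lincomb; simpl; reflexivity. }
  apply ex_derive_n_plus; apply filter_forall; intros y k _;
    apply ex_derive_n_minus; apply filter_forall; intros z j _;
    apply ex_derive_n_scal_l, ex_derive_n_smoothR; assumption.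
- apply ex_derive_n_ext with (fun s =>
    (Re a * Im (f s) + Im a * Re (f s)) + (Re b * Im (g s) + Im b * Re (g s))).
  { intros s; unfold lincomb; simpl; reflexivity. }
  apply ex_derive_n_plus; apply filter_forall; intros y k _;
    apply ex_derive_n_plus; apply filter_forall; intros z j _;
    apply ex_derive_n_scal_l, ex_derive_n_smoothR; assumption.
Qed.

Lemma derivC_n_lincomb (a : C) f b g p t : smooth f -> smooth g ->
  derivC_n p (lincomb a f b g) t = (a * derivC_n p f t + b * derivC_n p g t)%C.
Proof.
rewrite !smooth_iff; intros [f1 f2] [g1 g2]; rewrite !derivC_n_eq.
assert (sc : forall (h : R -> R) c n t, smoothR h -> ex_derive_n (fun s => c * h s) n t).
{ intros; apply ex_derive_n_scal_l, ex_derive_n_smoothR; assumption. }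
unfold Cplus, Cmult; simpl; f_equal.
- rewrite (Derive_n_ext _ (fun s =>
    (Re a * Re (f s) - Im a * Im (f s)) + (Re b * Re (g s) - Im b * Im (g s))))
    by (intros s; unfold lincomb; reflexivity).
  rewrite Derive_n_plus, !Derive_n_minus, !Derive_n_scal_l; try reflexivity;
    apply filter_forall; intros y k _; auto;
    apply ex_derive_n_minus; apply filter_forall; intros z j _; auto.
- rewrite (Derive_n_ext _ (fun s =>
    (Re a * Im (f s) + Im a * Re (f s)) + (Re b * Im (g s) + Im b * Re (g s))))
    by (intros s; unfold lincomb; reflexivity).
  rewrite !Derive_n_plus, !Derive_n_scal_l; try reflexivity;
    apply filter_forall; intros y k _; auto;
    apply ex_derive_n_plus; apply filter_forall; intros z j _; auto.
Qed.

Lemma smoothR_trans (g : R -> R) (c : R) : smoothR g -> smoothR (fun s => g (s + c)).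
Proof.
intros H; apply smoothR_ex_derive_n; intros n t.
apply ex_derive_n_comp_trans, ex_derive_n_smoothR, H.
Qed.

Lemma smooth_trans (f : R -> C) (c : R) : smooth f -> smooth (fun s => f (s + c)).
Proof.
rewrite !smooth_iff; intros [H1 H2]; split;
  [apply (smoothR_trans (fun s => Re (f s)))|apply (smoothR_trans (fun s => Im (f s)))]; assumption.
Qed.

Lemma derivC_n_trans (f : R -> C) (c : R) p t :
  derivC_n p (fun s => f (s + c)) t = derivC_n p f (t + c).
Proof.
rewrite !derivC_n_eq; f_equal.
- apply (Derive_n_comp_trans (fun s => Re (f s))).
- apply (Derive_n_comp_trans (fun s => Im (f s))).
Qed.

Lemma smooth_opp (f : R -> C) : smooth f -> smooth (fun s => f (- s)).
Proof.
rewrite !smooth_iff; intros [H1 H2]; split; apply smoothR_ex_derive_n; intros n t.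
- apply (ex_derive_n_comp_opp (fun s => Re (f s))).
  apply filter_forall; intros y k _; apply ex_derive_n_smoothR, H1.
- apply (ex_derive_n_comp_opp (fun s => Im (f s))).
  apply filter_forall; intros y k _; apply ex_derive_n_smoothR, H2.
Qed.

(** Reflection contributes only the factor [(-1)^p], of modulus 1. *)
Lemma Cmod_derivC_n_opp (f : R -> C) p t : smooth f ->
  Cmod (derivC_n p (fun s => f (- s)) t) = Cmod (derivC_n p f (- t)).
Proof.
rewrite smooth_iff; intros [H1 H2].
rewrite !derivC_n_eq.
rewrite (Derive_n_comp_opp (fun s => Re (f s))), (Derive_n_comp_opp (fun s => Im (f s)));
  try (apply filter_forall; intros y k _; apply ex_derive_n_smoothR; assumption).
match goal with |- Cmod (?e * ?x, ?e * ?y) = _ =>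
  replace ((e * x, e * y) : C) with ((RtoC e * (x, y))%C)
    by (unfold Cmult, RtoC; simpl; f_equal; ring) end.
rewrite Cmod_mult, Cmod_R, pow_1_abs; ring.
Qed.

(** * Test functions *)

(** The quantifier over [h] that governs membership: a projective limit asks for every [h], an
    inductive limit for some [h]. *)
Definition for_scales (s : udtype) (P : R -> Prop) : Prop :=
  match s with
  | Beurling => forall h, 0 < h -> P h
  | Roumieu => exists h, 0 < h /\ P h
  end.

Definition supported (r : R) (f : R -> C) : Prop := forall t, r < Rabs t -> f t = 0%C.

(** All [t] are allowed, not only those of a compact set: derivatives vanish outside the support, so
    the compact set drops out of the estimates. *)
Definition supbound (M : nat -> R) (h : R) (f : R -> C) (B : R) : Prop :=
  forall p t, h ^ p * Cmod (derivC_n p f t) <= B * M p.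

Lemma derivC_n_locally_zero (f : R -> C) (t : R) :
  locally t (fun s => f s = 0%C) -> forall p, derivC_n p f t = 0%C.
Proof.
intros H p; rewrite derivC_n_eq; unfold RtoC.
rewrite (Derive_n_ext_loc (fun s => Re (f s)) (fun _ => 0)),
        (Derive_n_ext_loc (fun s => Im (f s)) (fun _ => 0)).
- destruct p; [reflexivity|]; rewrite !Derive_n_const; reflexivity.
- apply filter_imp with (2 := H); intros s E; rewrite E; reflexivity.
- apply filter_imp with (2 := H); intros s E; rewrite E; reflexivity.
Qed.

Lemma locally_Rabs_gt (r t : R) : r < Rabs t -> locally t (fun s => r < Rabs s).
Proof.
intros H.
assert (He : 0 < Rabs t - r) by lra.
exists (mkposreal _ He); intros s Hs.
change (Rabs (s - t) < Rabs t - r) in Hs.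
pose proof (Rabs_triang_inv t s) as Ht.
rewrite Rabs_minus_sym in Hs; lra.
Qed.

Lemma derivC_n_supported (f : R -> C) (r : R) p :
  supported r f -> supported r (derivC_n p f).
Proof.
intros H t Ht; apply derivC_n_locally_zero.
apply filter_imp with (2 := locally_Rabs_gt r t Ht); exact H.
Qed.

Lemma derivC_n_outside_supp (f : R -> C) p t : ~ supp f t -> derivC_n p f t = 0%C.
Proof.
intros H; apply derivC_n_locally_zero, NNPP; intros H'; apply H.
intros V [d HV]; apply NNPP; intros HV'.
apply H'; exists d; intros y Hy; apply NNPP; intros Hf.
apply HV'; exists y; split; [apply HV; exact Hy|exact Hf].
Qed.

Lemma norm_DK_supbound (M : nat -> R) (Mpos : forall p, 0 < M p) K h f B :
  included (supp f) K -> 0 <= B -> Rbar_le (norm_DK M h K f) B -> supbound M h f B.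
Proof.
intros SK B0 N p t; unfold norm_DK in N.
destruct (classic (K t)) as [Kt|Kt].
- apply Rle_div_l; [apply Mpos|].
  assert (H : Rbar_le (h ^ p * Cmod (derivC_n p f t) / M p) B); [|exact H].
  eapply Rbar_le_trans; [|exact N].
  apply (proj1 (Lub_Rbar_correct _)); exists t, p; split; [exact Kt|reflexivity].
- rewrite derivC_n_outside_supp by (intros H; apply Kt, SK, H).
  rewrite Cmod_0, Rmult_0_r; apply Rmult_le_pos; [exact B0|left; apply Mpos].
Qed.

Lemma DKh_carrier_bound (M : nat -> R) (Mpos : forall p, 0 < M p) K h f :
  included (supp f) K ->
  Rbar_lt (norm_DK M h K f) p_infty -> exists B, supbound M h f B.
Proof.
intros SK N; exists (Rabs (real (norm_DK M h K f))).
apply norm_DK_supbound with K; [assumption..|apply Rabs_pos|].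
destruct (norm_DK M h K f); simpl in *; [apply Rle_abs|contradiction|exact I].
Qed.

(** The iterated limits become concrete because every compact set lies in some [[- r, r]], itself
    compact, and a supremum is finite exactly when some [B] bounds it. *)
Lemma carrier_Dspace (s : udtype) (M : nat -> R) (Mpos : forall p, 0 < M p) (f : R -> C) :
  carrier (Dspace s M) f <->
  smooth f /\ (exists r, 0 < r /\ supported r f) /\
  for_scales s (fun h => exists B, supbound M h f B).
Proof.
split.
- intros [[K cK] H]; simpl in H.
  assert (H' : smooth f /\ included (supp f) K /\
     for_scales s (fun h => exists B, supbound M h f B)).
  { destruct s; simpl in H |- *.
    - destruct (H (mkposreal 1 Rlt_0_1)) as [[H1 H2] _]; split; [exact H1|split; [exact H2|]].
      intros h h0; destruct (H (mkposreal h h0)) as [_ H3].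
      exact (DKh_carrier_bound M Mpos K h f H2 H3).
    - destruct H as [h [[H1 H2] H3]]; split; [exact H1|split; [exact H2|]].
      exists h; split; [apply cond_pos|].
      exact (DKh_carrier_bound M Mpos K h f H2 H3). }
  destruct H' as [H1 [H2 H3]]; split; [exact H1|split; [|exact H3]].
  destruct (compact_P1 K cK) as [m [m' Hm]].
  exists (Rabs m + Rabs m' + 1); split; [pose proof (Rabs_pos m); pose proof (Rabs_pos m'); lra|].
  intros t Ht; apply NNPP; intros Hf.
  assert (Kt : K t) by (apply H2, adherence_P1; exact Hf).
  specialize (Hm t Kt); revert Ht; unfold Rabs; repeat destruct Rcase_abs; lra.
- intros [Sf [[r [r0 Hr]] HB]].
  exists (exist _ (fun t => - r <= t <= r) (compact_P3 (- r) r)); simpl.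
  assert (SK : included (supp f) (fun t => - r <= t <= r)).
  { intros t Ht; apply NNPP; intros Hn.
    assert (Hrt : r < Rabs t) by (unfold Rabs; destruct Rcase_abs; lra).
    destruct (locally_Rabs_gt r t Hrt) as [d Hd].
    destruct (Ht (disc t d)) as [y [Hy1 Hy2]].
    { exists d; intros y Hy; exact Hy. }
    apply Hy2, Hr, Hd, Hy1. }
  assert (N : forall h, 0 < h -> (exists B, supbound M h f B) ->
     Rbar_lt (norm_DK M h (fun t => - r <= t <= r) f) p_infty).
  { intros h h0 [B HBh].
    apply Rbar_le_lt_trans with (Finite B); [|exact I].
    apply (proj2 (Lub_Rbar_correct _)); intros x [t [p [_ ->]]]; simpl.
    apply Rle_div_l; [apply Mpos|apply HBh]. }
  destruct s; simpl.
  + intros h; split; [split; assumption|]; apply N; [apply cond_pos|apply HB, cond_pos].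
  + destruct HB as [h [h0 HB]]; exists (mkposreal h h0); split; [split; assumption|].
    apply N; assumption.
Qed.

Lemma for_scales_impl s (P Q : R -> Prop) :
  (forall h, 0 < h -> P h -> Q h) -> for_scales s P -> for_scales s Q.
Proof.
destruct s; simpl; intros H.
- intros HP h h0; apply H, HP; assumption.
- intros [h [h0 HP]]; exists h; split; [|apply H]; assumption.
Qed.

Lemma supbound_trans M h f B c : supbound M h f B -> supbound M h (fun s => f (s + c)) B.
Proof. intros H p t; rewrite derivC_n_trans; apply H. Qed.

Lemma carrier_trans s M (Mpos : forall p, 0 < M p) f c :
  carrier (Dspace s M) f -> carrier (Dspace s M) (fun t => f (t + c)).
Proof.
rewrite !carrier_Dspace by assumption; intros [H1 [[r [r0 Hr]] H3]]; split; [|split].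
- apply smooth_trans, H1.
- exists (r + Rabs c); split; [pose proof (Rabs_pos c); lra|].
  intros t Ht; apply Hr.
  revert Ht; unfold Rabs; repeat destruct Rcase_abs; lra.
- revert H3; apply for_scales_impl; intros h _ [B HB]; exists B; apply supbound_trans, HB.
Qed.

Lemma supbound_opp M h f B : smooth f -> supbound M h f B -> supbound M h (fun s => f (- s)) B.
Proof. intros Sf H p t; rewrite Cmod_derivC_n_opp by assumption; apply H. Qed.

Lemma carrier_opp s M (Mpos : forall p, 0 < M p) f :
  carrier (Dspace s M) f -> carrier (Dspace s M) (fun t => f (- t)).
Proof.
rewrite !carrier_Dspace by assumption; intros [H1 [[r [r0 Hr]] H3]]; split; [|split].
- apply smooth_opp, H1.
- exists r; split; [exact r0|]; intros t Ht; apply Hr; rewrite Rabs_Ropp; exact Ht.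
- revert H3; apply for_scales_impl; intros h _ [B HB]; exists B; apply supbound_opp; assumption.
Qed.

Lemma carrier_reflect s M (Mpos : forall p, 0 < M p) f x :
  carrier (Dspace s M) f -> carrier (Dspace s M) (fun t => f (x - t)).
Proof.
intros H; replace (fun t => f (x - t)) with (fun t => (fun u => f (- u)) (t + - x)).
- apply (carrier_trans s M Mpos (fun u => f (- u))), carrier_opp; assumption.
- extensionality t; f_equal; ring.
Qed.

Lemma supbound_lincomb M h a f b g A B : 0 <= h -> smooth f -> smooth g ->
  supbound M h f A -> supbound M h g B ->
  supbound M h (lincomb a f b g) (Cmod a * A + Cmod b * B).
Proof.
intros h0 Sf Sg HA HB p t; rewrite derivC_n_lincomb by assumption.
pose proof (pow_le h p h0) as hp.
eapply Rle_trans; [apply Rmult_le_compat_l; [exact hp|apply Cmod_triangle]|].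
rewrite !Cmod_mult.
specialize (HA p t); specialize (HB p t).
apply (Rmult_le_compat_l (Cmod a)) in HA; [|apply Cmod_ge_0].
apply (Rmult_le_compat_l (Cmod b)) in HB; [|apply Cmod_ge_0].
lra.
Qed.

Lemma supbound_scale M h h1 f B : 0 <= h <= h1 -> supbound M h1 f B -> supbound M h f B.
Proof.
intros Hh H p t; eapply Rle_trans; [|apply H].
apply Rmult_le_compat_r; [apply Cmod_ge_0|]; apply pow_incr; lra.
Qed.

Lemma carrier_lincomb s M (Mpos : forall p, 0 < M p) a f b g :
  carrier (Dspace s M) f -> carrier (Dspace s M) g -> carrier (Dspace s M) (lincomb a f b g).
Proof.
rewrite !carrier_Dspace by assumption; intros [Sf [[r [r0 Hr]] HF]] [Sg [[r' [r0' Hr']] HG]].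
split; [apply smooth_lincomb; assumption|split].
- exists (Rmax r r'); split; [eapply Rlt_le_trans; [exact r0|apply Rmax_l]|].
  intros t Ht; unfold lincomb; rewrite Hr, Hr'; [ring| |];
    eapply Rle_lt_trans; [|exact Ht| |exact Ht]; [apply Rmax_r|apply Rmax_l].
- destruct s; simpl in *.
  + intros h h0; destruct (HF h h0) as [A HA]; destruct (HG h h0) as [B HB].
    eexists; apply supbound_lincomb; [lra|assumption..|exact HA|exact HB].
  + destruct HF as [h [h0 [A HA]]]; destruct HG as [h' [h0' [B HB]]].
    exists (Rmin h h'); split; [apply Rmin_case; assumption|].
    assert (0 <= Rmin h h') by (left; apply Rmin_case; assumption).
    eexists; apply supbound_lincomb; [assumption..| |].
    * apply supbound_scale with h; [split; [assumption|apply Rmin_l]|exact HA].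
    * apply supbound_scale with h'; [split; [assumption|apply Rmin_r]|exact HB].
Qed.

Lemma carrier_minus s M (Mpos : forall p, 0 < M p) f g :
  carrier (Dspace s M) f -> carrier (Dspace s M) g ->
  carrier (Dspace s M) (fun t => f t - g t)%C.
Proof.
intros Hf Hg; replace (fun t => f t - g t)%C with (lincomb (RtoC 1) f (- RtoC 1)%C g).
- apply carrier_lincomb; assumption.
- extensionality t; unfold lincomb; ring.
Qed.

(** * Test functions as elements of [D_L1] *)

(** Once the ends pass [c] and [d] the integral no longer changes, so the improper limit is
    attained. *)
Lemma is_RInt_gen_interval {V : CompleteNormedModule R_AbsRing} (f : R -> V) (c d : R) :
  c <= d -> (forall t, continuous f t) -> (forall t, t < c \/ d < t -> f t = zero) ->
  is_RInt_gen f (Rbar_locally m_infty) (Rbar_locally p_infty) (RInt f c d).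
Proof.
intros cd cf Hf P HP.
assert (ex : forall a b, ex_RInt f a b).
{ intros a b; apply (ex_RInt_continuous f); intros z _; apply cf. }
apply Filter_prod with (fun a => a < c) (fun b => d < b).
- exists c; auto.
- exists d; auto.
- intros a b Ha Hb; exists (RInt f c d); split; [|exact (locally_singleton _ _ HP)].
  simpl.
  assert (Z : forall x y, x <= y -> (y <= c \/ d <= x) -> is_RInt f x y zero).
  { intros x y xy Hxy; apply is_RInt_ext with (fun _ => zero).
    - intros z; rewrite Rmin_left, Rmax_right by assumption; intros Hz; symmetry; apply Hf; lra.
    - exact (eq_ind _ (fun l : V => is_RInt (fun _ => zero) x y l)
        (is_RInt_const x y zero) _ (scal_zero_r (y - x))). }
  replace (RInt f c d) with (plus zero (plus (RInt f c d) zero))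
    by (rewrite plus_zero_r, plus_zero_l; reflexivity).
  refine (is_RInt_Chasles (V := V) f a c b zero (plus (RInt f c d) zero) _ _);
    [apply Z; lra|].
  refine (is_RInt_Chasles (V := V) f c d b (RInt f c d) zero _ _);
    [apply RInt_correct, ex|apply Z; lra].
Qed.

Lemma is_RInt_gen_supported {V : CompleteNormedModule R_AbsRing} (f : R -> V) (r : R) :
  0 < r -> (forall t, continuous f t) -> (forall t, r < Rabs t -> f t = zero) ->
  is_RInt_gen f (Rbar_locally m_infty) (Rbar_locally p_infty) (RInt f (- r) r).
Proof.
intros r0 cf Hf; apply is_RInt_gen_interval; [lra|exact cf|].
intros t Ht; apply Hf; unfold Rabs; destruct Rcase_abs; lra.
Qed.

Lemma RInt_gen_supported {V : CompleteNormedModule R_AbsRing} (f : R -> V) (r : R) :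
  0 < r -> (forall t, continuous f t) -> (forall t, r < Rabs t -> f t = zero) ->
  RInt_gen f (Rbar_locally m_infty) (Rbar_locally p_infty) = RInt f (- r) r.
Proof. intros; apply is_RInt_gen_unique, is_RInt_gen_supported; assumption. Qed.

Lemma continuous_Cmod (f : R -> C) t :
  continuous (fun s => Re (f s)) t -> continuous (fun s => Im (f s)) t ->
  continuous (fun s => Cmod (f s)) t.
Proof.
intros H1 H2; unfold Cmod; apply continuous_comp; [|apply continuous_sqrt].
apply (continuous_plus (V := R_NormedModule) (fun s => Re (f s) ^ 2) (fun s => Im (f s) ^ 2)).
- apply (continuous_comp (fun s => Re (f s)) (fun x => x ^ 2)); [exact H1|].
  apply (@ex_derive_continuous R_AbsRing R_NormedModule); auto_derive; exact I.
- apply (continuous_comp (fun s => Im (f s)) (fun x => x ^ 2)); [exact H2|].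
  apply (@ex_derive_continuous R_AbsRing R_NormedModule); auto_derive; exact I.
Qed.

Lemma smooth_continuous_Re (f : R -> C) p t :
  smooth f -> continuous (fun s => Re (derivC_n p f s)) t.
Proof.
intros Sf; apply (@ex_derive_continuous R_AbsRing R_NormedModule).
apply (proj1 (ex_derive_C _ _) (Sf p t)).
Qed.

Lemma smooth_continuous_Im (f : R -> C) p t :
  smooth f -> continuous (fun s => Im (derivC_n p f s)) t.
Proof.
intros Sf; apply (@ex_derive_continuous R_AbsRing R_NormedModule).
apply (proj1 (ex_derive_C _ _) (Sf p t)).
Qed.

Lemma continuous_Cmod_derivC_n (f : R -> C) p t :
  smooth f -> continuous (fun s => Cmod (derivC_n p f s)) t.
Proof.
intros Sf; apply continuous_Cmod; [apply smooth_continuous_Re|apply smooth_continuous_Im]; exact Sf.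
Qed.

Lemma normL1_supported (f : R -> C) p r : smooth f -> 0 < r -> supported r f ->
  inL1 (derivC_n p f) /\
  normL1 (derivC_n p f) = RInt (fun t => Cmod (derivC_n p f t)) (- r) r.
Proof.
intros Sf r0 Hr.
assert (H : forall t, r < Rabs t -> Cmod (derivC_n p f t) = zero).
{ intros t Ht; rewrite derivC_n_supported with (r := r); [apply Cmod_0|exact Hr|exact Ht]. }
split.
- eexists; apply (is_RInt_gen_supported (V := R_CompleteNormedModule)) with (r := r);
    [exact r0| |exact H]; intros t; apply continuous_Cmod_derivC_n, Sf.
- refine (RInt_gen_supported (V := R_CompleteNormedModule) (fun t => Cmod (derivC_n p f t)) r _ _ _);
    [exact r0| |exact H]; intros t; apply continuous_Cmod_derivC_n, Sf.
Qed.

Definition L1bound (M : nat -> R) (h : R) (f : R -> C) (B : R) : Prop :=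
  forall p, h ^ p * normL1 (derivC_n p f) <= B * M p.

Lemma supbound_L1bound M h f B r : 0 <= h -> 0 < r -> smooth f -> supported r f ->
  supbound M h f B -> L1bound M h f (2 * r * B).
Proof.
intros h0 r0 Sf Hr HB p.
rewrite (proj2 (normL1_supported f p r Sf r0 Hr)).
assert (ex : ex_RInt (fun t => Cmod (derivC_n p f t)) (- r) r).
{ apply (ex_RInt_continuous (V := R_CompleteNormedModule)); intros z _.
  apply continuous_Cmod_derivC_n, Sf. }
rewrite <- (RInt_scal (V := R_CompleteNormedModule)) by exact ex.
replace (2 * r * B * M p) with (RInt (fun _ => B * M p) (- r) r).
2:{ rewrite RInt_const; unfold scal; simpl; unfold mult; simpl; ring. }
apply RInt_le; [lra| | |].
- apply (ex_RInt_scal (V := R_NormedModule)), ex.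
- apply ex_RInt_const.
- intros x _; apply HB.
Qed.

Lemma norm_DL1_le M (Mpos : forall p, 0 < M p) h f B :
  L1bound M h f B -> Rbar_le (norm_DL1 M h f) B.
Proof.
intros H; apply (proj2 (Lub_Rbar_correct _)); intros x [p ->]; simpl.
apply Rle_div_l; [apply Mpos|apply H].
Qed.

Lemma DL1h_carrier M (Mpos : forall p, 0 < M p) (h : posreal) f B r :
  smooth f -> 0 < r -> supported r f -> L1bound M h f B -> carrier (DL1h M h) f.
Proof.
intros Sf r0 Hr HB; split; [split; [exact Sf|]|].
- intros p; apply normL1_supported with r; assumption.
- apply Rbar_le_lt_trans with (Finite B); [apply norm_DL1_le; assumption|exact I].
Qed.

Lemma carrier_Dspace_L1 s M (Mpos : forall p, 0 < M p) f :
  carrier (Dspace s M) f -> for_scales s (fun h => exists B, L1bound M h f B).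
Proof.
rewrite carrier_Dspace by assumption; intros [Sf [[r [r0 Hr]] H]].
revert H; apply for_scales_impl; intros h h0 [B HB].
exists (2 * r * B); apply supbound_L1bound; try assumption; lra.
Qed.

Lemma carrier_DL1 s M (Mpos : forall p, 0 < M p) f :
  carrier (Dspace s M) f -> carrier (DL1 s M) f.
Proof.
intros H; pose proof (carrier_Dspace_L1 s M Mpos f H) as HB.
apply carrier_Dspace in H; [|assumption]; destruct H as [Sf [[r [r0 Hr]] _]].
destruct s; simpl in *.
- intros h; destruct (HB h (cond_pos h)) as [B HBh]; apply DL1h_carrier with B r; assumption.
- destruct HB as [h [h0 [B HBh]]]; exists (mkposreal h h0); apply DL1h_carrier with B r; assumption.
Qed.

(** The working form of continuity in [DL1]. A Beurling neighbourhood constrains finitely many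
    arbitrary [h], so smallness is asked at every [h]; a Roumieu neighbourhood is one at each single
    [h], so smallness at one [h] suffices. The bounds without smallness place each [g i] in the
    normed space at that [h]. *)
Lemma DL1_nbhs0_eventually s M (Mpos : forall p, 0 < M p) U {I : Type}
    (F : (I -> Prop) -> Prop) {FF : Filter F} (g : I -> R -> C) :
  nbhs0 (DL1 s M) U -> (forall i, carrier (Dspace s M) (g i)) ->
  for_scales s (fun h => (forall i, exists B, L1bound M h (g i) B) /\
                         forall eps, 0 < eps -> F (fun i => L1bound M h (g i) eps)) ->
  F (fun i => U (g i)).
Proof.
intros HU Hg Hs.
assert (ev : forall (h : posreal) V, nbhs0 (DL1h M h) V ->
  (forall i, exists B, L1bound M h (g i) B) ->
  (forall eps, 0 < eps -> F (fun i => L1bound M h (g i) eps)) -> F (fun i => V (g i))).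
{ intros h V [eps HV] HB HF.
  assert (e2 : 0 < eps / 2) by (pose proof (cond_pos eps); lra).
  apply filter_imp with (2 := HF _ e2); intros i Hi; apply HV.
  - destruct (HB i) as [B HBi].
    destruct (proj1 (carrier_Dspace s M Mpos (g i)) (Hg i)) as [Sf [[r [r0 Hr]] _]].
    apply DL1h_carrier with B r; assumption.
  - apply Rbar_le_lt_trans with (Finite (eps / 2)); [apply norm_DL1_le; assumption|].
    simpl; pose proof (cond_pos eps); lra. }
destruct s.
- destruct HU as [l [V [HV HU]]].
  assert (Hl : F (fun i => forall h, In h l -> V h (g i))).
  { revert HV; clear HU; induction l as [|h l IH]; intros HV.
    - apply filter_forall; intros i h [].
    - assert (H1 : F (fun i => V h (g i))).
      { apply (ev h); [apply HV; left; reflexivity| |]; apply Hs, cond_pos. }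
      assert (H2 := IH (fun k Hk => HV k (or_intror Hk))).
      apply filter_imp with (2 := filter_and _ _ H1 H2).
      intros i [Hi1 Hi2] k [<-|Hk]; [exact Hi1|apply Hi2, Hk]. }
  apply filter_imp with (2 := Hl); intros i Hi; apply HU; [|exact Hi].
  apply (carrier_DL1 Beurling); [assumption|apply Hg].
- destruct HU as [V [_ [HV HU]]]; destruct Hs as [h [h0 [HB HF]]].
  apply filter_imp with (2 := ev (mkposreal h h0) V (HV _) HB HF).
  intros i Hi; apply HU; [|exact Hi].
  apply (carrier_DL1 Roumieu); [assumption|apply Hg].
Qed.

(** * Limits and continuity expressed by the norm *)

Section NormConversions.

Context {X : CompleteNormedModule C_AbsRing}.

Lemma locally_norm_lt (x : X) (eps : R) : 0 < eps ->
  locally x (fun y => norm (minus y x) < eps).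
Proof.
intros e0; refine (locally_le_locally_norm (V := X) x _ _).
exists (mkposreal eps e0); intros y Hy; exact Hy.
Qed.

Lemma locally_of_norm (x : X) (W : X -> Prop) :
  locally x W -> exists eps, 0 < eps /\ forall y, norm (minus y x) < eps -> W y.
Proof.
intros H; destruct (locally_norm_le_locally (V := X) x W H) as [eps He].
exists eps; split; [apply cond_pos|]; intros y Hy; apply He, Hy.
Qed.

Lemma filterlim_norm_iff {I} (F : (I -> Prop) -> Prop) {FF : Filter F} (u : I -> X) (x : X) :
  filterlim u F (locally x) <->
  forall eps, 0 < eps -> F (fun i => norm (minus (u i) x) < eps).
Proof.
split.
- intros H eps e0; exact (H _ (locally_norm_lt x eps e0)).
- intros H W HW; destruct (locally_of_norm x W HW) as [eps [e0 He]].
  apply filter_imp with (2 := H eps e0); intros i; apply He.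
Qed.

Lemma tends_norm (u : nat -> X) (x : X) :
  tends u x <->
  forall eps, 0 < eps -> exists N, forall n, (N <= n)%nat -> norm (minus (u n) x) < eps.
Proof. exact (filterlim_norm_iff eventually u x). Qed.

Lemma continuous_norm (f : R -> X) (t : R) :
  continuous f t <->
  forall eps, 0 < eps -> exists d, 0 < d /\
    forall s, Rabs (s - t) < d -> norm (minus (f s) (f t)) < eps.
Proof.
unfold continuous; rewrite (filterlim_norm_iff (locally t) f (f t)); split.
- intros H eps e0; destruct (H eps e0) as [d Hd]; exists d; split; [apply cond_pos|exact Hd].
- intros H eps e0; destruct (H eps e0) as [d [d0 Hd]]; exists (mkposreal d d0); exact Hd.
Qed.

Lemma scal_RtoC_norm (r : R) (x : X) : norm (scal (RtoC r : C_AbsRing) x) <= Rabs r * norm x.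
Proof.
eapply Rle_trans; [apply (norm_scal (RtoC r : C_AbsRing) x)|].
apply Req_le; f_equal; exact (Cmod_R r).
Qed.

Lemma scal_C0 (x : X) : scal (RtoC 0 : C_AbsRing) x = zero.
Proof. exact (scal_zero_l x). Qed.

Lemma scal_C1 (x : X) : scal (RtoC 1 : C_AbsRing) x = x.
Proof. exact (scal_one x). Qed.

Lemma scal_Copp1 (x : X) : scal ((- RtoC 1)%C : C_AbsRing) x = opp x.
Proof.
exact (eq_trans (scal_opp_l (one : C_AbsRing) x) (f_equal opp (scal_one x))).
Qed.

Context (s : udtype) (M : nat -> R) (Mpos : forall p, 0 < M p) (T : (R -> C) -> X).

Lemma continuous_linear_zero (HT : continuous_linear (DL1 s M) T) f :
  carrier (Dspace s M) f -> T (fun _ => RtoC 0) = zero.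
Proof.
intros Hf; replace (fun _ : R => RtoC 0) with (lincomb (RtoC 0) f (RtoC 0) f).
2:{ extensionality t; unfold lincomb; ring. }
rewrite (proj1 HT) by (apply carrier_DL1; assumption).
rewrite !scal_C0; apply plus_zero_r.
Qed.

Lemma continuous_linear_real_scal (HT : continuous_linear (DL1 s M) T) f (c : R) :
  carrier (Dspace s M) f -> T (fun t => RtoC c * f t)%C = scal (RtoC c : C_AbsRing) (T f).
Proof.
intros Hf; replace (fun t => RtoC c * f t)%C with (lincomb (RtoC c) f (RtoC 0) f).
2:{ extensionality t; unfold lincomb; ring. }
rewrite (proj1 HT) by (apply carrier_DL1; assumption).
rewrite scal_C0; apply plus_zero_r.
Qed.

End NormConversions.

Lemma increment_bound (g : R -> R) (K a b : R) :
  (forall x, ex_derive g x) -> (forall x, Rabs (Derive g x) <= K) ->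
  Rabs (g b - g a) <= K * Rabs (b - a).
Proof.
intros dg HK.
destruct (MVT_gen g a b (Derive g)) as [c [_ Hc]].
- intros x _; apply Derive_correct, dg.
- intros x _; apply continuity_pt_filterlim.
  apply (@ex_derive_continuous R_AbsRing R_NormedModule), dg.
- rewrite Hc, Rabs_mult; apply Rmult_le_compat_r; [apply Rabs_pos|apply HK].
Qed.

(** The mean value theorem is applied to real and imaginary part separately, whence the factor 2. *)
Lemma derivC_n_increment (f : R -> C) p K a b : smooth f ->
  (forall t, Cmod (derivC_n (S p) f t) <= K) ->
  Cmod (derivC_n p f b - derivC_n p f a)%C <= 2 * K * Rabs (b - a).
Proof.
intros Sf HK.
pose proof (proj1 (smooth_iff f) Sf) as [S1 S2].
rewrite !derivC_n_eq; unfold Cminus, Cplus, Copp; simpl.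
eapply Rle_trans; [apply Cmod_pair_le|].
replace (2 * K * Rabs (b - a)) with (K * Rabs (b - a) + K * Rabs (b - a)) by ring.
apply Rplus_le_compat.
- apply (increment_bound (Derive_n (fun s => Re (f s)) p)); [exact (S1 p)|].
  intros x; eapply Rle_trans; [|apply (HK x)]; rewrite derivC_n_eq.
  exact (Rabs_Re_le (Derive_n (fun s => Re (f s)) (S p) x, Derive_n (fun s => Im (f s)) (S p) x)).
- apply (increment_bound (Derive_n (fun s => Im (f s)) p)); [exact (S2 p)|].
  intros x; eapply Rle_trans; [|apply (HK x)]; rewrite derivC_n_eq.
  exact (Rabs_Im_le (Derive_n (fun s => Re (f s)) (S p) x, Derive_n (fun s => Im (f s)) (S p) x)).
Qed.

Lemma uniform_radius (Q : nat -> R -> Prop) :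
  (forall p, exists d, 0 < d /\ forall s, Rabs s < d -> Q p s) ->
  forall N, exists d, 0 < d /\ forall p s, (p < N)%nat -> Rabs s < d -> Q p s.
Proof.
intros H N; induction N as [|N [d [d0 IH]]].
- exists 1; split; [lra|intros; lia].
- destruct (H N) as [e [e0 He]]; exists (Rmin d e); split; [apply Rmin_case; assumption|].
  intros p s Hp Hs; destruct (Nat.eq_dec p N) as [->|Hn].
  + apply He; eapply Rlt_le_trans; [exact Hs|apply Rmin_r].
  + apply IH; [lia|eapply Rlt_le_trans; [exact Hs|apply Rmin_l]].
Qed.

Lemma geometric_small (q B eps : R) : 0 <= q < 1 -> 0 < eps ->
  exists N, forall p, (N <= p)%nat -> B * q ^ p <= eps.
Proof.
intros Hq e0.
assert (HB : 0 < Rabs B + 1) by (pose proof (Rabs_pos B); lra).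
destruct (pow_lt_1_zero q) with (y := eps / (Rabs B + 1)) as [N HN].
- rewrite Rabs_pos_eq; lra.
- apply Rdiv_lt_0_compat; lra.
- exists N; intros p Hp; specialize (HN p Hp).
  assert (q0 : 0 <= q ^ p) by (apply pow_le; lra).
  rewrite Rabs_pos_eq in HN by exact q0.
  apply Rlt_div_r in HN; [|exact HB].
  pose proof (Rle_abs B) as H1.
  pose proof (Rmult_le_compat_r _ _ _ q0 H1) as H2; lra.
Qed.

Lemma smooth_minus f g : smooth f -> smooth g -> smooth (fun t => f t - g t)%C.
Proof.
intros Hf Hg; replace (fun t => f t - g t)%C with (lincomb (RtoC 1) f (- RtoC 1)%C g).
- apply smooth_lincomb; assumption.
- extensionality t; unfold lincomb; ring.
Qed.

Lemma derivC_n_minus f g p t : smooth f -> smooth g ->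
  derivC_n p (fun t => f t - g t)%C t = (derivC_n p f t - derivC_n p g t)%C.
Proof.
intros Hf Hg; replace (fun t => f t - g t)%C with (lincomb (RtoC 1) f (- RtoC 1)%C g).
- rewrite derivC_n_lincomb by assumption; ring.
- extensionality u; unfold lincomb; ring.
Qed.

Lemma supbound_minus M h f g A B : 0 <= h -> smooth f -> smooth g ->
  supbound M h f A -> supbound M h g B -> supbound M h (fun t => f t - g t)%C (A + B).
Proof.
intros h0 Sf Sg HA HB; replace (fun t => f t - g t)%C with (lincomb (RtoC 1) f (- RtoC 1)%C g).
2:{ extensionality t; unfold lincomb; ring. }
replace (A + B) with (Cmod (RtoC 1) * A + Cmod (- RtoC 1)%C * B).
- apply supbound_lincomb; assumption.
- rewrite Cmod_opp, Cmod_R, Rabs_R1; ring.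
Qed.

Lemma supported_trans r c f : supported r f -> supported (r + Rabs c) (fun t => f (t + c)).
Proof.
intros Hr t Ht; apply Hr; revert Ht; unfold Rabs; repeat destruct Rcase_abs; lra.
Qed.

Lemma supported_le r r' f : r <= r' -> supported r f -> supported r' f.
Proof. intros H Hr t Ht; apply Hr; lra. Qed.

Lemma supported_minus r f g :
  supported r f -> supported r g -> supported r (fun t => f t - g t)%C.
Proof. intros Hf Hg t Ht; rewrite Hf, Hg by assumption; ring. Qed.

(* High orders are absorbed by the factor [(h / h1) ^ p]; below a fixed order
   the mean value theorem applies.  No comparison of [M (S p)] with [M p] is
   needed. *)
Lemma translation_modulus M (Mpos : forall p, 0 < M p) h h1 B f :
  0 < h < h1 -> smooth f -> supbound M h1 f B ->
  forall eps, 0 < eps -> exists d, 0 < d /\ forall c, Rabs c < d ->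
    supbound M h (fun t => f (t + c)%R - f t)%C eps.
Proof.
intros Hh Sf HB eps e0.
assert (q1 : 0 <= h / h1 < 1).
{ split; [apply Rdiv_le_0_compat; lra|apply Rlt_div_l; lra]. }
destruct (geometric_small (h / h1) (2 * B) eps q1 e0) as [N HN].
assert (Q : forall p, exists d, 0 < d /\ forall c, Rabs c < d ->
  forall t, h ^ p * Cmod (derivC_n p f (t + c)%R - derivC_n p f t)%C <= eps * M p).
{ intros p.
  set (K := Rabs B * M (S p) / h1 ^ S p).
  assert (hp : 0 < h1 ^ S p) by (apply pow_lt; lra).
  assert (K0 : 0 <= K).
  { apply Rdiv_le_0_compat; [|exact hp].
    apply Rmult_le_pos; [apply Rabs_pos|left; apply Mpos]. }
  assert (HK : forall t, Cmod (derivC_n (S p) f t) <= K).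
  { intros t; apply Rle_div_r; [exact hp|]; rewrite Rmult_comm.
    eapply Rle_trans; [apply HB|apply Rmult_le_compat_r; [left; apply Mpos|apply Rle_abs]]. }
  set (L := h ^ p * (2 * K) + 1).
  assert (hp' : 0 < h ^ p) by (apply pow_lt; lra).
  assert (L0 : 0 < L) by (unfold L; nra).
  assert (eM : 0 < eps * M p) by (apply Rmult_lt_0_compat; [exact e0|apply Mpos]).
  exists (eps * M p / L); split; [apply Rdiv_lt_0_compat; assumption|].
  intros c Hc t.
  apply Rlt_div_r in Hc; [|exact L0].
  pose proof (derivC_n_increment f p K t (t + c) Sf HK) as Hi.
  replace (t + c - t) with c in Hi by ring.
  apply (Rmult_le_compat_l (h ^ p)) in Hi; [|lra].
  unfold L in Hc; pose proof (Rabs_pos c); nra. }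
destruct (uniform_radius (fun p c =>
  forall t, h ^ p * Cmod (derivC_n p f (t + c)%R - derivC_n p f t)%C <= eps * M p) Q N)
  as [d [d0 Hd]].
exists d; split; [exact d0|]; intros c Hc p t.
rewrite derivC_n_minus, derivC_n_trans; [|apply smooth_trans, Sf|exact Sf].
destruct (Nat.lt_ge_cases p N) as [Hp|Hp]; [apply Hd; assumption|].
assert (H2 : Cmod (derivC_n p f (t + c)%R - derivC_n p f t)%C <=
             Cmod (derivC_n p f (t + c)) + Cmod (derivC_n p f t)).
{ unfold Cminus; eapply Rle_trans; [apply Cmod_triangle|]; rewrite Cmod_opp; lra. }
pose proof (HB p (t + c)) as B1; pose proof (HB p t) as B2.
assert (hq : h ^ p = (h / h1) ^ p * h1 ^ p).
{ rewrite <- Rpow_mult_distr; f_equal; field; lra. }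
rewrite hq.
assert (qp : 0 <= (h / h1) ^ p) by (apply pow_le; lra).
assert (H3 : h1 ^ p * Cmod (derivC_n p f (t + c)%R - derivC_n p f t)%C <= 2 * B * M p).
{ assert (0 < h1 ^ p) by (apply pow_lt; lra); nra. }
apply (Rmult_le_compat_l _ _ _ qp) in H3.
pose proof (HN p Hp) as H4; apply (Rmult_le_compat_r (M p)) in H4; [|left; apply Mpos].
lra.
Qed.

(** * The implications (ii) -> (iii) -> (iv) *)

Section Consequences.

Context {X : CompleteNormedModule C_AbsRing} (M : nat -> R) (Mpos : forall p, 0 < M p).
Context (s : udtype) (T : (R -> C) -> X) (HT : continuous_linear (DL1 s M) T).

(** Moving the point from [x] to [y] translates the reflected function [g] by [x - y];
    [translation_modulus] makes the difference small and [T] is continuous at [g]. Some room in the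
    scale is given up: from [2 h] to [h] in the Beurling case, from [h] to [h / 2] in the Roumieu
    case. *)
Lemma continuous_convol phi : carrier (Dspace s M) phi -> forall x, continuous (convol T phi) x.
Proof.
intros Hphi x W HW; unfold convol in *.
pose proof (carrier_reflect s M Mpos phi x Hphi) as Hg.
set (g := fun t => phi (x - t)) in *.
pose proof (proj2 HT g (carrier_DL1 s M Mpos g Hg) W HW) as HU.
assert (E : forall y t, (phi (y - t)%R - phi (x - t)%R = g (t + (x - y))%R - g t)%C).
{ intros y t; unfold g; do 2 f_equal; ring. }
apply (DL1_nbhs0_eventually s M Mpos _ (locally x) (fun y t => phi (y - t)%R - phi (x - t)%R)%C)
  in HU.
- apply filter_imp with (2 := HU); intros y Hy.
  replace (fun t => phi (y - t)) with (fun t => g t + (phi (y - t)%R - phi (x - t)%R))%C;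
    [exact Hy|extensionality t; unfold g; ring].
- intros y; apply (carrier_minus s M Mpos (fun t => phi (y - t)) (fun t => phi (x - t)));
    apply carrier_reflect; assumption.
- apply carrier_Dspace in Hg; [|assumption]; destruct Hg as [Sg [[r [r0 Hr]] HB]].
  assert (K : forall h h1 B, 0 < h < h1 -> supbound M h1 g B ->
    (forall y, exists B, L1bound M h (fun t => phi (y - t)%R - phi (x - t)%R)%C B) /\
    forall eps, 0 < eps ->
      locally x (fun y => L1bound M h (fun t => phi (y - t)%R - phi (x - t)%R)%C eps)).
  { intros h h1 B Hh HBg.
    assert (sup : forall c, supported (r + Rabs c) (fun t => g (t + c)%R - g t)%C).
    { intros c; apply supported_minus; [apply supported_trans, Hr|].
      apply supported_le with r; [pose proof (Rabs_pos c); lra|exact Hr]. }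
    assert (sm : forall c, smooth (fun t => g (t + c)%R - g t)%C).
    { intros c; apply smooth_minus; [apply smooth_trans|]; exact Sg. }
    split.
    - intros y; rewrite (functional_extensionality _ _ (E y)).
      exists (2 * (r + Rabs (x - y)) * (B + B)); apply supbound_L1bound; auto; [lra| |].
      + pose proof (Rabs_pos (x - y)); lra.
      + assert (HBg' : supbound M h g B) by (apply supbound_scale with h1; [lra|exact HBg]).
        apply supbound_minus; [lra|apply smooth_trans, Sg|exact Sg| |exact HBg'].
        apply supbound_trans, HBg'.
    - intros eps e0.
      assert (e1 : 0 < eps / (2 * (r + 1))) by (apply Rdiv_lt_0_compat; lra).
      destruct (translation_modulus M Mpos h h1 B g Hh Sg HBg _ e1) as [d [d0 Hd]].
      assert (d1 : 0 < Rmin d 1) by (apply Rmin_case; lra).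
      exists (mkposreal _ d1); intros y Hy; change (Rabs (y - x) < Rmin d 1) in Hy.
      rewrite Rabs_minus_sym in Hy.
      rewrite (functional_extensionality _ _ (E y)).
      replace eps with (2 * (r + 1) * (eps / (2 * (r + 1)))) by (field; lra).
      apply supbound_L1bound; auto; try lra.
      + apply supported_le with (2 := sup (x - y)).
        pose proof (Rmin_r d 1); lra.
      + apply Hd; pose proof (Rmin_l d 1); lra. }
  destruct s; simpl in *.
  + intros h h0; destruct (HB (2 * h)) as [B HBg]; [lra|].
    apply (K h (2 * h) B); [lra|exact HBg].
  + destruct HB as [h [h0 [B HBg]]]; exists (h / 2); split; [lra|].
    apply (K (h / 2) h B); [lra|exact HBg].
Qed.

Lemma assertion_ii_iii : assertion_ii s M T -> assertion_iii s M T.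
Proof.
intros H b; destruct (H b) as [a [Hab [S [_ [H1 H2]]]]].
exists a; split; [exact Hab|]; intros phi Hphi.
(* The inner limit in [k] falls on the translates of [T] by [a k], tested on a translate of [phi];
   it is the value of [S] there. *)
exists (fun l => translate (- a l) S phi); split; [|apply H2, Hphi].
intros l; unfold translate at 1.
assert (Hl : carrier (Dspace s M) (fun t => phi (t - - a l))).
{ apply (carrier_trans s M Mpos phi (- - a l)), Hphi. }
exact (H1 _ Hl).
Qed.

Lemma assertion_iii_iv : assertion_iii s M T -> assertion_iv s M T.
Proof.
intros H phi Hphi; split; [apply continuous_convol, Hphi|].
intros b; destruct (H b) as [a [Hab Ha]]; exists a; split; [exact Hab|].
assert (Hx : forall x, carrier (Dspace s M) (fun t => phi (x - t))).
{ intros x; apply carrier_reflect; assumption. }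
(* [y x l] is the limit of [(T * phi) (x - a l + a k)] as [k] tends to infinity. *)
assert (Y : forall x, exists y : nat -> X,
  (forall l, tends (fun k => convol T phi (x - a l + a k)) (y l)) /\
  tends y (convol T phi x)).
{ intros x; destruct (Ha _ (Hx x)) as [y [Hy1 Hy2]]; exists y; split; [|exact Hy2].
  intros l; specialize (Hy1 l); revert Hy1; unfold tends; apply filterlim_ext.
  intros k; unfold translate, convol; f_equal; extensionality t; f_equal; ring. }
destruct (choice _ Y) as [y Hy].
(* Inner limits are known only along [x - a l + a k]. Starting from [x + a 0] and taking [l = 0]
   gives the limit along [x + a k]. *)
exists (fun x => y (x + a 0%nat) 0%nat); intros x; split.
- destruct (Hy (x + a 0%nat)) as [Hy1 _]; specialize (Hy1 0%nat); revert Hy1.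
  unfold tends; apply filterlim_ext; intros k; f_equal; ring.
- destruct (Hy x) as [Hy1 Hy2]; revert Hy2; unfold tends; apply filterlim_ext; intros l.
  (* Both [y x l] and the limit function at [x - a l] are limits of the same sequence in [k]. *)
  apply (filterlim_locally_unique (F := eventually)
    (fun k => convol T phi (x - a l + a k))); [apply Hy1|].
  destruct (Hy (x - a l + a 0%nat)) as [Hy3 _]; specialize (Hy3 0%nat); revert Hy3.
  apply filterlim_ext; intros k; f_equal; ring.
Qed.

End Consequences.

(** * Ultradifferential operators on test functions *)

(** The quantifier over [h] for estimates of functionals and operators, dual to [for_scales]: by
    [dual_scales_meet] the two always share a scale. *)
Definition dual_scales (s : udtype) (P : R -> Prop) : Prop :=
  match s with
  | Beurling => exists h, 0 < h /\ P h
  | Roumieu => forall h, 0 < h -> P h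
  end.

Lemma dual_scales_meet s (P Q : R -> Prop) :
  dual_scales s P -> for_scales s Q -> exists h, 0 < h /\ P h /\ Q h.
Proof.
destruct s; simpl.
- intros [h [h0 H]] HQ; exists h; auto.
- intros HP [h [h0 H]]; exists h; auto.
Qed.

Definition udo_term (a : nat -> C) (phi : R -> C) (p : nat) (t : R) : C :=
  (Cpow (- RtoC 1) p * a p * Dop p phi t)%C.

Definition udo_test (a : nat -> C) (phi : R -> C) (t : R) : C :=
  CSeries (fun p => udo_term a phi p t).

Lemma Cmod_pow_one (z : C) p : Cmod z = 1 -> Cmod (Cpow z p) = 1.
Proof.
intros H; induction p as [|p IH]; simpl; [apply Cmod_1|].
rewrite Cmod_mult, H, IH; ring.
Qed.

Lemma Cmod_udo_term a phi p t :
  Cmod (udo_term a phi p t) = Cmod (a p) * Cmod (derivC_n p phi t).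
Proof.
unfold udo_term, Dop; rewrite !Cmod_mult, !Cmod_pow_one; try ring.
- rewrite Cmod_opp; apply Cmod_Ci.
- rewrite Cmod_opp; apply Cmod_1.
Qed.

Lemma ex_series_geom_le (u : nat -> R) K q : 0 <= q < 1 ->
  (forall p, Rabs (u p) <= K * q ^ p) -> ex_series u.
Proof.
intros Hq H; apply (@ex_series_le R_AbsRing R_CompleteNormedModule) with (fun p => K * q ^ p).
- exact H.
- apply (ex_series_scal_l (K := R_AbsRing) K (fun p => q ^ p)), ex_series_geom.
  rewrite Rabs_pos_eq; lra.
Qed.

Lemma Series_geom_le (u : nat -> R) K q : 0 <= q < 1 ->
  (forall p, Rabs (u p) <= K * q ^ p) -> Rabs (Series u) <= K / (1 - q).
Proof.
intros Hq H.
assert (G : ex_series (fun p => K * q ^ p)).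
{ apply (ex_series_scal_l (K := R_AbsRing) K (fun p => q ^ p)), ex_series_geom.
  rewrite Rabs_pos_eq; lra. }
assert (A : ex_series (fun p => Rabs (u p))).
{ apply ex_series_geom_le with K q; [exact Hq|intros p; rewrite Rabs_Rabsolu; apply H]. }
eapply Rle_trans; [apply Series_Rabs, A|].
replace (K / (1 - q)) with (Series (fun p => K * q ^ p)).
- apply Series_le; [|exact G]; intros p; split; [apply Rabs_pos|apply H].
- rewrite Series_scal_l, Series_geom by (rewrite Rabs_pos_eq; lra); reflexivity.
Qed.

Lemma continuous_R (f : R -> R) (t : R) :
  continuous f t <->
  forall eps, 0 < eps -> exists d, 0 < d /\ forall s, Rabs (s - t) < d -> Rabs (f s - f t) < eps.
Proof.
split.
- intros H eps e0; destruct (H (ball (f t) (mkposreal eps e0))) as [d Hd].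
  + exists (mkposreal eps e0); intros y Hy; exact Hy.
  + exists d; split; [apply cond_pos|]; intros s Hs; exact (Hd s Hs).
- intros H P [eps HP]; destruct (H eps (cond_pos eps)) as [d [d0 Hd]].
  exists (mkposreal d d0); intros y Hy; apply HP, Hd, Hy.
Qed.

Lemma continuous_uniform_limit (f : R -> R) (t : R) :
  (forall eps, 0 < eps -> exists g : R -> R, continuous g t /\ forall s, Rabs (f s - g s) <= eps) ->
  continuous f t.
Proof.
intros H; apply continuous_R; intros eps e0.
destruct (H (eps / 4)) as [g [cg Hg]]; [lra|].
destruct (proj1 (continuous_R g t) cg (eps / 4)) as [d [d0 Hd]]; [lra|].
exists d; split; [exact d0|]; intros s Hs.
specialize (Hd s Hs); pose proof (Hg s) as H1; pose proof (Hg t) as H2.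
revert Hd H1 H2; unfold Rabs; repeat destruct Rcase_abs; lra.
Qed.

Lemma continuous_sum_n (u : nat -> R -> R) t : (forall p, continuous (u p) t) ->
  forall n, continuous (fun s => sum_n (fun p => u p s) n) t.
Proof.
intros H n; induction n as [|n IH].
- apply continuous_ext with (u 0%nat); [intros s; rewrite sum_O; reflexivity|apply H].
- apply continuous_ext with (fun s => plus (sum_n (fun p => u p s) n) (u (S n) s)).
  { intros s; rewrite sum_Sn; reflexivity. }
  apply (continuous_plus (V := R_NormedModule)); [exact IH|apply H].
Qed.

Lemma continuous_Series_geom (u : nat -> R -> R) K q t : 0 <= q < 1 ->
  (forall p s, Rabs (u p s) <= K * q ^ p) -> (forall p, continuous (u p) t) ->
  continuous (fun s => Series (fun p => u p s)) t.
Proof.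
intros Hq H cu; apply continuous_uniform_limit; intros eps e0.
destruct (geometric_small q (K / (1 - q)) eps Hq e0) as [N HN].
exists (fun s => sum_n (fun p => u p s) N); split; [apply continuous_sum_n, cu|].
intros s; rewrite (Series_incr_n (fun p => u p s) (S N)); [|lia|].
2:{ apply ex_series_geom_le with K q; auto. }
rewrite <- sum_n_Reals, Nat.pred_succ.
match goal with |- Rabs (?x + ?y - ?x) <= _ => replace (x + y - x) with y by ring end.
eapply Rle_trans; [apply (Series_geom_le _ (K * q ^ S N) q Hq)|].
- intros p; eapply Rle_trans; [apply H|]; rewrite pow_add; lra.
- specialize (HN (S N) (Nat.le_succ_diag_r N)); unfold Rdiv in *; lra.
Qed.

Definition continuousC (f : R -> C) : Prop :=
  forall t, continuous (fun s => Re (f s)) t /\ continuous (fun s => Im (f s)) t.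

Lemma continuous_Re_mult (c : C) (f : R -> C) :
  continuousC f -> continuousC (fun t => c * f t)%C.
Proof.
intros H t; destruct (H t) as [H1 H2]; simpl; split.
- apply (continuous_minus (V := R_NormedModule) (fun s => Re c * Re (f s)) (fun s => Im c * Im (f s)));
    apply (continuous_scal_r (V := R_NormedModule)); assumption.
- apply (continuous_plus (V := R_NormedModule) (fun s => Re c * Im (f s)) (fun s => Im c * Re (f s)));
    apply (continuous_scal_r (V := R_NormedModule)); assumption.
Qed.

Lemma smooth_continuousC phi : smooth phi -> continuousC phi.
Proof.
intros H t; split; [apply (smooth_continuous_Re phi 0)|apply (smooth_continuous_Im phi 0)]; exact H.
Qed.

Lemma continuousC_udo_term a phi p : smooth phi -> continuousC (udo_term a phi p).
Proof.
intros H; unfold udo_term, Dop.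
apply (continuous_Re_mult _ (fun t => Cpow (- Ci) p * derivC_n p phi t)%C).
apply (continuous_Re_mult _ (derivC_n p phi)).
intros t; split; [apply smooth_continuous_Re|apply smooth_continuous_Im]; exact H.
Qed.

(** At scale [2 l] a coefficient bound [c l^p / M p] leaves the factor [2^(-p)] in each term, so the
    series converges uniformly in [t]. That [K] does not depend on [phi] is what makes the limit [S]
    of (ii) continuous. *)
Lemma udo_test_bound (s : udtype) (M : nat -> R) (Mpos : forall p, 0 < M p) a :
  udo_class s M a ->
  dual_scales s (fun h => exists K, 0 <= K /\ forall phi B, 0 <= B ->
    smooth phi -> supbound M h phi B ->
    (forall p t, Cmod (udo_term a phi p t) <= K * B * (/ 2) ^ p) /\
    continuousC (udo_test a phi) /\ forall t, Cmod (udo_test a phi t) <= 4 * K * B).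
Proof.
intros Ha.
assert (G : forall l c, 0 < l -> 0 < c ->
  (forall p, (1 <= p)%nat -> Cmod (a p) <= c * l ^ p / M p) ->
  exists K, 0 <= K /\ forall phi B, 0 <= B -> smooth phi -> supbound M (2 * l) phi B ->
    (forall p t, Cmod (udo_term a phi p t) <= K * B * (/ 2) ^ p) /\
    continuousC (udo_test a phi) /\ forall t, Cmod (udo_test a phi t) <= 4 * K * B).
{ intros l c l0 c0 Hac.
  (* The class condition starts at [p = 1]; the second summand accounts for [a 0]. *)
  exists (c + Cmod (a 0%nat) * M 0%nat).
  assert (a0 : 0 <= Cmod (a 0%nat) * M 0%nat).
  { apply Rmult_le_pos; [apply Cmod_ge_0|left; apply Mpos]. }
  split; [lra|]; intros phi B B0 Sphi HB.
  set (K := (c + Cmod (a 0%nat) * M 0%nat)) in *.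
  assert (ap : forall p, Cmod (a p) * M p <= K * l ^ p).
  { intros p; destruct p as [|p].
    - simpl; unfold K; lra.
    - assert (H : Cmod (a (S p)) <= c * l ^ S p / M (S p)) by (apply Hac; lia).
      apply Rle_div_r in H; [|apply Mpos].
      eapply Rle_trans; [exact H|]; apply Rmult_le_compat_r; [apply pow_le; lra|unfold K; lra]. }
  assert (tb : forall p t, Cmod (udo_term a phi p t) <= K * B * (/ 2) ^ p).
  { intros p t; rewrite Cmod_udo_term.
    assert (lp : 0 < l ^ p) by (apply pow_lt; exact l0).
    assert (p2 : 0 < 2 ^ p) by (apply pow_lt; lra).
    specialize (HB p t); rewrite Rpow_mult_distr in HB.
    rewrite pow_inv; apply (Rmult_le_reg_r (2 ^ p * l ^ p)); [nra|].
    replace (K * B * / 2 ^ p * (2 ^ p * l ^ p)) with (K * B * l ^ p) by (field; lra).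
    pose proof (ap p) as H1.
    apply (Rmult_le_compat_r (B)) in H1; [|exact B0].
    apply (Rmult_le_compat_l (Cmod (a p))) in HB; [|apply Cmod_ge_0].
    lra. }
  assert (q2 : 0 <= / 2 < 1) by lra.
  assert (tbR : forall p t, Rabs (Re (udo_term a phi p t)) <= K * B * (/ 2) ^ p).
  { intros p t; eapply Rle_trans; [apply Rabs_Re_le|apply tb]. }
  assert (tbI : forall p t, Rabs (Im (udo_term a phi p t)) <= K * B * (/ 2) ^ p).
  { intros p t; eapply Rle_trans; [apply Rabs_Im_le|apply tb]. }
  split; [exact tb|split].
  - intros t; split.
    + refine (continuous_Series_geom (fun p s => Re (udo_term a phi p s)) (K * B) (/ 2) t q2 tbR _).
      intros p; exact (proj1 (continuousC_udo_term a phi p Sphi t)).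
    + refine (continuous_Series_geom (fun p s => Im (udo_term a phi p s)) (K * B) (/ 2) t q2 tbI _).
      intros p; exact (proj2 (continuousC_udo_term a phi p Sphi t)).
  - intros t; unfold udo_test, CSeries.
    eapply Rle_trans; [apply Cmod_pair_le|].
    pose proof (Series_geom_le _ _ _ q2 (fun p => tbR p t)) as H1.
    pose proof (Series_geom_le _ _ _ q2 (fun p => tbI p t)) as H2.
    (* Two components, each a geometric series with sum [2 K B]. *)
    replace (4 * K * B) with (K * B / (1 - / 2) + K * B / (1 - / 2)) by field.
    apply Rplus_le_compat; assumption. }
destruct s; simpl in *.
- destruct Ha as [l [c [l0 [c0 H]]]]; exists (2 * l); split; [lra|exact (G l c l0 c0 H)].
- intros h h0; destruct (Ha (h / 2)) as [c [c0 H]]; [lra|].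
  replace h with (2 * (h / 2)) by field; apply (G (h / 2) c); [lra|assumption..].
Qed.

Lemma CSeries_zero (u : nat -> C) : (forall p, u p = 0%C) -> CSeries u = 0%C.
Proof.
intros H; unfold CSeries, RtoC; f_equal.
- rewrite (Series_ext _ (fun _ => 0 * 0)); [rewrite Series_scal_l; ring|].
  intros n; rewrite H; simpl; ring.
- rewrite (Series_ext _ (fun _ => 0 * 0)); [rewrite Series_scal_l; ring|].
  intros n; rewrite H; simpl; ring.
Qed.

Lemma udo_test_supported a phi r : supported r phi -> supported r (udo_test a phi).
Proof.
intros H t Ht; apply CSeries_zero; intros p; unfold udo_term, Dop.
rewrite derivC_n_supported with (r := r); [ring|exact H|exact Ht].
Qed.

Lemma udo_test_trans a phi c t : udo_test a (fun u => phi (u + c)) t = udo_test a phi (t + c).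
Proof.
unfold udo_test; f_equal; extensionality p; unfold udo_term, Dop.
rewrite derivC_n_trans; reflexivity.
Qed.

(** * Vector-valued integrals *)

Section VectorIntegrals.

Context {X : CompleteNormedModule C_AbsRing}.

Lemma continuous_scal_C (psi : R -> C) (f : R -> X) t :
  continuous (fun s => Re (psi s)) t -> continuous (fun s => Im (psi s)) t ->
  continuous f t -> continuous (fun s => scal (psi s : C_AbsRing) (f s)) t.
Proof.
intros H1 H2 Hf; refine (continuous_scal (K := C_AbsRing) (V := X) psi f t _ Hf).
intros P [eps HP].
assert (e2 : 0 < eps / 2) by (pose proof (cond_pos eps); lra).
destruct (proj1 (continuous_R _ t) H1 _ e2) as [d1 [d1p Hd1]].
destruct (proj1 (continuous_R _ t) H2 _ e2) as [d2 [d2p Hd2]].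
assert (dp : 0 < Rmin d1 d2) by (apply Rmin_case; assumption).
exists (mkposreal _ dp); intros y Hy; change (Rabs (y - t) < Rmin d1 d2) in Hy; apply HP.
change (Cmod (psi y - psi t)%C < eps).
replace (psi y - psi t)%C with ((Re (psi y) - Re (psi t), Im (psi y) - Im (psi t)) : C).
2:{ unfold Cminus, Cplus, Copp; simpl; f_equal. }
eapply Rle_lt_trans; [apply Cmod_pair_le|].
specialize (Hd1 y); specialize (Hd2 y).
pose proof (Rmin_l d1 d2); pose proof (Rmin_r d1 d2).
assert (Rabs (y - t) < d1) by lra; assert (Rabs (y - t) < d2) by lra.
specialize (Hd1 H3); specialize (Hd2 H4); lra.
Qed.

(** By [regular_shift] this pairs [f] with [psi] translated by [c]. The shift sits on [f], so
    translating the distribution affects [f] alone, and the interval stays fixed. *)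
Definition weighted (psi : R -> C) (f : R -> X) (r c : R) : X :=
  RInt (V := realify X) (fun t => scal (psi t : C_AbsRing) (f (t + c))) (- r) r.

Lemma continuous_shift (f : R -> X) c t : (forall t, continuous f t) ->
  continuous (fun s => f (s + c)) t.
Proof.
intros H; apply (continuous_comp (fun s => s + c) f); [|apply H].
apply (@ex_derive_continuous R_AbsRing R_NormedModule); auto_derive; exact I.
Qed.

Lemma continuous_weight (psi : R -> C) (f : R -> X) c t :
  continuousC psi -> (forall t, continuous f t) ->
  continuous (fun s => scal (psi s : C_AbsRing) (f (s + c))) t.
Proof.
intros H Hf; refine (continuous_scal_C psi (fun s => f (s + c)) t _ _ _);
  [exact (proj1 (H t))|exact (proj2 (H t))|apply continuous_shift, Hf].
Qed.

Lemma continuousC_shift (psi : R -> C) c :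
  continuousC psi -> continuousC (fun t => psi (t + c)).
Proof.
assert (A : forall t, continuous (fun s => s + c) t).
{ intros t; apply (@ex_derive_continuous R_AbsRing R_NormedModule); auto_derive; exact I. }
intros H t; split.
- exact (continuous_comp (fun s => s + c) (fun s => Re (psi s)) t (A t) (proj1 (H (t + c)))).
- exact (continuous_comp (fun s => s + c) (fun s => Im (psi s)) t (A t) (proj2 (H (t + c)))).
Qed.

Lemma weighted_ex_RInt (psi : R -> C) (f : R -> X) c a b :
  continuousC psi -> (forall t, continuous f t) ->
  ex_RInt (V := realify X) (fun t => scal (psi t : C_AbsRing) (f (t + c))) a b.
Proof.
intros H Hf; apply (ex_RInt_continuous (V := realify X)); intros z _.
exact (continuous_weight psi f c z H Hf).
Qed.

Lemma regular_shift (psi : R -> C) (f : R -> X) r c : 0 < r ->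
  continuousC psi -> supported r psi -> (forall t, continuous f t) ->
  regular f (fun t => psi (t - c)) = weighted psi f r c.
Proof.
intros r0 cpsi Hr cf; unfold regular, weighted.
set (h := fun t => scal (psi (t - c) : C_AbsRing) (f t)).
assert (cont : forall t, continuous (h : R -> realify X) t).
{ intros t; apply (continuous_scal_C (fun t => psi (t - c))).
  - exact (proj1 (continuousC_shift psi (- c) cpsi t)).
  - exact (proj2 (continuousC_shift psi (- c) cpsi t)).
  - apply cf. }
transitivity (RInt (h : R -> realify X) (- r + c) (r + c)).
- refine (is_RInt_gen_unique (V := realify X) h _ (is_RInt_gen_interval (V := realify X) h _ _ _ cont _));
    [lra|].
  intros t Ht; unfold h; rewrite Hr; [exact (scal_C0 (f t))|].
  unfold Rabs; destruct Rcase_abs; lra.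
- pose proof (RInt_comp_lin (V := realify X) h 1 c (- r) r) as E.
  rewrite !Rmult_1_l in E; rewrite <- E.
  2:{ apply (ex_RInt_continuous (V := realify X)); intros z _; apply cont. }
  apply (RInt_ext (V := realify X)); intros t _.
  rewrite Rmult_1_l; etransitivity; [exact (scal_one (h (t + c)))|].
  unfold h; do 2 f_equal; ring.
Qed.

Lemma regular_weighted (psi : R -> C) (f : R -> X) r : 0 < r ->
  continuousC psi -> supported r psi -> (forall t, continuous f t) ->
  regular f psi = weighted psi f r 0.
Proof.
intros r0 cpsi Hr cf; rewrite <- (regular_shift psi f r 0) by assumption.
f_equal; extensionality t; f_equal; ring.
Qed.

Lemma norm_weighted (psi : R -> C) (f : R -> X) r c K B : 0 < r ->
  continuousC psi -> (forall t, continuous f t) ->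
  0 <= K -> (forall t, Cmod (psi t) <= K) -> (forall t, norm (f t) <= B) ->
  norm (weighted psi f r c) <= 2 * r * (K * B).
Proof.
intros r0 cpsi cf K0 HK HB.
replace (2 * r * (K * B)) with ((r - - r) * (K * B)) by ring.
refine (norm_RInt_le_const (V := realify X) (fun t => scal (psi t : C_AbsRing) (f (t + c)))
  (- r) r _ (K * B) _ _ _).
- lra.
- intros t _; eapply Rle_trans; [exact (norm_scal (psi t : C_AbsRing) (f (t + c)))|].
  apply Rmult_le_compat; [apply Cmod_ge_0|apply norm_ge_0|apply HK|apply HB].
- apply (RInt_correct (V := realify X)), weighted_ex_RInt; assumption.
Qed.

Lemma continuous_norm_minus (f g : R -> X) t : continuous f t -> continuous g t ->
  continuous (fun s => norm (minus (f s) (g s))) t.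
Proof.
intros Hf Hg.
apply (continuous_comp (V := X) (fun s => minus (f s) (g s)) norm).
- apply (continuous_minus (V := X) f g); assumption.
- exact (filterlim_norm (V := X) (minus (f t) (g t))).
Qed.

Definition shift_distance (f : R -> X) (r c c' : R) : R :=
  RInt (fun t => norm (minus (f (t + c)) (f (t + c')))) (- r) r.

Lemma shift_distance_ex (f : R -> X) c c' a b : (forall t, continuous f t) ->
  ex_RInt (fun t => norm (minus (f (t + c)) (f (t + c')))) a b.
Proof.
intros cf; apply (ex_RInt_continuous (V := R_CompleteNormedModule)); intros z _.
apply (continuous_norm_minus (fun t => f (t + c)) (fun t => f (t + c'))); apply continuous_shift, cf.
Qed.

(** This reduces the convergence of vector-valued integrals to that of [shift_distance], the
    integral of a continuous real function. *)
Lemma weighted_shift_le (psi : R -> C) (f : R -> X) r c c' K : 0 < r ->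
  continuousC psi -> (forall t, continuous f t) -> (forall t, Cmod (psi t) <= K) ->
  norm (minus (weighted psi f r c) (weighted psi f r c')) <= K * shift_distance f r c c'.
Proof.
intros r0 cpsi cf HK; unfold shift_distance.
pose proof (weighted_ex_RInt psi f c (- r) r cpsi cf) as E1.
pose proof (weighted_ex_RInt psi f c' (- r) r cpsi cf) as E2.
pose proof (is_RInt_minus (V := realify X) _ _ _ _ _ _
  (RInt_correct (V := realify X) _ _ _ E1) (RInt_correct (V := realify X) _ _ _ E2)) as D.
pose proof (shift_distance_ex f c c' (- r) r cf) as E3.
pose proof (is_RInt_scal (V := R_NormedModule) _ _ _ K _
  (RInt_correct (V := R_CompleteNormedModule) _ _ _ E3)) as D3.
refine (norm_RInt_le (V := realify X) _ _ (- r) r _ _ _ _ D D3); [lra|].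
intros t _.
assert (E : minus (scal (psi t : C_AbsRing) (f (t + c))) (scal (psi t : C_AbsRing) (f (t + c')))
  = scal (psi t : C_AbsRing) (minus (f (t + c)) (f (t + c')))).
{ exact (eq_sym (scal_minus_distr_l (psi t : C_AbsRing) (f (t + c)) (f (t + c')))). }
eapply Rle_trans; [apply Req_le, (f_equal (@norm C_AbsRing X) E)|].
eapply Rle_trans; [exact (norm_scal (psi t : C_AbsRing) (minus (f (t + c)) (f (t + c'))))|].
apply Rmult_le_compat_r; [apply norm_ge_0|apply HK].
Qed.

End VectorIntegrals.

(** * Almost automorphic functions *)

Lemma strictly_increasing_ge (sigma : nat -> nat) :
  (forall n, (sigma n < sigma (S n))%nat) -> forall n, (n <= sigma n)%nat.
Proof. intros H n; induction n as [|n IH]; [lia|specialize (H n); lia]. Qed.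

Lemma subseq_trans (a b c : nat -> R) : subseq a b -> subseq b c -> subseq a c.
Proof.
intros [sigma [Hs Ha]] [tau [Ht Hb]]; exists (fun n => tau (sigma n)); split.
- assert (mono : forall m n, (m < n)%nat -> (tau m < tau n)%nat).
  { intros m n H; induction H as [|n H IH]; [apply Ht|specialize (Ht n); lia]. }
  intros n; apply mono, Hs.
- intros n; rewrite Ha; apply Hb.
Qed.

Lemma plus_minus_cancel {G : AbelianGroup} (x y : G) : minus (plus x y) x = y.
Proof.
unfold minus; rewrite (plus_comm x y), <- plus_assoc.
exact (eq_trans (f_equal (plus y) (plus_opp_r x)) (plus_zero_r y)).
Qed.

Lemma plus_plus_swap {G : AbelianMonoid} (a b c d : G) :
  plus (plus a b) (plus c d) = plus (plus a c) (plus b d).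
Proof.
rewrite <- !plus_assoc; f_equal; rewrite !plus_assoc; f_equal; apply plus_comm.
Qed.

Lemma minus_plus_plus {G : AbelianGroup} (x y z w : G) :
  minus (plus x y) (plus z w) = plus (minus x z) (minus y w).
Proof.
exact (eq_trans (f_equal (plus (plus x y)) (opp_plus z w)) (plus_plus_swap x y (opp z) (opp w))).
Qed.

Section Automorphic.

Context {X : CompleteNormedModule C_AbsRing}.

Lemma norm_plus_le (x y : X) : norm (plus x y) <= norm x + norm y.
Proof. exact (norm_triangle x y). Qed.

Lemma norm_minus_sym (x y : X) : norm (minus x y) = norm (minus y x).
Proof. rewrite <- norm_opp, opp_minus; reflexivity. Qed.

Lemma norm_minus_triangle (y x z : X) :
  norm (minus x z) <= norm (minus x y) + norm (minus y z).
Proof. rewrite (minus_trans y x z); exact (norm_triangle (minus x y) (minus y z)). Qed.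

Lemma norm_minus_le (x y : X) : norm (minus x y) <= norm x + norm y.
Proof.
exact (Rle_trans _ _ _ (norm_triangle x (opp y))
  (Req_le _ _ (f_equal (Rplus (norm x)) (norm_opp y)))).
Qed.

Lemma norm_le_minus (x y : X) : norm x <= norm (minus x y) + norm y.
Proof.
assert (E : plus (minus x y) y = x).
{ unfold minus; rewrite <- plus_assoc, plus_opp_l, plus_zero_r; reflexivity. }
rewrite <- E at 1; apply norm_plus_le.
Qed.

Lemma norm_lincomb_lt (x y : X) (a b : C) eps : 0 < eps ->
  norm x < eps -> norm y < eps -> Cmod a + Cmod b <= 1 ->
  norm (plus (scal (a : C_AbsRing) x) (scal (b : C_AbsRing) y)) < eps.
Proof.
intros e0 Hx Hy Hab.
eapply Rle_lt_trans; [exact (norm_triangle (scal (a : C_AbsRing) x) (scal (b : C_AbsRing) y))|].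
pose proof (norm_scal (a : C_AbsRing) x : norm (scal (a : C_AbsRing) x) <= Cmod a * norm x) as N1.
pose proof (norm_scal (b : C_AbsRing) y : norm (scal (b : C_AbsRing) y) <= Cmod b * norm y) as N2.
pose proof (Cmod_ge_0 a); pose proof (Cmod_ge_0 b).
pose proof (norm_ge_0 x); pose proof (norm_ge_0 y).
set (m := Rmax (norm x) (norm y)).
assert (m1 : norm x <= m) by apply Rmax_l.
assert (m2 : norm y <= m) by apply Rmax_r.
assert (m3 : m < eps) by (apply Rmax_case; assumption).
assert (A1 : Cmod a * norm x <= Cmod a * m) by (apply Rmult_le_compat_l; assumption).
assert (A2 : Cmod b * norm y <= Cmod b * m) by (apply Rmult_le_compat_l; assumption).
assert (A3 : (Cmod a + Cmod b) * m <= 1 * m) by (apply Rmult_le_compat_r; lra).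
eapply Rle_lt_trans; [exact (Rplus_le_compat _ _ _ _ N1 N2)|lra].
Qed.

Lemma norm_minus_self (x : X) : norm (minus x x) = 0.
Proof. exact (eq_trans (f_equal (@norm C_AbsRing X) (minus_eq_zero x)) norm_zero). Qed.

Lemma tends_subseq (u : nat -> X) (x : X) (sigma : nat -> nat) :
  (forall n, (sigma n < sigma (S n))%nat) -> tends u x -> tends (fun n => u (sigma n)) x.
Proof.
intros Hs; rewrite !tends_norm; intros H eps e0; destruct (H eps e0) as [N HN].
exists N; intros n Hn; apply HN.
pose proof (strictly_increasing_ge sigma Hs n); lia.
Qed.

Lemma tends_unique (u : nat -> X) (x y : X) : tends u x -> tends u y -> x = y.
Proof. exact (filterlim_locally_unique (F := eventually) (V := X) u x y). Qed.

Lemma tends_norm_le (u : nat -> X) (x : X) (B : R) N :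
  tends u x -> (forall n, (N <= n)%nat -> norm (u n) <= B) -> norm x <= B.
Proof.
rewrite tends_norm; intros H HB; apply le_epsilon; intros eps e0.
destruct (H eps e0) as [K HK].
specialize (HK (Nat.max N K)); specialize (HB (Nat.max N K)).
assert (H1 := HK ltac:(lia)); assert (H2 := HB ltac:(lia)).
pose proof (norm_le_minus x (u (Nat.max N K))) as H3.
rewrite norm_minus_sym in H3; lra.
Qed.

Lemma tends_minus (u v : nat -> X) (x y : X) : tends u x -> tends v y ->
  tends (fun n => minus (u n) (v n)) (minus x y).
Proof.
intros H1 H2; unfold tends, minus.
refine (filterlim_comp_2 (F := eventually) u (fun n => opp (v n)) plus H1
  (filterlim_comp nat X X v opp _ _ _ H2 (filterlim_opp y)) (filterlim_plus (V := X) x (opp y))).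
Qed.

Lemma tends_minus_norm_le (u : nat -> X) (x y : X) (B : R) N :
  tends u x -> (forall n, (N <= n)%nat -> norm (minus (u n) y) <= B) -> norm (minus x y) <= B.
Proof.
intros H HB; apply (tends_norm_le (fun n => minus (u n) y) _ B N); [|exact HB].
apply (tends_minus u (fun _ => y)); [exact H|apply filterlim_const].
Qed.

Lemma tends_lim_norm (u : nat -> X) (x : X) :
  tends u x -> is_lim_seq (fun n => norm (u n)) (norm x).
Proof.
intros H; exact (filterlim_comp nat X R u norm _ _ _ H (filterlim_norm (V := X) x)).
Qed.

(** The threshold for [m] may depend on [n], as in the double limit; two late indices are compared
    through a common, still later [m]. *)
Lemma cauchy_tends (u : nat -> X) :
  (forall eps, 0 < eps -> exists N, forall n, (N <= n)%nat ->
     exists K, forall m, (K <= m)%nat -> norm (minus (u n) (u m)) <= eps) ->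
  exists x, tends u x.
Proof.
intros H; apply (filterlim_locally_cauchy (F := eventually) (U := X)).
intros eps; destruct (H (eps / 3)) as [N HN]; [pose proof (cond_pos eps); lra|].
exists (fun n => (N <= n)%nat); split; [exists N; auto|].
intros n m Hn Hm; apply (norm_compat1 (V := X)).
destruct (HN n Hn) as [K HK]; destruct (HN m Hm) as [K' HK'].
specialize (HK (Nat.max K K') ltac:(lia)); specialize (HK' (Nat.max K K') ltac:(lia)).
eapply Rle_lt_trans; [apply (norm_minus_triangle (u (Nat.max K K')))|].
rewrite (norm_minus_sym (u (Nat.max K K'))); pose proof (cond_pos eps); lra.
Qed.

(** Otherwise choose [b n] with [norm (f (b n)) > n]: no subsequence of [f (b n)] converges, against
    almost automorphy at the point 0. *)
Lemma AA_bounded (f : R -> X) : almost_automorphic f -> exists B, forall t, norm (f t) <= B.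
Proof.
intros [_ H]; apply NNPP; intros Hn.
assert (G : forall n : nat, exists t, INR n < norm (f t)).
{ intros n; apply NNPP; intros Hg; apply Hn; exists (INR n); intros t.
  destruct (Rle_lt_dec (norm (f t)) (INR n)) as [E|E]; [exact E|].
  exfalso; apply Hg; exists t; exact E. }
destruct (choice _ G) as [b Hb].
destruct (H b) as [a [[sigma [Hs Ha]] [g Hg]]].
destruct (Hg 0) as [H0 _]; rewrite tends_norm in H0.
destruct (H0 1 Rlt_0_1) as [N HN].
destruct (INR_unbounded (norm (g 0) + 1)) as [m Hm].
specialize (HN (Nat.max N m) ltac:(lia)).
rewrite Rplus_0_l, Ha in HN.
specialize (Hb (sigma (Nat.max N m))).
assert (INR m <= INR (sigma (Nat.max N m))).
{ apply le_INR; pose proof (strictly_increasing_ge sigma Hs (Nat.max N m)); lia. }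
pose proof (norm_le_minus (f (b (sigma (Nat.max N m)))) (g 0)); lra.
Qed.

(* The limit [S] is continuous because the approximants satisfy a common
   estimate by the norm of [phi] in [D^{M_p,h}_K]. *)
Lemma continuous_linear_Dspace (s : udtype) (M : nat -> R) (Mpos : forall p, 0 < M p)
    (S : (R -> C) -> X) :
  (forall f g a b, carrier (Dspace s M) f -> carrier (Dspace s M) g ->
     S (lincomb a f b g) = plus (scal (a : C_AbsRing) (S f)) (scal (b : C_AbsRing) (S g))) ->
  (forall r, 0 < r -> dual_scales s (fun h => exists K, 0 <= K /\ forall phi B, 0 <= B ->
     carrier (Dspace s M) phi -> supported r phi -> supbound M h phi B -> norm (S phi) <= K * B)) ->
  continuous_linear (Dspace s M) S.
Proof.
intros lin bnd; split; [intros; apply lin; assumption|].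
intros f Hf W HW; destruct (locally_of_norm (S f) W HW) as [eps [e0 HeW]].
exists (fun g => carrier (Dspace s M) g /\ norm (S g) < eps); split; [|split].
- intros u v a b [Hu1 Hu2] [Hv1 Hv2] Hab; split; [apply carrier_lincomb; assumption|].
  rewrite lin by assumption; apply norm_lincomb_lt; assumption.
- intros [K cK]; simpl.
  destruct (compact_P1 K cK) as [k [k' Hk]].
  set (r := Rabs k + Rabs k' + 1).
  assert (r0 : 0 < r) by (pose proof (Rabs_pos k); pose proof (Rabs_pos k'); unfold r; lra).
  assert (Kr : forall g, included (supp g) K -> supported r g).
  { intros g Hg t Ht; apply NNPP; intros H.
    assert (Kt : K t) by (apply Hg, adherence_P1; exact H).
    specialize (Hk t Kt); revert Ht; unfold r, Rabs; repeat destruct Rcase_abs; lra. }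
  assert (nb : forall h L, 0 <= L -> (forall phi B, 0 <= B ->
     carrier (Dspace s M) phi -> supported r phi -> supbound M h phi B -> norm (S phi) <= L * B) ->
     exists d : posreal, forall g, carrier (Dspace s M) g -> included (supp g) K ->
       Rbar_lt (norm_DK M h K g) d -> norm (S g) < eps).
  { intros h L L0 HL.
    assert (d0 : 0 < eps / (2 * (L + 1))) by (apply Rdiv_lt_0_compat; lra).
    exists (mkposreal _ d0); intros g Hg1 Hg2 Hg3.
    apply Rle_lt_trans with (L * (eps / (2 * (L + 1)))).
    - apply HL; [lra|exact Hg1|apply Kr, Hg2|].
      apply norm_DK_supbound with K; [assumption..|lra|apply Rbar_lt_le, Hg3].
    - replace (L * (eps / (2 * (L + 1)))) with (eps * (L / (2 * (L + 1)))) by (field; lra).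
      assert (L / (2 * (L + 1)) < 1) by (apply Rlt_div_l; lra); nra. }
  specialize (bnd r r0); destruct s; simpl in bnd |- *.
  + destruct bnd as [h [h0 [L [L0 HL]]]]; destruct (nb h L L0 HL) as [d Hd].
    exists (mkposreal h h0 :: nil), (fun h' g => Rbar_lt (norm_DK M h' K g) d); split.
    * intros i [<-|[]]; exists d; intros g _ Hg; exact Hg.
    * intros g Hg Hin.
      assert (Dg : carrier (Dspace Beurling M) g) by (exists (exist _ K cK); exact Hg).
      split; [exact Dg|]; apply Hd; [exact Dg|apply (Hg (mkposreal h h0))|].
      apply (Hin (mkposreal h h0)); left; reflexivity.
  + exists (fun g => carrier (Dspace Roumieu M) g /\ norm (S g) < eps); split; [|split].
    * intros u v a b [Hu1 Hu2] [Hv1 Hv2] Hab; split; [apply (carrier_lincomb Roumieu); assumption|].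
      rewrite lin by assumption; apply norm_lincomb_lt; assumption.
    * intros h; destruct (bnd h (cond_pos h)) as [L [L0 HL]]; destruct (nb h L L0 HL) as [d Hd].
      exists d; intros g [Hg1 Hg2] Hg3.
      assert (Dg : carrier (Dspace Roumieu M) g).
      { exists (exist _ K cK), h; split; [exact Hg1|exact Hg2]. }
      split; [exact Dg|]; apply Hd; [exact Dg|apply Hg1|exact Hg3].
    * auto.
- intros g Hg [Hg1 Hg2]; apply HeW.
  replace (fun t => f t + g t)%C with (lincomb (RtoC 1) f (RtoC 1) g).
  2:{ extensionality t; unfold lincomb; ring. }
  rewrite lin, !scal_C1 by assumption.
  assert (E : minus (plus (S f) (S g)) (S f) = S g).
  { exact (plus_minus_cancel (S f) (S g)). }
  exact (Rle_lt_trans _ _ _ (Req_le _ _ (f_equal (@norm C_AbsRing X) E)) Hg2).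
Qed.

End Automorphic.

(** * The implication (i) -> (ii) *)

Section Implication.

Context {X : CompleteNormedModule C_AbsRing}.

Lemma shift_distance_small (f : R -> X) (b c : nat -> nat -> R) (v : nat -> R -> R) r B :
  0 < r -> (forall t, continuous f t) -> (forall t, norm (f t) <= B) ->
  (forall n t, is_lim_seq (fun m => norm (minus (f (t + b n m)) (f (t + c n m)))) (v n t)) ->
  (forall t, is_lim_seq (fun n => v n t) 0) ->
  forall eps, 0 < eps -> exists N, forall n, (N <= n)%nat ->
    exists K, forall m, (K <= m)%nat -> shift_distance f r (b n m) (c n m) <= eps.
Proof.
intros r0 cf HB H1 H2.
apply (double_dominated_limit (- r) r (B + B)
  (fun n m t => norm (minus (f (t + b n m)) (f (t + c n m)))) v); auto; [lra| |].
- intros n m t; apply (continuous_norm_minus (fun t => f (t + b n m)) (fun t => f (t + c n m)));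
    apply continuous_shift, cf.
- intros n m t; split; [apply norm_ge_0|].
  eapply Rle_trans; [apply norm_minus_le|]; apply Rplus_le_compat; apply HB.
Qed.

(** Pointwise, the limit in [m] is [norm (minus (f (t + a n)) (g t))], and this tends to 0 in [n];
    [g] occurs in pointwise limits only. *)
Lemma automorphic_shift_cauchy (f g : R -> X) (a : nat -> R) r B :
  0 < r -> (forall t, continuous f t) -> (forall t, norm (f t) <= B) ->
  (forall t, tends (fun n => f (t + a n)) (g t)) ->
  forall eps, 0 < eps -> exists N, forall n, (N <= n)%nat ->
    exists K, forall m, (K <= m)%nat -> shift_distance f r (a n) (a m) <= eps.
Proof.
intros r0 cf HB Hg.
apply (shift_distance_small f (fun n _ => a n) (fun _ m => a m)
  (fun n t => norm (minus (f (t + a n)) (g t))) r B); auto.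
- intros n t; apply (tends_lim_norm (fun m => minus (f (t + a n)) (f (t + a m)))).
  apply (tends_minus (fun _ => f (t + a n))); [apply filterlim_const|apply Hg].
- intros t; rewrite <- (norm_minus_self (g t)).
  apply (tends_lim_norm (fun n => minus (f (t + a n)) (g t))).
  apply (tends_minus _ (fun _ => g t)); [apply Hg|apply filterlim_const].
Qed.

(** [f (t + (a m - a n))] tends to [g (t - a n)] as [m] grows, and this to [f t] as [n] grows: the
    return half of almost automorphy is read through translates of [f] alone. *)
Lemma automorphic_shift_back (f g : R -> X) (a : nat -> R) r B :
  0 < r -> (forall t, continuous f t) -> (forall t, norm (f t) <= B) ->
  (forall t, tends (fun n => f (t + a n)) (g t) /\ tends (fun n => g (t - a n)) (f t)) ->
  forall eps, 0 < eps -> exists N, forall n, (N <= n)%nat ->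
    exists K, forall m, (K <= m)%nat -> shift_distance f r (a m - a n) 0 <= eps.
Proof.
intros r0 cf HB Hg.
apply (shift_distance_small f (fun n m => a m - a n) (fun _ _ => 0)
  (fun n t => norm (minus (g (t - a n)) (f t))) r B); auto.
- intros n t; apply (tends_lim_norm (fun m => minus (f (t + (a m - a n))) (f (t + 0)))).
  apply (tends_minus _ (fun _ => f (t + 0))).
  + apply (filterlim_ext (fun m => f (t - a n + a m))); [|apply Hg].
    intros m; f_equal; ring.
  + rewrite Rplus_0_r; apply filterlim_const.
- intros t; rewrite <- (norm_minus_self (f t)).
  apply (tends_lim_norm (fun n => minus (g (t - a n)) (f t))).
  apply (tends_minus _ (fun _ => f t)); [apply Hg|apply filterlim_const].
Qed.

Context (M : nat -> R) (Mpos : forall p, 0 < M p) (s : udtype) (T : (R -> C) -> X).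
Context (HT : continuous_linear (DL1 s M) T).

Lemma udo_test_regularity a phi : udo_class s M a -> carrier (Dspace s M) phi ->
  continuousC (udo_test a phi) /\ exists K, 0 <= K /\
    forall t, Cmod (udo_test a phi t) <= K /\ Cmod (phi t) <= K.
Proof.
intros Ha Hphi; apply carrier_Dspace in Hphi; [|assumption]; destruct Hphi as [Sphi [_ HB]].
destruct (dual_scales_meet s _ _ (udo_test_bound s M Mpos a Ha) HB) as
  [h [h0 [[K [K0 HK]] [B HBh]]]].
assert (HB' : supbound M h phi (Rabs B)).
{ intros p t; eapply Rle_trans; [apply HBh|].
  apply Rmult_le_compat_r; [left; apply Mpos|apply Rle_abs]. }
pose proof (Rabs_pos B) as B0.
destruct (HK phi (Rabs B) B0 Sphi HB') as [_ [H1 H2]].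
split; [exact H1|].
exists (Rmax (4 * K * Rabs B) (Rabs B * M 0%nat)); split.
- eapply Rle_trans; [|apply Rmax_l]; nra.
- intros t; split.
  + eapply Rle_trans; [apply H2|apply Rmax_l].
  + eapply Rle_trans; [|apply Rmax_r]; specialize (HB' 0%nat t); simpl in HB'; lra.
Qed.

Lemma representation_shift a (f g : R -> X) phi r c : udo_class s M a ->
  (forall t, continuous f t) -> (forall t, continuous g t) ->
  (forall phi, carrier (Dspace s M) phi ->
     T phi = plus (udo a (regular f) phi) (regular g phi)) ->
  carrier (Dspace s M) phi -> 0 < r -> supported r phi ->
  translate c T phi = plus (weighted (udo_test a phi) f r c) (weighted phi g r c).
Proof.
intros Ha cf cg Hrep Hphi r0 Hr; unfold translate.
rewrite Hrep by exact (carrier_trans s M Mpos phi (- c) Hphi).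
f_equal.
- unfold udo; rewrite <- regular_shift; [|exact r0| |apply udo_test_supported, Hr|exact cf].
  + f_equal; extensionality t; exact (udo_test_trans a phi (- c) t).
  + apply (udo_test_regularity a phi Ha Hphi).
- apply regular_shift; [exact r0| |exact Hr|exact cg].
  apply smooth_continuousC; apply carrier_Dspace in Hphi; [apply Hphi|assumption].
Qed.

Lemma translate_shift_le a (f g : R -> X) phi r : udo_class s M a ->
  (forall t, continuous f t) -> (forall t, continuous g t) ->
  (forall phi, carrier (Dspace s M) phi ->
     T phi = plus (udo a (regular f) phi) (regular g phi)) ->
  carrier (Dspace s M) phi -> 0 < r -> supported r phi ->
  exists K, 0 < K /\ forall c c', norm (minus (translate c T phi) (translate c' T phi)) <=
    K * (shift_distance f r c c' + shift_distance g r c c').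
Proof.
intros Ha cf cg Hrep Hphi r0 Hr.
destruct (udo_test_regularity a phi Ha Hphi) as [cu [K [K0 HK]]].
exists (K + 1); split; [lra|]; intros c c'.
rewrite !(representation_shift a f g phi r) by assumption.
assert (E : forall x y z w : X, minus (plus x y) (plus z w) = plus (minus x z) (minus y w)).
{ exact minus_plus_plus. }
rewrite E; eapply Rle_trans; [apply norm_plus_le|].
rewrite Rmult_plus_distr_l; apply Rplus_le_compat; apply weighted_shift_le; auto.
- intros t; destruct (HK t); lra.
- apply smooth_continuousC; apply carrier_Dspace in Hphi; [apply Hphi|assumption].
- intros t; destruct (HK t); lra.
Qed.

Lemma assertion_i_ii : assertion_i s M T -> assertion_ii s M T.
Proof.
intros [a [f [g [Ha [Hf [Hg Hrep]]]]]] b.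
destruct (AA_bounded f Hf) as [Bf HBf]; destruct (AA_bounded g Hg) as [Bg HBg].
destruct Hf as [cf Hf]; destruct Hg as [cg Hg].
destruct (Hf b) as [b1 [Hb1 [f1 Hf1]]].
(* Extracting for [g] from the subsequence found for [f] gives one sequence [e] that serves both. *)
destruct (Hg b1) as [e [Hb2 [g1 Hg1]]].
exists e; split; [exact (subseq_trans _ _ _ Hb2 Hb1)|].
assert (Hf2 : forall t, tends (fun n => f (t + e n)) (f1 t) /\ tends (fun n => f1 (t - e n)) (f t)).
{ destruct Hb2 as [sigma [Hs He]]; intros t; destruct (Hf1 t) as [H1 H2]; split.
  - apply (tends_subseq _ _ sigma Hs) in H1; revert H1; apply filterlim_ext.
    intros n; rewrite He; reflexivity.
  - apply (tends_subseq _ _ sigma Hs) in H2; revert H2; apply filterlim_ext.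
    intros n; rewrite He; reflexivity. }
assert (Hphi : forall phi, carrier (Dspace s M) phi -> exists r, 0 < r /\ supported r phi).
{ intros phi H; apply carrier_Dspace in H; [apply H|assumption]. }
assert (cv : forall phi, carrier (Dspace s M) phi ->
  exists x, tends (fun n => translate (e n) T phi) x).
{ intros phi H; destruct (Hphi phi H) as [r [r0 Hr]].
  destruct (translate_shift_le a f g phi r Ha cf cg Hrep H r0 Hr) as [K [K0 HK]].
  apply cauchy_tends; intros eps e0.
  assert (e1 : 0 < eps / (2 * K)) by (apply Rdiv_lt_0_compat; lra).
  destruct (automorphic_shift_cauchy f f1 e r Bf r0 cf HBf (fun t => proj1 (Hf2 t)) _ e1) as [N1 HN1].
  destruct (automorphic_shift_cauchy g g1 e r Bg r0 cg HBg (fun t => proj1 (Hg1 t)) _ e1) as [N2 HN2].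
  exists (Nat.max N1 N2); intros n Hn.
  destruct (HN1 n ltac:(lia)) as [K1 HK1]; destruct (HN2 n ltac:(lia)) as [K2 HK2].
  exists (Nat.max K1 K2); intros m Hm.
  eapply Rle_trans; [apply HK|].
  specialize (HK1 m ltac:(lia)); specialize (HK2 m ltac:(lia)).
  replace eps with (K * (eps / (2 * K) + eps / (2 * K))) by (field; lra).
  apply Rmult_le_compat_l; lra. }
(* Off the test space the limit may not exist and [S] is arbitrary; every claim about [S] is
   restricted to the carrier. *)
set (S := fun phi => epsilon (inhabits (zero : X)) (fun x => tends (fun n => translate (e n) T phi) x)).
assert (HS : forall phi, carrier (Dspace s M) phi -> tends (fun n => translate (e n) T phi) (S phi)).
{ intros phi H; apply epsilon_spec, cv, H. }
exists S; split; [|split; [exact HS|]].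
- apply continuous_linear_Dspace; [assumption| |].
  + intros u v x y Hu Hv.
    apply (tends_unique (fun n => translate (e n) T (lincomb x u y v))).
    { apply HS, carrier_lincomb; assumption. }
    apply (filterlim_ext (fun n => plus (scal (x : C_AbsRing) (translate (e n) T u))
                                        (scal (y : C_AbsRing) (translate (e n) T v)))).
    { intros n; symmetry; apply (proj1 HT); apply carrier_DL1; try assumption;
        [exact (carrier_trans s M Mpos u (- e n) Hu)|exact (carrier_trans s M Mpos v (- e n) Hv)]. }
    refine (filterlim_comp_2 (F := eventually) (fun n => scal (x : C_AbsRing) (translate (e n) T u))
      (fun n => scal (y : C_AbsRing) (translate (e n) T v)) plus
      (filterlim_comp nat X X _ _ _ _ _ (HS u Hu) (filterlim_scal_r (V := X) (x : C_AbsRing) (S u)))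
      (filterlim_comp nat X X _ _ _ _ _ (HS v Hv) (filterlim_scal_r (V := X) (y : C_AbsRing) (S v)))
      (filterlim_plus (V := X) _ _)).
  + intros r r0; pose proof (udo_test_bound s M Mpos a Ha) as Hdual.
    assert (G : forall h, (exists K, 0 <= K /\ forall phi B, 0 <= B ->
        smooth phi -> supbound M h phi B ->
        (forall p t, Cmod (udo_term a phi p t) <= K * B * (/ 2) ^ p) /\
        continuousC (udo_test a phi) /\ forall t, Cmod (udo_test a phi t) <= 4 * K * B) ->
      exists K, 0 <= K /\ forall phi B, 0 <= B -> carrier (Dspace s M) phi ->
        supported r phi -> supbound M h phi B -> norm (S phi) <= K * B).
    { intros h [K [K0 HK]].
      assert (Bf0 : 0 <= Bf) by exact (Rle_trans _ _ _ (norm_ge_0 (f 0)) (HBf 0)).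
      assert (Bg0 : 0 <= Bg) by exact (Rle_trans _ _ _ (norm_ge_0 (g 0)) (HBg 0)).
      pose proof (Mpos 0%nat) as M00.
      exists (2 * r * (4 * K * Bf) + 2 * r * (M 0%nat * Bg)); split.
      { assert (0 <= K * Bf) by nra; assert (0 <= M 0%nat * Bg) by nra; nra. }
      intros phi B B0 H Hr HB.
      assert (Sphi : smooth phi) by (apply carrier_Dspace in H; [apply H|assumption]).
      destruct (HK phi B B0 Sphi HB) as [_ [cu Hu]].
      (* The bound of [norm_weighted] does not involve the shift [e n], so it survives in the
         limit. *)
      apply (tends_norm_le _ _ _ 0%nat (HS phi H)); intros n _.
      rewrite (representation_shift a f g phi r) by assumption.
      eapply Rle_trans; [apply norm_plus_le|].
      eapply Rle_trans; [apply Rplus_le_compat|].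
      - apply (norm_weighted _ f r (e n) (4 * K * B) Bf r0 cu cf); [nra|exact Hu|exact HBf].
      - apply (norm_weighted _ g r (e n) (B * M 0%nat) Bg r0 (smooth_continuousC phi Sphi) cg);
          [nra| |exact HBg].
        intros t; specialize (HB 0%nat t); simpl in HB; lra.
      - apply Req_le; ring. }
    destruct s; simpl in *.
    * destruct Hdual as [h [h0 H]]; exists h; split; [exact h0|apply G, H].
    * intros h h0; apply G, Hdual, h0.
- intros phi H; destruct (Hphi phi H) as [r [r0 Hr]].
  destruct (translate_shift_le a f g phi r Ha cf cg Hrep H r0 Hr) as [K [K0 HK]].
  apply tends_norm; intros eps e0.
  assert (e1 : 0 < eps / (4 * K)) by (apply Rdiv_lt_0_compat; lra).
  destruct (automorphic_shift_back f f1 e r Bf r0 cf HBf Hf2 _ e1) as [N1 HN1].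
  destruct (automorphic_shift_back g g1 e r Bg r0 cg HBg Hg1 _ e1) as [N2 HN2].
  exists (Nat.max N1 N2); intros n Hn.
  destruct (HN1 n ltac:(lia)) as [K1 HK1]; destruct (HN2 n ltac:(lia)) as [K2 HK2].
  apply Rle_lt_trans with (eps / 2); [|lra].
  (* The value of [S] at a translate is itself a limit in [m], of [T] translated by [e m - e n];
     comparing [e m - e n] with 0 is therefore enough. *)
  unfold translate at 1.
  apply (tends_minus_norm_le _ _ _ _ (Nat.max K1 K2)
    (HS _ (carrier_trans s M Mpos phi (- - e n) H))); intros m Hm.
  specialize (HK (e m - e n) 0); unfold translate in HK |- *.
  replace (fun t => phi (t - e m + - - e n)) with (fun t => phi (t - (e m - e n)))
    by (extensionality t; f_equal; ring).
  replace (fun t => phi (t - 0)) with phi in HK by (extensionality t; f_equal; ring).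
  eapply Rle_trans; [exact HK|].
  specialize (HK1 m ltac:(lia)); specialize (HK2 m ltac:(lia)).
  replace (eps / 2) with (K * (eps / (4 * K) + eps / (4 * K))) by (field; lra).
  apply Rmult_le_compat_l; lra.
Qed.

End Implication.

(** * Seminorm estimate for Beurling ultradistributions *)

Lemma normL1_nonneg (f : R -> C) p r : smooth f -> 0 < r -> supported r f ->
  0 <= normL1 (derivC_n p f).
Proof.
intros Sf r0 Hr; rewrite (proj2 (normL1_supported f p r Sf r0 Hr)).
apply RInt_ge_0; [lra| |intros; apply Cmod_ge_0].
apply (ex_RInt_continuous (V := R_CompleteNormedModule)); intros z _.
apply continuous_Cmod_derivC_n, Sf.
Qed.

Lemma normL1_real_scal (f : R -> C) p r c : 0 < c -> smooth f -> 0 < r -> supported r f ->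
  normL1 (derivC_n p (fun t => RtoC c * f t)%C) = c * normL1 (derivC_n p f).
Proof.
intros c0 Sf r0 Hr.
assert (E : (fun t => RtoC c * f t)%C = lincomb (RtoC c) f (RtoC 0) f).
{ extensionality t; unfold lincomb; ring. }
assert (S1 : smooth (fun t => RtoC c * f t)%C) by (rewrite E; apply smooth_lincomb; assumption).
assert (Hr1 : supported r (fun t => RtoC c * f t)%C).
{ intros t Ht; rewrite Hr by exact Ht; ring. }
rewrite (proj2 (normL1_supported _ p r S1 r0 Hr1)), (proj2 (normL1_supported f p r Sf r0 Hr)).
rewrite (RInt_ext _ (fun t => scal c (Cmod (derivC_n p f t)))).
- apply (RInt_scal (V := R_CompleteNormedModule)).
  apply (ex_RInt_continuous (V := R_CompleteNormedModule)); intros z _.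
  apply continuous_Cmod_derivC_n, Sf.
- intros t _; rewrite E, derivC_n_lincomb by assumption.
  replace (RtoC c * derivC_n p f t + RtoC 0 * derivC_n p f t)%C
    with (RtoC c * derivC_n p f t)%C by ring.
  rewrite Cmod_mult, Cmod_R, Rabs_pos_eq by lra; reflexivity.
Qed.

(** A neighbourhood of 0 in a projective limit involves finitely many scales; the largest scale and
    the smallest radius control them all, and homogeneity turns the neighbourhood into a norm
    estimate. *)
Lemma beurling_operator_bound {X : CompleteNormedModule C_AbsRing} M
    (Mpos : forall p, 0 < M p) (T : (R -> C) -> X) :
  continuous_linear (DL1 Beurling M) T ->
  exists h K, 0 < h /\ 0 <= K /\ forall f B, carrier (Dspace Beurling M) f ->
    L1bound M h f B -> norm (T f) <= K * B.
Proof.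
intros HT.
assert (D0 : carrier (Dspace Beurling M) (fun _ => RtoC 0)).
{ assert (Z : forall p t, derivC_n p (fun _ => RtoC 0) t = RtoC 0).
  { intros p t; apply derivC_n_locally_zero, filter_forall; reflexivity. }
  apply carrier_Dspace; [assumption|]; split; [|split].
  - apply smooth_iff; split; apply smoothR_ex_derive_n; intros n t;
      exact (ex_derive_n_const 0 n t).
  - exists 1; split; [lra|]; intros t _; reflexivity.
  - intros h h0; exists 0; intros p t; rewrite Z, Cmod_0; lra. }
pose proof (proj2 HT _ (carrier_DL1 Beurling M Mpos _ D0) _
  (locally_norm_lt (T (fun _ => RtoC 0)) 1 Rlt_0_1)) as HU.
rewrite (continuous_linear_zero Beurling M Mpos T HT _ D0) in HU.
destruct HU as [l [V [HV HU]]].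
assert (unif : exists h eps, 0 < h /\ 0 < eps /\ forall f, carrier (Dspace Beurling M) f ->
  L1bound M h f eps -> forall k, In k l -> V k f).
{ clear HU; revert HV; induction l as [|k l IH]; intros HV.
  - exists 1, 1; repeat split; try lra; intros f _ _ k [].
  - destruct IH as [h [eps [h0 [e0 H]]]]; [intros i Hi; apply HV; right; exact Hi|].
    destruct (HV k (or_introl eq_refl)) as [d Hd].
    exists (Rmax h k), (Rmin eps (d / 2)).
    pose proof (cond_pos d) as dp; pose proof (cond_pos k) as kp.
    split; [eapply Rlt_le_trans; [exact h0|apply Rmax_l]|].
    split; [apply Rmin_case; lra|].
    intros f Hf HB.
    destruct (proj1 (carrier_Dspace Beurling M Mpos f) Hf) as [Sf [[r [r0 Hr]] _]].
    assert (mono : forall h' e, 0 <= h' <= Rmax h k -> Rmin eps (d / 2) <= e -> L1bound M h' f e).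
    { intros h' e Hh' He p.
      eapply Rle_trans; [|eapply Rle_trans; [apply (HB p)|]].
      - apply Rmult_le_compat_r; [apply normL1_nonneg with r; assumption|].
        apply pow_incr; exact Hh'.
      - apply Rmult_le_compat_r; [left; apply Mpos|exact He]. }
    intros i [<-|Hi].
    + apply Hd.
      * apply DL1h_carrier with (d / 2) r; try assumption; apply mono; [|apply Rmin_r].
        split; [lra|apply Rmax_r].
      * apply Rbar_le_lt_trans with (Finite (d / 2)).
        -- apply norm_DL1_le; [assumption|]; apply mono; [|apply Rmin_r].
           split; [lra|apply Rmax_r].
        -- simpl; lra.
    + apply H; [exact Hf|apply mono; [split; [lra|apply Rmax_l]|apply Rmin_l]|exact Hi]. }
destruct unif as [h [eps [h0 [e0 H]]]].
assert (small : forall f, carrier (Dspace Beurling M) f -> L1bound M h f eps -> norm (T f) <= 1).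
{ intros f Hf HB.
  assert (G := HU f (carrier_DL1 Beurling M Mpos f Hf) (H f Hf HB)).
  replace (fun t => RtoC 0 + f t)%C with f in G by (extensionality t; ring).
  left; eapply Rle_lt_trans; [|exact G].
  pose proof (norm_le_minus (T f) zero) as N.
  replace (norm (zero : X)) with 0 in N by (symmetry; exact norm_zero); lra. }
exists h, (/ eps); split; [exact h0|split; [left; apply Rinv_0_lt_compat, e0|]].
intros f B Hf HB.
destruct (proj1 (carrier_Dspace Beurling M Mpos f) Hf) as [Sf [[r [r0 Hr]] _]].
assert (B0 : 0 <= B).
{ specialize (HB 0%nat); pose proof (normL1_nonneg f 0 r Sf r0 Hr); pose proof (Mpos 0%nat).
  simpl pow in HB; nra. }
apply le_epsilon; intros d d0.
(* The summand [d * eps] keeps the denominator positive when [B = 0]; it costs exactly the error [d]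
   granted by [le_epsilon]. *)
set (c := eps / (B + d * eps)).
assert (den : 0 < B + d * eps) by nra.
assert (c0 : 0 < c) by (apply Rdiv_lt_0_compat; assumption).
assert (Hc : carrier (Dspace Beurling M) (fun t => RtoC c * f t)%C).
{ replace (fun t => RtoC c * f t)%C with (lincomb (RtoC c) f (RtoC 0) f).
  - apply carrier_lincomb; assumption.
  - extensionality t; unfold lincomb; ring. }
assert (N : norm (T (fun t => RtoC c * f t)%C) <= 1).
{ apply small; [exact Hc|]; intros p; rewrite (normL1_real_scal f p r) by assumption.
  specialize (HB p); pose proof (Mpos p).
  replace (h ^ p * (c * normL1 (derivC_n p f))) with (c * (h ^ p * normL1 (derivC_n p f))) by ring.
  eapply Rle_trans; [apply Rmult_le_compat_l; [lra|exact HB]|].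
  replace (c * (B * M p)) with ((c * B) * M p) by ring.
  apply Rmult_le_compat_r; [lra|].
  unfold c; apply (Rmult_le_reg_r (B + d * eps)); [exact den|].
  replace (eps / (B + d * eps) * B * (B + d * eps)) with (eps * B) by (field; lra); nra. }
replace (T f) with (scal (RtoC (/ c) : C_AbsRing) (T (fun t => RtoC c * f t)%C)).
- eapply Rle_trans; [apply scal_RtoC_norm|].
  rewrite Rabs_pos_eq by (left; apply Rinv_0_lt_compat, c0).
  apply Rle_trans with (/ c * 1).
  + apply Rmult_le_compat_l; [left; apply Rinv_0_lt_compat, c0|exact N].
  + apply Req_le; unfold c; field; lra.
- rewrite <- (continuous_linear_real_scal Beurling M Mpos T HT) by exact Hc.
  f_equal; extensionality t; rewrite Cmult_assoc, <- RtoC_mult, Rinv_l by lra; ring.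
Qed.

(** * Real test functions *)

Definition suppR (r : R) (f : R -> R) : Prop := forall t, r < Rabs t -> f t = 0.

Definition bounded_derivatives (M : nat -> R) (h : R) (f : R -> R) (B : R) : Prop :=
  forall p t, h ^ p * Rabs (Derive_n f p t) <= B * M p.

Definition real_test (M : nat -> R) (f : R -> R) : Prop :=
  smoothR f /\ (exists r, 0 < r /\ suppR r f) /\
  forall h, 0 < h -> exists B, bounded_derivatives M h f B.

Lemma derivC_n_RtoC (f : R -> R) p t : derivC_n p (fun s => RtoC (f s)) t = RtoC (Derive_n f p t).
Proof.
rewrite derivC_n_eq; unfold RtoC; simpl; f_equal.
destruct p; [reflexivity|apply Derive_n_const].
Qed.

Lemma smooth_RtoC (f : R -> R) : smoothR f -> smooth (fun s => RtoC (f s)).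
Proof.
intros H; apply smooth_iff; split; [exact H|].
apply smoothR_ex_derive_n; intros n t; exact (ex_derive_n_const 0 n t).
Qed.

Lemma real_test_carrier M (Mpos : forall p, 0 < M p) f :
  real_test M f -> carrier (Dspace Beurling M) (fun s => RtoC (f s)).
Proof.
intros [H1 [[r [r0 Hr]] H3]]; apply carrier_Dspace; [assumption|]; split; [|split].
- apply smooth_RtoC, H1.
- exists r; split; [exact r0|]; intros t Ht; rewrite Hr by exact Ht; reflexivity.
- intros h h0; destruct (H3 h h0) as [B HB]; exists B; intros p t.
  rewrite derivC_n_RtoC, Cmod_R; apply HB.
Qed.

Lemma carrier_real_test M (Mpos : forall p, 0 < M p) f :
  carrier (Dspace Beurling M) f ->
  real_test M (fun s => Re (f s)) /\ real_test M (fun s => Im (f s)).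
Proof.
intros Hf; apply carrier_Dspace in Hf; [|assumption].
destruct Hf as [Sf [[r [r0 Hr]] HB]]; apply smooth_iff in Sf; destruct Sf as [S1 S2].
split; split; [exact S1| |exact S2|]; split.
- exists r; split; [exact r0|]; intros t Ht; rewrite Hr by exact Ht; reflexivity.
- intros h h0; destruct (HB h h0) as [B HBh]; exists B; intros p t.
  eapply Rle_trans; [|apply (HBh p t)]; apply Rmult_le_compat_l; [apply pow_le; lra|].
  rewrite derivC_n_eq.
  exact (Rabs_Re_le (Derive_n (fun s => Re (f s)) p t, Derive_n (fun s => Im (f s)) p t)).
- exists r; split; [exact r0|]; intros t Ht; rewrite Hr by exact Ht; reflexivity.
- intros h h0; destruct (HB h h0) as [B HBh]; exists B; intros p t.
  eapply Rle_trans; [|apply (HBh p t)]; apply Rmult_le_compat_l; [apply pow_le; lra|].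
  rewrite derivC_n_eq.
  exact (Rabs_Im_le (Derive_n (fun s => Re (f s)) p t, Derive_n (fun s => Im (f s)) p t)).
Qed.

Lemma smoothR_continuous f p t : smoothR f -> continuous (Derive_n f p) t.
Proof. intros H; apply (@ex_derive_continuous R_AbsRing R_NormedModule), H. Qed.

Lemma Derive_n_suppR r f p : suppR r f -> suppR r (Derive_n f p).
Proof.
intros H t Ht; rewrite (Derive_n_ext_loc f (fun _ => 0)).
- destruct p; [reflexivity|apply Derive_n_const].
- apply filter_imp with (2 := locally_Rabs_gt r t Ht); exact H.
Qed.

Lemma ex_RInt_cont (f : R -> R) a b : (forall t, continuous f t) -> ex_RInt f a b.
Proof. intros H; apply (ex_RInt_continuous (V := R_CompleteNormedModule)); intros z _; apply H. Qed.

Lemma continuous_Rabs_comp (f : R -> R) t : continuous f t -> continuous (fun s => Rabs (f s)) t.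
Proof. intros H; apply (continuous_comp f Rabs); [exact H|apply continuous_Rabs]. Qed.

Lemma L1bound_RtoC M (Mpos : forall p, 0 < M p) h f B r : smoothR f -> 0 < r -> suppR r f ->
  (forall p, h ^ p * RInt (fun t => Rabs (Derive_n f p t)) (- r) r <= B * M p) ->
  L1bound M h (fun s => RtoC (f s)) B.
Proof.
intros Sf r0 Hr HB p.
assert (Hr' : supported r (fun s => RtoC (f s))).
{ intros t Ht; rewrite Hr by exact Ht; reflexivity. }
rewrite (proj2 (normL1_supported _ p r (smooth_RtoC f Sf) r0 Hr')).
rewrite (RInt_ext _ (fun t => Rabs (Derive_n f p t))); [apply HB|].
intros t _; rewrite derivC_n_RtoC, Cmod_R; reflexivity.
Qed.

Lemma RInt_abs_le_const (f : R -> R) r B : 0 <= r -> (forall t, continuous f t) ->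
  (forall t, Rabs (f t) <= B) -> RInt (fun t => Rabs (f t)) (- r) r <= 2 * r * B.
Proof.
intros r0 cf HB.
replace (2 * r * B) with (RInt (fun _ => B) (- r) r).
2:{ rewrite RInt_const; unfold scal; simpl; unfold mult; simpl; ring. }
apply RInt_le; [lra| |apply ex_RInt_const|intros; apply HB].
apply ex_RInt_cont; intros t; apply continuous_Rabs_comp, cf.
Qed.

(** * Truncated exponential averages *)

(** [exp (- u)] on [[0, 1]] has mass [1 - rho] and a jump of height [rho] at its right end; [kap]
    normalises the mass. *)
Definition rho : R := exp (Ropp 1).
Definition kap : R := / (1 - rho).

Lemma rho_bounds : 0 < rho <= / 2.
Proof.
unfold rho; split; [apply exp_pos|].
rewrite exp_Ropp; apply Rinv_le_contravar; [lra|].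
pose proof (exp_ineq1_le 1); lra.
Qed.

Lemma kap_bounds : 1 <= kap <= 2.
Proof.
pose proof rho_bounds as H; unfold kap; split.
- rewrite <- Rinv_1 at 1; apply Rinv_le_contravar; lra.
- rewrite <- (Rinv_inv 2); apply Rinv_le_contravar; lra.
Qed.

Lemma kap_rho : kap * (1 - rho) = 1.
Proof. pose proof rho_bounds; unfold kap; field; lra. Qed.

(** Convolution with the probability density [kap / mu * exp (- x / mu)] on [[0, mu]], rescaled to
    the unit interval. *)
Definition avg (mu : R) (chi : R -> R) (x : R) : R :=
  kap * RInt (fun u => exp (- u) * chi (x - mu * u)) 0 1.

(** The derivative of the average, solved from [(1 + mu d/dx) avg mu chi = kap (chi - rho chi (. -
    mu))]. It contains no derivative of [chi]: each average gains one order of smoothness. *)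
Definition Dav (mu : R) (chi : R -> R) (x : R) : R :=
  (kap * (chi x - rho * chi (x - mu)) - avg mu chi x) / mu.

Lemma continuous_affine (a b t : R) : continuous (fun u => a + b * u) t.
Proof. apply (@ex_derive_continuous R_AbsRing R_NormedModule); auto_derive; exact I. Qed.

Lemma continuous_comp_sub (chi : R -> R) c t : (forall t, continuous chi t) ->
  continuous (fun s => chi (s - c)) t.
Proof.
intros H; apply (continuous_ext (fun s => chi (- c + 1 * s))); [intros s; f_equal; ring|].
apply (continuous_comp (fun s => - c + 1 * s) chi); [apply continuous_affine|apply H].
Qed.

Lemma continuous_exp_opp t : continuous (fun u => exp (- u)) t.
Proof. apply (@ex_derive_continuous R_AbsRing R_NormedModule); auto_derive; exact I. Qed.

Lemma avg_integrand_continuous mu chi x t : (forall t, continuous chi t) ->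
  continuous (fun u => exp (- u) * chi (x - mu * u)) t.
Proof.
intros H; apply (continuous_mult (K := R_AbsRing) (fun u => exp (- u)) (fun u => chi (x - mu * u))).
- apply continuous_exp_opp.
- apply (continuous_ext (fun s => chi (x + (- mu) * s))); [intros s; f_equal; ring|].
  apply (continuous_comp (fun s => x + (- mu) * s) chi); [apply continuous_affine|apply H].
Qed.

Lemma avg_ex_RInt mu chi x : (forall t, continuous chi t) ->
  ex_RInt (fun u => exp (- u) * chi (x - mu * u)) 0 1.
Proof. intros H; apply ex_RInt_cont; intros t; apply avg_integrand_continuous, H. Qed.

Lemma RInt_exp_opp : RInt (fun u => exp (- u)) 0 1 = 1 - rho.
Proof.
assert (H : is_RInt (fun u => exp (- u)) 0 1 (minus ((fun u => - exp (- u)) 1) ((fun u => - exp (- u)) 0))).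
{ apply (is_RInt_derive (V := R_CompleteNormedModule) (fun u => - exp (- u))).
  - intros x _; auto_derive; [exact I|ring].
  - intros x _; apply continuous_exp_opp. }
apply (is_RInt_unique (V := R_CompleteNormedModule)) in H; rewrite H.
unfold minus, plus, opp; simpl; unfold rho; rewrite Ropp_0, exp_0; ring.
Qed.

Lemma avg_ext mu chi1 chi2 x : (forall t, chi1 t = chi2 t) -> avg mu chi1 x = avg mu chi2 x.
Proof.
intros H; unfold avg; f_equal; apply RInt_ext; intros u _; rewrite H; reflexivity.
Qed.

Lemma avg_const mu c x : avg mu (fun _ => c) x = c.
Proof.
unfold avg; rewrite (RInt_ext _ (fun u => scal c (exp (- u)))).
- rewrite (RInt_scal (V := R_CompleteNormedModule)), RInt_exp_opp.
  + change (kap * (c * (1 - rho)) = c).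
    replace (kap * (c * (1 - rho))) with (c * (kap * (1 - rho))) by ring.
    rewrite kap_rho; ring.
  + apply ex_RInt_cont; intros t; apply continuous_exp_opp.
- intros u _; unfold scal; simpl; unfold mult; simpl; ring.
Qed.

Lemma avg_lin mu chi1 chi2 a b x :
  (forall t, continuous chi1 t) -> (forall t, continuous chi2 t) ->
  avg mu (fun t => a * chi1 t + b * chi2 t) x = a * avg mu chi1 x + b * avg mu chi2 x.
Proof.
intros H1 H2; unfold avg.
rewrite (RInt_ext _ (fun u => plus (scal a (exp (- u) * chi1 (x - mu * u)))
                                   (scal b (exp (- u) * chi2 (x - mu * u))))).
- pose proof (avg_ex_RInt mu chi1 x H1) as E1; pose proof (avg_ex_RInt mu chi2 x H2) as E2.
  rewrite (RInt_plus (V := R_CompleteNormedModule)), !(RInt_scal (V := R_CompleteNormedModule));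
    try assumption; try (apply (ex_RInt_scal (V := R_NormedModule)); assumption).
  unfold plus, scal; simpl; unfold mult; simpl; ring.
- intros u _; unfold plus, scal; simpl; unfold mult; simpl; ring.
Qed.

Lemma avg_mono mu chi1 chi2 x :
  (forall t, continuous chi1 t) -> (forall t, continuous chi2 t) ->
  (forall u, 0 <= u <= 1 -> chi1 (x - mu * u) <= chi2 (x - mu * u)) ->
  avg mu chi1 x <= avg mu chi2 x.
Proof.
intros H1 H2 H; unfold avg; apply Rmult_le_compat_l; [pose proof kap_bounds; lra|].
apply RInt_le; [lra|apply avg_ex_RInt; assumption..|].
intros u Hu; apply Rmult_le_compat_l; [left; apply exp_pos|apply H; lra].
Qed.

Lemma avg_abs_le mu chi x : (forall t, continuous chi t) ->
  Rabs (avg mu chi x) <= avg mu (fun t => Rabs (chi t)) x.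
Proof.
intros H.
assert (H' : forall t, continuous (fun t => Rabs (chi t)) t) by (intros; apply continuous_Rabs_comp, H).
apply Rabs_le; split.
- replace (- avg mu (fun t => Rabs (chi t)) x)
    with (avg mu (fun t => (-1) * Rabs (chi t) + 0 * Rabs (chi t)) x)
    by (rewrite avg_lin by assumption; ring).
  apply avg_mono; [|exact H|].
  + intros t; apply (continuous_plus (V := R_NormedModule) (fun t => (-1) * Rabs (chi t)) (fun t => 0 * Rabs (chi t)));
      apply (continuous_scal_r (V := R_NormedModule)), H'.
  + intros u _; pose proof (Rle_abs (- chi (x - mu * u))) as E; rewrite Rabs_Ropp in E; lra.
- apply avg_mono; [exact H|exact H'|]; intros u _; apply Rle_abs.
Qed.

Lemma avg_bound_local mu chi x B : (forall t, continuous chi t) ->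
  (forall u, 0 <= u <= 1 -> Rabs (chi (x - mu * u)) <= B) -> Rabs (avg mu chi x) <= B.
Proof.
intros H HB; eapply Rle_trans; [apply avg_abs_le, H|].
rewrite <- (avg_const mu B x); apply avg_mono.
- intros t; apply continuous_Rabs_comp, H.
- intros t; apply continuous_const.
- exact HB.
Qed.

Lemma avg_bound mu chi x B : (forall t, continuous chi t) ->
  (forall t, Rabs (chi t) <= B) -> Rabs (avg mu chi x) <= B.
Proof. intros H HB; apply avg_bound_local; [exact H|intros; apply HB]. Qed.

Lemma avg_nonneg mu chi x : (forall t, continuous chi t) ->
  (forall t, 0 <= chi t) -> 0 <= avg mu chi x.
Proof.
intros H HB; rewrite <- (avg_const mu 0 x); apply avg_mono; auto.
intros t; apply continuous_const.
Qed.

Lemma avg_minus mu chi1 chi2 x :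
  (forall t, continuous chi1 t) -> (forall t, continuous chi2 t) ->
  avg mu (fun t => chi1 t - chi2 t) x = avg mu chi1 x - avg mu chi2 x.
Proof.
intros H1 H2; rewrite (avg_ext mu _ (fun t => 1 * chi1 t + (-1) * chi2 t)) by (intros; ring).
rewrite avg_lin by assumption; ring.
Qed.

Lemma avg_shift mu chi c x : avg mu (fun t => chi (t - c)) x = avg mu chi (x - c).
Proof.
unfold avg; f_equal; apply RInt_ext; intros u _; f_equal; f_equal; ring.
Qed.

Lemma avg_dist mu chi1 chi2 x d :
  (forall t, continuous chi1 t) -> (forall t, continuous chi2 t) ->
  (forall t, Rabs (chi1 t - chi2 t) <= d) -> Rabs (avg mu chi1 x - avg mu chi2 x) <= d.
Proof.
intros H1 H2 Hd; rewrite <- avg_minus by assumption; apply avg_bound; [|exact Hd].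
intros t; apply (continuous_minus (V := R_NormedModule)); [apply H1|apply H2].
Qed.

Lemma avg_supp r mu chi : 0 < mu -> (forall t, continuous chi t) -> suppR r chi ->
  suppR (r + mu) (avg mu chi).
Proof.
intros m0 H Hr x Hx.
assert (E : Rabs (avg mu chi x) <= 0).
{ apply avg_bound_local; [exact H|]; intros u Hu; rewrite Hr; [rewrite Rabs_R0; lra|].
  assert (0 <= mu * u <= mu) by nra.
  revert Hx; unfold Rabs; repeat destruct Rcase_abs; lra. }
pose proof (Rabs_pos (avg mu chi x)).
destruct (Req_dec (avg mu chi x) 0) as [E0|E0]; [exact E0|].
apply Rabs_no_R0 in E0; lra.
Qed.

Lemma suppR_le r r' f : r <= r' -> suppR r f -> suppR r' f.
Proof. intros H Hf t Ht; apply Hf; lra. Qed.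

(* Written over [x - mu, x], the average is a primitive times an exponential. *)
Lemma avg_primitive mu chi x : 0 < mu -> (forall t, continuous chi t) ->
  avg mu chi x = kap / mu * exp (- (x / mu)) *
    (RInt (fun y => exp (y / mu) * chi y) 0 x - RInt (fun y => exp (y / mu) * chi y) 0 (x - mu)).
Proof.
intros m0 H.
set (w := fun y => exp (y / mu) * chi y).
assert (cw : forall t, continuous w t).
{ intros t; apply (continuous_mult (K := R_AbsRing) (fun y => exp (y / mu)) chi); [|apply H].
  apply (@ex_derive_continuous R_AbsRing R_NormedModule); auto_derive; lra. }
pose proof (RInt_comp_lin (V := R_CompleteNormedModule) w (- mu) x 0 1
  (ex_RInt_cont _ _ _ cw)) as E.
replace (- mu * 0 + x) with x in E by ring.
replace (- mu * 1 + x) with (x - mu) in E by ring.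
rewrite (RInt_ext _ (fun u => scal (- mu * exp (x / mu)) (exp (- u) * chi (x - mu * u)))) in E.
2:{ intros u _; unfold w, scal; simpl; unfold mult; simpl.
    replace ((- mu * u + x) / mu) with (x / mu + - u) by (field; lra).
    replace (- mu * u + x) with (x - mu * u) by ring.
    rewrite exp_plus; ring. }
rewrite (RInt_scal (V := R_CompleteNormedModule)) in E by (apply avg_ex_RInt, H).
pose proof (RInt_Chasles (V := R_CompleteNormedModule) w 0 x (x - mu)
  (ex_RInt_cont _ _ _ cw) (ex_RInt_cont _ _ _ cw)) as C.
unfold plus in C; simpl in C.
unfold scal in E; simpl in E; unfold mult in E; simpl in E.
unfold avg; rewrite <- C, <- E.
pose proof (exp_pos (x / mu)); rewrite exp_Ropp; field; lra.
Qed.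

Lemma is_derive_avg mu chi x : 0 < mu -> (forall t, continuous chi t) ->
  is_derive (avg mu chi) x (Dav mu chi x).
Proof.
intros m0 H.
set (w := fun y => exp (y / mu) * chi y).
assert (cw : forall t, continuous w t).
{ intros t; apply (continuous_mult (K := R_AbsRing) (fun y => exp (y / mu)) chi); [|apply H].
  apply (@ex_derive_continuous R_AbsRing R_NormedModule); auto_derive; lra. }
assert (dW : forall y, is_derive (RInt w 0) y (w y)).
{ intros y; apply is_derive_RInt with (a := 0); [|apply cw].
  apply filter_forall; intros z; apply (RInt_correct (V := R_CompleteNormedModule)), ex_RInt_cont, cw. }
apply (is_derive_ext (fun x => kap / mu * exp (- (x / mu)) * (RInt w 0 x - RInt w 0 (x - mu)))).
{ intros t; symmetry; apply avg_primitive; assumption. }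
assert (E : Dav mu chi x = - (1 / mu) * (kap / mu * exp (- (x / mu))) * (RInt w 0 x - RInt w 0 (x - mu)) +
   kap / mu * exp (- (x / mu)) * (w x - w (x - mu))).
{ unfold Dav; rewrite avg_primitive by assumption; fold w.
  unfold w at 5 6.
  replace ((x - mu) / mu) with (x / mu + Ropp 1) by (field; lra).
  rewrite exp_plus; fold rho.
  pose proof (exp_pos (x / mu)); rewrite exp_Ropp; field; lra. }
rewrite E.
apply (is_derive_ext (fun x => (kap / mu * exp (- (x / mu))) * (RInt w 0 x - RInt w 0 (x - mu))));
  [reflexivity|].
assert (d1 : is_derive (fun x => kap / mu * exp (- (x / mu))) x (- (1 / mu) * (kap / mu * exp (- (x / mu))))).
{ auto_derive; [lra|unfold Rdiv; field; lra]. }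
assert (d2 : is_derive (fun x => RInt w 0 x - RInt w 0 (x - mu)) x (w x - w (x - mu))).
{ apply (is_derive_minus (V := R_NormedModule) (RInt w 0) (fun x => RInt w 0 (x - mu))); [apply dW|].
  replace (w (x - mu)) with (scal 1 (w (x - mu))) by (unfold scal; simpl; unfold mult; simpl; ring).
  apply (is_derive_comp (V := R_NormedModule) (RInt w 0) (fun x => x - mu)); [apply dW|].
  auto_derive; [exact I|ring]. }
exact (is_derive_mult (K := R_AbsRing) _ _ x _ _ d1 d2 Rmult_comm).
Qed.

Lemma continuous_avg mu chi x : 0 < mu -> (forall t, continuous chi t) ->
  continuous (avg mu chi) x.
Proof.
intros m0 H; apply (@ex_derive_continuous R_AbsRing R_NormedModule).
eexists; apply is_derive_avg; assumption.
Qed.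

Lemma continuous_Dav mu chi x : 0 < mu -> (forall t, continuous chi t) ->
  continuous (Dav mu chi) x.
Proof.
intros m0 H; unfold Dav, Rdiv.
apply (continuous_ext (fun x => / mu * (kap * (chi x - rho * chi (x - mu)) - avg mu chi x)));
  [intros t; exact (Rmult_comm _ _)|].
apply (continuous_scal_r (V := R_NormedModule)), (continuous_minus (V := R_NormedModule)).
- apply (continuous_scal_r (V := R_NormedModule)), (continuous_minus (V := R_NormedModule)); [apply H|].
  apply (continuous_scal_r (V := R_NormedModule) rho (fun x => chi (x - mu))).
  apply continuous_comp_sub, H.
- apply continuous_avg; assumption.
Qed.

(* Integration by parts in the variable of integration of [avg]. *)
Lemma avg_deriv mu chi dchi x : 0 < mu ->
  (forall t, is_derive chi t (dchi t)) -> (forall t, continuous dchi t) ->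
  avg mu dchi x = Dav mu chi x.
Proof.
intros m0 Hd cd.
assert (c : forall t, continuous chi t).
{ intros t; apply (@ex_derive_continuous R_AbsRing R_NormedModule); eexists; apply Hd. }
set (G := fun u => exp (- u) * chi (x - mu * u)).
set (dG := fun u => plus (scal (-1) (exp (- u) * chi (x - mu * u)))
                         (scal (- mu) (exp (- u) * dchi (x - mu * u)))).
assert (H : is_RInt dG 0 1 (minus (G 1) (G 0))).
{ apply (is_RInt_derive (V := R_CompleteNormedModule)).
  - intros u _; unfold G, dG.
    assert (d1 : is_derive (fun u => exp (- u)) u (- exp (- u))) by (auto_derive; [exact I|ring]).
    assert (d2 : is_derive (fun u => chi (x - mu * u)) u (scal (- mu) (dchi (x - mu * u)))).
    { apply (is_derive_comp (V := R_NormedModule) chi (fun u => x - mu * u)); [apply Hd|].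
      auto_derive; [exact I|ring]. }
    refine (eq_ind _ (fun l => is_derive _ u l) (is_derive_mult (K := R_AbsRing) _ _ u _ _ d1 d2 Rmult_comm) _ _).
    unfold plus, scal, mult; simpl; unfold mult; simpl; ring.
  - intros u _; apply (continuous_plus (V := R_NormedModule));
      apply (continuous_scal_r (V := R_NormedModule)), avg_integrand_continuous; assumption. }
apply (is_RInt_unique (V := R_CompleteNormedModule)) in H.
unfold dG in H.
pose proof (avg_ex_RInt mu chi x c) as E1; pose proof (avg_ex_RInt mu dchi x cd) as E2.
rewrite (RInt_plus (V := R_CompleteNormedModule)), !(RInt_scal (V := R_CompleteNormedModule)) in H;
  try assumption; try (apply (ex_RInt_scal (V := R_NormedModule)); assumption).
unfold Dav, avg; unfold minus, plus, opp, scal, G in H; simpl in H; unfold mult in H; simpl in H.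
rewrite Ropp_0, exp_0, Rmult_0_r, Rminus_0_r, Rmult_1_r in H; fold rho in H.
apply (Rmult_eq_reg_r (- mu)); [|lra].
match goal with |- kap * ?J * _ = (kap * ?A - kap * ?I) / mu * _ =>
  transitivity (kap * (- mu * J)); [ring|];
  replace (- mu * J) with (rho * chi (x - mu) + - (1 * chi x) - -1 * I) by lra end.
field; lra.
Qed.

Lemma is_derive_avg_C1 mu chi dchi x : 0 < mu ->
  (forall t, is_derive chi t (dchi t)) -> (forall t, continuous dchi t) ->
  is_derive (avg mu chi) x (avg mu dchi x).
Proof.
intros m0 Hd cd; rewrite (avg_deriv mu chi) by assumption; apply is_derive_avg; [exact m0|].
intros t; apply (@ex_derive_continuous R_AbsRing R_NormedModule); eexists; apply Hd.
Qed.

Lemma is_derive_sub (chi dchi : R -> R) c x : (forall t, is_derive chi t (dchi t)) ->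
  is_derive (fun t => chi (t - c)) x (dchi (x - c)).
Proof.
intros H.
replace (dchi (x - c)) with (scal 1 (dchi (x - c))) by (unfold scal; simpl; unfold mult; simpl; ring).
apply (is_derive_comp (V := R_NormedModule) chi (fun x => x - c)); [apply H|].
auto_derive; [exact I|ring].
Qed.

Lemma is_derive_Dav_C1 mu chi dchi x : 0 < mu ->
  (forall t, is_derive chi t (dchi t)) -> (forall t, continuous dchi t) ->
  is_derive (Dav mu chi) x (Dav mu dchi x).
Proof.
intros m0 Hd cd; unfold Dav.
pose proof (is_derive_sub chi dchi mu x Hd) as d2.
assert (d3 : is_derive (fun t => chi t - rho * chi (t - mu)) x (dchi x - rho * dchi (x - mu))).
{ apply (is_derive_minus (V := R_NormedModule) chi (fun t => rho * chi (t - mu))); [apply Hd|].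
  apply is_derive_scal, d2. }
assert (d4 : is_derive (fun t => kap * (chi t - rho * chi (t - mu)) - avg mu chi t) x
  (kap * (dchi x - rho * dchi (x - mu)) - avg mu dchi x)).
{ apply (is_derive_minus (V := R_NormedModule) (fun t => kap * (chi t - rho * chi (t - mu))) (avg mu chi)).
  - apply is_derive_scal, d3.
  - apply is_derive_avg_C1; assumption. }
apply (is_derive_ext (fun t => / mu * (kap * (chi t - rho * chi (t - mu)) - avg mu chi t)));
  [intros t; exact (Rmult_comm _ _)|].
unfold Rdiv; rewrite (Rmult_comm _ (/ mu)); apply is_derive_scal, d4.
Qed.

(** The origin of the constant 4: [kap * (1 - rho) = 1] and [kap * rho <= 1] give
    [kap * (1 + rho) <= 3] for the two translates, and the average adds 1. *)
Lemma Dav_bound mu chi x B : 0 < mu -> (forall t, continuous chi t) ->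
  (forall t, Rabs (chi t) <= B) -> Rabs (Dav mu chi x) <= 4 / mu * B.
Proof.
intros m0 H HB; unfold Dav.
pose proof rho_bounds as r1; pose proof kap_bounds as k1; pose proof kap_rho as k2.
pose proof (avg_bound mu chi x B H HB) as A.
pose proof (HB x) as B1; pose proof (HB (x - mu)) as B2.
unfold Rdiv; rewrite Rabs_mult, (Rabs_pos_eq (/ mu)) by (left; apply Rinv_0_lt_compat, m0).
rewrite (Rmult_comm 4), Rmult_assoc, (Rmult_comm (Rabs _)).
apply Rmult_le_compat_l; [left; apply Rinv_0_lt_compat, m0|].
assert (C : Rabs (kap * (chi x - rho * chi (x - mu)) - avg mu chi x) <=
  kap * (Rabs (chi x) + rho * Rabs (chi (x - mu))) + Rabs (avg mu chi x)).
{ eapply Rle_trans; [apply Rabs_triang|rewrite Rabs_Ropp; apply Rplus_le_compat_r].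
  rewrite Rabs_mult, Rabs_pos_eq by lra; apply Rmult_le_compat_l; [lra|].
  eapply Rle_trans; [apply Rabs_triang|rewrite Rabs_Ropp, Rabs_mult, (Rabs_pos_eq rho) by lra; lra]. }
assert (B0 : 0 <= B) by (pose proof (Rabs_pos (chi x)); lra).
assert (rho * Rabs (chi (x - mu)) <= rho * B) by (apply Rmult_le_compat_l; lra).
assert (kap * (Rabs (chi x) + rho * Rabs (chi (x - mu))) <= kap * (B + rho * B))
  by (apply Rmult_le_compat_l; lra).
assert (kap * (1 + rho) <= 3) by nra.
nra.
Qed.

Lemma Dav_supp r mu chi : 0 < mu -> (forall t, continuous chi t) -> suppR r chi ->
  suppR (r + mu) (Dav mu chi).
Proof.
intros m0 H Hr x Hx; unfold Dav.
rewrite (avg_supp r mu chi m0 H Hr x Hx), Hr, Hr; [field; lra| |lra].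
revert Hx; unfold Rabs; repeat destruct Rcase_abs; lra.
Qed.

Lemma RInt_supp (f : R -> R) r R0 : 0 <= r -> r <= R0 -> (forall t, continuous f t) ->
  suppR r f -> RInt f (- R0) R0 = RInt f (- r) r.
Proof.
intros r0 H cf Hr.
assert (Z : forall a b, a <= b -> (b <= - r \/ r <= a) -> RInt f a b = 0).
{ intros a b ab Hab; rewrite (RInt_ext _ (fun _ => 0)).
  - rewrite RInt_const; unfold scal; simpl; unfold mult; simpl; ring.
  - rewrite Rmin_left, Rmax_right by assumption; intros t Ht; apply Hr.
    unfold Rabs; destruct Rcase_abs; lra. }
rewrite <- (RInt_Chasles (V := R_CompleteNormedModule) f (- R0) (- r) R0),
  <- (RInt_Chasles (V := R_CompleteNormedModule) f (- r) r R0)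
  by (apply ex_RInt_cont, cf).
rewrite (Z (- R0) (- r)), (Z r R0) by lra.
unfold plus; simpl; ring.
Qed.

Lemma RInt_supp_shift (f : R -> R) r R0 c : 0 <= r -> r + Rabs c <= R0 ->
  (forall t, continuous f t) -> suppR r f ->
  RInt (fun t => f (t - c)) (- R0) R0 = RInt f (- r) r.
Proof.
intros r0 H cf Hr.
rewrite (RInt_ext _ (fun y => scal 1 (f (1 * y + - c)))).
2:{ intros t _; unfold scal; simpl; unfold mult; simpl; rewrite !Rmult_1_l; reflexivity. }
rewrite (RInt_comp_lin (V := R_CompleteNormedModule)) by (apply ex_RInt_cont, cf).
assert (Hc : r <= R0 - c /\ - R0 - c <= - r) by (revert H; unfold Rabs; destruct Rcase_abs; lra).
assert (Z : forall a b, a <= b -> (b <= - r \/ r <= a) -> RInt f a b = 0).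
{ intros a b ab Hab; rewrite (RInt_ext _ (fun _ => 0)).
  - rewrite RInt_const; unfold scal; simpl; unfold mult; simpl; ring.
  - rewrite Rmin_left, Rmax_right by assumption; intros t Ht; apply Hr.
    unfold Rabs; destruct Rcase_abs; lra. }
rewrite <- (RInt_Chasles (V := R_CompleteNormedModule) f _ (- r) _),
  <- (RInt_Chasles (V := R_CompleteNormedModule) f (- r) r _)
  by (apply ex_RInt_cont, cf).
rewrite (Z _ (- r)), (Z r) by lra.
unfold plus; simpl; ring.
Qed.

(** Integrate the formula for [Dav]: the left side is 0 because the average vanishes at both ends,
    the two translates of [chi] have equal integrals, and [kap * (1 - rho) = 1]. This takes the
    place of Fubini's theorem. *)
Lemma avg_integral mu chi r R0 : 0 < mu -> 0 <= r -> r + mu <= R0 ->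
  (forall t, continuous chi t) -> suppR r chi ->
  RInt (avg mu chi) (- R0) R0 = RInt chi (- R0) R0.
Proof.
intros m0 r0 HR H Hr.
assert (E : RInt (Dav mu chi) (- R0) R0 = 0).
{ assert (D : is_RInt (Dav mu chi) (- R0) R0 (minus (avg mu chi R0) (avg mu chi (- R0)))).
  { apply (is_RInt_derive (V := R_CompleteNormedModule) (avg mu chi)); intros x _.
    - apply is_derive_avg; assumption.
    - apply continuous_Dav; assumption. }
  apply (is_RInt_unique (V := R_CompleteNormedModule)) in D; rewrite D.
  assert (Z : forall x, Rabs x = R0 -> avg mu chi x = 0).
  (* [suppR] says nothing where [Rabs x] equals [r + mu]; there the value is a limit of zeros from
     outside. *)
  { intros x Hx; destruct (Req_dec R0 (r + mu)) as [Eq|Ne].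
    - pose proof (avg_supp r mu chi m0 H Hr) as S.
      assert (C : forall eps, 0 < eps -> Rabs (avg mu chi x) <= eps).
      { intros eps e0.
        destruct (proj1 (continuous_R (avg mu chi) x) (continuous_avg mu chi x m0 H) eps e0)
          as [d [d0 Hd]].
        set (y := if Rle_dec 0 x then x + d / 2 else x - d / 2).
        assert (Hy : Rabs (y - x) < d) by (unfold y; destruct Rle_dec; unfold Rabs; destruct Rcase_abs; lra).
        assert (Sy : avg mu chi y = 0).
        { apply S; rewrite <- Eq, <- Hx; unfold y; destruct Rle_dec; unfold Rabs; repeat destruct Rcase_abs; lra. }
        specialize (Hd y Hy); rewrite Sy, Rminus_0_l, Rabs_Ropp in Hd; lra. }
      destruct (Req_dec (avg mu chi x) 0) as [Z|Z]; [exact Z|].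
      apply Rabs_pos_lt in Z; specialize (C (Rabs (avg mu chi x) / 2)); lra.
    - apply (avg_supp r mu chi m0 H Hr); lra. }
  rewrite !Z; [unfold minus, plus, opp; simpl; ring| |].
  - rewrite Rabs_Ropp; apply Rabs_pos_eq; lra.
  - apply Rabs_pos_eq; lra. }
assert (c2 : forall t, continuous (fun t => chi (t - mu)) t) by (intros; apply continuous_comp_sub, H).
assert (ca : forall t, continuous (avg mu chi) t) by (intros; apply continuous_avg; assumption).
assert (E2 : RInt (Dav mu chi) (- R0) R0 =
  (kap * (RInt chi (- R0) R0 - rho * RInt (fun t => chi (t - mu)) (- R0) R0) - RInt (avg mu chi) (- R0) R0) / mu).
{ pose proof (RInt_correct (V := R_CompleteNormedModule) _ _ _ (ex_RInt_cont chi (- R0) R0 H)) as I1.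
  pose proof (RInt_correct (V := R_CompleteNormedModule) _ _ _ (ex_RInt_cont _ (- R0) R0 c2)) as I2.
  pose proof (RInt_correct (V := R_CompleteNormedModule) _ _ _ (ex_RInt_cont _ (- R0) R0 ca)) as I3.
  apply (is_RInt_scal (V := R_NormedModule) _ _ _ rho) in I2.
  pose proof (is_RInt_minus (V := R_NormedModule) _ _ _ _ _ _ I1 I2) as I4.
  apply (is_RInt_scal (V := R_NormedModule) _ _ _ kap) in I4.
  pose proof (is_RInt_minus (V := R_NormedModule) _ _ _ _ _ _ I4 I3) as I5.
  apply (is_RInt_scal (V := R_NormedModule) _ _ _ (/ mu)) in I5.
  apply (is_RInt_unique (V := R_CompleteNormedModule)).
  unfold Rdiv; rewrite (Rmult_comm _ (/ mu)).
  eapply is_RInt_ext; [|exact I5]; intros t _; simpl; unfold Dav, Rdiv.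
  rewrite (Rmult_comm _ (/ mu)); reflexivity. }
rewrite E in E2.
rewrite (RInt_supp_shift chi r R0 mu) in E2; [|exact r0| |exact H|exact Hr].
2:{ rewrite Rabs_pos_eq; lra. }
rewrite (RInt_supp chi r R0) in E2 |- *; [|lra..|exact H|exact Hr|lra|lra|exact H|exact Hr].
pose proof kap_rho as K.
apply (f_equal (Rmult mu)) in E2; unfold Rdiv in E2.
rewrite Rmult_0_r, (Rmult_comm _ (/ mu)), <- Rmult_assoc, Rinv_r, Rmult_1_l in E2 by lra.
set (I := RInt chi (- r) r) in *.
replace (kap * (I - rho * I)) with (kap * (1 - rho) * I) in E2 by ring.
rewrite K in E2; lra.
Qed.

(** * L1 bounds *)

(** A bound over all [[- r, r]] is a bound of the L1 norm that needs neither an improper integral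
    nor the support. *)
Definition l1 (chi : R -> R) (B : R) : Prop :=
  forall r, 0 <= r -> RInt (fun t => Rabs (chi t)) (- r) r <= B.

Lemma RInt_abs_mono (f : R -> R) r R0 : 0 <= r <= R0 -> (forall t, continuous f t) ->
  RInt (fun t => Rabs (f t)) (- r) r <= RInt (fun t => Rabs (f t)) (- R0) R0.
Proof.
intros H cf.
assert (ca : forall t, continuous (fun t => Rabs (f t)) t) by (intros; apply continuous_Rabs_comp, cf).
rewrite <- (RInt_Chasles (V := R_CompleteNormedModule) (fun t => Rabs (f t)) (- R0) (- r) R0),
  <- (RInt_Chasles (V := R_CompleteNormedModule) (fun t => Rabs (f t)) (- r) r R0)
  by (apply ex_RInt_cont, ca).
assert (P1 : 0 <= RInt (fun t => Rabs (f t)) (- R0) (- r)).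
{ apply RInt_ge_0; [lra|apply ex_RInt_cont, ca|intros; apply Rabs_pos]. }
assert (P2 : 0 <= RInt (fun t => Rabs (f t)) r R0).
{ apply RInt_ge_0; [lra|apply ex_RInt_cont, ca|intros; apply Rabs_pos]. }
unfold plus; simpl; lra.
Qed.

Lemma l1_avg mu chi r B : 0 < mu -> 0 <= r -> (forall t, continuous chi t) -> suppR r chi ->
  l1 chi B -> l1 (avg mu chi) B.
Proof.
intros m0 r0 H Hr HB s s0.
set (R0 := Rmax s (r + mu)).
assert (s <= R0) by apply Rmax_l; assert (r + mu <= R0) by apply Rmax_r.
assert (ca : forall t, continuous (fun t => Rabs (chi t)) t) by (intros; apply continuous_Rabs_comp, H).
eapply Rle_trans; [apply (RInt_abs_mono (avg mu chi) s R0); [lra|intros; apply continuous_avg; assumption]|].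
apply Rle_trans with (RInt (avg mu (fun t => Rabs (chi t))) (- R0) R0).
- apply RInt_le; [lra| | |intros x _; apply avg_abs_le, H].
  + apply ex_RInt_cont; intros t; apply continuous_Rabs_comp, continuous_avg; assumption.
  + apply ex_RInt_cont; intros t; apply continuous_avg; assumption.
- rewrite (avg_integral mu _ r); [apply HB; lra|assumption..|].
  intros t Ht; rewrite Hr by exact Ht; apply Rabs_R0.
Qed.

Lemma l1_Dav mu chi r B : 0 < mu -> 0 <= r -> (forall t, continuous chi t) -> suppR r chi ->
  l1 chi B -> l1 (Dav mu chi) (4 / mu * B).
Proof.
intros m0 r0 H Hr HB s s0.
set (R0 := Rmax s (r + mu)).
assert (s <= R0) by apply Rmax_l; assert (HR : r + mu <= R0) by apply Rmax_r.
eapply Rle_trans; [apply (RInt_abs_mono (Dav mu chi) s R0); [lra|intros; apply continuous_Dav; assumption]|].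
assert (ca : forall t, continuous (fun t => Rabs (chi t)) t) by (intros; apply continuous_Rabs_comp, H).
assert (cs : forall t, continuous (fun t => Rabs (chi (t - mu))) t).
{ intros t; apply (continuous_comp_sub (fun t => Rabs (chi t))), ca. }
assert (cv : forall t, continuous (fun t => Rabs (avg mu chi t)) t).
{ intros t; apply continuous_Rabs_comp, continuous_avg; assumption. }
pose proof (RInt_correct (V := R_CompleteNormedModule) _ _ _ (ex_RInt_cont _ (- R0) R0 ca)) as I1.
pose proof (RInt_correct (V := R_CompleteNormedModule) _ _ _ (ex_RInt_cont _ (- R0) R0 cs)) as I2.
pose proof (RInt_correct (V := R_CompleteNormedModule) _ _ _ (ex_RInt_cont _ (- R0) R0 cv)) as I3.
apply (is_RInt_scal (V := R_NormedModule) _ _ _ rho) in I2.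
pose proof (is_RInt_plus (V := R_NormedModule) _ _ _ _ _ _ I1 I2) as I4.
apply (is_RInt_scal (V := R_NormedModule) _ _ _ kap) in I4.
pose proof (is_RInt_plus (V := R_NormedModule) _ _ _ _ _ _ I4 I3) as I5.
apply (is_RInt_scal (V := R_NormedModule) _ _ _ (/ mu)) in I5.
pose proof rho_bounds as r1; pose proof kap_bounds as k1; pose proof kap_rho as k2.
pose proof (Rinv_0_lt_compat mu m0) as im.
pose proof (ex_RInt_cont (fun t => Rabs (Dav mu chi t)) (- R0) R0
  (fun t => continuous_Rabs_comp _ t (continuous_Dav mu chi t m0 H))) as I6.
apply (RInt_correct (V := R_CompleteNormedModule)) in I6.
eapply Rle_trans; [refine (is_RInt_le _ _ _ _ _ _ _ I6 I5 _); [lra|]|].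
- intros x _; unfold Dav, Rdiv; rewrite Rabs_mult, (Rabs_pos_eq (/ mu)) by lra.
  rewrite (Rmult_comm _ (/ mu)); apply Rmult_le_compat_l; [lra|].
  unfold plus, scal; simpl; unfold mult; simpl.
  eapply Rle_trans; [apply Rabs_triang|rewrite Rabs_Ropp; apply Rplus_le_compat_r].
  rewrite Rabs_mult, Rabs_pos_eq by lra; apply Rmult_le_compat_l; [lra|].
  eapply Rle_trans; [apply Rabs_triang|rewrite Rabs_Ropp, Rabs_mult, (Rabs_pos_eq rho) by lra; lra].
- unfold plus, scal; simpl; unfold mult; simpl.
  assert (Ha : suppR r (fun t => Rabs (chi t))) by (intros t Ht; rewrite Hr by exact Ht; apply Rabs_R0).
  rewrite (RInt_supp_shift (fun t => Rabs (chi t)) r R0 mu); [|exact r0| |exact ca|exact Ha].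
  2:{ rewrite Rabs_pos_eq; lra. }
  rewrite (RInt_supp (fun t => Rabs (chi t)) r R0); [|lra|lra|exact ca|exact Ha].
  pose proof (HB r r0) as H1.
  pose proof (l1_avg mu chi r B m0 r0 H Hr HB R0 ltac:(lra)) as H2.
  unfold Rdiv; rewrite (Rmult_comm 4), Rmult_assoc; apply Rmult_le_compat_l; [lra|].
  set (I := RInt (fun t => Rabs (chi t)) (- r) r) in *.
  assert (I0 : 0 <= I) by (apply RInt_ge_0; [lra|apply ex_RInt_cont, ca|intros; apply Rabs_pos]).
  assert (kap * (1 + rho) <= 3) by nra.
  assert (kap * (I + rho * I) <= 3 * I) by nra.
  eapply Rle_trans; [apply Rplus_le_compat; [eassumption|exact H2]|lra].
Qed.

(** * Infinite products of averages *)

Definition shift (p : nat) (mu : nat -> R) : nat -> R := fun j => mu (p + j)%nat.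

(** The average with scale [mu 0] is outermost. [prodD] puts one derivative on each average, and
    [prod4] is the price of these derivatives. *)
Fixpoint prodA (mu : nat -> R) (n : nat) (chi : R -> R) : R -> R :=
  match n with
  | O => chi
  | S n => avg (mu 0%nat) (prodA (shift 1 mu) n chi)
  end.

Fixpoint prodD (mu : nat -> R) (n : nat) (chi : R -> R) : R -> R :=
  match n with
  | O => chi
  | S n => Dav (mu 0%nat) (prodD (shift 1 mu) n chi)
  end.

Fixpoint prod4 (mu : nat -> R) (n : nat) : R :=
  match n with
  | O => 1
  | S n => 4 / mu 0%nat * prod4 (shift 1 mu) n
  end.

Lemma shift_shift p q mu : shift p (shift q mu) = shift (q + p) mu.
Proof. extensionality j; unfold shift; f_equal; lia. Qed.

Lemma prod4_S_r n : forall mu, prod4 mu (S n) = prod4 mu n * (4 / mu n).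
Proof.
induction n as [|n IH]; intros mu; [simpl; ring|].
change (4 / mu 0%nat * prod4 (shift 1 mu) (S n) = 4 / mu 0%nat * prod4 (shift 1 mu) n * (4 / mu (S n))).
rewrite IH; unfold shift; simpl; ring.
Qed.

Lemma prod4_pos n : forall mu, (forall j, 0 < mu j) -> 0 < prod4 mu n.
Proof.
induction n as [|n IH]; intros mu Hm; simpl; [lra|].
apply Rmult_lt_0_compat; [apply Rdiv_lt_0_compat; [lra|apply Hm]|].
apply IH; intros j; apply Hm.
Qed.

Lemma partial_sums_shift mu s : (forall m, sum_n mu m <= s) ->
  forall m, sum_n (shift 1 mu) m <= s - mu 0%nat.
Proof.
intros Hs m; specialize (Hs (S m)); unfold sum_n in Hs; rewrite sum_Sn_m in Hs by lia.
rewrite <- sum_n_m_S in Hs; unfold plus in Hs; simpl in Hs; unfold sum_n, shift; simpl; lra.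
Qed.

Section ProdA.

Context (chi : R -> R) (cchi : forall t, continuous chi t).

Lemma prodA_continuous n : forall mu, (forall j, 0 < mu j) -> forall t, continuous (prodA mu n chi) t.
Proof.
induction n as [|n IH]; intros mu Hm t; simpl; [apply cchi|].
apply continuous_avg; [apply Hm|apply IH; intros j; apply Hm].
Qed.

Lemma prodD_continuous n : forall mu, (forall j, 0 < mu j) -> forall t, continuous (prodD mu n chi) t.
Proof.
induction n as [|n IH]; intros mu Hm t; simpl; [apply cchi|].
apply continuous_Dav; [apply Hm|apply IH; intros j; apply Hm].
Qed.

(** Moves the innermost average onto [chi]; consecutive stages are compared this way, and operator
    factors are later cancelled one at a time. *)
Lemma prodA_S_r n : forall mu, prodA mu (S n) chi = prodA mu n (avg (mu n) chi).
Proof.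
induction n as [|n IH]; intros mu; [reflexivity|].
change (avg (mu 0%nat) (prodA (shift 1 mu) (S n) chi) =
  avg (mu 0%nat) (prodA (shift 1 mu) n (avg (mu (S n)) chi))).
rewrite IH; reflexivity.
Qed.

Lemma prodA_bound n B : (forall t, Rabs (chi t) <= B) ->
  forall mu, (forall j, 0 < mu j) -> forall t, Rabs (prodA mu n chi t) <= B.
Proof.
intros HB; induction n as [|n IH]; intros mu Hm t; simpl; [apply HB|].
apply avg_bound; [apply prodA_continuous|apply IH]; intros j; apply Hm.
Qed.

Lemma prodA_nonneg n : (forall t, 0 <= chi t) ->
  forall mu, (forall j, 0 < mu j) -> forall t, 0 <= prodA mu n chi t.
Proof.
intros HB; induction n as [|n IH]; intros mu Hm t; simpl; [apply HB|].
apply avg_nonneg; [apply prodA_continuous|apply IH]; intros j; apply Hm.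
Qed.

Lemma prodD_bound n B : (forall t, Rabs (chi t) <= B) ->
  forall mu, (forall j, 0 < mu j) -> forall t, Rabs (prodD mu n chi t) <= prod4 mu n * B.
Proof.
intros HB; induction n as [|n IH]; intros mu Hm t; simpl; [rewrite Rmult_1_l; apply HB|].
rewrite Rmult_assoc; apply Dav_bound; [apply Hm|apply prodD_continuous|apply IH];
  intros j; apply Hm.
Qed.

Lemma prodA_supp n r : suppR r chi ->
  forall mu s, (forall j, 0 < mu j) -> (forall m, sum_n mu m <= s) ->
  suppR (r + s) (prodA mu n chi).
Proof.
intros Hr; induction n as [|n IH]; intros mu s Hm Hs; simpl.
- apply suppR_le with r; [|exact Hr].
  specialize (Hs 0%nat); rewrite sum_O in Hs; specialize (Hm 0%nat); lra.
- pose proof (partial_sums_shift mu s Hs) as Hs'.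
  replace (r + s) with (r + (s - mu 0%nat) + mu 0%nat) by ring.
  apply avg_supp; [apply Hm|apply prodA_continuous; intros j; apply Hm|].
  apply IH; [intros j; apply Hm|exact Hs'].
Qed.

Lemma prodD_supp n r : suppR r chi ->
  forall mu s, (forall j, 0 < mu j) -> (forall m, sum_n mu m <= s) ->
  suppR (r + s) (prodD mu n chi).
Proof.
intros Hr; induction n as [|n IH]; intros mu s Hm Hs; simpl.
- apply suppR_le with r; [|exact Hr].
  specialize (Hs 0%nat); rewrite sum_O in Hs; specialize (Hm 0%nat); lra.
- pose proof (partial_sums_shift mu s Hs) as Hs'.
  replace (r + s) with (r + (s - mu 0%nat) + mu 0%nat) by ring.
  apply Dav_supp; [apply Hm|apply prodD_continuous; intros j; apply Hm|].
  apply IH; [intros j; apply Hm|exact Hs'].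
Qed.

Lemma l1_prodA n r B : 0 <= r -> suppR r chi -> l1 chi B ->
  forall mu s, (forall j, 0 < mu j) -> (forall m, sum_n mu m <= s) -> l1 (prodA mu n chi) B.
Proof.
intros r0 Hr HB; induction n as [|n IH]; intros mu s Hm Hs; simpl; [exact HB|].
pose proof (partial_sums_shift mu s Hs) as Hs'.
assert (Hm' : forall j, 0 < shift 1 mu j) by (intros j; apply Hm).
assert (s0 : 0 <= s - mu 0%nat).
{ specialize (Hs' 0%nat); rewrite sum_O in Hs'; specialize (Hm' 0%nat); lra. }
apply l1_avg with (r + (s - mu 0%nat)); [apply Hm|lra|apply prodA_continuous, Hm'| |].
- apply prodA_supp; assumption.
- apply IH with (s - mu 0%nat); assumption.
Qed.

Lemma l1_prodD n r B : 0 <= r -> suppR r chi -> l1 chi B ->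
  forall mu s, (forall j, 0 < mu j) -> (forall m, sum_n mu m <= s) ->
  l1 (prodD mu n chi) (prod4 mu n * B).
Proof.
intros r0 Hr HB; induction n as [|n IH]; intros mu s Hm Hs; simpl; [rewrite Rmult_1_l; exact HB|].
pose proof (partial_sums_shift mu s Hs) as Hs'.
assert (Hm' : forall j, 0 < shift 1 mu j) by (intros j; apply Hm).
assert (s0 : 0 <= s - mu 0%nat).
{ specialize (Hs' 0%nat); rewrite sum_O in Hs'; specialize (Hm' 0%nat); lra. }
rewrite Rmult_assoc; apply l1_Dav with (r + (s - mu 0%nat)); [apply Hm|lra|apply prodD_continuous, Hm'| |].
- apply prodD_supp; assumption.
- apply IH with (s - mu 0%nat); assumption.
Qed.

Lemma prodA_integral n r : 0 <= r -> suppR r chi ->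
  forall mu s R0, (forall j, 0 < mu j) -> (forall m, sum_n mu m <= s) -> r + s <= R0 ->
  RInt (prodA mu n chi) (- R0) R0 = RInt chi (- R0) R0.
Proof.
intros r0 Hr; induction n as [|n IH]; intros mu s R0 Hm Hs HR; simpl; [reflexivity|].
pose proof (partial_sums_shift mu s Hs) as Hs'.
assert (Hm' : forall j, 0 < shift 1 mu j) by (intros j; apply Hm).
pose proof (Hm 0%nat) as m0.
assert (s0 : 0 <= s - mu 0%nat).
{ specialize (Hs' 0%nat); rewrite sum_O in Hs'; specialize (Hm' 0%nat); lra. }
rewrite (avg_integral _ _ (r + (s - mu 0%nat))); [|exact m0|lra|lra|apply prodA_continuous, Hm'|].
- apply (IH _ (s - mu 0%nat)); [exact Hm'|exact Hs'|lra].
- apply prodA_supp; assumption.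
Qed.

(** Averages commute with translations and do not increase the sup norm, so a Lipschitz constant is
    inherited. *)
Lemma prodA_lipschitz n L : (forall x y, Rabs (chi x - chi y) <= L * Rabs (x - y)) ->
  forall mu, (forall j, 0 < mu j) ->
  forall x y, Rabs (prodA mu n chi x - prodA mu n chi y) <= L * Rabs (x - y).
Proof.
intros HL; induction n as [|n IH]; intros mu Hm x y; simpl; [apply HL|].
assert (Hm' : forall j, 0 < shift 1 mu j) by (intros j; apply Hm).
pose proof (prodA_continuous n _ Hm') as c.
replace y with (x - (x - y)) at 1 by ring.
rewrite <- avg_shift; apply avg_dist; [exact c|intros t; apply continuous_comp_sub, c|].
intros t; eapply Rle_trans; [apply IH, Hm'|].
apply Req_le; do 2 f_equal; ring.
Qed.

Lemma prodA_dist n mu chi' d : (forall j, 0 < mu j) -> (forall t, continuous chi' t) ->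
  (forall t, Rabs (chi t - chi' t) <= d) ->
  forall t, Rabs (prodA mu n chi t - prodA mu n chi' t) <= d.
Proof.
intros Hm c' Hd; revert mu Hm; induction n as [|n IH]; intros mu Hm t; simpl; [apply Hd|].
assert (Hm' : forall j, 0 < shift 1 mu j) by (intros j; apply Hm).
apply avg_dist; [apply prodA_continuous, Hm'| |apply IH, Hm'].
clear IH; revert mu Hm Hm'; induction n as [|n IH]; intros mu Hm Hm' u; simpl; [apply c'|].
apply continuous_avg; [apply Hm'|].
apply (IH (shift 1 mu)); intros j; [apply Hm'|exact (Hm (2 + j)%nat)].
Qed.

End ProdA.

Lemma lipschitz_continuous (f : R -> R) L :
  (forall x y, Rabs (f x - f y) <= L * Rabs (x - y)) -> forall t, continuous f t.
Proof.
intros HL t; apply continuous_R; intros eps e0.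
assert (L1 : 0 < Rabs L + 1) by (pose proof (Rabs_pos L); lra).
exists (eps / (Rabs L + 1)); split; [apply Rdiv_lt_0_compat; assumption|].
intros s Hs; apply Rlt_div_r in Hs; [|exact L1].
eapply Rle_lt_trans; [apply HL|].
pose proof (Rle_abs L); pose proof (Rabs_pos (s - t)); nra.
Qed.

(** The density of the average lives within distance [mu] of 0. *)
Lemma avg_near (chi : R -> R) L mu x : 0 < mu ->
  (forall x y, Rabs (chi x - chi y) <= L * Rabs (x - y)) ->
  Rabs (avg mu chi x - chi x) <= L * mu.
Proof.
intros m0 HL; pose proof (lipschitz_continuous chi L HL) as c.
assert (L0 : 0 <= L).
{ specialize (HL 1 0); rewrite Rminus_0_r, Rabs_R1 in HL; pose proof (Rabs_pos (chi 1 - chi 0)); lra. }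
rewrite <- (avg_const mu (chi x) x), <- avg_minus; [|exact c|intros; apply continuous_const].
apply avg_bound_local.
- intros t; apply (continuous_minus (V := R_NormedModule)); [apply c|apply continuous_const].
- intros u Hu; eapply Rle_trans; [apply HL|]; apply Rmult_le_compat_l; [exact L0|].
  replace (x - mu * u - x) with (- (mu * u)) by ring; rewrite Rabs_Ropp, Rabs_pos_eq; nra.
Qed.

Lemma ex_series_shift mu n : ex_series mu -> ex_series (shift n mu).
Proof. intros H; apply (ex_series_incr_n mu n), H. Qed.

Lemma Series_split mu n : ex_series mu ->
  Series mu = sum_n mu n + Series (shift (S n) mu).
Proof.
intros H; rewrite (Series_incr_n mu (S n)) by (lia || exact H).
rewrite sum_n_Reals; reflexivity.
Qed.

Lemma Series_shift_lim mu : ex_series mu -> is_lim_seq (fun n => Series (shift n mu)) 0.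
Proof.
intros H; apply is_lim_seq_incr_1.
apply (is_lim_seq_ext (fun n => Series mu - sum_n mu n)).
- intros n; rewrite (Series_split mu n H); ring.
- replace (Finite 0) with (Rbar_minus (Finite (Series mu)) (Finite (Series mu)))
    by (simpl; f_equal; ring).
  apply is_lim_seq_minus'; [apply is_lim_seq_const|apply Series_correct, H].
Qed.

Lemma sum_n_le_Series mu m : (forall j, 0 < mu j) -> ex_series mu -> sum_n mu m <= Series mu.
Proof.
intros Hm H.
rewrite (Series_split mu m H).
apply Rle_trans with (sum_n mu m + 0); [rewrite Rplus_0_r; apply Rle_refl|].
apply Rplus_le_compat_l.
rewrite <- (Rmult_0_l (Series (shift (S m) mu))), <- Series_scal_l.
apply Series_le; [|apply (ex_series_shift mu (S m)), H].
intros k; specialize (Hm (S m + k)%nat); rewrite Rmult_0_l; unfold shift; split; lra.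
Qed.

(** The infinite convolution of the averages, applied to [g]. [Lim_seq] and [real] are total;
    convergence is proved in [Phi_limit]. *)
Definition Phi (g : R -> R) (mu : nat -> R) (x : R) : R :=
  real (Lim_seq (fun n => prodA mu n g x)).

(** Lipschitz continuity makes the averages converge at the rate of the scales; mass 1 and
    positivity make [Phi] a probability density again. *)
Record kernel (g : R -> R) (eta L B : R) : Prop := {
  kernel_lipschitz : forall x y, Rabs (g x - g y) <= L * Rabs (x - y);
  kernel_nonneg : forall x, 0 <= g x;
  kernel_bound : forall x, g x <= B;
  kernel_eta : 0 <= eta;
  kernel_supp : suppR eta g;
  kernel_mass : RInt g (- eta) eta = 1
}.

Section PhiTheory.

Context (g : R -> R) (eta L B : R) (Hg : kernel g eta L B).

Let cg : forall t, continuous g t.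
Proof. exact (lipschitz_continuous g L (kernel_lipschitz _ _ _ _ Hg)). Qed.

Let L0 : 0 <= L.
Proof.
pose proof (kernel_lipschitz _ _ _ _ Hg 1 0) as HL.
rewrite Rminus_0_r, Rabs_R1 in HL; pose proof (Rabs_pos (g 1 - g 0)); lra.
Qed.

Let Babs : forall t, Rabs (g t) <= B.
Proof.
intros t; rewrite Rabs_pos_eq; [apply (kernel_bound _ _ _ _ Hg)|apply (kernel_nonneg _ _ _ _ Hg)].
Qed.

Definition summable_scales (mu : nat -> R) : Prop := (forall j, 0 < mu j) /\ ex_series mu.

Lemma summable_scales_shift mu p : summable_scales mu -> summable_scales (shift p mu).
Proof. intros [H1 H2]; split; [intros j; apply H1|apply ex_series_shift, H2]. Qed.

Lemma prodA_step mu n x : (forall j, 0 < mu j) ->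
  Rabs (prodA mu (S n) g x - prodA mu n g x) <= L * mu n.
Proof.
intros Hm; rewrite prodA_S_r.
assert (ca : forall t, continuous (avg (mu n) g) t).
{ intros t; apply continuous_avg; [apply Hm|apply cg]. }
apply (prodA_dist (avg (mu n) g) ca n mu g); [exact Hm|exact cg|].
intros t; apply avg_near; [apply Hm|apply (kernel_lipschitz _ _ _ _ Hg)].
Qed.

(** Stages [n] and [S n] differ by averaging [g] at scale [mu n] inside operators of norm at most 1,
    hence by at most [L * mu n]; the telescoping series converges because the scales are
    summable. *)
Lemma Phi_limit mu n x : summable_scales mu ->
  is_lim_seq (fun m => prodA mu m g x) (Phi g mu x) /\
  Rabs (Phi g mu x - prodA mu n g x) <= L * Series (shift n mu).
Proof.
intros [Hm Hs].
set (w := fun k => prodA mu (S (n + k)) g x - prodA mu (n + k) g x).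
assert (Hw : forall k, Rabs (w k) <= L * shift n mu k) by (intros k; exact (prodA_step mu (n + k) x Hm)).
assert (es : ex_series (fun k => L * shift n mu k)).
{ apply (ex_series_scal_l (K := R_AbsRing) L (shift n mu)), ex_series_shift, Hs. }
assert (ea : ex_series (fun k => Rabs (w k))).
{ apply (@ex_series_le R_AbsRing R_CompleteNormedModule) with (fun k => L * shift n mu k); [|exact es].
  intros k; change (Rabs (Rabs (w k)) <= L * shift n mu k); rewrite Rabs_Rabsolu; apply Hw. }
assert (ew : ex_series w) by (apply ex_series_Rabs, ea).
assert (tel : forall m, sum_n w m = prodA mu (S (n + m)) g x - prodA mu n g x).
{ intros m; induction m as [|m IH].
  - rewrite sum_O; unfold w; rewrite Nat.add_0_r; reflexivity.
  - rewrite sum_Sn, IH; unfold w; rewrite Nat.add_succ_r.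
    match goal with |- plus ?a ?b = _ => change (a + b = prodA mu (S (S (n + m))) g x - prodA mu n g x) end.
    ring. }
assert (lim : is_lim_seq (fun m => prodA mu m g x) (prodA mu n g x + Series w)).
{ apply (is_lim_seq_incr_n _ (S n)).
  apply (is_lim_seq_ext (fun m => prodA mu n g x + sum_n w m)).
  - intros m; rewrite tel; replace (m + S n)%nat with (S (n + m)) by lia; ring.
  - apply is_lim_seq_plus'; [apply is_lim_seq_const|apply Series_correct, ew]. }
assert (E : Phi g mu x = prodA mu n g x + Series w).
{ unfold Phi; rewrite (is_lim_seq_unique _ _ lim); reflexivity. }
split; [rewrite E; exact lim|].
rewrite E; replace (prodA mu n g x + Series w - prodA mu n g x) with (Series w) by ring.
eapply Rle_trans; [apply Series_Rabs, ea|].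
rewrite <- Series_scal_l; apply Series_le; [|exact es].
intros k; split; [apply Rabs_pos|apply Hw].
Qed.

Lemma Phi_lipschitz mu x y : summable_scales mu ->
  Rabs (Phi g mu x - Phi g mu y) <= L * Rabs (x - y).
Proof.
intros Hmu.
assert (l : is_lim_seq (fun n => Rabs (prodA mu n g x - prodA mu n g y))
              (Rabs (Phi g mu x - Phi g mu y))).
{ apply (is_lim_seq_abs _ (Finite (Phi g mu x - Phi g mu y))).
  apply is_lim_seq_minus'; apply Phi_limit; assumption || exact 0%nat. }
refine (is_lim_seq_le _ (fun _ => L * Rabs (x - y)) _ _ _ l (is_lim_seq_const _)).
intros n; apply prodA_lipschitz; [exact cg|apply (kernel_lipschitz _ _ _ _ Hg)|apply Hmu].
Qed.

Lemma Phi_continuous mu t : summable_scales mu -> continuous (Phi g mu) t.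
Proof. intros H; apply lipschitz_continuous with L; intros x y; apply Phi_lipschitz, H. Qed.

Lemma Phi_unfold mu x : summable_scales mu -> Phi g mu x = avg (mu 0%nat) (Phi g (shift 1 mu)) x.
Proof.
intros Hmu; pose proof (summable_scales_shift mu 1 Hmu) as Hmu'.
destruct Hmu as [Hm Hs].
pose proof (proj1 (Phi_limit mu 0 x (conj Hm Hs))) as l; apply is_lim_seq_incr_1 in l.
assert (l2 : is_lim_seq (fun n => prodA mu (S n) g x) (avg (mu 0%nat) (Phi g (shift 1 mu)) x)).
{ apply is_lim_seq_spec; intros eps.
  pose proof (Series_shift_lim (shift 1 mu) (proj2 Hmu')) as ls.
  apply (is_lim_seq_scal_l _ L) in ls; simpl in ls; rewrite Rmult_0_r in ls.
  apply is_lim_seq_spec in ls; destruct (ls eps) as [N HN]; exists N; intros n Hn.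
  specialize (HN n Hn); rewrite Rminus_0_r in HN.
  eapply Rle_lt_trans; [|exact HN]; eapply Rle_trans; [|apply Rle_abs].
  simpl; apply avg_dist.
  - apply prodA_continuous; [exact cg|apply Hmu'].
  - intros t; apply Phi_continuous, Hmu'.
  - intros t; rewrite Rabs_minus_sym; apply Phi_limit, Hmu'. }
pose proof (is_lim_seq_unique _ _ l) as U1; pose proof (is_lim_seq_unique _ _ l2) as U2.
rewrite U1 in U2; injection U2; auto.
Qed.

Lemma Phi_prodA mu n x : summable_scales mu -> Phi g mu x = prodA mu n (Phi g (shift n mu)) x.
Proof.
revert mu x; induction n as [|n IH]; intros mu x Hmu; [reflexivity|].
rewrite Phi_unfold by exact Hmu; simpl; apply avg_ext; intros t.
rewrite IH by (apply summable_scales_shift, Hmu).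
rewrite shift_shift; reflexivity.
Qed.

Lemma Phi_nonneg mu x : summable_scales mu -> 0 <= Phi g mu x.
Proof.
intros Hmu; refine (is_lim_seq_le (fun _ => 0) _ _ _ _ (is_lim_seq_const _) (proj1 (Phi_limit mu 0 x Hmu))).
intros n; apply prodA_nonneg; [exact cg|apply (kernel_nonneg _ _ _ _ Hg)|apply Hmu].
Qed.

Lemma Phi_bound mu x : summable_scales mu -> Rabs (Phi g mu x) <= B.
Proof.
intros Hmu; pose proof (proj1 (Phi_limit mu 0 x Hmu)) as l; apply is_lim_seq_abs in l; simpl in l.
refine (is_lim_seq_le _ (fun _ => B) _ _ _ l (is_lim_seq_const _)).
intros n; apply prodA_bound; [exact cg|exact Babs|apply Hmu].
Qed.

Lemma Phi_supp mu : summable_scales mu -> suppR (eta + Series mu) (Phi g mu).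
Proof.
intros Hmu x Hx; pose proof (proj1 (Phi_limit mu 0 x Hmu)) as l.
assert (l2 : is_lim_seq (fun n => prodA mu n g x) 0).
{ apply (is_lim_seq_ext (fun _ => 0)); [|apply is_lim_seq_const].
  intros n; symmetry; apply (prodA_supp g cg n eta (kernel_supp _ _ _ _ Hg) mu (Series mu)); [apply Hmu| |exact Hx].
  intros m; apply sum_n_le_Series; apply Hmu. }
pose proof (is_lim_seq_unique _ _ l) as U1; pose proof (is_lim_seq_unique _ _ l2) as U2.
rewrite U1 in U2; injection U2; auto.
Qed.

Lemma Series_scales_pos mu : summable_scales mu -> 0 < Series mu.
Proof.
intros [Hm Hs]; eapply Rlt_le_trans; [apply (Hm 0%nat)|].
rewrite <- (sum_O mu); apply sum_n_le_Series; assumption.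
Qed.

(** The finite stages have mass 1 and converge uniformly on [[- R0, R0]]. *)
Lemma Phi_mass mu R0 : summable_scales mu -> eta + Series mu <= R0 -> RInt (Phi g mu) (- R0) R0 = 1.
Proof.
intros Hmu HR; pose proof (Series_scales_pos mu Hmu) as s0.
pose proof (kernel_eta _ _ _ _ Hg) as eta0.
assert (close : forall n, Rabs (RInt (Phi g mu) (- R0) R0 - 1) <= 2 * R0 * (L * Series (shift n mu))).
{ intros n.
  assert (E : RInt (prodA mu n g) (- R0) R0 = 1).
  { rewrite (prodA_integral g cg n eta eta0 (kernel_supp _ _ _ _ Hg) mu (Series mu));
      [|apply Hmu|intros m; apply sum_n_le_Series; apply Hmu|exact HR].
    rewrite (RInt_supp g eta R0 eta0); [apply (kernel_mass _ _ _ _ Hg)|lra|exact cg|apply (kernel_supp _ _ _ _ Hg)]. }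
  rewrite <- E.
  pose proof (ex_RInt_cont (Phi g mu) (- R0) R0 (fun t => Phi_continuous mu t Hmu)) as E1.
  pose proof (ex_RInt_cont (prodA mu n g) (- R0) R0 (prodA_continuous g cg n mu (proj1 Hmu))) as E2.
  replace (RInt (Phi g mu) (- R0) R0 - RInt (prodA mu n g) (- R0) R0)
    with (RInt (fun t => minus (Phi g mu t) (prodA mu n g t)) (- R0) R0)
    by (rewrite (RInt_minus (V := R_CompleteNormedModule)) by assumption; reflexivity).
  replace (2 * R0) with (R0 - - R0) by ring.
  apply abs_RInt_le_const; [lra|apply (ex_RInt_minus (V := R_NormedModule)); assumption|].
  intros t _; apply Phi_limit, Hmu. }
assert (l : is_lim_seq (fun n => 2 * R0 * (L * Series (shift n mu))) 0).
{ pose proof (Series_shift_lim mu (proj2 Hmu)) as l.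
  apply (is_lim_seq_scal_l _ L) in l; apply (is_lim_seq_scal_l _ (2 * R0)) in l.
  simpl in l; rewrite !Rmult_0_r in l; exact l. }
assert (Z : Rabs (RInt (Phi g mu) (- R0) R0 - 1) <= 0).
{ refine (is_lim_seq_le (fun _ => _) _ _ _ close (is_lim_seq_const _) l). }
pose proof (Rabs_pos (RInt (Phi g mu) (- R0) R0 - 1)).
destruct (Req_dec (RInt (Phi g mu) (- R0) R0 - 1) 0) as [Q|Q]; [lra|apply Rabs_pos_lt in Q; lra].
Qed.

Lemma l1_Phi mu : summable_scales mu -> l1 (Phi g mu) 1.
Proof.
intros Hmu r r0; pose proof (Series_scales_pos mu Hmu) as s0.
pose proof (kernel_eta _ _ _ _ Hg) as eta0.
set (R0 := Rmax r (eta + Series mu)).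
assert (r <= R0) by apply Rmax_l; assert (HR : eta + Series mu <= R0) by apply Rmax_r.
eapply Rle_trans; [apply (RInt_abs_mono (Phi g mu) r R0); [lra|intros t; apply Phi_continuous, Hmu]|].
rewrite (RInt_ext _ (Phi g mu)); [rewrite Phi_mass by assumption; lra|].
intros t _; apply Rabs_pos_eq, Phi_nonneg, Hmu.
Qed.

(** Every derivative is spent on a fresh scale: the tail unfolds one more average, whose derivative
    is [Dav], and the outer [Dav] commute with differentiation. No derivative ever reaches [g]. *)
Lemma is_derive_prodD_Phi p : forall mu x, summable_scales mu ->
  is_derive (prodD mu p (Phi g (shift p mu))) x (prodD mu (S p) (Phi g (shift (S p) mu)) x).
Proof.
induction p as [|p IH]; intros mu x Hmu.
- simpl; pose proof (summable_scales_shift mu 1 Hmu) as Hmu'.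
  apply (is_derive_ext (avg (mu 0%nat) (Phi g (shift 1 mu)))).
  + intros t; symmetry; apply (Phi_unfold mu t Hmu).
  + apply is_derive_avg; [apply Hmu|intros t; apply Phi_continuous, Hmu'].
- pose proof (summable_scales_shift mu 1 Hmu) as Hmu'.
  change (is_derive (Dav (mu 0%nat) (prodD (shift 1 mu) p (Phi g (shift (S p) mu)))) x
    (Dav (mu 0%nat) (prodD (shift 1 mu) (S p) (Phi g (shift (S (S p)) mu))) x)).
  apply is_derive_Dav_C1; [apply Hmu| |].
  + intros t; specialize (IH (shift 1 mu) t Hmu'); rewrite !shift_shift in IH; exact IH.
  + apply prodD_continuous; [|apply Hmu'].
    intros t; apply Phi_continuous, summable_scales_shift, Hmu.
Qed.

Lemma Derive_n_Phi p : forall mu x, summable_scales mu ->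
  Derive_n (Phi g mu) p x = prodD mu p (Phi g (shift p mu)) x.
Proof.
induction p as [|p IH]; intros mu x Hmu; [reflexivity|].
change (Derive (Derive_n (Phi g mu) p) x = prodD mu (S p) (Phi g (shift (S p) mu)) x).
rewrite (Derive_ext _ _ _ (fun t => IH mu t Hmu)).
apply is_derive_unique, is_derive_prodD_Phi, Hmu.
Qed.

Lemma smoothR_Phi mu : summable_scales mu -> smoothR (Phi g mu).
Proof.
intros Hmu p x; eexists.
apply (is_derive_ext (prodD mu p (Phi g (shift p mu)))).
- intros t; symmetry; apply Derive_n_Phi, Hmu.
- apply is_derive_prodD_Phi, Hmu.
Qed.

Lemma Derive_n_Phi_bound mu p x : summable_scales mu -> Rabs (Derive_n (Phi g mu) p x) <= prod4 mu p * B.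
Proof.
intros Hmu; rewrite Derive_n_Phi by exact Hmu.
pose proof (summable_scales_shift mu p Hmu) as Hmu'.
apply prodD_bound; [intros t; apply Phi_continuous, Hmu'|intros t; apply Phi_bound, Hmu'|apply Hmu].
Qed.

Lemma l1_Derive_n_Phi mu p : summable_scales mu -> l1 (Derive_n (Phi g mu) p) (prod4 mu p).
Proof.
intros Hmu; pose proof (summable_scales_shift mu p Hmu) as Hmu'.
pose proof (Series_scales_pos _ Hmu') as s0; pose proof (kernel_eta _ _ _ _ Hg) as eta0.
assert (E : Derive_n (Phi g mu) p = prodD mu p (Phi g (shift p mu))).
{ extensionality x; apply Derive_n_Phi, Hmu. }
rewrite E, <- (Rmult_1_r (prod4 mu p)).
apply l1_prodD with (eta + Series (shift p mu)) (Series mu).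
- intros t; apply Phi_continuous, Hmu'.
- lra.
- apply Phi_supp, Hmu'.
- apply l1_Phi, Hmu'.
- apply Hmu.
- intros m; apply sum_n_le_Series; apply Hmu.
Qed.

End PhiTheory.

(** * Choice of the scales *)

Lemma Series_pos_lt mu : (forall j, 0 < mu j) -> ex_series mu -> 0 < Series mu.
Proof.
intros Hm Hs; eapply Rlt_le_trans; [apply (Hm 0%nat)|].
rewrite <- (sum_O mu); apply sum_n_le_Series; assumption.
Qed.

Lemma Series_shift_S mu n : ex_series mu -> Series (shift n mu) = mu n + Series (shift (S n) mu).
Proof.
intros H; rewrite (Series_split (shift n mu) 0) by (apply ex_series_shift, H).
rewrite sum_O, shift_shift; unfold shift at 1; rewrite Nat.add_0_r.
replace (n + 1)%nat with (S n) by lia; reflexivity.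
Qed.

(* [a j / sqrt (r j)], with [r j] the tail of the series, is at most
   [2 (sqrt (r j) - sqrt (r (S j)))]. *)
Lemma slower_summable (a : nat -> R) : (forall j, 0 < a j) -> ex_series a ->
  exists d, (forall j, 0 < d j) /\ ex_series d /\ (forall j, (/ 2) ^ j <= d j) /\
    forall K, exists N, forall j, (N <= j)%nat -> K * a j <= d j.
Proof.
intros Ha Hs.
set (r := fun j => Series (shift j a)).
assert (r0 : forall j, 0 < r j).
{ intros j; apply Series_pos_lt; [intros i; apply Ha|apply ex_series_shift, Hs]. }
assert (rS : forall j, a j = r j - r (S j)) by (intros j; unfold r; rewrite (Series_shift_S a j Hs); ring).
assert (s0 : forall j, 0 < sqrt (r j)) by (intros j; apply sqrt_lt_R0, r0).
assert (rl : is_lim_seq (fun j => sqrt (r j)) 0).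
{ rewrite <- sqrt_0; apply is_lim_seq_continuous; [apply continuity_pt_sqrt; lra|].
  apply Series_shift_lim, Hs. }
assert (g0 : forall j, 0 < (/ 2) ^ j) by (intros j; apply pow_lt; lra).
(* The geometric summand secures [d j >= 2^(-j)], on which [prod4_scales_next] relies. *)
exists (fun j => a j / sqrt (r j) + (/ 2) ^ j); split; [|split; [|split]].
- intros j; pose proof (Rdiv_lt_0_compat _ _ (Ha j) (s0 j)); specialize (g0 j); lra.
- apply (ex_series_plus (V := R_NormedModule) (fun j => a j / sqrt (r j)) (fun j => (/ 2) ^ j)).
  2:{ apply ex_series_geom; rewrite Rabs_pos_eq; lra. }
  apply (@ex_series_le R_AbsRing R_CompleteNormedModule) with
    (fun j => 2 * (sqrt (r j) - sqrt (r (S j)))).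
  + intros j; change (Rabs (a j / sqrt (r j)) <= 2 * (sqrt (r j) - sqrt (r (S j)))).
    rewrite Rabs_pos_eq by (left; apply Rdiv_lt_0_compat; auto).
    apply Rle_div_l; [apply s0|].
    pose proof (sqrt_sqrt (r j) (Rlt_le _ _ (r0 j))) as q1.
    pose proof (sqrt_sqrt (r (S j)) (Rlt_le _ _ (r0 (S j)))) as q2.
    pose proof (s0 j) as p1; pose proof (s0 (S j)) as p2.
    assert (sqrt (r (S j)) <= sqrt (r j)) by (apply sqrt_le_1_alt; specialize (Ha j); rewrite rS in Ha; lra).
    rewrite rS; nra.
  + exists (2 * sqrt (r 0%nat)).
    assert (tel : forall n, sum_n (fun j => 2 * (sqrt (r j) - sqrt (r (S j)))) n =
      2 * (sqrt (r 0%nat) - sqrt (r (S n)))).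
    { intros n; induction n as [|n IH]; [rewrite sum_O; reflexivity|].
      rewrite sum_Sn, IH.
      match goal with |- plus ?x ?y = ?z => change (x + y = z) end; ring. }
    assert (L : is_lim_seq (fun n => 2 * (sqrt (r 0%nat) - sqrt (r (S n)))) (2 * sqrt (r 0%nat))).
    { replace (Finite (2 * sqrt (r 0%nat))) with (Rbar_mult 2 (sqrt (r 0%nat) - 0))
        by (simpl; f_equal; ring).
      apply is_lim_seq_scal_l; apply is_lim_seq_minus'; [apply is_lim_seq_const|].
      apply (is_lim_seq_incr_1 (fun j => sqrt (r j))), rl. }
    apply (is_lim_seq_ext _ _ _ (fun n => eq_sym (tel n)) L).
- intros j; pose proof (Rdiv_lt_0_compat _ _ (Ha j) (s0 j)); lra.
- intros K; set (K' := Rabs K + 1).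
  assert (K0 : 0 < K') by (unfold K'; pose proof (Rabs_pos K); lra).
  apply is_lim_seq_spec in rl.
  destruct (rl (mkposreal _ (Rinv_0_lt_compat _ K0))) as [N HN]; exists N; intros j Hj.
  specialize (HN j Hj); simpl in HN; rewrite Rminus_0_r, Rabs_pos_eq in HN by (left; apply s0).
  specialize (g0 j); specialize (Ha j); specialize (s0 j).
  assert (K' <= / sqrt (r j)).
  { rewrite <- (Rinv_inv K'); apply Rinv_le_contravar; lra. }
  pose proof (Rle_abs K); unfold Rdiv, K' in *; nra.
Qed.

Lemma eventually_bounded (u : nat -> R) K N :
  (forall p, (N <= p)%nat -> u p <= K) -> exists K', forall p, u p <= K'.
Proof.
revert K; induction N as [|N IH]; intros K H; [exists K; intros p; apply H; lia|].
apply (IH (Rmax K (u N))); intros p Hp.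
destruct (Nat.eq_dec p N) as [->|Hn]; [apply Rmax_r|].
eapply Rle_trans; [apply H; lia|apply Rmax_l].
Qed.

(** From [N] on, consecutive values of [k^p * prod4 mu p / M p] have ratio at most 1. *)
Lemma prod4_growth M (Mpos : forall p, 0 < M p) mu k N : 0 < k -> (forall j, 0 < mu j) ->
  (forall j, (N <= j)%nat -> k * (4 / mu j) * M j <= M (S j)) ->
  exists B, forall p, k ^ p * prod4 mu p <= B * M p.
Proof.
intros k0 Hm H.
set (u := fun p => k ^ p * prod4 mu p / M p).
assert (up : forall p, (N <= p)%nat -> u p <= u N).
{ intros p Hp; induction Hp as [|p Hp IH]; [apply Rle_refl|].
  eapply Rle_trans; [|exact IH]; unfold u.
  apply Rle_div_l; [apply Mpos|].
  apply Rle_trans with (k ^ p * prod4 mu p / M p * (k * (4 / mu p) * M p)).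
  - rewrite prod4_S_r; simpl; apply Req_le; field; split; [specialize (Hm p)|specialize (Mpos p)]; lra.
  - apply Rmult_le_compat_l; [|apply H, Hp].
    apply Rdiv_le_0_compat; [|apply Mpos].
    apply Rmult_le_pos; [apply pow_le; lra|left; apply prod4_pos, Hm]. }
destruct (eventually_bounded u (u N) N up) as [B HB]; exists B; intros p.
specialize (HB p); unfold u in HB; apply Rle_div_l in HB; [exact HB|apply Mpos].
Qed.

Lemma prod4_antimono mu nu : (forall j, 0 < mu j <= nu j) -> forall p, prod4 nu p <= prod4 mu p.
Proof.
intros H p; induction p as [|p IH]; [apply Rle_refl|].
rewrite !prod4_S_r; apply Rmult_le_compat; [|  |exact IH|].
- left; apply prod4_pos; intros j; destruct (H j); lra.
- left; apply Rdiv_lt_0_compat; [lra|destruct (H p); lra].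
- unfold Rdiv; apply Rmult_le_compat_l; [lra|]; apply Rinv_le_contravar; apply H.
Qed.

(** The head [lam] lets the first [N] factors of the operator cancel exactly; the slower tail [d]
    produces a genuine test function. *)
Definition mixed (lam d : nat -> R) (N j : nat) : R := if (j <? N)%nat then lam j else d j.

Lemma mixed_lt lam d N j : (j < N)%nat -> mixed lam d N j = lam j.
Proof. intros H; unfold mixed; destruct (Nat.ltb_spec j N); [reflexivity|lia]. Qed.

Lemma mixed_ge lam d N j : (N <= j)%nat -> mixed lam d N j = d j.
Proof. intros H; unfold mixed; destruct (Nat.ltb_spec j N); [lia|reflexivity]. Qed.

Lemma summable_mixed lam d N :
  summable_scales lam -> summable_scales d -> summable_scales (mixed lam d N).
Proof.
intros [l1 l2] [d1 d2]; split.
- intros j; unfold mixed; destruct (j <? N)%nat; auto.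
- apply (@ex_series_le R_AbsRing R_CompleteNormedModule) with (fun j => lam j + d j).
  + intros j; change (Rabs (mixed lam d N j) <= lam j + d j).
    unfold mixed; specialize (l1 j); specialize (d1 j).
    destruct (j <? N)%nat; rewrite Rabs_pos_eq; lra.
  + apply (ex_series_plus (V := R_NormedModule)); assumption.
Qed.

Lemma Series_shift_mixed lam d N P : summable_scales lam -> summable_scales d ->
  Series (shift P (mixed lam d N)) <= Series (shift P lam) + Series (shift P d).
Proof.
intros Hl Hd.
pose proof (summable_scales_shift lam P Hl) as [l1 l2].
pose proof (summable_scales_shift d P Hd) as [d1 d2].
rewrite <- Series_plus by assumption.
apply Series_le; [|apply (ex_series_plus (V := R_NormedModule)); assumption].
intros j; specialize (l1 j); specialize (d1 j); unfold shift, mixed in *.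
destruct (P + j <? N)%nat; lra.
Qed.

(** Any Lipschitz density concentrated near 0 would serve; all smoothness comes from the
    averages. *)
Definition tent (eta x : R) : R := Rmax 0 (1 - Rabs x / eta) / eta.

Lemma Rmax_0_lipschitz x y : Rabs (Rmax 0 x - Rmax 0 y) <= Rabs (x - y).
Proof. unfold Rmax; repeat destruct Rle_dec; unfold Rabs; repeat destruct Rcase_abs; lra. Qed.

Lemma tent_kernel eta : 0 < eta -> kernel (tent eta) eta (/ eta / eta) (/ eta).
Proof.
intros e0; pose proof (Rinv_0_lt_compat eta e0) as i0.
assert (lip : forall x y, Rabs (tent eta x - tent eta y) <= / eta / eta * Rabs (x - y)).
{ intros x y; unfold tent, Rdiv; rewrite <- Rmult_minus_distr_r, Rabs_mult, (Rabs_pos_eq (/ eta)) by lra.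
  eapply Rle_trans; [apply Rmult_le_compat_r; [lra|apply Rmax_0_lipschitz]|].
  replace (1 - Rabs x * / eta - (1 - Rabs y * / eta)) with ((Rabs y - Rabs x) * / eta) by ring.
  rewrite Rabs_mult, (Rabs_pos_eq (/ eta)) by lra.
  pose proof (Rabs_triang_inv2 y x) as T; rewrite (Rabs_minus_sym y x) in T.
  assert (0 < / eta * / eta) by (apply Rmult_lt_0_compat; assumption); nra. }
split.
- exact lip.
- intros x; unfold tent, Rdiv; apply Rmult_le_pos; [apply Rmax_l|lra].
- intros x; unfold tent, Rdiv; rewrite <- (Rmult_1_l (/ eta)) at 3.
  apply Rmult_le_compat_r; [lra|].
  assert (0 <= Rabs x * / eta) by (apply Rmult_le_pos; [apply Rabs_pos|lra]).
  apply Rmax_case; lra.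
- lra.
- intros x Hx; unfold tent.
  assert (1 <= Rabs x / eta) by (apply Rle_div_r; lra).
  rewrite Rmax_left by lra; unfold Rdiv; ring.
- pose proof (lipschitz_continuous _ _ lip) as c.
  rewrite <- (RInt_Chasles (V := R_CompleteNormedModule) (tent eta) (- eta) 0 eta)
    by (apply ex_RInt_cont, c).
  assert (H1 : RInt (tent eta) (- eta) 0 = / 2).
  { rewrite (RInt_ext _ (fun x => (1 + x / eta) / eta)).
    - assert (D : is_RInt (fun x => (1 + x / eta) / eta) (- eta) 0
        (minus ((fun x => x / eta + x ^ 2 / (2 * eta ^ 2)) 0) ((fun x => x / eta + x ^ 2 / (2 * eta ^ 2)) (- eta)))).
      { apply (is_RInt_derive (V := R_CompleteNormedModule) (fun x => x / eta + x ^ 2 / (2 * eta ^ 2))).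
        - intros x _; auto_derive; [exact I|field; lra].
        - intros x _; apply (@ex_derive_continuous R_AbsRing R_NormedModule); auto_derive; exact I. }
      apply (is_RInt_unique (V := R_CompleteNormedModule)) in D; rewrite D.
      unfold minus, plus, opp; simpl; field; lra.
    - rewrite Rmin_left, Rmax_right by lra; intros x Hx; unfold tent.
      rewrite Rabs_left by lra.
      rewrite Rmax_right.
      { match goal with |- ?a = ?b => change (@eq R a b) end; field; lra. }
      assert (- x / eta <= 1) by (apply Rle_div_l; lra); lra. }
  assert (H2 : RInt (tent eta) 0 eta = / 2).
  { rewrite (RInt_ext _ (fun x => (1 - x / eta) / eta)).
    - assert (D : is_RInt (fun x => (1 - x / eta) / eta) 0 eta
        (minus ((fun x => x / eta - x ^ 2 / (2 * eta ^ 2)) eta) ((fun x => x / eta - x ^ 2 / (2 * eta ^ 2)) 0))).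
      { apply (is_RInt_derive (V := R_CompleteNormedModule) (fun x => x / eta - x ^ 2 / (2 * eta ^ 2))).
        - intros x _; auto_derive; [exact I|field; lra].
        - intros x _; apply (@ex_derive_continuous R_AbsRing R_NormedModule); auto_derive; exact I. }
      apply (is_RInt_unique (V := R_CompleteNormedModule)) in D; rewrite D.
      unfold minus, plus, opp; simpl; field; lra.
    - rewrite Rmin_left, Rmax_right by lra; intros x Hx; unfold tent.
      rewrite Rabs_right by lra.
      rewrite Rmax_right; [reflexivity|].
      assert (x / eta <= 1) by (apply Rle_div_l; lra); lra. }
  rewrite H1, H2; unfold plus; simpl; field.
Qed.

(** * The approximate fundamental solutions *)

Section Approximation.

Context (M : nat -> R) (Mpos : forall p, 0 < M p) (M0 : M 0%nat = 1) (HM3' : condM3' M).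
Context (h : R) (h0 : 0 < h).

Definition lam (j : nat) : R := 8 * h * (M j / M (S j)).

Lemma summable_lam : summable_scales lam.
Proof.
split.
- intros j; unfold lam; pose proof (Rdiv_lt_0_compat _ _ (Mpos j) (Mpos (S j))); nra.
- apply (ex_series_scal_l (K := R_AbsRing) (8 * h) (fun j => M j / M (S j))), HM3'.
Qed.

(** The product of the [M j / M (S j)] telescopes to [1 / M p] since [M 0 = 1], and each order
    contributes [h * 4 / (8 h) = 1 / 2]. *)
Lemma prod4_lam p : h ^ p * prod4 lam p = M p * (/ 2) ^ p.
Proof.
induction p as [|p IH]; [simpl; rewrite M0; ring|].
rewrite prod4_S_r; simpl pow.
replace (h * h ^ p * (prod4 lam p * (4 / lam p))) with (h * (4 / lam p) * (h ^ p * prod4 lam p)) by ring.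
rewrite IH; unfold lam; pose proof (Mpos p); pose proof (Mpos (S p)); field; lra.
Qed.

Context (d : nat -> R) (Hd : summable_scales d) (dgeom : forall j, (/ 2) ^ j <= d j).
Context (dfast : forall K, exists N, forall j, (N <= j)%nat -> K * (M j / M (S j)) <= d j).

Definition scales (N : nat) : nat -> R := mixed lam d N.

Lemma summable_scales_mixed N : summable_scales (scales N).
Proof. apply summable_mixed; [apply summable_lam|exact Hd]. Qed.

(** The tail [d] eventually exceeds every multiple of [M j / M (S j)]; this yields the bound at
    every scale [k] that the Beurling space demands, with [B] depending on [N]. *)
Lemma prod4_scales_beurling N k : 0 < k -> exists B, forall p, k ^ p * prod4 (scales N) p <= B * M p.
Proof.
intros k0; destruct (dfast (4 * k)) as [N1 HN1].
apply (prod4_growth M Mpos _ k (Nat.max N N1) k0).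
- apply summable_scales_mixed.
- intros j Hj; unfold scales; rewrite mixed_ge by lia.
  specialize (HN1 j ltac:(lia)); pose proof (proj1 Hd j) as dj.
  pose proof (Mpos j) as m1; pose proof (Mpos (S j)) as m2.
  apply (Rmult_le_reg_r (d j / M (S j))); [apply Rdiv_lt_0_compat; assumption|].
  replace (k * (4 / d j) * M j * (d j / M (S j))) with (4 * k * (M j / M (S j))) by (field; lra).
  replace (M (S j) * (d j / M (S j))) with (d j) by (field; lra); exact HN1.
Qed.

(** At the one scale [h] the bound is uniform in [N]: beyond [N0] the tail [d] is at least [lam],
    and larger scales make derivatives cheaper. *)
Lemma prod4_scales_uniform : exists N0, forall N, (N0 <= N)%nat -> forall p,
  h ^ p * prod4 (scales N) p <= M p * (/ 2) ^ p.
Proof.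
destruct (dfast (8 * h)) as [N0 HN0]; exists N0; intros N HN p; rewrite <- prod4_lam.
apply Rmult_le_compat_l; [apply pow_le; lra|]; apply prod4_antimono; intros j.
split; [apply summable_lam|].
destruct (Nat.lt_ge_cases j N) as [Hj|Hj]; unfold scales.
- rewrite mixed_lt by exact Hj; apply Rle_refl.
- rewrite mixed_ge by exact Hj; apply HN0; lia.
Qed.

(** Beyond [N] an additional derivative costs [4 / d p], at most [4 * 2^p], which the bound at scale
    [2 h] absorbs. It serves the Lipschitz continuity of [T] convolved with [phiN N]. *)
Lemma prod4_scales_next N : exists B, forall p, h ^ p * prod4 (scales N) (S p) <= B * M p.
Proof.
destruct (prod4_scales_beurling N (2 * h)) as [B HB]; [lra|].
destruct (eventually_bounded (fun p => 4 / scales N p * (/ 2) ^ p) 4 N) as [K HK].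
{ intros p Hp; unfold scales; rewrite mixed_ge by exact Hp.
  pose proof (proj1 Hd p) as dp; specialize (dgeom p).
  apply (Rmult_le_reg_r (d p)); [exact dp|].
  replace (4 / d p * (/ 2) ^ p * d p) with (4 * (/ 2) ^ p) by (field; lra); lra. }
exists (K * B); intros p; rewrite prod4_S_r.
specialize (HB p); specialize (HK p).
assert (q1 : 0 < h ^ p) by (apply pow_lt, h0).
assert (q2 : 0 < 2 ^ p) by (apply pow_lt; lra).
pose proof (prod4_pos p (scales N) (proj1 (summable_scales_mixed N))) as q3.
assert (q4 : 0 <= (2 * h) ^ p * prod4 (scales N) p).
{ apply Rmult_le_pos; [apply pow_le; lra|lra]. }
replace (h ^ p * (prod4 (scales N) p * (4 / scales N p)))
  with (4 / scales N p * (/ 2) ^ p * ((2 * h) ^ p * prod4 (scales N) p)).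
2:{ rewrite Rpow_mult_distr, pow_inv; field; split; [pose proof (proj1 (summable_scales_mixed N) p)|]; lra. }
assert (K0 : 0 <= K).
{ eapply Rle_trans; [|exact HK]; apply Rmult_le_pos.
  - left; apply Rdiv_lt_0_compat; [lra|apply summable_scales_mixed].
  - apply pow_le; lra. }
eapply Rle_trans; [apply Rmult_le_compat_r; [exact q4|exact HK]|].
rewrite Rmult_assoc; apply Rmult_le_compat_l; assumption.
Qed.

Definition width (N : nat) : R := / (INR N + 1).

Lemma width_pos N : 0 < width N.
Proof. apply Rinv_0_lt_compat; pose proof (pos_INR N); lra. Qed.

Definition base (N : nat) : R -> R := tent (width N).

Lemma base_kernel N : kernel (base N) (width N) (/ width N / width N) (/ width N).
Proof. apply tent_kernel, width_pos. Qed.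

Definition phiN (N : nat) : R -> R := Phi (base N) (scales N).

Definition phi_radius : R := 1 + Series lam + Series d.

Lemma Series_scales_le N : Series (scales N) <= Series lam + Series d.
Proof. exact (Series_shift_mixed lam d N 0 summable_lam Hd). Qed.

Lemma width_le N : width N <= 1.
Proof.
unfold width; rewrite <- Rinv_1 at 2.
apply Rinv_le_contravar; [lra|pose proof (pos_INR N); lra].
Qed.

Lemma phi_radius_pos : 0 < phi_radius.
Proof.
unfold phi_radius.
pose proof (Series_pos_lt lam (proj1 summable_lam) (proj2 summable_lam)).
pose proof (Series_pos_lt d (proj1 Hd) (proj2 Hd)); lra.
Qed.

Lemma phiN_supp N : suppR phi_radius (phiN N).
Proof.
apply suppR_le with (width N + Series (scales N)).
- pose proof (Series_scales_le N); pose proof (width_le N); unfold phi_radius; lra.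
- apply (Phi_supp _ _ _ _ (base_kernel N)), summable_scales_mixed.
Qed.

Lemma phiN_real_test N : real_test M (phiN N).
Proof.
split; [|split].
- apply (smoothR_Phi _ _ _ _ (base_kernel N)), summable_scales_mixed.
- exists phi_radius; split; [apply phi_radius_pos|apply phiN_supp].
- intros k k0; destruct (prod4_scales_beurling N k k0) as [B HB].
  exists (B * / width N); intros p t.
  eapply Rle_trans; [apply Rmult_le_compat_l; [apply pow_le; lra|]|].
  + apply (Derive_n_Phi_bound _ _ _ _ (base_kernel N)), summable_scales_mixed.
  + rewrite <- Rmult_assoc.
    replace (B * / width N * M p) with (B * M p * / width N) by ring.
    apply Rmult_le_compat_r; [left; apply Rinv_0_lt_compat, width_pos|apply HB].
Qed.

End Approximation.

Lemma continuous_Rminus (f g : R -> R) t : continuous f t -> continuous g t ->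
  continuous (fun s => f s - g s) t.
Proof. exact (continuous_minus (V := R_NormedModule) f g t). Qed.

Lemma Dav_ext mu chi1 chi2 x : (forall t, chi1 t = chi2 t) -> Dav mu chi1 x = Dav mu chi2 x.
Proof. intros H; unfold Dav; rewrite !H, (avg_ext mu chi1 chi2 x H); reflexivity. Qed.

Lemma Dav_minus mu chi1 chi2 x : 0 < mu ->
  (forall t, continuous chi1 t) -> (forall t, continuous chi2 t) ->
  Dav mu (fun t => chi1 t - chi2 t) x = Dav mu chi1 x - Dav mu chi2 x.
Proof. intros m0 H1 H2; unfold Dav; rewrite avg_minus by assumption; field; lra. Qed.

Lemma prodA_ext n : forall mu nu chi1 chi2 x, (forall j, (j < n)%nat -> mu j = nu j) ->
  (forall t, chi1 t = chi2 t) -> prodA mu n chi1 x = prodA nu n chi2 x.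
Proof.
induction n as [|n IH]; intros mu nu chi1 chi2 x Hm H; simpl; [apply H|].
rewrite (Hm 0%nat) by lia; apply avg_ext; intros t; apply IH; [|exact H].
intros j Hj; apply Hm; lia.
Qed.

Lemma prodD_ext n : forall mu nu chi1 chi2 x, (forall j, (j < n)%nat -> mu j = nu j) ->
  (forall t, chi1 t = chi2 t) -> prodD mu n chi1 x = prodD nu n chi2 x.
Proof.
induction n as [|n IH]; intros mu nu chi1 chi2 x Hm H; simpl; [apply H|].
rewrite (Hm 0%nat) by lia; apply Dav_ext; intros t; apply IH; [|exact H].
intros j Hj; apply Hm; lia.
Qed.

Lemma prodA_minus n chi1 chi2 : (forall t, continuous chi1 t) -> (forall t, continuous chi2 t) ->
  forall mu x, (forall j, 0 < mu j) ->
  prodA mu n (fun t => chi1 t - chi2 t) x = prodA mu n chi1 x - prodA mu n chi2 x.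
Proof.
intros H1 H2; induction n as [|n IH]; intros mu x Hm; simpl; [reflexivity|].
assert (Hm' : forall j, 0 < shift 1 mu j) by (intros j; apply Hm).
rewrite (avg_ext _ _ (fun t => prodA (shift 1 mu) n chi1 t - prodA (shift 1 mu) n chi2 t))
  by (intros t; apply IH, Hm').
apply avg_minus; apply prodA_continuous; assumption.
Qed.

Lemma prodD_minus n chi1 chi2 : (forall t, continuous chi1 t) -> (forall t, continuous chi2 t) ->
  forall mu x, (forall j, 0 < mu j) ->
  prodD mu n (fun t => chi1 t - chi2 t) x = prodD mu n chi1 x - prodD mu n chi2 x.
Proof.
intros H1 H2; induction n as [|n IH]; intros mu x Hm; simpl; [reflexivity|].
assert (Hm' : forall j, 0 < shift 1 mu j) by (intros j; apply Hm).
rewrite (Dav_ext _ _ (fun t => prodD (shift 1 mu) n chi1 t - prodD (shift 1 mu) n chi2 t))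
  by (intros t; apply IH, Hm').
apply Dav_minus; [apply Hm|apply prodD_continuous; assumption..].
Qed.

Lemma is_derive_prodA n chi dchi : (forall t, is_derive chi t (dchi t)) ->
  (forall t, continuous dchi t) -> forall mu x, (forall j, 0 < mu j) ->
  is_derive (prodA mu n chi) x (prodA mu n dchi x).
Proof.
intros H c; induction n as [|n IH]; intros mu x Hm; simpl; [apply H|].
assert (Hm' : forall j, 0 < shift 1 mu j) by (intros j; apply Hm).
apply is_derive_avg_C1; [apply Hm|intros t; apply IH, Hm'|apply prodA_continuous; assumption].
Qed.

(** Equal masses make the primitive vanish beyond [s], and positivity of the densities bounds it by
    1. On a short interval it is thus small in L1, even if the two densities are not close to each
    other. *)
Lemma density_difference_primitive f1 f2 s : 0 <= s ->
  (forall t, continuous f1 t) -> (forall t, continuous f2 t) ->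
  (forall t, 0 <= f1 t) -> (forall t, 0 <= f2 t) -> suppR s f1 -> suppR s f2 ->
  RInt f1 (- s) s = 1 -> RInt f2 (- s) s = 1 ->
  exists X, (forall t, is_derive X t (f1 t - f2 t)) /\ suppR s X /\ forall t, Rabs (X t) <= 1.
Proof.
intros s0 c1 c2 p1 p2 S1 S2 I1 I2.
set (f := fun t => f1 t - f2 t).
assert (c : forall t, continuous f t) by (intros t; apply continuous_Rminus; [apply c1|apply c2]).
assert (Hf : suppR s f) by (intros t Ht; unfold f; rewrite S1, S2 by exact Ht; ring).
assert (dX : forall t, is_derive (RInt f (- s)) t (f t)).
{ intros y; apply is_derive_RInt with (a := - s); [|apply c].
  apply filter_forall; intros z; apply (RInt_correct (V := R_CompleteNormedModule)), ex_RInt_cont, c. }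
assert (dec : forall a b, RInt f a b = RInt f1 a b - RInt f2 a b).
{ intros a b; apply (RInt_minus (V := R_CompleteNormedModule)); apply ex_RInt_cont; assumption. }
assert (tot : RInt f (- s) s = 0) by (rewrite dec, I1, I2; exact (Rminus_diag 1)).
assert (Z : forall a b, a <= b -> (b <= - s \/ s <= a) -> RInt f a b = 0).
{ intros a b ab Hab; rewrite (RInt_ext _ (fun _ => 0)).
  - rewrite RInt_const; unfold scal; simpl; unfold mult; simpl; ring.
  - rewrite Rmin_left, Rmax_right by assumption; intros t Ht; apply Hf.
    unfold Rabs; destruct Rcase_abs; lra. }
assert (sX : suppR s (RInt f (- s))).
{ intros t Ht; destruct (Rle_lt_dec t 0) as [Hn|Hp].
  - rewrite Rabs_left1 in Ht by exact Hn.
    rewrite <- (opp_RInt_swap (V := R_CompleteNormedModule)) by (apply ex_RInt_cont, c).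
    rewrite Z by lra; unfold opp; simpl; ring.
  - rewrite Rabs_right in Ht by lra.
    rewrite <- (RInt_Chasles (V := R_CompleteNormedModule) f (- s) s t) by (apply ex_RInt_cont, c).
    rewrite tot, Z by lra; unfold plus; simpl; ring. }
exists (RInt f (- s)); split; [exact dX|split; [exact sX|]].
intros t; destruct (Rlt_le_dec s (Rabs t)) as [Ht|Ht]; [rewrite sX by exact Ht; rewrite Rabs_R0; lra|].
assert (Ht' : - s <= t <= s) by (revert Ht; unfold Rabs; destruct Rcase_abs; lra).
assert (bd : forall g, (forall t, continuous g t) -> (forall t, 0 <= g t) -> RInt g (- s) s = 1 ->
  0 <= RInt g (- s) t <= 1).
{ intros g cg pg Ig; split.
  - apply RInt_ge_0; [lra|apply ex_RInt_cont, cg|intros; apply pg].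
  - rewrite <- Ig, <- (RInt_Chasles (V := R_CompleteNormedModule) g (- s) t s) by (apply ex_RInt_cont, cg).
    assert (0 <= RInt g t s) by (apply RInt_ge_0; [lra|apply ex_RInt_cont, cg|intros; apply pg]).
    unfold plus; simpl; lra. }
rewrite dec; pose proof (bd f1 c1 p1 I1); pose proof (bd f2 c2 p2 I2).
apply Rabs_le; lra.
Qed.

Lemma l1_of_bound X s B : 0 <= s -> (forall t, continuous X t) -> suppR s X ->
  (forall t, Rabs (X t) <= B) -> l1 X (2 * s * B).
Proof.
intros s0 c S H r r0.
set (R0 := Rmax r s).
assert (r <= R0) by apply Rmax_l; assert (s <= R0) by apply Rmax_r.
eapply Rle_trans; [apply (RInt_abs_mono X r R0); [lra|exact c]|].
rewrite (RInt_supp (fun t => Rabs (X t)) s R0); [apply RInt_abs_le_const; assumption|lra|lra| |].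
- intros t; apply continuous_Rabs_comp, c.
- intros t Ht; rewrite S by exact Ht; apply Rabs_R0.
Qed.

(** * The approximants form a Cauchy sequence for the seminorm at scale [h] *)

Section Cauchy.

Context (M : nat -> R) (Mpos : forall p, 0 < M p) (M0 : M 0%nat = 1) (HM3' : condM3' M).
Context (h : R) (h0 : 0 < h).
Context (d : nat -> R) (Hd : summable_scales d) (dgeom : forall j, (/ 2) ^ j <= d j).
Context (dfast : forall K, exists N, forall j, (N <= j)%nat -> K * (M j / M (S j)) <= d j).

Local Notation lam := (lam M h).
Local Notation scales := (scales M h d).
Local Notation phiN := (phiN M h d).

Let slam : summable_scales lam := summable_lam M Mpos HM3' h h0.
Let smix : forall N, summable_scales (scales N) := summable_scales_mixed M Mpos HM3' h h0 d Hd.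

(** A common support radius of the tails from index [P], valid for all [N >= P]. *)
Definition radius (P : nat) : R := width P + Series (shift P lam) + Series (shift P d).

Lemma radius_lim : is_lim_seq radius 0.
Proof.
replace (Finite 0) with (Finite (0 + 0 + 0)) by (f_equal; ring).
apply is_lim_seq_plus'; [apply is_lim_seq_plus'|].
- apply (is_lim_seq_ext (fun n => / INR (S n))).
  + intros n; unfold width; rewrite S_INR; reflexivity.
  + apply (is_lim_seq_incr_1 (fun n => / INR n)).
    apply (is_lim_seq_inv INR p_infty); [apply is_lim_seq_INR|discriminate].
- apply Series_shift_lim, slam.
- apply Series_shift_lim, Hd.
Qed.

Lemma tail_supp N P : (P <= N)%nat -> 
  suppR (radius P) (Phi (base N) (shift P (scales N))) /\
  RInt (Phi (base N) (shift P (scales N))) (- radius P) (radius P) = 1.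
Proof.
intros HP.
assert (le : width N + Series (shift P (scales N)) <= radius P).
{ unfold radius; pose proof (Series_shift_mixed lam d N P slam Hd) as H1.
  assert (width N <= width P); [|unfold scales; lra].
  unfold width; apply Rinv_le_contravar; [pose proof (pos_INR P); lra|].
  apply le_INR in HP; lra. }
pose proof (summable_scales_shift _ P (smix N)) as Hs.
split.
- apply suppR_le with (1 := le), (Phi_supp _ _ _ _ (base_kernel N)), Hs.
- apply (Phi_mass _ _ _ _ (base_kernel N)); assumption.
Qed.

(** Both functions arise by the same [P] averages from tail densities, whose difference is the
    derivative of a function small in L1. That derivative is thrown onto the average of scale
    [lam p], untouched by the first [p] derivatives; hence [S p] factors in the price. *)
Lemma phiN_low_order N N' P p : (p < P)%nat -> (P <= N)%nat -> (P <= N')%nat ->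
  l1 (fun t => Derive_n (phiN N) p t - Derive_n (phiN N') p t) (prod4 lam (S p) * (2 * radius P)).
Proof.
intros Hp HN HN'.
(* The averages that remain after [p] derivatives and the one kept for the primitive. *)
set (m := (P - S p)%nat).
set (chi := fun K => Phi (base K) (shift P (scales K))).
assert (cchi : forall K, forall t, continuous (chi K) t).
{ intros K t; apply (Phi_continuous _ _ _ _ (base_kernel K)), summable_scales_shift, smix. }
assert (posl : forall q j, 0 < shift q lam j) by (intros q j; apply slam).
assert (E : forall K, (P <= K)%nat -> forall t, Derive_n (phiN K) p t =
  prodD lam p (avg (lam p) (prodA (shift (S p) lam) m (chi K))) t).
{ intros K HK t; unfold phiN; rewrite (Derive_n_Phi _ _ _ _ (base_kernel K)) by apply smix.
  apply prodD_ext.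
  - intros j Hj; apply mixed_lt; lia.
  - intros u; rewrite (Phi_prodA _ _ _ _ (base_kernel K) _ (S m)) by (apply summable_scales_shift, smix).
    simpl prodA.
    assert (E0 : shift p (scales K) 0%nat = lam p).
    { unfold shift, scales; rewrite Nat.add_0_r; apply mixed_lt; lia. }
    rewrite E0; apply avg_ext; intros v; apply prodA_ext.
    + intros j Hj; rewrite shift_shift; unfold shift, scales; rewrite mixed_lt by (unfold m in Hj; lia).
      f_equal; lia.
    + intros w; unfold chi; rewrite shift_shift.
      replace (p + S m)%nat with P by (unfold m; lia); reflexivity. }
destruct (tail_supp N P HN) as [S1 I1]; destruct (tail_supp N' P HN') as [S2 I2].
assert (rP : 0 <= radius P).
{ unfold radius; pose proof (width_pos P).
  pose proof (summable_scales_shift _ P slam) as [a1 a2]; pose proof (summable_scales_shift _ P Hd) as [b1 b2].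
  pose proof (Series_pos_lt _ a1 a2); pose proof (Series_pos_lt _ b1 b2); lra. }
destruct (density_difference_primitive (chi N) (chi N') (radius P)) as [X [dX [sX bX]]]; try assumption;
  try apply cchi.
{ intros t; apply (Phi_nonneg _ _ _ _ (base_kernel N)), summable_scales_shift, smix. }
{ intros t; apply (Phi_nonneg _ _ _ _ (base_kernel N')), summable_scales_shift, smix. }
assert (cX : forall t, continuous X t).
{ intros t; apply (@ex_derive_continuous R_AbsRing R_NormedModule); eexists; apply dX. }
set (xi := fun t => chi N t - chi N' t) in *.
assert (cxi : forall t, continuous xi t) by (intros t; apply continuous_Rminus; apply cchi).
set (Y := prodA (shift (S p) lam) m X).
assert (cY : forall t, continuous Y t) by (apply prodA_continuous; [exact cX|apply posl]).
assert (F : (fun t => Derive_n (phiN N) p t - Derive_n (phiN N') p t) = prodD lam p (Dav (lam p) Y)).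
{ extensionality t; rewrite !E by assumption.
  assert (ca : forall K t, continuous (prodA (shift (S p) lam) m (chi K)) t).
  { intros K; apply prodA_continuous; [apply cchi|apply posl]. }
  rewrite <- prodD_minus; [|intros u; apply continuous_avg; [apply slam|apply ca]..|apply slam].
  apply prodD_ext; [reflexivity|]; intros u.
  rewrite <- avg_minus by apply ca.
  rewrite <- (avg_deriv (lam p) Y (prodA (shift (S p) lam) m xi)).
  - apply avg_ext; intros v; symmetry; apply prodA_minus; [apply cchi..|apply posl].
  - apply slam.
  - intros v; apply is_derive_prodA; [exact dX|exact cxi|apply posl].
  - apply prodA_continuous; [exact cxi|apply posl]. }
assert (sums : forall q j, sum_n (shift q lam) j <= Series (shift q lam)).
{ intros q j; apply sum_n_le_Series; apply (summable_scales_shift lam q slam). }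
assert (pS : forall q, 0 < Series (shift q lam)).
{ intros q; apply Series_pos_lt; apply (summable_scales_shift lam q slam). }
assert (lY : l1 Y (2 * radius P)).
{ apply (l1_prodA X cX m (radius P)) with (Series (shift (S p) lam)); auto.
  rewrite <- (Rmult_1_r (2 * radius P)); apply l1_of_bound; assumption. }
assert (sY : suppR (radius P + Series (shift (S p) lam)) Y).
{ apply prodA_supp; auto. }
rewrite F, prod4_S_r, Rmult_assoc.
apply (l1_prodD _ (fun t => continuous_Dav (lam p) Y t (proj1 slam p) cY) p
  (radius P + Series (shift (S p) lam) + lam p)) with (Series lam).
- pose proof (pS (S p)); pose proof (proj1 slam p); lra.
- apply Dav_supp; [apply slam|exact cY|exact sY].
- apply l1_Dav with (radius P + Series (shift (S p) lam)); [apply slam| |exact cY|exact sY|exact lY].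
  pose proof (pS (S p)); lra.
- apply slam.
- exact (sums 0%nat).
Qed.

Lemma l1_minus f g A B : (forall t, continuous f t) -> (forall t, continuous g t) ->
  l1 f A -> l1 g B -> l1 (fun t => f t - g t) (A + B).
Proof.
intros cf cg HA HB r r0.
assert (ca : forall t, continuous (fun t => Rabs (f t)) t) by (intros; apply continuous_Rabs_comp, cf).
assert (cb : forall t, continuous (fun t => Rabs (g t)) t) by (intros; apply continuous_Rabs_comp, cg).
apply Rle_trans with (RInt (fun t => plus (Rabs (f t)) (Rabs (g t))) (- r) r).
- apply RInt_le; [lra| | |].
  + apply ex_RInt_cont; intros t; apply continuous_Rabs_comp, continuous_Rminus; auto.
  + apply (ex_RInt_plus (V := R_NormedModule)); apply ex_RInt_cont; assumption.
  + intros t _; unfold plus; simpl; eapply Rle_trans; [apply Rabs_triang|rewrite Rabs_Ropp; lra].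
- rewrite (RInt_plus (V := R_CompleteNormedModule)) by (apply ex_RInt_cont; assumption).
  apply Rplus_le_compat; auto.
Qed.

Lemma l1_phiN N p : l1 (Derive_n (phiN N) p) (prod4 (scales N) p).
Proof. apply (l1_Derive_n_Phi _ _ _ _ (base_kernel N)), smix. Qed.

(** Orders [p >= P0] are small by the factor [2^(-p)], uniformly in [N]. The finitely many lower
    orders are small because the radius of the tails tends to 0, while the constant [K] depends on
    [P0] and not on the index of the tail. *)
Lemma phiN_cauchy : forall eps, 0 < eps -> exists P, forall N N', (P <= N)%nat -> (P <= N')%nat ->
  forall p r, 0 <= r ->
  h ^ p * RInt (fun t => Rabs (Derive_n (phiN N) p t - Derive_n (phiN N') p t)) (- r) r <= eps * M p.
Proof.
intros eps e0.
destruct (geometric_small (/ 2) 2 eps) as [P0 HP0]; [lra|exact e0|].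
destruct (prod4_scales_uniform M Mpos M0 HM3' h h0 d dfast) as [N0 HN0].
destruct (eventually_bounded (fun p => if (p <? P0)%nat then h ^ p * prod4 lam (S p) / M p else 0) 0 P0)
  as [K HK].
{ intros p Hp; destruct (Nat.ltb_spec p P0); [lia|lra]. }
set (K' := Rabs K + 1).
assert (K0 : 0 < K') by (unfold K'; pose proof (Rabs_pos K); lra).
assert (e1 : 0 < eps / (2 * K')) by (apply Rdiv_lt_0_compat; lra).
pose proof radius_lim as rl; apply is_lim_seq_spec in rl.
destruct (rl (mkposreal _ e1)) as [P1 HP1]; simpl in HP1.
exists (Nat.max N0 (Nat.max P1 P0)); intros N N' HN HN' p r r0.
assert (hp : 0 < h ^ p) by (apply pow_lt, h0).
pose proof (Mpos p) as mp.
destruct (Nat.lt_ge_cases p P0) as [Hp|Hp].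
- pose proof (phiN_low_order N N' (Nat.max N0 (Nat.max P1 P0)) p ltac:(lia) HN HN' r r0) as H.
  specialize (HK p); simpl in HK; destruct (Nat.ltb_spec p P0); [|lia].
  specialize (HP1 (Nat.max N0 (Nat.max P1 P0)) ltac:(lia)).
  rewrite Rminus_0_r in HP1.
  set (rr := radius (Nat.max N0 (Nat.max P1 P0))) in *.
  apply Rle_div_l in HK; [|exact mp].
  eapply Rle_trans; [apply Rmult_le_compat_l; [lra|exact H]|].
  pose proof (Rle_abs rr) as R1; pose proof (Rle_abs K) as R2.
  replace (h ^ p * (prod4 lam (S p) * (2 * rr))) with (h ^ p * prod4 lam (S p) * (2 * rr)) by ring.
  assert (q0 : 0 <= h ^ p * prod4 lam (S p)).
  { apply Rmult_le_pos; [lra|left; apply prod4_pos, slam]. }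
  apply Rle_trans with (K' * M p * (2 * (eps / (2 * K')))).
  + apply Rmult_le_compat; [exact q0| | |lra].
    2:{ eapply Rle_trans; [exact HK|apply Rmult_le_compat_r; unfold K'; lra]. }
    assert (0 <= rr); [|lra].
    unfold rr, radius; set (Q := Nat.max N0 (Nat.max P1 P0)).
    pose proof (width_pos Q).
    pose proof (summable_scales_shift _ Q slam) as [a1 a2]; pose proof (summable_scales_shift _ Q Hd) as [b1 b2].
    pose proof (Series_pos_lt _ a1 a2); pose proof (Series_pos_lt _ b1 b2); lra.
  + apply Req_le; field; lra.
- assert (A : l1 (fun t => Derive_n (phiN N) p t - Derive_n (phiN N') p t)
     (prod4 (scales N) p + prod4 (scales N') p)).
  { apply l1_minus; try apply l1_phiN; intros t; apply smoothR_continuous;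
      apply (phiN_real_test M Mpos HM3' h h0 d Hd dfast). }
  eapply Rle_trans; [apply Rmult_le_compat_l; [lra|apply A, r0]|].
  pose proof (HN0 N ltac:(lia) p) as B1; pose proof (HN0 N' ltac:(lia) p) as B2.
  specialize (HP0 p Hp).
  apply Rle_trans with (2 * (/ 2) ^ p * M p); [lra|].
  apply Rmult_le_compat_r; lra.
Qed.

End Cauchy.

(** * Diagonal extraction *)

Definition increasing (sigma : nat -> nat) : Prop := forall n, (sigma n < sigma (S n))%nat.

Lemma increasing_lt sigma : increasing sigma -> forall m n, (m < n)%nat -> (sigma m < sigma n)%nat.
Proof. intros H m n Hmn; induction Hmn as [|n Hmn IH]; [apply H|specialize (H n); lia]. Qed.

(** The diagonal is a subsequence of each extraction only after finitely many terms; the second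
    hypothesis lets [P N] pass to such sequences. *)
Lemma diagonal_subsequence (P : nat -> (nat -> nat) -> Prop) :
  (forall N sigma, increasing sigma ->
     exists tau, increasing tau /\ P N (fun n => sigma (tau n))) ->
  (forall N sigma tau k, increasing tau -> P N sigma ->
     forall delta, (forall n, delta (n + k)%nat = sigma (tau n)) -> P N delta) ->
  exists delta, increasing delta /\ forall N, P N delta.
Proof.
intros Hex Htail.
assert (Ch : exists T : nat * (nat -> nat) -> nat -> nat, forall x, increasing (snd x) ->
  increasing (T x) /\ P (fst x) (fun n => snd x (T x n))).
{ apply (choice (fun (x : nat * (nat -> nat)) tau => increasing (snd x) ->
    increasing tau /\ P (fst x) (fun n => snd x (tau n)))).
  intros [N sigma]; simpl; destruct (classic (increasing sigma)) as [H|H].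
  - destruct (Hex N sigma H) as [tau Ht]; exists tau; auto.
  - exists (fun n => n); intros H'; contradiction. }
destruct Ch as [T HT].
(* [s N] composes the first [N] extractions. *)
set (s := fix s (N : nat) : nat -> nat :=
  match N with O => fun k => k | S n => fun k => s n (T (n, s n) k) end).
assert (is : forall N, increasing (s N)).
{ induction N as [|N IH]; [intros n; simpl; lia|].
  intros n; simpl; apply increasing_lt; [exact IH|].
  destruct (HT (N, s N) IH) as [H _]; apply H. }
set (t := fun N => T (N, s N)).
assert (it : forall N, increasing (t N)) by (intros N; apply (HT (N, s N) (is N))).
(* [r N m] composes only the [m] extractions that follow the first [N], so that [s (N + m)] factors
   through [s N]. *)
set (r := fun N => fix r (m : nat) : nat -> nat :=
  match m with O => fun k => k | S m => fun k => r m (t (N + m)%nat k) end).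
assert (ir : forall N m, increasing (r N m)).
{ intros N m; induction m as [|m IH]; [intros n; simpl; lia|].
  intros n; simpl; apply increasing_lt; [exact IH|apply it]. }
assert (sr : forall N m k, s (N + m)%nat k = s N (r N m k)).
{ intros N m; induction m as [|m IH]; intros k; [rewrite Nat.add_0_r; reflexivity|].
  rewrite Nat.add_succ_r; simpl; rewrite IH; reflexivity. }
assert (diag : forall N, increasing (fun k => r N k (N + k)%nat)).
{ intros N k; simpl; apply increasing_lt; [apply ir|].
  pose proof (strictly_increasing_ge (t (N + k)%nat) (it _) (N + S k)%nat); lia. }
exists (fun n => s n n); split.
- intros n; simpl; apply increasing_lt; [apply is|].
  pose proof (strictly_increasing_ge (t n) (it _) (S n)); unfold t in *; lia.
- intros N; apply (Htail N (s (S N)) (fun k => r (S N) k (S N + k)%nat) (S N)).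
  + apply diag.
  + destruct (HT (N, s N) (is N)) as [_ H]; exact H.
  + intros n; rewrite <- sr; f_equal; lia.
Qed.

(** * Uniform limits of almost automorphic functions *)

Section AutomorphicLimits.

Context {X : CompleteNormedModule C_AbsRing}.

Definition automorphic_along (a : nat -> R) (f g : R -> X) : Prop :=
  forall t, tends (fun n => f (t + a n)) (g t) /\ tends (fun n => g (t - a n)) (f t).

Lemma automorphic_along_subseq a sigma f g : increasing sigma ->
  automorphic_along a f g -> automorphic_along (fun n => a (sigma n)) f g.
Proof.
intros Hs H t; destruct (H t) as [H1 H2]; split.
- exact (tends_subseq _ _ sigma Hs H1).
- exact (tends_subseq _ _ sigma Hs H2).
Qed.

Lemma tends_tail (u : nat -> X) x k : tends (fun n => u (n + k)%nat) x -> tends u x.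
Proof.
rewrite !tends_norm; intros H eps e0; destruct (H eps e0) as [N HN].
exists (N + k)%nat; intros n Hn; specialize (HN (n - k)%nat ltac:(lia)).
replace (n - k + k)%nat with n in HN by lia; exact HN.
Qed.

Lemma tends_close (u : nat -> X) (x : X) :
  (forall eps, 0 < eps -> exists (v : nat -> X) (y : X), tends v y /\
     (forall n, norm (minus (u n) (v n)) <= eps) /\ norm (minus x y) <= eps) -> tends u x.
Proof.
intros H; apply tends_norm; intros eps e0.
destruct (H (eps / 4)) as [v [y [Hv [H1 H2]]]]; [lra|].
destruct (proj1 (tends_norm v y) Hv (eps / 4)) as [N HN]; [lra|].
exists N; intros n Hn; specialize (HN n Hn); specialize (H1 n).
pose proof (norm_minus_triangle (v n) (u n) x) as T1.
pose proof (norm_minus_triangle y (v n) x) as T2.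
rewrite (norm_minus_sym y x) in T2; lra.
Qed.

Lemma uniformly_cauchy_limit (F : nat -> R -> X) :
  (forall eps, 0 < eps -> exists N0, forall N N', (N0 <= N)%nat -> (N0 <= N')%nat ->
     forall x, norm (minus (F N x) (F N' x)) <= eps) ->
  exists f, forall eps, 0 < eps -> exists N0, forall N, (N0 <= N)%nat ->
     forall x, norm (minus (F N x) (f x)) <= eps.
Proof.
intros H.
assert (L : forall x, exists y, tends (fun N => F N x) y).
{ intros x; apply cauchy_tends; intros eps e0; destruct (H eps e0) as [N0 HN0].
  exists N0; intros n Hn; exists N0; intros m Hm; apply HN0; assumption. }
destruct (choice _ L) as [f Hf]; exists f; intros eps e0.
destruct (H eps e0) as [N0 HN0]; exists N0; intros N HN x.
rewrite norm_minus_sym; apply (tends_minus_norm_le _ _ _ _ N0 (Hf x)).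
intros n Hn; apply HN0; assumption.
Qed.

(** One diagonal subsequence serves all [F N]. The limit functions [G N] are uniformly Cauchy
    because norm bounds pass to pointwise limits; both required limits then follow by a three-term
    estimate. *)
Lemma AA_uniform_limit (F : nat -> R -> X) (f : R -> X) :
  (forall N, almost_automorphic (F N)) ->
  (forall eps, 0 < eps -> exists N0, forall N, (N0 <= N)%nat ->
     forall x, norm (minus (F N x) (f x)) <= eps) ->
  almost_automorphic f.
Proof.
intros HF Hlim; split.
- intros t; apply continuous_norm; intros eps e0.
  destruct (Hlim (eps / 4)) as [N HN]; [lra|]; specialize (HN N (Nat.le_refl N)).
  destruct (proj1 (continuous_norm (F N) t) (proj1 (HF N) t) (eps / 4)) as [d [d0 Hd]]; [lra|].
  exists d; split; [exact d0|]; intros s Hs; specialize (Hd s Hs).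
  pose proof (HN s) as H1; pose proof (HN t) as H2.
  rewrite norm_minus_sym in H1.
  pose proof (norm_minus_triangle (F N s) (f s) (f t)) as T1.
  pose proof (norm_minus_triangle (F N t) (F N s) (f t)) as T2; lra.
- intros b.
  destruct (diagonal_subsequence (fun N sigma => exists g, automorphic_along (fun n => b (sigma n)) (F N) g))
    as [delta [Hdelta HP]].
  + intros N sigma Hs; destruct (HF N) as [_ H].
    destruct (H (fun n => b (sigma n))) as [a [[tau [Ht Ha]] [g Hg]]].
    exists tau; split; [exact Ht|exists g].
    replace (fun n => b (sigma (tau n))) with a by (extensionality n; apply Ha); exact Hg.
  + intros N sigma tau k Ht [g Hg] delta Hdelta; exists g; intros t.
    destruct (automorphic_along_subseq _ tau _ _ Ht Hg t) as [H1 H2]; split.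
    * apply (tends_tail _ _ k); revert H1; apply filterlim_ext; intros n; rewrite Hdelta; reflexivity.
    * apply (tends_tail _ _ k); revert H2; apply filterlim_ext; intros n; rewrite Hdelta; reflexivity.
  + destruct (choice _ HP) as [G HG].
    exists (fun n => b (delta n)); split; [exists delta; split; [exact Hdelta|reflexivity]|].
    assert (GC : forall eps, 0 < eps -> exists N0, forall N N', (N0 <= N)%nat -> (N0 <= N')%nat ->
      forall x, norm (minus (G N x) (G N' x)) <= eps).
    { intros eps e0; destruct (Hlim (eps / 2)) as [N0 HN0]; [lra|]; exists N0; intros N N' HN HN' x.
      apply (tends_norm_le (fun n => minus (F N (x + b (delta n))) (F N' (x + b (delta n)))) _ _ 0%nat).
      - apply tends_minus; [apply (HG N x)|apply (HG N' x)].
      - intros n _; pose proof (HN0 N HN (x + b (delta n))) as H1.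
        pose proof (HN0 N' HN' (x + b (delta n))) as H2; rewrite norm_minus_sym in H2.
        pose proof (norm_minus_triangle (f (x + b (delta n))) (F N (x + b (delta n))) (F N' (x + b (delta n)))); lra. }
    destruct (uniformly_cauchy_limit G GC) as [g Hg]; exists g; intros t; split.
    * apply tends_close; intros eps e0.
      destruct (Hlim eps e0) as [N1 HN1]; destruct (Hg eps e0) as [N2 HN2].
      exists (fun n => F (Nat.max N1 N2) (t + b (delta n))), (G (Nat.max N1 N2) t).
      split; [apply HG|split].
      -- intros n; rewrite norm_minus_sym; apply HN1; lia.
      -- rewrite norm_minus_sym; apply HN2; lia.
    * apply tends_close; intros eps e0.
      destruct (Hlim eps e0) as [N1 HN1]; destruct (Hg eps e0) as [N2 HN2].
      exists (fun n => G (Nat.max N1 N2) (t - b (delta n))), (F (Nat.max N1 N2) t).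
      split; [apply HG|split].
      -- intros n; rewrite norm_minus_sym; apply HN2; lia.
      -- rewrite norm_minus_sym; apply HN1; lia.
Qed.

(** * Inverting [F - rho F(. - lam)] on bounded functions *)

Definition rs (r : R) (x : X) : X := scal (RtoC r : C_AbsRing) x.

Lemma norm_rs r x : 0 <= r -> norm (rs r x) <= r * norm x.
Proof.
intros r0; eapply Rle_trans; [apply scal_RtoC_norm|rewrite Rabs_pos_eq by exact r0; apply Rle_refl].
Qed.

Lemma rs_minus r x y : rs r (minus x y) = minus (rs r x) (rs r y).
Proof. exact (scal_minus_distr_l (RtoC r : C_AbsRing) x y). Qed.

Lemma rs_plus r x y : rs r (plus x y) = plus (rs r x) (rs r y).
Proof. exact (scal_distr_l (RtoC r : C_AbsRing) x y). Qed.

Lemma rs_rs r s x : rs r (rs s x) = rs (r * s) x.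
Proof. exact (rscal_assoc X r s x). Qed.

Lemma rs_add r s x : rs (r + s) x = plus (rs r x) (rs s x).
Proof. exact (rscal_distr_r X r s x). Qed.

Lemma rs_1 x : rs 1 x = x.
Proof. exact (scal_C1 x). Qed.

(** [G x = mix (F x) (G (x - lam))] is the equation [kap * (G - rho G (. - lam)) = F], rewritten as
    a fixed point problem. *)
Definition mix (x y : X) : X := plus (rs (1 - rho) x) (rs rho y).

Lemma mix_minus x y x' y' : minus (mix x y) (mix x' y') = mix (minus x x') (minus y y').
Proof. unfold mix; rewrite !rs_minus.
exact (minus_plus_plus (rs (1 - rho) x) (rs rho y) (rs (1 - rho) x') (rs rho y')). Qed.

Lemma norm_mix x y : norm (mix x y) <= (1 - rho) * norm x + rho * norm y.
Proof.
pose proof rho_bounds; unfold mix; eapply Rle_trans; [apply norm_plus_le|].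
apply Rplus_le_compat; apply norm_rs; lra.
Qed.

Lemma norm_mix_same x y y' : norm (minus (mix x y) (mix x y')) <= rho * norm (minus y y').
Proof.
rewrite mix_minus; eapply Rle_trans; [apply norm_mix|].
rewrite norm_minus_self, Rmult_0_r, Rplus_0_l; apply Rle_refl.
Qed.

Lemma mix_same x : mix x x = x.
Proof. unfold mix; rewrite <- rs_add; replace (1 - rho + rho) with 1 by ring; apply rs_1. Qed.

Lemma tends_mix u v x y : tends u x -> tends v y -> tends (fun n => mix (u n) (v n)) (mix x y).
Proof.
pose proof rho_bounds as r0.
intros Hu Hv; apply tends_norm; intros eps e0.
destruct (proj1 (tends_norm u x) Hu eps e0) as [N1 H1].
destruct (proj1 (tends_norm v y) Hv eps e0) as [N2 H2].
exists (Nat.max N1 N2); intros n Hn; rewrite mix_minus.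
specialize (H1 n ltac:(lia)); specialize (H2 n ltac:(lia)).
eapply Rle_lt_trans; [apply norm_mix|nra].
Qed.

(** Partial sums of the Neumann series: [(1 - rho)] times the sum of [rho^i F (x - i lam)] over
    [i < k]. *)
Fixpoint Git (lam : R) (F : R -> X) (k : nat) (x : R) : X :=
  match k with
  | O => zero
  | S k => mix (F x) (Git lam F k (x - lam))
  end.

Lemma Git_bound lam F B k : (forall x, norm (F x) <= B) -> forall x, norm (Git lam F k x) <= B.
Proof.
pose proof rho_bounds as r0.
intros HB; assert (B0 : 0 <= B) by exact (Rle_trans _ _ _ (norm_ge_0 (F 0)) (HB 0)).
induction k as [|k IH]; intros x; simpl; [exact (Rle_trans _ _ _ (Req_le _ _ norm_zero) B0)|].
eapply Rle_trans; [apply norm_mix|]; specialize (HB x); specialize (IH (x - lam)); nra.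
Qed.

Lemma Git_cauchy lam F B k : (forall x, norm (F x) <= B) -> forall m x,
  norm (minus (Git lam F (k + m) x) (Git lam F k x)) <= B * rho ^ k.
Proof.
pose proof rho_bounds as r0.
intros HB m; induction k as [|k IH]; intros x.
- simpl; rewrite Rmult_1_r.
  exact (Rle_trans _ _ _ (Req_le _ _ (f_equal (@norm C_AbsRing X) (minus_zero_r (Git lam F m x))))
    (Git_bound lam F B m HB x)).
- change (norm (minus (mix (F x) (Git lam F (k + m) (x - lam))) (mix (F x) (Git lam F k (x - lam))))
    <= B * (rho * rho ^ k)).
  eapply Rle_trans; [apply norm_mix_same|].
  replace (B * (rho * rho ^ k)) with (rho * (B * rho ^ k)) by ring.
  apply Rmult_le_compat_l; [lra|apply IH].
Qed.

Definition Cop (lam : R) (F : R -> X) (x : R) : X :=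
  epsilon (inhabits (zero : X)) (fun y => tends (fun k => Git lam F k x) y).

Definition boundedX (F : R -> X) : Prop := exists B, forall x, norm (F x) <= B.

Lemma Cop_tends lam F x : boundedX F -> tends (fun k => Git lam F k x) (Cop lam F x).
Proof.
pose proof rho_bounds as r0.
intros [B HB]; unfold Cop; apply epsilon_spec, cauchy_tends; intros eps e0.
destruct (geometric_small rho B eps) as [N HN]; [lra|exact e0|].
exists N; intros n Hn; exists n; intros m Hm; rewrite norm_minus_sym.
replace m with (n + (m - n))%nat by lia.
eapply Rle_trans; [apply (Git_cauchy lam F B n HB)|apply HN, Hn].
Qed.

Lemma Cop_bound lam F B : (forall x, norm (F x) <= B) -> forall x, norm (Cop lam F x) <= B.
Proof.
intros HB x; apply (tends_norm_le _ _ _ 0%nat (Cop_tends lam F x (ex_intro _ B HB))).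
intros n _; apply Git_bound, HB.
Qed.

Lemma Cop_bounded lam F : boundedX F -> boundedX (Cop lam F).
Proof. intros [B HB]; exists B; apply Cop_bound, HB. Qed.

Lemma Cop_eq lam F x : boundedX F -> Cop lam F x = mix (F x) (Cop lam F (x - lam)).
Proof.
intros HF; apply (tends_unique (fun k => Git lam F (S k) x)).
- exact (tends_subseq _ _ S (fun n => Nat.lt_succ_diag_r (S n)) (Cop_tends lam F x HF)).
- apply (tends_mix (fun _ => F x)); [apply filterlim_const|apply Cop_tends, HF].
Qed.

(** Iteration improves the a priori bound [W] to [b + (W - b) * rho^k]. Uniqueness, stability and
    nearness for [Cop] are drawn from the functional equation in this way. *)
Lemma contraction_principle (w : R -> R) lam W b :
  (forall x, w x <= W) -> (forall x, w x <= (1 - rho) * b + rho * w (x - lam)) -> forall x, w x <= b.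
Proof.
pose proof rho_bounds as r0; intros HW H.
assert (I : forall k x, w x <= b + (W - b) * rho ^ k).
{ induction k as [|k IH]; intros x; simpl; [specialize (HW x); lra|].
  eapply Rle_trans; [apply H|]; specialize (IH (x - lam)); nra. }
intros x; apply le_epsilon; intros eps e0.
destruct (geometric_small rho (W - b) eps) as [N HN]; [lra|exact e0|].
specialize (HN N (Nat.le_refl N)); specialize (I N x); lra.
Qed.

Lemma boundedX_minus F G : boundedX F -> boundedX G -> exists W, forall x, norm (minus (F x) (G x)) <= W.
Proof.
intros [A HA] [B HB]; exists (A + B); intros x.
eapply Rle_trans; [apply norm_minus_le|apply Rplus_le_compat; auto].
Qed.

Lemma norm_minus_zero_eq (x y : X) : norm (minus x y) <= 0 -> x = y.
Proof.
intros H.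
pose proof (norm_eq_zero (V := X) (minus x y) (Rle_antisym _ _ H (norm_ge_0 (minus x y)))) as E.
apply (plus_reg_r (opp y)).
exact (eq_trans E (eq_sym (plus_opp_r y))).
Qed.

Lemma Cop_dist lam F G b : boundedX F -> boundedX G ->
  (forall x, norm (minus (F x) (G x)) <= b) -> forall x, norm (minus (Cop lam F x) (Cop lam G x)) <= b.
Proof.
pose proof rho_bounds as r0; intros HF HG H.
destruct (boundedX_minus _ _ (Cop_bounded lam F HF) (Cop_bounded lam G HG)) as [W HW].
apply (contraction_principle _ lam W b HW); intros x.
rewrite (Cop_eq lam F x HF), (Cop_eq lam G x HG), mix_minus.
eapply Rle_trans; [apply norm_mix|]; specialize (H x); nra.
Qed.

Lemma Cop_unique lam F G : boundedX F -> boundedX G ->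
  (forall x, G x = mix (F x) (G (x - lam))) -> forall x, Cop lam F x = G x.
Proof.
pose proof rho_bounds as r0; intros HF HG H x; apply norm_minus_zero_eq; revert x.
destruct (boundedX_minus _ _ (Cop_bounded lam F HF) HG) as [W HW].
apply (contraction_principle _ lam W 0 HW); intros x.
rewrite (Cop_eq lam F x HF), (H x).
eapply Rle_trans; [apply norm_mix_same|apply Req_le; ring].
Qed.

Lemma Cop_shift lam F c x : boundedX F -> Cop lam (fun t => F (t + c)) x = Cop lam F (x + c).
Proof.
intros HF; apply (Cop_unique lam (fun t => F (t + c)) (fun t => Cop lam F (t + c))).
- destruct HF as [B HB]; exists B; intros t; apply HB.
- destruct (Cop_bounded lam F HF) as [B HB]; exists B; intros t; apply HB.
- intros t; rewrite Cop_eq by exact HF; do 2 f_equal; ring.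
Qed.

Definition lipschitzX (L : R) (F : R -> X) : Prop :=
  forall x y, norm (minus (F x) (F y)) <= L * Rabs (x - y).

Lemma Cop_lipschitz lam F L : boundedX F -> lipschitzX L F -> lipschitzX L (Cop lam F).
Proof.
intros HF HL x y; replace y with (x + (y - x)) at 1 by ring.
rewrite <- Cop_shift by exact HF.
apply Cop_dist; [exact HF| |].
- destruct HF as [B HB]; exists B; intros t; apply HB.
- intros t; eapply Rle_trans; [apply HL|]; apply Req_le; do 2 f_equal; ring.
Qed.

(** The error [w] satisfies [w x <= rho * (w (x - lam) + L * lam)]; since [rho <= 1 - rho], the
    contraction principle applies with [b = L * lam]. *)
Lemma Cop_near lam F L : 0 < lam -> 0 <= L -> boundedX F -> lipschitzX L F ->
  forall x, norm (minus (Cop lam F x) (F x)) <= L * lam.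
Proof.
pose proof rho_bounds as r0; intros l0 L0 HF HL.
destruct (boundedX_minus _ _ (Cop_bounded lam F HF) HF) as [W HW].
apply (contraction_principle _ lam W (L * lam) HW); intros x.
rewrite (Cop_eq lam F x HF).
assert (E : norm (minus (mix (F x) (Cop lam F (x - lam))) (F x)) <=
  rho * norm (minus (Cop lam F (x - lam)) (F x))).
{ rewrite <- (mix_same (F x)) at 2; apply norm_mix_same. }
eapply Rle_trans; [exact E|].
pose proof (norm_minus_triangle (F (x - lam)) (Cop lam F (x - lam)) (F x)) as T.
pose proof (HL (x - lam) x) as T2.
replace (x - lam - x) with (- lam) in T2 by ring; rewrite Rabs_Ropp, Rabs_pos_eq in T2 by lra.
assert (rho * (L * lam) <= (1 - rho) * (L * lam)) by (apply Rmult_le_compat_r; nra).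
nra.
Qed.

Lemma lipschitzX_continuous L F : lipschitzX L F -> forall t, continuous F t.
Proof.
intros HL t; apply continuous_norm; intros eps e0.
assert (L1 : 0 < Rabs L + 1) by (pose proof (Rabs_pos L); lra).
exists (eps / (Rabs L + 1)); split; [apply Rdiv_lt_0_compat; assumption|].
intros s Hs; apply Rlt_div_r in Hs; [|exact L1].
eapply Rle_lt_trans; [apply HL|].
pose proof (Rle_abs L); pose proof (Rabs_pos (s - t)); nra.
Qed.

(** After [k] steps of the functional equation the remainder is at most [2 * B * rho^k], whatever
    [n]; so bounded pointwise convergence is preserved, and [G] may be discontinuous. *)
Lemma Cop_pointwise lam (F : nat -> R -> X) (G : R -> X) B :
  (forall n x, norm (F n x) <= B) -> (forall x, tends (fun n => F n x) (G x)) ->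
  forall x, tends (fun n => Cop lam (F n) x) (Cop lam G x).
Proof.
pose proof rho_bounds as r0; intros HB HG.
assert (HGB : forall x, norm (G x) <= B).
{ intros x; apply (tends_norm_le _ _ _ 0%nat (HG x)); intros n _; apply HB. }
assert (bF : forall n, boundedX (F n)) by (intros n; exists B; apply HB).
assert (bG : boundedX G) by (exists B; exact HGB).
assert (I : forall k x eps, 0 < eps -> exists N, forall n, (N <= n)%nat ->
  norm (minus (Cop lam (F n) x) (Cop lam G x)) <= eps + 2 * B * rho ^ k).
{ induction k as [|k IH]; intros x eps e0.
  - exists 0%nat; intros n _; simpl; eapply Rle_trans; [apply norm_minus_le|].
    pose proof (Cop_bound lam (F n) B (HB n) x); pose proof (Cop_bound lam G B HGB x); lra.
  - destruct (IH (x - lam) eps e0) as [N1 H1].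
    destruct (proj1 (tends_norm _ _) (HG x) eps e0) as [N2 H2].
    exists (Nat.max N1 N2); intros n Hn.
    rewrite (Cop_eq lam (F n) x (bF n)), (Cop_eq lam G x bG), mix_minus.
    eapply Rle_trans; [apply norm_mix|].
    specialize (H1 n ltac:(lia)); specialize (H2 n ltac:(lia)); simpl; nra. }
intros x; apply tends_norm; intros eps e0.
destruct (geometric_small rho (2 * B) (eps / 4)) as [k Hk]; [lra|lra|].
destruct (I k x (eps / 4)) as [N HN]; [lra|]; exists N; intros n Hn.
specialize (HN n Hn); specialize (Hk k (Nat.le_refl k)); lra.
Qed.

(** Inversion commutes with translations and with bounded pointwise limits: the subsequence chosen
    for [F] works, with limit function [Cop lam g]. *)
Lemma Cop_automorphic lam F L : lipschitzX L F -> almost_automorphic F ->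
  almost_automorphic (Cop lam F).
Proof.
intros HL HF; destruct (AA_bounded F HF) as [B HB].
assert (bF : boundedX F) by (exists B; exact HB).
split; [apply lipschitzX_continuous with L, Cop_lipschitz; assumption|].
intros b; destruct HF as [_ HF]; destruct (HF b) as [a [Hab [g Hg]]].
exists a; split; [exact Hab|exists (Cop lam g)]; intros t.
assert (HgB : forall x, norm (g x) <= B).
{ intros x; apply (tends_norm_le _ _ _ 0%nat (proj1 (Hg x))); intros n _; apply HB. }
assert (bg : boundedX g) by (exists B; exact HgB).
split.
- apply (filterlim_ext (fun n => Cop lam (fun x => F (x + a n)) t)).
  { intros n; apply Cop_shift, bF. }
  apply (Cop_pointwise lam (fun n x => F (x + a n)) g B); [intros n x; apply HB|intros x; apply Hg].
- apply (filterlim_ext (fun n => Cop lam (fun x => g (x + - a n)) t)).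
  { intros n; apply (Cop_shift lam g (- a n)), bg. }
  apply (Cop_pointwise lam (fun n x => g (x + - a n)) F B); [intros n x; apply HgB|intros x; apply Hg].
Qed.

Fixpoint Cprod (lam : nat -> R) (n : nat) (F : R -> X) : R -> X :=
  match n with O => F | S n => Cop (lam n) (Cprod lam n F) end.

Lemma Cprod_bound lam n F B : (forall x, norm (F x) <= B) -> forall x, norm (Cprod lam n F x) <= B.
Proof. intros HB; induction n as [|n IH]; simpl; [exact HB|apply Cop_bound, IH]. Qed.

Lemma Cprod_lipschitz lam n F L : boundedX F -> lipschitzX L F -> lipschitzX L (Cprod lam n F).
Proof.
intros [B HB] HL; induction n as [|n IH]; simpl; [exact HL|].
apply Cop_lipschitz; [exists B; apply Cprod_bound, HB|exact IH].
Qed.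

Lemma Cprod_dist lam n F G b : boundedX F -> boundedX G -> (forall x, norm (minus (F x) (G x)) <= b) ->
  forall x, norm (minus (Cprod lam n F x) (Cprod lam n G x)) <= b.
Proof.
intros [A HA] [B HB] H; induction n as [|n IH]; simpl; [exact H|].
apply Cop_dist; [exists A; apply Cprod_bound, HA|exists B; apply Cprod_bound, HB|exact IH].
Qed.

Lemma Cprod_automorphic lam n F L : lipschitzX L F -> almost_automorphic F ->
  almost_automorphic (Cprod lam n F).
Proof.
intros HL HF; pose proof (AA_bounded F HF) as bF.
induction n as [|n IH]; simpl; [exact HF|].
apply Cop_automorphic with L; [apply Cprod_lipschitz; assumption|exact IH].
Qed.

(** Each further inversion keeps the Lipschitz constant [L] and moves the function by at most [L]
    times its scale; the displacements are summed. *)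
Lemma Cprod_near lam F L : summable_scales lam -> 0 <= L -> boundedX F -> lipschitzX L F ->
  forall n m x, norm (minus (Cprod lam (n + m) F x) (Cprod lam n F x)) <= L * Series (shift n lam).
Proof.
intros Hl L0 bF HL n m.
assert (I : forall x, norm (minus (Cprod lam (n + m) F x) (Cprod lam n F x)) <=
  L * (Series (shift n lam) - Series (shift (n + m) lam))).
{ induction m as [|m IH]; intros x.
  - rewrite Nat.add_0_r, Rminus_diag, Rmult_0_r; apply Req_le.
    apply norm_minus_self.
  - rewrite Nat.add_succ_r; simpl.
    eapply Rle_trans; [apply (norm_minus_triangle (Cprod lam (n + m) F x))|].
    rewrite (Series_shift_S lam (n + m)) in IH by apply Hl.
    assert (H : norm (minus (Cop (lam (n + m)%nat) (Cprod lam (n + m) F) x) (Cprod lam (n + m) F x)) <=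
      L * lam (n + m)%nat).
    { apply Cop_near; [apply Hl|exact L0| |apply Cprod_lipschitz; assumption].
      destruct bF as [B HB]; exists B; apply Cprod_bound, HB. }
    specialize (IH x); lra. }
intros x; eapply Rle_trans; [apply I|]; apply Rmult_le_compat_l; [exact L0|].
pose proof (summable_scales_shift lam (n + m) Hl) as [a1 a2].
pose proof (Series_pos_lt _ a1 a2); lra.
Qed.

(** The Lipschitz constants of the [F N] may grow with [N]. So an index [P] is fixed first and [F N]
    is exchanged for [F P], which the inversions do not amplify; only then is the tail of the
    inversions estimated with the constant of [F P]. *)
Lemma Cprod_limit lam (F : nat -> R -> X) : summable_scales lam ->
  (forall N, almost_automorphic (F N)) -> (forall N, exists L, 0 <= L /\ lipschitzX L (F N)) ->
  (forall eps, 0 < eps -> exists N0, forall N N', (N0 <= N)%nat -> (N0 <= N')%nat ->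
     forall x, norm (minus (F N x) (F N' x)) <= eps) ->
  exists f, almost_automorphic f /\
    forall eps, 0 < eps -> exists N0, forall N, (N0 <= N)%nat ->
      forall x, norm (minus (Cprod lam N (F N) x) (f x)) <= eps.
Proof.
intros Hl HF HL HC.
assert (bF : forall N, boundedX (F N)) by (intros N; apply AA_bounded, HF).
destruct (uniformly_cauchy_limit (fun N => Cprod lam N (F N))) as [f Hf].
{ intros eps e0; destruct (HC (eps / 4)) as [P HP]; [lra|].
  destruct (HL P) as [L [L0 HLP]].
  pose proof (Series_shift_lim lam (proj2 Hl)) as sl.
  apply (is_lim_seq_scal_l _ L) in sl; simpl in sl; rewrite Rmult_0_r in sl.
  apply is_lim_seq_spec in sl.
  assert (e4 : 0 < eps / 4) by lra.
  destruct (sl (mkposreal _ e4)) as [Q HQ]; simpl in HQ.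
  set (n0 := Nat.max P Q).
  assert (K : forall N, (n0 <= N)%nat -> forall x,
    norm (minus (Cprod lam N (F N) x) (Cprod lam n0 (F P) x)) <= eps / 2).
  { intros N HN x.
    eapply Rle_trans; [apply (norm_minus_triangle (Cprod lam N (F P) x))|].
    assert (H1 : norm (minus (Cprod lam N (F N) x) (Cprod lam N (F P) x)) <= eps / 4).
    { apply Cprod_dist; auto; intros y; apply HP; unfold n0 in HN; lia. }
    assert (H2 : norm (minus (Cprod lam N (F P) x) (Cprod lam n0 (F P) x)) <= eps / 4).
    { replace N with (n0 + (N - n0))%nat by lia.
      eapply Rle_trans; [apply Cprod_near with (L := L); auto|].
      specialize (HQ n0 ltac:(unfold n0; lia)); rewrite Rminus_0_r in HQ.
      pose proof (Rle_abs (L * Series (shift n0 lam))); lra. }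
    lra. }
  exists n0; intros N N' HN HN' x.
  pose proof (K N HN x) as K1; pose proof (K N' HN' x) as K2.
  eapply Rle_trans; [apply (norm_minus_triangle (Cprod lam n0 (F P) x))|].
  rewrite (norm_minus_sym (Cprod lam n0 (F P) x)); lra. }
exists f; split; [|exact Hf].
apply (AA_uniform_limit (fun N => Cprod lam N (F N))); [|exact Hf].
intros N; destruct (HL N) as [L [_ HLN]]; apply Cprod_automorphic with L; auto.
Qed.

End AutomorphicLimits.

(** * The ultradifferential operator [Prod_j (1 + lam j d/dx)] *)

(** Elementary symmetric polynomials of [lam 0, ..., lam (n - 1)]: the coefficients of the
    polynomial whose value at [r] is [prod1 lam r n]. *)
Fixpoint esym (lam : nat -> R) (n p : nat) : R :=
  match n with
  | O => match p with O => 1 | S _ => 0 end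
  | S n => esym lam n p + lam n * match p with O => 0 | S q => esym lam n q end
  end.

Fixpoint prod1 (lam : nat -> R) (r : R) (n : nat) : R :=
  match n with O => 1 | S n => prod1 lam r n * (1 + lam n * r) end.

Lemma exp_le x y : x <= y -> exp x <= exp y.
Proof. intros [H|H]; [left; apply exp_increasing, H|rewrite H; apply Rle_refl]. Qed.

Section Coefficients.

Context (lam : nat -> R) (lpos : forall j, 0 < lam j).

Lemma esym_nonneg n : forall p, 0 <= esym lam n p.
Proof.
induction n as [|n IH]; intros p; simpl; [destruct p; lra|].
pose proof (IH p); pose proof (lpos n); destruct p as [|p]; [lra|].
pose proof (Rmult_le_pos _ _ (Rlt_le _ _ H0) (IH p)); lra.
Qed.

Lemma esym_incr n p : esym lam n p <= esym lam (S n) p.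
Proof.
simpl; pose proof (lpos n); destruct p as [|p]; [lra|].
pose proof (Rmult_le_pos _ _ (Rlt_le _ _ H) (esym_nonneg n p)); lra.
Qed.

Lemma esym_mono n m p : (n <= m)%nat -> esym lam n p <= esym lam m p.
Proof.
intros H; induction H as [|m H IH]; [apply Rle_refl|].
eapply Rle_trans; [exact IH|apply esym_incr].
Qed.

Lemma esym_gt n : forall p, (n < p)%nat -> esym lam n p = 0.
Proof.
induction n as [|n IH]; intros p Hp; simpl; [destruct p; [lia|reflexivity]|].
rewrite IH by lia; destruct p as [|p]; [lia|]; rewrite IH by lia; ring.
Qed.

Lemma prod1_pos r n : 0 <= r -> 0 < prod1 lam r n.
Proof.
intros r0; induction n as [|n IH]; simpl; [lra|].
apply Rmult_lt_0_compat; [exact IH|]; pose proof (lpos n); nra.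
Qed.

(** All coefficients are nonnegative, so a single monomial is at most the value of the polynomial at
    [r >= 0]. *)
Lemma esym_le_prod1 r n : 0 <= r -> forall p, esym lam n p * r ^ p <= prod1 lam r n.
Proof.
intros r0; induction n as [|n IH]; intros p.
- simpl; destruct p; simpl; lra.
- simpl prod1; pose proof (lpos n) as ln; pose proof (prod1_pos r n r0) as P.
  assert (lr : 0 <= lam n * r) by nra.
  destruct p as [|p].
  + simpl; specialize (IH 0%nat); simpl in IH; nra.
  + change (esym lam (S n) (S p)) with (esym lam n (S p) + lam n * esym lam n p).
    pose proof (IH (S p)) as I1; pose proof (IH p) as I2; simpl pow in *.
    apply (Rmult_le_compat_l _ _ _ lr) in I2; lra.
Qed.

End Coefficients.

Section OperatorM3.

Context (M : nat -> R) (Mpos : forall p, 0 < M p) (M0 : M 0%nat = 1).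
Context (HM1 : condM1 M) (HM3' : condM3' M) (HM3 : condM3 M) (h : R) (h0 : 0 < h).

Local Notation lam := (lam M h).

Let slam : summable_scales lam := summable_lam M Mpos HM3' h h0.

(** This is (M.1) at index [S j]. *)
Lemma lam_decreasing j : lam (S j) <= lam j.
Proof.
unfold lam; apply Rmult_le_compat_l; [lra|].
pose proof (HM1 (S j) ltac:(lia)) as H.
replace (S j + 1)%nat with (S (S j)) in H by lia; replace (S j - 1)%nat with j in H by lia.
pose proof (Mpos j); pose proof (Mpos (S j)); pose proof (Mpos (S (S j))).
apply (Rmult_le_reg_r (M (S j) * M (S (S j)))); [apply Rmult_lt_0_compat; assumption|].
replace (M (S j) / M (S (S j)) * (M (S j) * M (S (S j)))) with (M (S j) ^ 2) by (field; lra).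
replace (M j / M (S j) * (M (S j) * M (S (S j)))) with (M (S (S j)) * M j) by (field; lra).
exact H.
Qed.

Lemma lam_antitone i j : (i <= j)%nat -> lam j <= lam i.
Proof.
intros H; induction H as [|j H IH]; [apply Rle_refl|].
eapply Rle_trans; [apply lam_decreasing|exact IH].
Qed.

(* This is condition (M.3), rephrased. *)
Lemma lam_tail : exists B, 0 <= B /\ forall p, (1 <= p)%nat -> Series (shift p lam) <= B * INR p * lam p.
Proof.
destruct HM3 as [B HB]; exists (Rabs B); split; [apply Rabs_pos|]; intros p Hp.
destruct (HB p Hp) as [_ H].
assert (ip : 0 < INR p) by (apply lt_0_INR; lia).
pose proof (Mpos p) as mp; pose proof (Mpos (S p)) as mp1.
assert (E : Series (fun k => M (p + k)%nat * M (p + 1)%nat / (INR p * M p * M (p + 1 + k)%nat)) =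
  / (INR p * lam p) * Series (shift p lam)).
{ rewrite <- Series_scal_l; apply Series_ext; intros k; unfold shift, lam.
  replace (p + 1)%nat with (S p) by lia; replace (S p + k)%nat with (S (p + k)) by lia.
  pose proof (Mpos (p + k)); pose proof (Mpos (S (p + k))).
  field; repeat split; lra. }
rewrite E in H.
pose proof (proj1 slam p) as lp.
assert (c : 0 < INR p * lam p) by (apply Rmult_lt_0_compat; assumption).
apply (Rmult_le_compat_l (INR p * lam p)) in H; [|lra].
rewrite <- Rmult_assoc, Rinv_r, Rmult_1_l in H by lra.
eapply Rle_trans; [exact H|].
replace (Rabs B * INR p * lam p) with (INR p * lam p * Rabs B) by ring.
apply Rmult_le_compat_l; [lra|apply Rle_abs].
Qed.

(** Where [lam j * r >= 1], the factor [1 + lam j * r] is at most [2 * lam j * r], and the product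
    of the [lam j] telescopes to [(8 h)^p / M p]. *)
Lemma prod1_head r p : (forall j, (j < p)%nat -> 1 <= lam j * r) ->
  prod1 lam r p <= 2 ^ p * r ^ p * (8 * h) ^ p / M p.
Proof.
intros H; induction p as [|p IH]; [simpl; rewrite M0; lra|].
assert (IH' : prod1 lam r p <= 2 ^ p * r ^ p * (8 * h) ^ p / M p) by (apply IH; intros; apply H; lia).
pose proof (H p ltac:(lia)) as Hp; pose proof (Mpos p); pose proof (Mpos (S p)).
assert (r0 : 0 <= r).
{ pose proof (proj1 slam p) as lp; destruct (Rle_lt_dec 0 r) as [E|E]; [exact E|nra]. }
pose proof (prod1_pos lam (proj1 slam) r p r0) as pp.
apply Rle_trans with (2 ^ p * r ^ p * (8 * h) ^ p / M p * (2 * (lam p * r))).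
- simpl; apply Rmult_le_compat; lra.
- apply Req_le; unfold lam; simpl; field; lra.
Qed.

(** [1 + x <= exp x] on each factor from [p] on. *)
Lemma prod1_tail r p n : 0 <= r -> (p <= n)%nat ->
  prod1 lam r n <= prod1 lam r p * exp (r * (Series (shift p lam) - Series (shift n lam))).
Proof.
intros r0 H; induction H as [|n H IH].
- rewrite Rminus_diag, Rmult_0_r, exp_0; lra.
- rewrite (Series_shift_S lam n) in IH by apply slam; simpl.
  replace (r * (Series (shift p lam) - Series (shift (S n) lam)))
    with (r * (Series (shift p lam) - (lam n + Series (shift (S n) lam))) + lam n * r) by ring.
  rewrite exp_plus, <- Rmult_assoc; apply Rmult_le_compat; [| |exact IH|].
  + left; apply prod1_pos; [apply slam|exact r0].
  + pose proof (proj1 slam n); nra.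
  + apply exp_ineq1_le.
Qed.

(* Cauchy estimate for [Prod (1 + lam j z)] on the circle of radius [1 / lam (p - 1)]. *)
Lemma esym_bound : exists l, 0 < l /\ forall n p, esym lam n p <= l ^ p / M p.
Proof.
destruct lam_tail as [B [B0 HB]].
(* Per order, [16 h = 2 * (8 h)] comes from the head of the product and [exp B] from its tail. *)
exists (16 * h * exp B); split; [pose proof (exp_pos B); nra|].
assert (big : forall n p, (p <= n)%nat -> esym lam n p <= (16 * h * exp B) ^ p / M p).
{ intros n p Hn; destruct p as [|p].
  - simpl; rewrite M0, Rdiv_1_r.
    clear Hn; induction n as [|n IH]; simpl; lra.
  - pose proof (proj1 slam p) as lp.
    set (r := / lam p).
    assert (r0 : 0 < r) by (apply Rinv_0_lt_compat, lp).
    assert (rp : 0 < r ^ S p) by (apply pow_lt, r0).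
    apply (Rmult_le_reg_r (r ^ S p)); [exact rp|].
    eapply Rle_trans; [apply esym_le_prod1; [apply slam|lra]|].
    eapply Rle_trans; [apply (prod1_tail r (S p) n); [lra|exact Hn]|].
    pose proof (Mpos (S p)) as mp.
    assert (E1 : prod1 lam r (S p) <= 2 ^ S p * r ^ S p * (8 * h) ^ S p / M (S p)).
    { apply prod1_head; intros j Hj; unfold r.
      apply (Rmult_le_reg_r (lam p)); [exact lp|].
      rewrite Rmult_assoc, Rinv_l, Rmult_1_r, Rmult_1_l by lra; apply lam_antitone; lia. }
    (* The tail bound at [S p] together with [lam (S p) <= lam p] keeps the exponent below
       [INR (S p) * B]. *)
    assert (E2 : exp (r * (Series (shift (S p) lam) - Series (shift n lam))) <= exp B ^ S p).
    { assert (E : exp B ^ S p = exp (INR (S p) * B)).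
      { rewrite <- Rpower_pow by apply exp_pos; unfold Rpower; rewrite ln_exp; reflexivity. }
      rewrite E; apply exp_le.
      pose proof (summable_scales_shift lam n slam) as [a1 a2]; pose proof (Series_pos_lt _ a1 a2).
      pose proof (HB (S p) ltac:(lia)) as H1.
      pose proof (lam_decreasing p) as H2.
      assert (ip : 0 <= INR (S p)) by apply pos_INR.
      assert (H3 : B * INR (S p) * lam (S p) <= B * INR (S p) * lam p).
      { apply Rmult_le_compat_l; [apply Rmult_le_pos; assumption|exact H2]. }
      apply (Rmult_le_reg_l (lam p)); [exact lp|]; unfold r.
      rewrite <- Rmult_assoc, Rinv_r, Rmult_1_l by lra; nra. }
    eapply Rle_trans; [apply Rmult_le_compat; [left; apply prod1_pos; [apply slam|lra]|left; apply exp_pos|exact E1|exact E2]|].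
    apply Req_le; replace (16 * h * exp B) with (2 * (8 * h) * exp B) by ring.
    rewrite !Rpow_mult_distr; field; lra. }
(* The case [p > n] is reached by adding factors, which only increases the coefficients. *)
intros n p; eapply Rle_trans; [apply (esym_mono lam (proj1 slam) n (Nat.max n p)); lia|].
apply big; lia.
Qed.

Definition elim (p : nat) : R := real (Lim_seq (fun n => esym lam n p)).

Lemma elim_limit : exists l, 0 < l /\ forall p,
  is_lim_seq (fun n => esym lam n p) (elim p) /\
  (forall n, 0 <= esym lam n p <= elim p) /\ elim p <= l ^ p / M p.
Proof.
destruct esym_bound as [l [l0 Hl]]; exists l; split; [exact l0|]; intros p.
assert (ex : ex_finite_lim_seq (fun n => esym lam n p)).
{ apply ex_finite_lim_seq_incr with (l ^ p / M p); [|intros n; apply Hl].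
  intros n; apply esym_incr, slam. }
pose proof (Lim_seq_correct' _ ex) as L; split; [exact L|split].
- intros n; split; [apply esym_nonneg, slam|].
  refine (is_lim_seq_incr_compare _ _ L _ n); intros k; apply esym_incr, slam.
- refine (is_lim_seq_le _ (fun _ => l ^ p / M p) _ _ _ L (is_lim_seq_const _)).
  intros n; apply Hl.
Qed.

(** The transpose of [Prod_j (1 + lam j d/dx)]: integration by parts turns [d/dx] into its negative,
    whence [(-1)^p]. Its finite versions are the [psiR] below. *)
Definition psi (f : R -> R) (t : R) : R := Series (fun p => (-1) ^ p * elim p * Derive_n f p t).

Fixpoint psiR (N : nat) (f : R -> R) : R -> R :=
  match N with
  | O => f
  | S n => psiR n (fun t => f t - lam n * Derive f t)
  end.

Lemma Derive_n_step c f p t : smoothR f ->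
  Derive_n (fun t => f t - c * Derive f t) p t = Derive_n f p t - c * Derive_n f (S p) t.
Proof.
intros Sf.
rewrite (Derive_n_minus f (fun t => c * Derive f t)).
- f_equal; rewrite Derive_n_scal_l; f_equal.
  rewrite <- (Nat.add_1_r p); exact (Derive_n_comp f p 1 t).
- apply filter_forall; intros y k _; apply ex_derive_n_smoothR, Sf.
- apply filter_forall; intros y k _; apply ex_derive_n_scal_l.
  destruct k as [|k]; [exact I|].
  apply (ex_derive_ext (Derive_n f (S k))); [|exact (Sf (S k) y)].
  intros u; rewrite <- (Nat.add_1_r k); symmetry; exact (Derive_n_comp f k 1 u).
Qed.

Lemma smoothR_step c f : smoothR f -> smoothR (fun t => f t - c * Derive f t).
Proof.
intros Sf p t.
apply (ex_derive_ext (fun t => Derive_n f p t - c * Derive_n f (S p) t)).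
- intros u; symmetry; apply Derive_n_step, Sf.
- apply (ex_derive_minus (V := R_NormedModule) (Derive_n f p) (fun t => c * Derive_n f (S p) t)); [apply Sf|].
  apply ex_derive_scal, Sf.
Qed.

Lemma suppR_step c r f : suppR r f -> suppR r (fun t => f t - c * Derive f t).
Proof.
intros H t Ht; rewrite H by exact Ht.
change (Derive f t) with (Derive_n f 1 t); rewrite (Derive_n_suppR r f 1 H t Ht); ring.
Qed.

Lemma psiR_smooth N : forall f, smoothR f -> smoothR (psiR N f).
Proof. induction N as [|N IH]; intros f Sf; simpl; [exact Sf|apply IH, smoothR_step, Sf]. Qed.

Lemma psiR_supp N r : forall f, suppR r f -> suppR r (psiR N f).
Proof. induction N as [|N IH]; intros f Sf; simpl; [exact Sf|apply IH, suppR_step, Sf]. Qed.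

(** The upper limit [K] is free because [esym] vanishes beyond [N]; the induction lowers it by one
    when the derivative shifts the index. *)
Lemma psiR_sum t N : forall f K, smoothR f -> (N <= K)%nat ->
  psiR N f t = sum_n (fun p => (-1) ^ p * esym lam N p * Derive_n f p t) K.
Proof.
induction N as [|N IH]; intros f K Sf HK.
- simpl psiR; clear HK; induction K as [|K IHK]; [rewrite sum_O; simpl; ring|].
  rewrite sum_Sn, <- IHK; simpl esym.
  match goal with |- _ = plus ?a ?b => change (f t = a + b) end; simpl; ring.
- destruct K as [|K]; [lia|]; simpl psiR.
  rewrite (IH _ K (smoothR_step (lam N) f Sf)) by lia.
  rewrite (sum_n_ext _ (fun p => plus ((-1) ^ p * esym lam N p * Derive_n f p t)
     ((-1) ^ S p * (lam N * esym lam N p) * Derive_n f (S p) t))).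
  2:{ intros p; rewrite Derive_n_step by exact Sf; unfold plus; simpl; ring. }
  rewrite sum_n_plus.
  set (b := fun p => (-1) ^ p * (lam N * match p with O => 0 | S q => esym lam N q end) * Derive_n f p t).
  rewrite (sum_n_ext (fun p => (-1) ^ p * esym lam (S N) p * Derive_n f p t)
    (fun p => plus ((-1) ^ p * esym lam N p * Derive_n f p t) (b p))).
  2:{ intros p; unfold b, plus; simpl; ring. }
  rewrite sum_n_plus, sum_Sn, (esym_gt lam N (S K)) by lia.
  assert (Eb : sum_n b (S K) = sum_n (fun p => b (S p)) K).
  { unfold sum_n; rewrite sum_Sn_m by lia; rewrite <- sum_n_m_S.
    unfold b at 1; rewrite Rmult_0_r, Rmult_0_r, Rmult_0_l; exact (Rplus_0_l _). }
  rewrite Eb; unfold b.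
  match goal with |- plus ?x ?y = plus (plus ?x ?z) ?y => change (x + y = x + z + y) end.
  ring.
Qed.

(** Dominated convergence for series: the geometric majorant controls the tails uniformly in [N],
    and finitely many terms remain. *)
Lemma tannery (v : nat -> nat -> R) K q : 0 <= q < 1 ->
  (forall N p, 0 <= v N p <= K * q ^ p) -> (forall p, is_lim_seq (fun N => v N p) 0) ->
  is_lim_seq (fun N => Series (v N)) 0.
Proof.
intros Hq Hv Hl.
assert (fin : forall P, is_lim_seq (fun N => sum_n (v N) P) 0).
{ induction P as [|P IH].
  - apply (is_lim_seq_ext (fun N => v N 0%nat)); [intros N; rewrite sum_O; reflexivity|apply Hl].
  - replace (Finite 0) with (Finite (0 + 0)) by (f_equal; ring).
    apply (is_lim_seq_ext (fun N => sum_n (v N) P + v N (S P))).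
    + intros N; rewrite sum_Sn; reflexivity.
    + apply is_lim_seq_plus'; [exact IH|apply Hl]. }
apply is_lim_seq_spec; intros eps.
assert (e4 : 0 < eps / 4) by (pose proof (cond_pos eps); lra).
destruct (geometric_small q (K / (1 - q)) (eps / 4) Hq e4) as [P HP].
pose proof (fin P) as F; apply is_lim_seq_spec in F.
destruct (F (mkposreal _ e4)) as [N0 HN0]; simpl in HN0.
exists N0; intros N HN; specialize (HN0 N HN); rewrite Rminus_0_r in *.
assert (ab : forall p, Rabs (v N p) <= K * q ^ p).
{ intros p; rewrite Rabs_pos_eq; apply Hv. }
rewrite (Series_split (v N) P) by (apply ex_series_geom_le with K q; assumption).
assert (T : Rabs (Series (shift (S P) (v N))) <= K * q ^ S P / (1 - q)).
{ apply Series_geom_le; [exact Hq|]; intros p; eapply Rle_trans; [apply ab|].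
  rewrite pow_add; lra. }
specialize (HP (S P) (Nat.le_succ_diag_r P)).
pose proof (Rabs_triang (sum_n (v N) P) (Series (shift (S P) (v N)))) as TT.
pose proof (cond_pos eps); unfold Rdiv in *.
eapply Rle_lt_trans; [exact TT|]; lra.
Qed.

(** The test function is bounded at scale [2 l] and the coefficients are at most [l^p / M p], so a
    factor [2^(-p)] is left. The majorants [v N p] are free of [t], hence the uniformity. *)
Lemma psiR_limit f : real_test M f -> forall eps, 0 < eps -> exists N0, forall N, (N0 <= N)%nat ->
  forall t, Rabs (psiR N f t - psi f t) <= eps.
Proof.
intros [Sf [_ Hf]] eps e0.
destruct elim_limit as [l [l0 Hl]].
destruct (Hf (2 * l)) as [B HB]; [lra|].
assert (B0 : 0 <= B).
{ pose proof (HB 0%nat 0) as H; simpl in H; rewrite M0 in H; pose proof (Rabs_pos (f 0)); lra. }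
assert (key : forall a p t, 0 <= a <= l ^ p / M p -> Rabs ((-1) ^ p * a * Derive_n f p t) <= a * (B * M p / (2 * l) ^ p) /\
   a * (B * M p / (2 * l) ^ p) <= B * (/ 2) ^ p).
{ intros a p t [a0 Ha].
  assert (lp : 0 < (2 * l) ^ p) by (apply pow_lt; lra).
  assert (lp' : 0 < l ^ p) by (apply pow_lt; lra).
  assert (p2 : 0 < 2 ^ p) by (apply pow_lt; lra).
  pose proof (Mpos p) as mp; split.
  - rewrite !Rabs_mult, pow_1_abs, Rmult_1_l, (Rabs_pos_eq a a0).
    apply Rmult_le_compat_l; [exact a0|].
    apply Rle_div_r; [exact lp|]; rewrite Rmult_comm; apply HB.
  - eapply Rle_trans; [apply Rmult_le_compat_r; [|exact Ha]|].
    + apply Rdiv_le_0_compat; [apply Rmult_le_pos; lra|exact lp].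
    + apply Req_le; rewrite Rpow_mult_distr, pow_inv; field; lra. }
set (v := fun N p => (elim p - esym lam N p) * (B * M p / (2 * l) ^ p)).
assert (dif : forall N p, 0 <= elim p - esym lam N p <= l ^ p / M p).
{ intros N p; destruct (Hl p) as [_ [H1 H2]]; specialize (H1 N); lra. }
assert (v1 : forall N p, 0 <= v N p <= B * (/ 2) ^ p).
{ intros N p; destruct (key (elim p - esym lam N p) p 0 (dif N p)) as [K1 K2]; split; [|exact K2].
  eapply Rle_trans; [apply Rabs_pos|exact K1]. }
assert (v2 : forall p, is_lim_seq (fun N => v N p) 0).
{ intros p; unfold v.
  replace (Finite 0) with (Rbar_mult (Finite (elim p - elim p)) (Finite (B * M p / (2 * l) ^ p)))
    by (simpl; f_equal; ring).
  apply (is_lim_seq_scal_r _ (Finite (B * M p / (2 * l) ^ p))).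
  apply is_lim_seq_minus'; [apply is_lim_seq_const|apply Hl]. }
assert (q2 : 0 <= / 2 < 1) by lra.
pose proof (tannery v B (/ 2) q2 v1 v2) as L; apply is_lim_seq_spec in L.
destruct (L (mkposreal eps e0)) as [N0 HN0]; simpl in HN0; exists N0; intros N HN t.
specialize (HN0 N HN); rewrite Rminus_0_r in HN0.
pose proof (Rle_abs (Series (v N))) as Q.
assert (ex1 : ex_series (fun p => (-1) ^ p * elim p * Derive_n f p t)).
{ apply ex_series_geom_le with B (/ 2); [exact q2|]; intros p.
  destruct (key (elim p) p t) as [K1 K2]; [|lra].
  destruct (Hl p) as [_ [H1 H2]]; specialize (H1 0%nat); lra. }
assert (ex2 : ex_series (fun p => (-1) ^ p * esym lam N p * Derive_n f p t)).
{ apply ex_series_geom_le with B (/ 2); [exact q2|]; intros p.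
  destruct (key (esym lam N p) p t) as [K1 K2]; [|lra].
  destruct (Hl p) as [_ [H1 H2]]; specialize (H1 N); lra. }
assert (E : psiR N f t = Series (fun p => (-1) ^ p * esym lam N p * Derive_n f p t)).
{ rewrite (psiR_sum t N f N Sf (Nat.le_refl N)), (Series_split _ N ex2).
  rewrite (Series_ext (shift (S N) _) (fun _ => 0 * 0)); [rewrite Series_scal_l, Rmult_0_l; symmetry; exact (Rplus_0_r _)|].
  intros k; unfold shift; rewrite esym_gt by lia; ring. }
rewrite E, Rabs_minus_sym; unfold psi; rewrite <- Series_minus by assumption.
apply Rle_trans with (Series (v N)); [|lra].
assert (term : forall p, Rabs ((-1) ^ p * elim p * Derive_n f p t - (-1) ^ p * esym lam N p * Derive_n f p t) <= v N p).
{ intros p; replace ((-1) ^ p * elim p * Derive_n f p t - (-1) ^ p * esym lam N p * Derive_n f p t)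
    with ((-1) ^ p * (elim p - esym lam N p) * Derive_n f p t) by ring.
  apply key, dif. }
assert (exv : ex_series (v N)).
{ apply ex_series_geom_le with B (/ 2); [exact q2|]; intros p; rewrite Rabs_pos_eq; apply v1. }
eapply Rle_trans; [apply Series_Rabs|].
- apply (@ex_series_le R_AbsRing R_CompleteNormedModule) with (v N); [|exact exv].
  intros p; change (Rabs (Rabs ((-1) ^ p * elim p * Derive_n f p t - (-1) ^ p * esym lam N p * Derive_n f p t)) <= v N p).
  rewrite Rabs_Rabsolu; apply term.
- apply Series_le; [|exact exv]; intros p; split; [apply Rabs_pos|apply term].
Qed.

(** The power of [Ci] undoes [D = - i d/dx]: [i^p D^p] is the plain [p]-th derivative. *)
Definition udo_coef (p : nat) : C := (Cpow Ci p * RtoC (elim p))%C.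

Lemma udo_coef_class : udo_class Beurling M udo_coef.
Proof.
destruct elim_limit as [l [l0 Hl]]; exists l, 1; split; [exact l0|split; [lra|]]; intros p _.
unfold udo_coef; rewrite Cmod_mult, Cmod_pow_one, Cmod_R by apply Cmod_Ci.
destruct (Hl p) as [_ [H1 H2]]; specialize (H1 0%nat).
rewrite Rabs_pos_eq by lra; unfold Rdiv in *; lra.
Qed.

Lemma Cpow_mult (z w : C) p : (Cpow z p * Cpow w p = Cpow (z * w) p)%C.
Proof. induction p as [|p IH]; simpl; [ring|]; rewrite <- IH; ring. Qed.

Lemma udo_term_coef f p t :
  udo_term udo_coef f p t = (RtoC ((-1) ^ p * elim p) * derivC_n p f t)%C.
Proof.
unfold udo_term, udo_coef, Dop.
assert (E : (Cpow Ci p * Cpow (- Ci) p = 1)%C).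
{ rewrite Cpow_mult; replace (Ci * - Ci)%C with (RtoC 1).
  - induction p as [|p IH]; simpl; [reflexivity|rewrite IH; ring].
  - unfold Ci, Cmult, Copp, RtoC; simpl; f_equal; ring. }
assert (E1 : Cpow (- RtoC 1) p = RtoC ((-1) ^ p)).
{ clear E; induction p as [|p IH]; simpl; [reflexivity|]; rewrite IH, RtoC_mult, <- RtoC_opp; reflexivity. }
rewrite E1, RtoC_mult.
transitivity (RtoC ((-1) ^ p) * RtoC (elim p) * (Cpow Ci p * Cpow (- Ci) p) * derivC_n p f t)%C; [ring|].
rewrite E; ring.
Qed.

Lemma udo_test_coef f t :
  udo_test udo_coef f t = (psi (fun s => Re (f s)) t, psi (fun s => Im (f s)) t).
Proof.
unfold udo_test, CSeries, psi; f_equal; apply Series_ext; intros p;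
  rewrite udo_term_coef, derivC_n_eq; simpl; ring.
Qed.

End OperatorM3.

(** * Correlations of test functions *)

Lemma RtoC_lincomb (a b : R) (f g : R -> R) :
  (fun t => RtoC (a * f t + b * g t)) = lincomb (RtoC a) (fun t => RtoC (f t)) (RtoC b) (fun t => RtoC (g t)).
Proof. extensionality t; unfold lincomb; rewrite RtoC_plus, !RtoC_mult; reflexivity. Qed.

Lemma smoothR_lincomb (a b : R) f g : smoothR f -> smoothR g -> smoothR (fun t => a * f t + b * g t).
Proof.
intros Sf Sg.
pose proof (smooth_lincomb (RtoC a) _ (RtoC b) _ (smooth_RtoC f Sf) (smooth_RtoC g Sg)) as H.
rewrite <- RtoC_lincomb in H; exact (proj1 (proj1 (smooth_iff _) H)).
Qed.

Lemma Derive_n_lincomb (a b : R) f g p t : smoothR f -> smoothR g ->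
  Derive_n (fun t => a * f t + b * g t) p t = a * Derive_n f p t + b * Derive_n g p t.
Proof.
intros Sf Sg.
pose proof (derivC_n_lincomb (RtoC a) _ (RtoC b) _ p t (smooth_RtoC f Sf) (smooth_RtoC g Sg)) as H.
rewrite <- RtoC_lincomb, !derivC_n_RtoC, <- !RtoC_mult, <- RtoC_plus in H.
exact (f_equal Re H).
Qed.

Lemma Derive_n_reflect f c p t : smoothR f ->
  Rabs (Derive_n (fun s => f (c - s)) p t) = Rabs (Derive_n f p (c - t)).
Proof.
intros Sf.
transitivity (Rabs (Derive_n (fun s => f (s + c)) p (- t))).
- rewrite <- !Cmod_R, <- !derivC_n_RtoC.
  rewrite <- (Cmod_derivC_n_opp (fun s => RtoC (f (s + c)))).
  + f_equal; f_equal; extensionality s; do 2 f_equal; ring.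
  + apply (smooth_RtoC (fun s => f (s + c))), smoothR_trans, Sf.
- rewrite Derive_n_comp_trans; do 2 f_equal; ring.
Qed.

Section RealTests.

Context (M : nat -> R) (Mpos : forall p, 0 < M p).

Lemma real_test_lincomb (a b : R) f g :
  real_test M f -> real_test M g -> real_test M (fun t => a * f t + b * g t).
Proof.
intros Hf Hg.
pose proof (carrier_lincomb Beurling M Mpos (RtoC a) _ (RtoC b) _
  (real_test_carrier M Mpos f Hf) (real_test_carrier M Mpos g Hg)) as H.
rewrite <- RtoC_lincomb in H; exact (proj1 (carrier_real_test M Mpos _ H)).
Qed.

Lemma real_test_reflect c f : real_test M f -> real_test M (fun t => f (c - t)).
Proof.
intros Hf.
exact (proj1 (carrier_real_test M Mpos _
  (carrier_reflect Beurling M Mpos _ c (real_test_carrier M Mpos f Hf)))).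
Qed.

Lemma real_test_trans c f : real_test M f -> real_test M (fun t => f (t + c)).
Proof.
intros Hf.
exact (proj1 (carrier_real_test M Mpos _
  (carrier_trans Beurling M Mpos _ c (real_test_carrier M Mpos f Hf)))).
Qed.

Lemma real_translation_modulus f h : 0 < h -> real_test M f -> forall eps, 0 < eps ->
  exists d, 0 < d /\ forall c, Rabs c < d -> forall p t,
    h ^ p * Rabs (Derive_n f p (t + c) - Derive_n f p t) <= eps * M p.
Proof.
intros h0 [Sf [_ Hf]] eps e0.
destruct (Hf (h + 1)) as [B HB]; [lra|].
destruct (translation_modulus M Mpos h (h + 1) B (fun t => RtoC (f t))) with (eps := eps)
  as [d [d0 Hd]]; [lra|apply smooth_RtoC, Sf| |exact e0|].
- intros p t; rewrite derivC_n_RtoC, Cmod_R; apply HB.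
- exists d; split; [exact d0|]; intros c Hc p t.
  specialize (Hd c Hc p t).
  rewrite derivC_n_minus in Hd.
  + rewrite (derivC_n_trans (fun t => RtoC (f t))), !derivC_n_RtoC, <- RtoC_minus, Cmod_R in Hd; exact Hd.
  + apply (smooth_trans (fun t => RtoC (f t))), smooth_RtoC, Sf.
  + apply smooth_RtoC, Sf.
Qed.

End RealTests.

(** A correlation of [f] with a weight [w] that will only be continuous; every derivative falls on
    [f]. *)
Definition cv (w : R -> R) (a b : R) (f : R -> R) (y : R) : R :=
  RInt (fun t => w t * f (y + t)) a b.

Section Correlation.

Context (w : R -> R) (cw : forall t, continuous w t).

Lemma continuous_comp_add (f : R -> R) c t : (forall t, continuous f t) ->
  continuous (fun s => f (c + s)) t.
Proof.
intros cf; apply (continuous_ext (fun s => f (s - - c))); [intros s; f_equal; ring|].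
apply continuous_comp_sub, cf.
Qed.

Lemma cv_integrand_continuous f y t : (forall t, continuous f t) ->
  continuous (fun t => w t * f (y + t)) t.
Proof.
intros cf; apply (continuous_mult (K := R_AbsRing)); [apply cw|apply continuous_comp_add, cf].
Qed.

Lemma cv_ex_RInt f y a b : (forall t, continuous f t) -> ex_RInt (fun t => w t * f (y + t)) a b.
Proof. intros cf; apply ex_RInt_cont; intros t; apply cv_integrand_continuous, cf. Qed.

Lemma is_derive_cv f a b y : smoothR f -> is_derive (cv w a b f) y (cv w a b (Derive f) y).
Proof.
intros Sf; unfold cv.
assert (E : forall u t, Derive (fun z => w t * f (z + t)) u = w t * Derive f (u + t)).
{ intros u t; rewrite Derive_scal; f_equal.
  change (Derive (fun z => f (z + t)) u) with (Derive_n (fun z => f (z + t)) 1 u).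
  apply Derive_n_comp_trans. }
assert (c0 : forall t, continuous f t) by (intros t; exact (smoothR_continuous f 0 t Sf)).
assert (c1 : forall t, continuous (Derive f) t) by (intros t; exact (smoothR_continuous f 1 t Sf)).
rewrite (RInt_ext (V := R_CompleteNormedModule) _ (fun t => Derive (fun z => w t * f (z + t)) y)) by (intros; symmetry; apply E).
apply is_derive_RInt_param.
- apply filter_forall; intros u t _; apply ex_derive_scal.
  apply (ex_derive_comp (V := R_NormedModule) f (fun u => u + t)); [exact (Sf 0%nat (u + t))|auto_derive; exact I].
- intros t _; apply (continuity_2d_pt_ext (fun u v => w v * Derive f (u + v))).
  { intros; symmetry; apply E. }
  apply continuity_2d_pt_mult.
  + apply (continuity_1d_2d_pt_comp w (fun u v => v)); [|apply continuity_2d_pt_id2].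
    apply continuity_pt_filterlim, cw.
  + apply (continuity_1d_2d_pt_comp (Derive f) (fun u v => u + v)).
    * apply continuity_pt_filterlim, c1.
    * apply continuity_2d_pt_plus; [apply continuity_2d_pt_id1|apply continuity_2d_pt_id2].
- apply filter_forall; intros u; apply cv_ex_RInt, c0.
Qed.

Lemma smoothR_Derive f : smoothR f -> smoothR (Derive f).
Proof.
intros Sf p t; apply (ex_derive_ext (Derive_n f (S p))); [|exact (Sf (S p) t)].
intros u; rewrite <- (Nat.add_1_r p); symmetry; exact (Derive_n_comp f p 1 u).
Qed.

Lemma Derive_n_cv a b p : forall f y, smoothR f ->
  Derive_n (cv w a b f) p y = cv w a b (Derive_n f p) y.
Proof.
induction p as [|p IH]; intros f y Sf; [reflexivity|].
assert (E : Derive_n (cv w a b f) (S p) y = Derive_n (Derive (cv w a b f)) p y).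
{ rewrite <- (Nat.add_1_r p); symmetry; exact (Derive_n_comp (cv w a b f) p 1 y). }
rewrite E, (Derive_n_ext _ (cv w a b (Derive f))).
- rewrite IH by apply smoothR_Derive, Sf; unfold cv; apply RInt_ext; intros t _; f_equal.
  rewrite <- (Nat.add_1_r p); exact (Derive_n_comp f p 1 (y + t)).
- intros t; apply is_derive_unique, is_derive_cv, Sf.
Qed.

Lemma smoothR_cv a b f : smoothR f -> smoothR (cv w a b f).
Proof.
intros Sf; assert (H : forall p f, smoothR f -> forall y, ex_derive (Derive_n (cv w a b f) p) y).
{ induction p as [|p IH]; intros g Sg y.
  - eexists; apply is_derive_cv, Sg.
  - apply (ex_derive_ext (Derive_n (cv w a b (Derive g)) p)).
    + intros u; rewrite <- (Nat.add_1_r p), <- (Derive_n_comp (cv w a b g) p 1 u).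
      apply Derive_n_ext; intros t; symmetry; apply is_derive_unique, is_derive_cv, Sg.
    + apply IH, smoothR_Derive, Sg. }
intros p y; apply H, Sf.
Qed.

Lemma cv_supp a b r f : suppR r f -> suppR (r + (Rabs a + Rabs b)) (cv w a b f).
Proof.
intros Hf y Hy; unfold cv.
rewrite (RInt_ext (V := R_CompleteNormedModule) _ (fun _ => 0)).
{ rewrite RInt_const; exact (Rmult_0_r _). }
intros t Ht; rewrite Hf; [apply Rmult_0_r|].
assert (Rabs t <= Rabs a + Rabs b).
{ pose proof (Rabs_pos a); pose proof (Rabs_pos b).
  pose proof (Rle_abs a); pose proof (Rle_abs b); pose proof (Rle_abs (- a)); pose proof (Rle_abs (- b)).
  rewrite Rabs_Ropp in *; unfold Rmin, Rmax in Ht; destruct (Rle_dec a b); apply Rabs_le; lra. }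
pose proof (Rabs_triang (y + t) (- t)) as T; rewrite Rabs_Ropp in T.
replace (y + t + - t) with y in T by ring; lra.
Qed.

Lemma RInt_abs_le_seg (g : R -> R) a b B : (forall t, continuous g t) ->
  (forall t, Rmin a b <= t <= Rmax a b -> Rabs (g t) <= B) -> Rabs (RInt g a b) <= Rabs (b - a) * B.
Proof.
intros cg Hg; destruct (Rle_lt_dec a b) as [H|H].
- rewrite (Rabs_pos_eq (b - a)) by lra.
  rewrite Rmin_left, Rmax_right in Hg by lra.
  apply (norm_RInt_le_const (V := R_NormedModule) g a b _ B H Hg).
  apply (RInt_correct (V := R_CompleteNormedModule)), ex_RInt_cont, cg.
- rewrite (Rabs_left (b - a)) by lra.
  rewrite Rmin_right, Rmax_left in Hg by lra.
  assert (E : RInt g a b = - RInt g b a).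
  { symmetry; apply (opp_RInt_swap (V := R_CompleteNormedModule)), ex_RInt_cont, cg. }
  rewrite E, Rabs_Ropp; replace (- (b - a)) with (a - b) by ring.
  apply (norm_RInt_le_const (V := R_NormedModule) g b a _ B (Rlt_le _ _ H) Hg).
  apply (RInt_correct (V := R_CompleteNormedModule)), ex_RInt_cont, cg.
Qed.

Lemma continuous_bounded_seg (g : R -> R) a b : (forall t, continuous g t) ->
  exists B, 0 <= B /\ forall t, Rmin a b <= t <= Rmax a b -> Rabs (g t) <= B.
Proof.
intros cg.
destruct (continuity_ab_maj (fun t => Rabs (g t)) (Rmin a b) (Rmax a b)) as [m [Hm _]].
- unfold Rmin, Rmax; destruct (Rle_dec a b); lra.
- intros t _; apply continuity_pt_filterlim, continuous_Rabs_comp, cg.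
- exists (Rabs (g m)); split; [apply Rabs_pos|exact Hm].
Qed.

Lemma real_test_cv M (Mpos : forall p, 0 < M p) a b f : real_test M f -> real_test M (cv w a b f).
Proof.
intros [Sf [[r [r0 Hr]] Hf]]; split; [apply smoothR_cv, Sf|split].
- exists (r + (Rabs a + Rabs b)); split; [pose proof (Rabs_pos a); pose proof (Rabs_pos b); lra|].
  apply cv_supp, Hr.
- intros h h0; destruct (Hf h h0) as [B HB].
  destruct (continuous_bounded_seg w a b cw) as [W [W0 HW]].
  exists (Rabs (b - a) * (W * B)); intros p t.
  rewrite Derive_n_cv by exact Sf.
  assert (hp : 0 < h ^ p) by (apply pow_lt, h0).
  pose proof (Mpos p) as mp.
  assert (S : forall u, Rabs (Derive_n f p u) <= B * M p / h ^ p).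
  { intros u; apply Rle_div_r; [exact hp|]; rewrite Rmult_comm; apply HB. }
  assert (I : Rabs (cv w a b (Derive_n f p) t) <= Rabs (b - a) * (W * (B * M p / h ^ p))).
  { apply RInt_abs_le_seg.
    - intros u; apply cv_integrand_continuous; intros v; apply smoothR_continuous, Sf.
    - intros u Hu; rewrite Rabs_mult; apply Rmult_le_compat; [apply Rabs_pos|apply Rabs_pos|apply HW, Hu|apply S]. }
  apply (Rmult_le_compat_l (h ^ p)) in I; [|lra].
  eapply Rle_trans; [exact I|]; apply Req_le; field; lra.
Qed.

End Correlation.

(** * Convolutions of [T] with real test functions *)

Section RealPart.

Context {X : CompleteNormedModule C_AbsRing} (M : nat -> R) (Mpos : forall p, 0 < M p).
Context (T : (R -> C) -> X) (HT : continuous_linear (DL1 Beurling M) T).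
Context (h K : R) (h0 : 0 < h) (K0 : 0 <= K).
Context (HK : forall f B, carrier (Dspace Beurling M) f -> L1bound M h f B -> norm (T f) <= K * B).

Definition TR (f : R -> R) : X := T (fun t => RtoC (f t)).

Definition tconv (g : R -> R) (x : R) : X := TR (fun y => g (x - y)).

Lemma TR_lincomb a b f g : real_test M f -> real_test M g ->
  TR (fun t => a * f t + b * g t) = plus (rs a (TR f)) (rs b (TR g)).
Proof.
intros Hf Hg; unfold TR, rs; rewrite RtoC_lincomb.
apply (proj1 HT); apply carrier_DL1, real_test_carrier; assumption.
Qed.

Lemma tconv_lincomb a b f g x : real_test M f -> real_test M g ->
  tconv (fun t => a * f t + b * g t) x = plus (rs a (tconv f x)) (rs b (tconv g x)).
Proof.
intros Hf Hg; unfold tconv.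
exact (TR_lincomb a b (fun y => f (x - y)) (fun y => g (x - y))
  (real_test_reflect M Mpos x f Hf) (real_test_reflect M Mpos x g Hg)).
Qed.

(** Reflection and translation preserve the L1 norms of derivatives, so L1 seminorms of [g] bound
    the convolution uniformly in [x]. *)
Lemma tconv_bound g B : real_test M g ->
  (forall p r, 0 <= r -> h ^ p * RInt (fun t => Rabs (Derive_n g p t)) (- r) r <= B * M p) ->
  forall x, norm (tconv g x) <= K * B.
Proof.
intros Hg HB x; pose proof Hg as [Sg [[r [r0 Hr]] _]].
apply HK; [apply (real_test_carrier M Mpos), (real_test_reflect M Mpos), Hg|].
set (R0 := r + Rabs x).
assert (R00 : 0 < R0) by (pose proof (Rabs_pos x); unfold R0; lra).
destruct (real_test_reflect M Mpos x g Hg) as [Sr _].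
apply (L1bound_RtoC M Mpos h (fun y => g (x - y)) B R0 Sr R00).
- intros t Ht; apply Hr; pose proof (Rabs_triang (x - t) (- x)) as Q.
  replace (x - t + - x) with (- t) in Q by ring; rewrite !Rabs_Ropp in Q; unfold R0 in Ht; lra.
- intros p.
  set (b := fun v => Rabs (Derive_n g p (- v))).
  assert (cb : forall t, continuous b t).
  { intros t; apply continuous_Rabs_comp.
    apply (continuous_comp (fun v => - v) (Derive_n g p)); [|apply smoothR_continuous, Sg].
    apply (continuous_opp (V := R_NormedModule)), continuous_id. }
  assert (sb : suppR r b).
  { intros t Ht; unfold b; rewrite (Derive_n_suppR r g p Hr), Rabs_R0; [reflexivity|].
    rewrite Rabs_Ropp; exact Ht. }
  rewrite (RInt_ext (V := R_CompleteNormedModule) _ (fun y => b (y - x))).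
  2:{ intros t _; unfold b; rewrite Derive_n_reflect by exact Sg; do 2 f_equal; ring. }
  rewrite (RInt_supp_shift b r R0 x (Rlt_le _ _ r0) (Rle_refl _) cb sb).
  replace (RInt b (- r) r) with (RInt (fun t => Rabs (Derive_n g p t)) (- r) r); [apply HB; lra|].
  pose proof (is_RInt_comp_opp (V := R_NormedModule) (fun t => Rabs (Derive_n g p t)) r (- r)) as Q.
  rewrite Ropp_involutive in Q.
  assert (cg : forall t, continuous (fun t => Rabs (Derive_n g p t)) t).
  { intros t; apply continuous_Rabs_comp, smoothR_continuous, Sg. }
  specialize (Q _ (RInt_correct (V := R_CompleteNormedModule) _ _ _ (ex_RInt_cont _ _ _ cg))).
  apply (is_RInt_opp (V := R_NormedModule)), (is_RInt_swap (V := R_NormedModule)) in Q.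
  apply (is_RInt_unique (V := R_CompleteNormedModule)) in Q.
  rewrite (RInt_ext (V := R_CompleteNormedModule) _ b) in Q.
  2:{ intros t _; unfold b; exact (Ropp_involutive _). }
  symmetry; rewrite Q; exact (Ropp_involutive _).
Qed.

Lemma tconv_sup_bound g r B : 0 <= r -> suppR r g -> 0 <= B -> real_test M g -> bounded_derivatives M h g B ->
  forall x, norm (tconv g x) <= K * (2 * r * B).
Proof.
intros r0 Hr B0 Hg HB; apply tconv_bound; [exact Hg|]; intros p R0 HR0.
assert (hp : 0 < h ^ p) by (apply pow_lt, h0).
destruct Hg as [Sg _].
assert (L : l1 (Derive_n g p) (2 * r * (B * M p / h ^ p))).
{ apply l1_of_bound; [exact r0|intros t; apply smoothR_continuous, Sg|apply Derive_n_suppR, Hr|].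
  intros t; apply Rle_div_r; [exact hp|]; rewrite Rmult_comm; apply HB. }
specialize (L R0 HR0); apply (Rmult_le_compat_l (h ^ p)) in L; [|lra].
eapply Rle_trans; [exact L|]; apply Req_le; field; lra.
Qed.

Lemma bounded_derivatives_nonneg g B : bounded_derivatives M h g B -> 0 <= B.
Proof.
intros HB; specialize (HB 0%nat 0); simpl in HB; pose proof (Mpos 0%nat); pose proof (Rabs_pos (g 0)).
destruct (Rle_lt_dec 0 B); [assumption|nra].
Qed.

Lemma tconv_bounded g : real_test M g -> boundedX (tconv g).
Proof.
intros Hg; pose proof Hg as [_ [[r [r0 Hr]] Hb]]; destruct (Hb h h0) as [B HB].
eexists; apply (tconv_sup_bound g r B); try assumption; [lra|].
exact (bounded_derivatives_nonneg g B HB).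
Qed.

Lemma TR_tconv f : TR f = tconv (fun y => f (- y)) 0.
Proof. unfold tconv; f_equal; extensionality y; f_equal; ring. Qed.

Lemma TR_sup_bound g r B : 0 <= r -> suppR r g -> 0 <= B -> real_test M g -> bounded_derivatives M h g B ->
  norm (TR g) <= K * (2 * r * B).
Proof.
intros r0 Hr B0 Hg HB; rewrite TR_tconv.
assert (E : (fun y => g (- y)) = fun y => g (0 - y)) by (extensionality y; f_equal; ring).
apply (tconv_sup_bound (fun y => g (- y)) r B r0); [|exact B0| |].
- intros t Ht; apply Hr; rewrite Rabs_Ropp; exact Ht.
- rewrite E; apply (real_test_reflect M Mpos), Hg.
- intros p t; rewrite E, Derive_n_reflect by apply Hg; apply HB.
Qed.

Lemma is_derive_realify (Z : R -> X) (x : R) (l : X) :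
  (forall eps, 0 < eps -> exists d, 0 < d /\ forall y, Rabs (y - x) < d ->
     norm (minus (minus (Z y) (Z x)) (rs (y - x) l)) <= eps * Rabs (y - x)) ->
  is_derive (V := realify X) Z x l.
Proof.
intros H; split; [apply is_linear_scal_l|].
intros x' Hx'; pose proof (is_filter_lim_locally_unique (V := R_NormedModule) x x' Hx'); subst x'.
intros eps; destruct (H eps (cond_pos eps)) as [d [d0 Hd]].
exists (mkposreal d d0); intros y Hy; exact (Hd y Hy).
Qed.

Lemma continuous_RtoC_scal (w : R -> R) (F : R -> X) t : continuous w t -> continuous F t ->
  continuous (fun s => rs (w s) (F s)) t.
Proof.
intros cw cF; apply (continuous_scal_C (fun s => RtoC (w s))); [exact cw|apply continuous_const|exact cF].
Qed.

Lemma tconv_continuous f x : real_test M f -> continuous (tconv f) x.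
Proof. intros Hf; exact (continuous_convol M Mpos Beurling T HT _ (real_test_carrier M Mpos f Hf) x). Qed.

Lemma tconv_continuous_add f c x : real_test M f -> continuous (fun t => tconv f (t + c)) x.
Proof. intros Hf; apply continuous_shift; intros t; apply tconv_continuous, Hf. Qed.

(* Both sides have the same derivative with respect to the upper end [z]. *)
Lemma tconv_cv (w : R -> R) (cw : forall t, continuous w t) a b f c : real_test M f ->
  tconv (cv w a b f) c = RInt (V := realify X) (fun t => rs (w t) (tconv f (t + c))) a b.
Proof.
intros Hf.
pose proof Hf as [Sf [[r [r0 Hr]] Hb]]; destruct (Hb h h0) as [B HB].
pose proof (bounded_derivatives_nonneg f B HB) as B0.
assert (rt : forall c d, real_test M (cv w c d f)) by (intros; apply real_test_cv; assumption).
assert (cf : forall p t, continuous (Derive_n f p) t) by (intros; apply smoothR_continuous, Sf).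
set (df := fun t => rs (w t) (tconv f (t + c))).
assert (D : forall x, is_derive (V := realify X) (fun z => tconv (cv w a z f) c) x (df x)).
{ intros x; apply is_derive_realify; intros eps e0.
  set (R0 := r + (Rabs x + 1) + (Rabs x + 1)).
  set (Q := K * (2 * R0) * (B + Rabs (w x) + 1)).
  assert (R00 : 0 < R0) by (pose proof (Rabs_pos x); unfold R0; lra).
  assert (Q0 : 0 <= Q).
  { pose proof (Rabs_pos (w x)); unfold Q; apply Rmult_le_pos; [apply Rmult_le_pos|]; lra. }
  set (e1 := eps / (Q + 1)).
  assert (e10 : 0 < e1) by (apply Rdiv_lt_0_compat; lra).
  destruct (proj1 (continuous_R w x) (cw x) e1 e10) as [d1 [d10 Hd1]].
  destruct (real_translation_modulus M Mpos f h h0 Hf e1 e10) as [d2 [d20 Hd2]].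
  exists (Rmin 1 (Rmin d1 d2)); split; [repeat apply Rmin_glb_lt; lra|]; intros z Hz.
  assert (z1 : Rabs (z - x) < 1 /\ Rabs (z - x) < d1 /\ Rabs (z - x) < d2).
  { pose proof (Rmin_l 1 (Rmin d1 d2)); pose proof (Rmin_r 1 (Rmin d1 d2)).
    pose proof (Rmin_l d1 d2); pose proof (Rmin_r d1 d2); lra. }
  destruct z1 as [z1 [z2 z3]].
  (* The first order remainder in [z], written as the convolution of [T] with one test function; the
     bound on [T] then replaces an interchange of [T] with an integral. *)
  set (G := fun y => 1 * (1 * cv w a z f y + -1 * cv w a x f y) + - ((z - x) * w x) * f (y + x)).
  assert (rtx : real_test M (fun y => f (y + x))) by (apply real_test_trans; assumption).
  assert (rG : real_test M G).
  { apply real_test_lincomb; [exact Mpos| |exact rtx]; apply real_test_lincomb; auto. }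
  assert (EG : minus (minus (tconv (cv w a z f) c) (tconv (cv w a x f) c)) (rs (z - x) (df x)) = tconv G c).
  { unfold G.
    rewrite (tconv_lincomb 1 (- ((z - x) * w x)) (fun y => 1 * cv w a z f y + -1 * cv w a x f y)
      (fun y => f (y + x)) c (real_test_lincomb M Mpos 1 (-1) _ _ (rt a z) (rt a x)) rtx).
    rewrite (tconv_lincomb 1 (-1) _ _ c (rt a z) (rt a x)).
    unfold df; rewrite rs_rs, !rs_1.
    assert (N : forall u v, rs (- u) v = opp (rs u v) :> X).
    { intros u v; unfold rs; rewrite RtoC_opp; exact (scal_opp_l (RtoC u : C_AbsRing) v). }
    rewrite N, (N 1), rs_1.
    replace (tconv (fun y => f (y + x)) c) with (tconv f (x + c)); [reflexivity|].
    unfold tconv; f_equal; extensionality y; f_equal; ring. }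
  rewrite EG.
  (* Between [x] and [z] the weight and all translated derivatives vary little, the latter uniformly
     in [p] at scale [h]; so the integral is small compared with [z - x]. *)
  assert (DG : forall p y, Derive_n G p y =
    RInt (fun t => w t * Derive_n f p (y + t) - w x * Derive_n f p (y + x)) x z).
  { intros p y; unfold G.
    rewrite Derive_n_lincomb; [|apply smoothR_lincomb; apply rt|apply rtx].
    rewrite Derive_n_lincomb by apply rt.
    rewrite !Derive_n_cv, Derive_n_comp_trans by assumption; unfold cv.
    pose proof (cv_ex_RInt w cw (Derive_n f p) y) as ex.
    rewrite (RInt_minus (V := R_CompleteNormedModule)); [|apply ex, cf|apply ex_RInt_const].
    rewrite RInt_const.
    rewrite <- (RInt_Chasles (V := R_CompleteNormedModule) _ a x z) by (apply ex, cf).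
    unfold minus, plus, opp, scal; simpl; unfold mult; simpl; ring. }
  eapply Rle_trans; [apply (tconv_sup_bound G R0 (Rabs (z - x) * (e1 * (B + Rabs (w x))))); [lra| | |exact rG|]|].
  - assert (Ez : Rabs z <= Rabs x + 1).
    { pose proof (Rabs_triang x (z - x)) as P; replace (x + (z - x)) with z in P by ring; lra. }
    intros y Hy; pose proof (DG 0%nat y) as E0; simpl in E0; rewrite E0.
    rewrite (RInt_ext (V := R_CompleteNormedModule) _ (fun _ => 0)); [rewrite RInt_const; exact (Rmult_0_r _)|].
    assert (out : forall t, Rabs t <= Rabs x + 1 -> f (y + t) = 0).
    { intros t Ht; apply Hr; pose proof (Rabs_triang (y + t) (- t)) as P; rewrite Rabs_Ropp in P.
      replace (y + t + - t) with y in P by ring; unfold R0 in Hy; pose proof (Rabs_pos x); lra. }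
    intros t Ht; rewrite !out; [match goal with |- ?u = ?v => change (@eq R u v) end; ring|lra|].
    pose proof (Rle_abs x); pose proof (Rle_abs (- x)); pose proof (Rle_abs z); pose proof (Rle_abs (- z)).
    rewrite Rabs_Ropp in *; unfold Rmin, Rmax in Ht; destruct (Rle_dec x z); apply Rabs_le; lra.
  - pose proof (Rabs_pos (z - x)); pose proof (Rabs_pos (w x)).
    apply Rmult_le_pos; [assumption|apply Rmult_le_pos; lra].
  - intros p y; rewrite DG.
    assert (hp : 0 < h ^ p) by (apply pow_lt, h0).
    assert (I : Rabs (RInt (fun t => w t * Derive_n f p (y + t) - w x * Derive_n f p (y + x)) x z)
       <= Rabs (z - x) * (e1 * (B + Rabs (w x)) * M p / h ^ p)).
    { apply RInt_abs_le_seg.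
      - intros t; apply continuous_Rminus; [apply cv_integrand_continuous; [exact cw|apply cf]|apply continuous_const].
      - intros t Ht.
        assert (tx : Rabs (t - x) <= Rabs (z - x)).
        { unfold Rmin, Rmax in Ht; destruct (Rle_dec x z).
          - rewrite !Rabs_pos_eq by lra; lra.
          - rewrite !Rabs_left1 by lra; lra. }
        apply Rle_div_r; [exact hp|].
        replace (w t * Derive_n f p (y + t) - w x * Derive_n f p (y + x)) with
          ((w t - w x) * Derive_n f p (y + t) + w x * (Derive_n f p (y + x + (t - x)) - Derive_n f p (y + x)))
          by (replace (y + x + (t - x)) with (y + t) by ring; ring).
        pose proof (Rabs_triang ((w t - w x) * Derive_n f p (y + t))
          (w x * (Derive_n f p (y + x + (t - x)) - Derive_n f p (y + x)))) as P.
        rewrite !Rabs_mult in P.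
        pose proof (Hd1 t ltac:(lra)) as P1; pose proof (Hd2 (t - x) ltac:(lra) p (y + x)) as P2.
        pose proof (HB p (y + t)) as P3.
        set (u := Rabs (Derive_n f p (y + t))) in *.
        set (v := Rabs (Derive_n f p (y + x + (t - x)) - Derive_n f p (y + x))) in *.
        assert (u0 : 0 <= u) by apply Rabs_pos.
        assert (Q1 : Rabs (w t - w x) * (h ^ p * u) <= e1 * (B * M p)).
        { apply Rmult_le_compat; [apply Rabs_pos|apply Rmult_le_pos; lra|lra|exact P3]. }
        assert (Q2 : Rabs (w x) * (h ^ p * v) <= Rabs (w x) * (e1 * M p)).
        { apply Rmult_le_compat_l; [apply Rabs_pos|exact P2]. }
        apply (Rmult_le_compat_r (h ^ p)) in P; lra. }
    apply (Rmult_le_compat_l (h ^ p)) in I; [|lra].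
    eapply Rle_trans; [exact I|]; apply Req_le; field; lra.
  - pose proof (Rabs_pos (z - x)) as zx.
    replace (K * (2 * R0 * (Rabs (z - x) * (e1 * (B + Rabs (w x))))))
      with (K * (2 * R0) * (B + Rabs (w x)) * e1 * Rabs (z - x)) by ring.
    apply Rmult_le_compat_r; [exact zx|].
    apply Rle_trans with (Q * e1).
    + apply Rmult_le_compat_r; [lra|]; unfold Q; apply Rmult_le_compat_l; [apply Rmult_le_pos; lra|lra].
    + apply Rle_trans with ((Q + 1) * e1); [lra|unfold e1; apply Req_le; field; lra]. }
pose proof (is_RInt_derive (V := realify X) (fun z => tconv (cv w a z f) c) df a b) as I.
specialize (I (fun x _ => D x) (fun x _ => continuous_RtoC_scal w _ x (cw x) (tconv_continuous_add f c x Hf))).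
apply (is_RInt_unique (V := realify X)) in I; refine (eq_trans _ (eq_sym I)).
assert (Ez : tconv (cv w a a f) c = zero).
{ replace (cv w a a f) with (fun y => 0 * f y + 0 * f y).
  - rewrite tconv_lincomb by assumption; unfold rs; rewrite !scal_C0; exact (plus_zero_l zero).
  - extensionality y; unfold cv; rewrite RInt_point; unfold zero; simpl; ring. }
cbv beta; rewrite Ez.
symmetry; exact (eq_trans (f_equal (plus _) opp_zero) (plus_zero_r _)).
Qed.

End RealPart.

(** * Cancellation of averages against operator factors *)

Lemma suppR_endpoint (f : R -> R) r t : 0 <= r -> (forall t, continuous f t) -> suppR r f ->
  Rabs t = r -> f t = 0.
Proof.
intros r0 cf Hf Ht; apply NNPP; intros N.
assert (p : 0 < Rabs (f t)) by (apply Rabs_pos_lt, N).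
destruct (proj1 (continuous_R f t) (cf t) _ p) as [d [d0 Hd]].
set (e := if Rle_dec 0 t then d / 2 else - (d / 2)).
assert (e1 : Rabs e < d) by (unfold e; destruct (Rle_dec 0 t); [rewrite Rabs_pos_eq|rewrite Rabs_left]; lra).
assert (e2 : r < Rabs (t + e)).
{ rewrite <- Ht; unfold e; destruct (Rle_dec 0 t); [rewrite !Rabs_pos_eq|rewrite !Rabs_left]; lra. }
specialize (Hd (t + e)); replace (t + e - t) with e in Hd by ring; specialize (Hd e1).
rewrite (Hf _ e2), Rminus_0_l, Rabs_Ropp in Hd; lra.
Qed.

(* Integration by parts against [mu * d/dx + 1], the inverse of the exponential average. *)
Lemma cv_step mu r (phi chi : R -> R) z : 0 < mu -> 0 < r -> smoothR phi -> suppR r phi ->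
  (forall t, continuous chi t) ->
  cv (fun t => phi t - mu * Derive phi t) (- r) r (avg mu chi) z =
  kap * (cv phi (- r) r chi z - rho * cv phi (- r) r chi (z - mu)).
Proof.
intros m0 r0 Sp Hp cchi.
assert (c0 : forall t, continuous phi t) by (intros t; exact (smoothR_continuous phi 0 t Sp)).
assert (c1 : forall t, continuous (Derive phi) t) by (intros t; exact (smoothR_continuous phi 1 t Sp)).
assert (ca : forall t, continuous (avg mu chi) t) by (intros t; apply continuous_avg; assumption).
assert (cd : forall t, continuous (Dav mu chi) t) by (intros t; apply continuous_Dav; assumption).
set (dG := fun t => Derive phi t * avg mu chi (z + t) + phi t * Dav mu chi (z + t)).
assert (H : is_RInt dG (- r) r
  (minus (phi r * avg mu chi (z + r)) (phi (- r) * avg mu chi (z + - r)))).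
{ apply (is_RInt_derive (V := R_CompleteNormedModule) (fun t => phi t * avg mu chi (z + t))).
  - intros t _; unfold dG.
    assert (d1 : is_derive phi t (Derive phi t)) by (apply Derive_correct; exact (Sp 0%nat t)).
    assert (d2 : is_derive (fun t => avg mu chi (z + t)) t (Dav mu chi (z + t))).
    { rewrite <- (Rmult_1_l (Dav mu chi (z + t))).
      apply (is_derive_comp (V := R_NormedModule) (avg mu chi) (fun t => z + t)); [apply is_derive_avg; assumption|].
      auto_derive; [exact I|ring]. }
    exact (is_derive_mult (K := R_AbsRing) _ _ t _ _ d1 d2 Rmult_comm).
  - intros t _; apply (continuous_plus (V := R_NormedModule));
      apply cv_integrand_continuous; assumption. }
apply (is_RInt_unique (V := R_CompleteNormedModule)) in H.
rewrite (suppR_endpoint phi r r), (suppR_endpoint phi r (- r)) in H; try assumption; try lra;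
  [|rewrite Rabs_Ropp; apply Rabs_pos_eq; lra|apply Rabs_pos_eq; lra].
rewrite !Rmult_0_l in H.
assert (H' : RInt (fun t => Derive phi t * avg mu chi (z + t)) (- r) r + cv phi (- r) r (Dav mu chi) z = 0).
{ transitivity (minus 0 0); [|apply (minus_eq_zero (G := R_AbelianGroup))].
  rewrite <- H; symmetry; apply (RInt_plus (V := R_CompleteNormedModule)); apply cv_ex_RInt; assumption. }
assert (E1 : cv (fun t => phi t - mu * Derive phi t) (- r) r (avg mu chi) z =
  cv phi (- r) r (avg mu chi) z - mu * RInt (fun t => Derive phi t * avg mu chi (z + t)) (- r) r).
{ unfold cv.
  rewrite <- (RInt_scal (V := R_CompleteNormedModule)) by (apply cv_ex_RInt; assumption).
  assert (ex : ex_RInt (fun t => scal mu (Derive phi t * avg mu chi (z + t))) (- r) r).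
  { apply (ex_RInt_scal (V := R_NormedModule)), cv_ex_RInt; assumption. }
  rewrite <- (RInt_minus (V := R_CompleteNormedModule)); [|apply cv_ex_RInt; assumption|exact ex].
  apply (RInt_ext (V := R_CompleteNormedModule)); intros t _.
  unfold minus, plus, opp, scal; simpl; unfold mult; simpl; ring. }
assert (E2 : cv phi (- r) r (avg mu chi) z + mu * cv phi (- r) r (Dav mu chi) z =
  kap * (cv phi (- r) r chi z - rho * cv phi (- r) r chi (z - mu))).
{ unfold cv.
  rewrite <- !(RInt_scal (V := R_CompleteNormedModule)) by (try apply cv_ex_RInt; assumption).
  assert (ex : forall a (f : R -> R), (forall t, continuous f t) -> forall y, ex_RInt (fun t => scal a (phi t * f (y + t))) (- r) r).
  { intros a f cf y; apply (ex_RInt_scal (V := R_NormedModule)), cv_ex_RInt; assumption. }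
  rewrite <- (RInt_minus (V := R_CompleteNormedModule)); [|apply cv_ex_RInt; assumption|apply ex, cchi].
  rewrite <- (RInt_scal (V := R_CompleteNormedModule)).
  2:{ apply (ex_RInt_minus (V := R_NormedModule)); [apply cv_ex_RInt; assumption|apply ex, cchi]. }
  rewrite <- (RInt_plus (V := R_CompleteNormedModule)); [|apply cv_ex_RInt; assumption|apply ex, cd].
  apply (RInt_ext (V := R_CompleteNormedModule)); intros t _.
  replace (z - mu + t) with (z + t - mu) by ring.
  unfold minus, plus, opp, scal; simpl; unfold mult; simpl; unfold Dav; field; lra. }
rewrite E1, <- E2.
match goal with |- ?a - mu * ?b = ?a + mu * ?c => replace b with (- c) by lra end; ring.
Qed.

(** The substitution [u = z + t]; extending both integrals to [[- R0, R0]] makes the change of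
    limits harmless. *)
Lemma cv_swap r s (phi chi : R -> R) z : 0 < r -> 0 <= s ->
  (forall t, continuous phi t) -> (forall t, continuous chi t) -> suppR r phi -> suppR s chi ->
  cv phi (- r) r chi z = cv chi (- s) s phi (- z).
Proof.
intros r0 s0 cp cc Hp Hc; unfold cv.
set (R0 := r + s + Rabs (- z)); pose proof (Rabs_pos (- z)).
set (g := fun u => chi u * phi (- z + u)).
assert (cg : forall t, continuous g t) by (intros t; apply cv_integrand_continuous; assumption).
rewrite <- (RInt_supp_shift g s R0 (- z)); [|exact s0|unfold R0; lra|exact cg|].
2:{ intros t Ht; unfold g; rewrite Hc by exact Ht; ring. }
rewrite <- (RInt_supp (fun t => phi t * chi (z + t)) r R0); [|lra|unfold R0; lra| |].
- apply RInt_ext; intros t _; unfold g.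
  replace (- z + (t - - z)) with t by ring; replace (t - - z) with (z + t) by ring; apply Rmult_comm.
- intros t; apply cv_integrand_continuous; assumption.
- intros t Ht; rewrite Hp by exact Ht; ring.
Qed.

(** The product of the difference operators [kap * (1 - rho tau_(lam j))], [j < n]: what is left
    when each operator factor has met its average. *)
Fixpoint Qz (lam : nat -> R) (n : nat) (k : R -> R) : R -> R :=
  match n with
  | O => k
  | S n => Qz lam n (fun z => kap * k z + - (kap * rho) * k (z + - lam n))
  end.

(** From the innermost average outwards, each factor [1 - lam j d/dx] on [phi] meets the average of
    the same scale, and [cv_step] replaces the pair by a difference operator on the correlation. *)
Lemma cv_psiR M h r : (forall j, 0 < lam M h j) -> 0 < r ->
  forall n phi chi, smoothR phi -> suppR r phi -> (forall t, continuous chi t) ->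
  cv (psiR M h n phi) (- r) r (prodA (lam M h) n chi) = Qz (lam M h) n (cv phi (- r) r chi).
Proof.
intros lpos r0; induction n as [|n IH]; intros phi chi Sp Hp cc; [reflexivity|].
rewrite prodA_S_r; change (psiR M h (S n) phi) with (psiR M h n (fun t => phi t - lam M h n * Derive phi t)).
rewrite IH; [|apply smoothR_step, Sp|apply suppR_step, Hp|intros t; apply continuous_avg; auto].
change (Qz (lam M h) (S n) (cv phi (- r) r chi)) with
  (Qz (lam M h) n (fun z => kap * cv phi (- r) r chi z + - (kap * rho) * cv phi (- r) r chi (z + - lam M h n))).
f_equal; extensionality z; rewrite (cv_step (lam M h n) r phi chi z) by auto; unfold Rminus; ring.
Qed.

(** * Linearity of weighted integrals and their commutation with inversion *)

Section WeightedLinear.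

Context {X : CompleteNormedModule C_AbsRing}.

Lemma rs_scal_comm r (z : C) (x : X) : rs r (scal (z : C_AbsRing) x) = scal (z : C_AbsRing) (rs r x).
Proof. unfold rs; rewrite !scal_assoc; f_equal; exact (Cmult_comm (RtoC r) z). Qed.

(** [realify X] knows real scalars only; a complex scalar is pulled out of the Riemann sums and then
    of their limit. *)
Lemma is_RInt_scal_complex (u : C) (f : R -> X) a b l : is_RInt (V := realify X) f a b l ->
  is_RInt (V := realify X) (fun t => scal (u : C_AbsRing) (f t)) a b (scal (u : C_AbsRing) l).
Proof.
intros H; unfold is_RInt.
assert (E : forall ptd, Riemann_sum (V := realify X) (fun t => scal (u : C_AbsRing) (f t)) ptd =
  scal (u : C_AbsRing) (Riemann_sum (V := realify X) f ptd)).
{ intros ptd; apply (SF_cons_ind (T := R) (fun ptd => Riemann_sum (V := realify X) (fun t => scal (u : C_AbsRing) (f t)) ptd =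
  scal (u : C_AbsRing) (Riemann_sum (V := realify X) f ptd))).
  - intros x0; symmetry; exact (scal_zero_r (u : C_AbsRing)).
  - intros q s IH; rewrite !(Riemann_sum_cons (V := realify X)), IH.
    refine (eq_trans _ (eq_sym (scal_distr_l (u : C_AbsRing) _ _))).
    f_equal; exact (rs_scal_comm _ u _). }
apply (filterlim_ext (fun ptd => scal (u : C_AbsRing)
  (scal (V := realify X) (sign (b - a)) (Riemann_sum (V := realify X) f ptd)))).
{ intros ptd; rewrite E; symmetry; exact (rs_scal_comm _ u _). }
refine (filterlim_comp _ _ _ _ _ _ _ _ H _).
exact (filterlim_scal_r (V := X) (u : C_AbsRing) l).
Qed.

Lemma continuous_rs_plus a b (f g : R -> X) t : continuous f t -> continuous g t ->
  continuous (fun s => plus (rs a (f s)) (rs b (g s))) t.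
Proof.
intros cf cg; apply (continuous_plus (V := realify X));
  apply (continuous_RtoC_scal (fun _ => _)); first [assumption|apply continuous_const].
Qed.

Lemma weighted_lincomb (W : R -> C) (f g : R -> X) a b r c : continuousC W ->
  (forall t, continuous f t) -> (forall t, continuous g t) ->
  weighted W (fun t => plus (rs a (f t)) (rs b (g t))) r c =
  plus (rs a (weighted W f r c)) (rs b (weighted W g r c)).
Proof.
intros cW cf cg; unfold weighted.
pose proof (weighted_ex_RInt W f c (- r) r cW cf) as e1.
pose proof (weighted_ex_RInt W g c (- r) r cW cg) as e2.
apply (is_RInt_unique (V := realify X)).
refine (is_RInt_ext (V := realify X) _ _ _ _ _ _
  (is_RInt_plus (V := realify X) _ _ _ _ _ _
    (is_RInt_scal (V := realify X) _ _ _ a _ (RInt_correct (V := realify X) _ _ _ e1))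
    (is_RInt_scal (V := realify X) _ _ _ b _ (RInt_correct (V := realify X) _ _ _ e2)))).
intros t _; symmetry.
refine (eq_trans (scal_distr_l (W t : C_AbsRing) (rs a (f (t + c))) (rs b (g (t + c)))) _).
rewrite <- !rs_scal_comm; reflexivity.
Qed.

Lemma weighted_weight_lincomb (W W1 W2 : R -> C) (u v : C) (f : R -> X) r c :
  continuousC W1 -> continuousC W2 -> (forall t, continuous f t) ->
  (forall t, W t = u * W1 t + v * W2 t)%C ->
  weighted W f r c = plus (scal (u : C_AbsRing) (weighted W1 f r c)) (scal (v : C_AbsRing) (weighted W2 f r c)).
Proof.
intros c1 c2 cf EW; unfold weighted.
pose proof (weighted_ex_RInt W1 f c (- r) r c1 cf) as e1.
pose proof (weighted_ex_RInt W2 f c (- r) r c2 cf) as e2.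
apply (is_RInt_unique (V := realify X)).
refine (is_RInt_ext (V := realify X) _ _ _ _ _ _
  (is_RInt_plus (V := realify X) _ _ _ _ _ _
    (is_RInt_scal_complex u _ _ _ _ (RInt_correct (V := realify X) _ _ _ e1))
    (is_RInt_scal_complex v _ _ _ _ (RInt_correct (V := realify X) _ _ _ e2)))).
intros t _; rewrite EW, !scal_assoc; symmetry.
exact (scal_distr_r (u * W1 t : C_AbsRing)%C (v * W2 t)%C (f (t + c))).
Qed.

Lemma boundedX_weighted (W : R -> C) (F : R -> X) r k : 0 < r -> continuousC W ->
  (forall t, continuous F t) -> 0 <= k -> (forall t, Cmod (W t) <= k) -> boundedX F ->
  boundedX (weighted W F r).
Proof.
intros r0 cW cF k0 Hk [B HB]; eexists; intros x; exact (norm_weighted W F r x k B r0 cW cF k0 Hk HB).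
Qed.

(** The right side solves the functional equation of the left by linearity of the integral;
    uniqueness of bounded solutions replaces an interchange of series and integral. *)
Lemma weighted_Cop (W : R -> C) (F : R -> X) r k L mu x : 0 < r -> continuousC W -> 0 <= k ->
  (forall t, Cmod (W t) <= k) -> boundedX F -> lipschitzX L F ->
  Cop mu (weighted W F r) x = weighted W (Cop mu F) r x.
Proof.
intros r0 cW k0 Hk HF HL.
assert (cF : forall t, continuous F t) by (apply (lipschitzX_continuous L), HL).
assert (cC : forall t, continuous (Cop mu F) t).
{ apply (lipschitzX_continuous L), Cop_lipschitz; assumption. }
apply Cop_unique.
- apply (boundedX_weighted W F r k); assumption.
- apply (boundedX_weighted W (Cop mu F) r k); try assumption; apply Cop_bounded, HF.
- intros y; unfold mix.
  assert (cs : forall t, continuous (fun t => Cop mu F (t - mu)) t).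
  { intros t; exact (continuous_shift (Cop mu F) (- mu) t cC). }
  transitivity (weighted W (fun t => plus (rs (1 - rho) (F t)) (rs rho (Cop mu F (t - mu)))) r y).
  + unfold weighted; apply (RInt_ext (V := realify X)); intros t _; f_equal; exact (Cop_eq mu F (t + y) HF).
  + rewrite weighted_lincomb by assumption.
    f_equal; f_equal; unfold weighted; apply (RInt_ext (V := realify X)); intros t _; do 2 f_equal; ring.
Qed.

Lemma Cprod_bounded lam n (F : R -> X) : boundedX F -> boundedX (Cprod lam n F).
Proof. intros [B HB]; exists B; apply Cprod_bound, HB. Qed.

Lemma weighted_Cprod (W : R -> C) (F : R -> X) r k L lam n : 0 < r -> continuousC W -> 0 <= k ->
  (forall t, Cmod (W t) <= k) -> boundedX F -> lipschitzX L F ->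
  Cprod lam n (weighted W F r) = weighted W (Cprod lam n F) r.
Proof.
intros r0 cW k0 Hk HF HL; induction n as [|n IH]; [reflexivity|].
simpl; rewrite IH; extensionality x.
apply (weighted_Cop W (Cprod lam n F) r k L); try assumption.
- apply Cprod_bounded, HF.
- apply Cprod_lipschitz; assumption.
Qed.

End WeightedLinear.

(** * Undoing the difference operators on convolutions *)

Section Inversion.

Context {X : CompleteNormedModule C_AbsRing} (M : nat -> R) (Mpos : forall p, 0 < M p).
Context (T : (R -> C) -> X) (HT : continuous_linear (DL1 Beurling M) T).
Context (h K : R) (h0 : 0 < h) (K0 : 0 <= K).
Context (HK : forall f B, carrier (Dspace Beurling M) f -> L1bound M h f B -> norm (T f) <= K * B).

Local Notation tconv := (tconv T).

Let btconv g : real_test M g -> boundedX (tconv g) := tconv_bounded M Mpos T h K h0 HK g.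

(** Applying one difference operator to [k] gives [q], and [tconv k] is a bounded solution of the
    equation with data [tconv q]; uniqueness identifies it with the inverse. The algebra is
    [kap * (1 - rho) = 1]. *)
Lemma Cprod_tconv_Qz lam n : forall k, real_test M k -> Cprod lam n (tconv (Qz lam n k)) = tconv k.
Proof.
induction n as [|n IH]; intros k Hk; [reflexivity|].
pose proof rho_bounds as rb; pose proof kap_rho as kr.
set (q := fun z => kap * k z + - (kap * rho) * k (z + - lam n)).
assert (Hs : real_test M (fun z => k (z + - lam n))) by (apply (real_test_trans M Mpos), Hk).
assert (Hq : real_test M q) by (apply (real_test_lincomb M Mpos); assumption).
change (Cprod lam (S n) (tconv (Qz lam (S n) k))) with (Cop (lam n) (Cprod lam n (tconv (Qz lam n q)))).
rewrite (IH q Hq); extensionality x; apply Cop_unique; [apply btconv, Hq|apply btconv, Hk|].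
intros y; unfold q; rewrite (tconv_lincomb M Mpos T HT) by assumption.
replace (tconv (fun z => k (z + - lam n)) y) with (tconv k (y - lam n)).
2:{ apply (f_equal T); extensionality t; do 2 f_equal; ring. }
unfold mix; rewrite rs_plus, !rs_rs.
set (u := tconv k y); set (v := tconv k (y - lam n)).
replace ((1 - rho) * kap) with 1 by lra.
replace ((1 - rho) * - (kap * rho)) with (- rho).
2:{ transitivity (- (kap * (1 - rho) * rho)); [rewrite kr|]; ring. }
rewrite rs_1, <- (plus_assoc u), <- rs_add, Rplus_opp_l.
unfold rs; rewrite scal_C0; symmetry; exact (plus_zero_r u).
Qed.

Lemma weighted_tconv (w : R -> R) (cw : forall t, continuous w t) g r c : real_test M g ->
  weighted (fun t => RtoC (w t)) (tconv g) r c = tconv (cv w (- r) r g) c.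
Proof. intros Hg; exact (eq_sym (tconv_cv M Mpos T HT h K h0 K0 HK w cw (- r) r g c Hg)). Qed.

End Inversion.

Lemma continuous_supp_bounded (f : R -> R) r : (forall t, continuous f t) -> suppR r f ->
  exists k, 0 <= k /\ forall t, Rabs (f t) <= k.
Proof.
intros cf Hf; destruct (continuous_bounded_seg f (- r) r cf) as [k [k0 Hk]].
exists k; split; [exact k0|]; intros t; destruct (Rle_lt_dec (Rabs t) r) as [H|H].
- apply Hk; pose proof (Rabs_pos t); rewrite Rmin_left, Rmax_right by lra.
  apply Rabs_le_between, H.
- rewrite Hf by exact H; rewrite Rabs_R0; exact k0.
Qed.

Lemma continuousC_RtoC (f : R -> R) : (forall t, continuous f t) -> continuousC (fun t => RtoC (f t)).
Proof. intros cf t; split; [exact (cf t)|apply continuous_const]. Qed.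

Lemma rs_minus_eq {X : CompleteNormedModule C_AbsRing} (x y : X) : plus (rs 1 x) (rs (-1) y) = minus x y.
Proof.
rewrite rs_1; unfold minus; f_equal; unfold rs.
replace (-1) with (- (1)) by ring; rewrite RtoC_opp; apply scal_Copp1.
Qed.

(** * The approximating functions and their pairings with test functions *)

Section Representation.

Context {X : CompleteNormedModule C_AbsRing} (M : nat -> R) (Mpos : forall p, 0 < M p) (M0 : M 0%nat = 1).
Context (HM1 : condM1 M) (HM3' : condM3' M) (HM3 : condM3 M).
Context (T : (R -> C) -> X) (HT : continuous_linear (DL1 Beurling M) T).
Context (h K : R) (h0 : 0 < h) (K0 : 0 <= K).
Context (HK : forall f B, carrier (Dspace Beurling M) f -> L1bound M h f B -> norm (T f) <= K * B).
Context (d : nat -> R) (Hd : summable_scales d) (dgeom : forall j, (/ 2) ^ j <= d j).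
Context (dfast : forall K, exists N, forall j, (N <= j)%nat -> K * (M j / M (S j)) <= d j).

Local Notation lam := (lam M h).
Local Notation scales := (scales M h d).
Local Notation phiN := (phiN M h d).
Local Notation radius := (radius M h d).

Let slam : summable_scales lam := summable_lam M Mpos HM3' h h0.
Let smix : forall N, summable_scales (scales N) := summable_scales_mixed M Mpos HM3' h h0 d Hd.
Let rtN : forall N, real_test M (phiN N) := phiN_real_test M Mpos HM3' h h0 d Hd dfast.

(** These are the convolutions to which (iv) is applied. *)
Definition FN (N : nat) : R -> X := tconv T (phiN N).

Lemma FN_cauchy eps : 0 < eps -> exists N0, forall N N', (N0 <= N)%nat -> (N0 <= N')%nat ->
  forall x, norm (minus (FN N x) (FN N' x)) <= eps.
Proof.
intros e0; assert (e1 : 0 < eps / (K + 1)) by (apply Rdiv_lt_0_compat; lra).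
destruct (phiN_cauchy M Mpos M0 HM3' h h0 d Hd dfast _ e1) as [P HP]; exists P; intros N N' HN HN' x.
pose proof (real_test_lincomb M Mpos 1 (-1) _ _ (rtN N) (rtN N')) as rt.
replace (minus (FN N x) (FN N' x)) with (tconv T (fun t => 1 * phiN N t + -1 * phiN N' t) x).
- apply Rle_trans with (K * (eps / (K + 1))).
  + apply (tconv_bound M Mpos T h K HK _ (eps / (K + 1)) rt); intros p r r0.
    rewrite (RInt_ext (V := R_CompleteNormedModule) _ (fun t => Rabs (Derive_n (phiN N) p t - Derive_n (phiN N') p t))).
    * apply HP; assumption.
    * intros t _; rewrite (Derive_n_lincomb 1 (-1) _ _ p t (proj1 (rtN N)) (proj1 (rtN N'))); f_equal; ring.
  + apply Rle_trans with ((K + 1) * (eps / (K + 1))); [lra|apply Req_le; field; lra].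
- rewrite (tconv_lincomb M Mpos T HT) by apply rtN.
  apply rs_minus_eq.
Qed.

(** For nearby points the mean value theorem costs one extra derivative, paid by
    [prod4_scales_next]; for [Rabs (x - y) > 1] boundedness suffices, whence the summand [2 * BF].
    The constant may depend on [N]. *)
Lemma FN_lipschitz N : exists L, 0 <= L /\ lipschitzX L (FN N).
Proof.
destruct (tconv_bounded M Mpos T h K h0 HK _ (rtN N)) as [BF HBF].
destruct (prod4_scales_next M Mpos HM3' h h0 d Hd dgeom dfast N) as [B HB].
set (b := / width N).
assert (b0 : 0 < b) by (apply Rinv_0_lt_compat, width_pos).
assert (BF0 : 0 <= BF) by exact (Rle_trans _ _ _ (norm_ge_0 _) (HBF 0)).
assert (B0 : 0 <= B).
{ specialize (HB 0%nat); rewrite M0, Rmult_1_r in HB.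
  eapply Rle_trans; [|exact HB].
  change (0 <= 1 * prod4 (scales N) 1); pose proof (prod4_pos 1 _ (proj1 (smix N))); lra. }
(* The 1 makes room for a translation by at most 1. *)
set (R0 := phi_radius M h d + 1).
assert (R00 : 0 < R0).
{ pose proof (phi_radius_pos M Mpos HM3' h h0 d Hd); unfold R0; lra. }
set (L := K * (2 * R0 * (b * B))).
assert (L0 : 0 <= L).
{ unfold L; apply Rmult_le_pos; [exact K0|]; apply Rmult_le_pos; [lra|apply Rmult_le_pos; lra]. }
exists (L + 2 * BF); split; [lra|]; intros x y.
pose proof (Rabs_pos (x - y)) as xy0.
destruct (Rle_lt_dec (Rabs (x - y)) 1) as [Hxy|Hxy].
- pose proof (real_test_trans M Mpos (y - x) _ (rtN N)) as rt'.
  pose proof (real_test_lincomb M Mpos 1 (-1) _ _ (rtN N) rt') as rt.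
  replace (minus (FN N x) (FN N y)) with (tconv T (fun t => 1 * phiN N t + -1 * phiN N (t + (y - x))) x).
  + apply Rle_trans with (K * (2 * R0 * (Rabs (x - y) * (b * B)))).
    * apply (tconv_sup_bound M Mpos T h K h0 HK); [lra| | |exact rt|].
      -- intros t Ht; pose proof (phiN_supp M Mpos HM3' h h0 d Hd N) as S; unfold R0 in Ht.
         rewrite (S t) by lra; rewrite (S (t + (y - x))); [ring|].
         pose proof (Rabs_triang (t + (y - x)) (x - y)) as Q; replace (t + (y - x) + (x - y)) with t in Q by ring; lra.
      -- apply Rmult_le_pos; [exact xy0|apply Rmult_le_pos; lra].
      -- intros p t.
         rewrite (Derive_n_lincomb 1 (-1) _ _ p t (proj1 (rtN N)) (proj1 rt')).
         rewrite Derive_n_comp_trans.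
         assert (I : Rabs (Derive_n (phiN N) p (t + (y - x)) - Derive_n (phiN N) p t) <=
            prod4 (scales N) (S p) * b * Rabs (t + (y - x) - t)).
         { apply increment_bound.
           - intros u; apply rtN.
           - intros u; exact (Derive_n_Phi_bound _ _ _ _ (base_kernel N) (scales N) (S p) u (smix N)). }
         replace (t + (y - x) - t) with (y - x) in I by ring.
         rewrite (Rabs_minus_sym y x) in I.
         replace (1 * Derive_n (phiN N) p t + -1 * Derive_n (phiN N) p (t + (y - x)))
           with (- (Derive_n (phiN N) p (t + (y - x)) - Derive_n (phiN N) p t)) by ring.
         rewrite Rabs_Ropp.
         assert (hp : 0 < h ^ p) by (apply pow_lt, h0).
         apply (Rmult_le_compat_l (h ^ p)) in I; [|lra].
         eapply Rle_trans; [exact I|].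
         replace (h ^ p * (prod4 (scales N) (S p) * b * Rabs (x - y)))
           with (Rabs (x - y) * b * (h ^ p * prod4 (scales N) (S p))) by ring.
         replace (Rabs (x - y) * (b * B) * M p) with (Rabs (x - y) * b * (B * M p)) by ring.
         apply Rmult_le_compat_l; [apply Rmult_le_pos; lra|apply HB].
    * replace (K * (2 * R0 * (Rabs (x - y) * (b * B)))) with (L * Rabs (x - y)) by (unfold L; ring).
      apply Rmult_le_compat_r; lra.
  + rewrite (tconv_lincomb M Mpos T HT 1 (-1) _ _ x (rtN N) rt').
    replace (tconv T (fun t => phiN N (t + (y - x))) x) with (FN N y).
    * apply rs_minus_eq.
    * unfold FN, tconv; f_equal; extensionality t; f_equal; ring.
- eapply Rle_trans; [apply norm_minus_le|].
  pose proof (HBF x) as H1; pose proof (HBF y) as H2; change (tconv T (phiN N)) with (FN N) in *.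
  assert (BF <= BF * Rabs (x - y)) by nra.
  assert (0 <= L * Rabs (x - y)) by (apply Rmult_le_pos; lra).
  lra.
Qed.

(** What remains of [phiN N] once its first [N] averages are split off; it acts as an approximate
    delta. *)
Definition rhoN (N : nat) : R -> R := Phi (base N) (shift N (scales N)).

Lemma phiN_factor N : phiN N = prodA lam N (rhoN N).
Proof.
extensionality x; transitivity (Phi (base N) (scales N) x); [reflexivity|].
rewrite (Phi_prodA _ _ _ _ (base_kernel N) _ N x (smix N)).
apply prodA_ext; [|reflexivity]; intros j Hj; apply mixed_lt, Hj.
Qed.

Lemma rhoN_continuous N t : continuous (rhoN N) t.
Proof. exact (Phi_continuous _ _ _ _ (base_kernel N) _ t (summable_scales_shift _ N (smix N))). Qed.

Lemma rhoN_nonneg N t : 0 <= rhoN N t.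
Proof. exact (Phi_nonneg _ _ _ _ (base_kernel N) _ t (summable_scales_shift _ N (smix N))). Qed.

Lemma radius_pos N : 0 < radius N.
Proof.
destruct (tail_supp M Mpos HM3' h h0 d Hd N N (Nat.le_refl N)) as [_ H].
destruct (Rle_lt_dec (radius N) 0) as [E|E]; [|exact E].
pose proof (width_pos N); pose proof (summable_scales_shift _ N slam) as [a1 a2].
pose proof (summable_scales_shift _ N Hd) as [b1 b2].
pose proof (Series_pos_lt _ a1 a2); pose proof (Series_pos_lt _ b1 b2).
assert (R : radius N = width N + Series (shift N lam) + Series (shift N d)) by reflexivity; lra.
Qed.

Lemma correlation_swap phi r N z : 0 < r -> smoothR phi -> suppR r phi ->
  cv phi (- r) r (rhoN N) z = cv (rhoN N) (- radius N) (radius N) phi (- z).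
Proof.
intros r0 Sp Hp; apply cv_swap; [exact r0|left; apply radius_pos| | |exact Hp|].
- intros t; exact (smoothR_continuous phi 0 t Sp).
- apply rhoN_continuous.
- apply (tail_supp M Mpos HM3' h h0 d Hd N N (Nat.le_refl N)).
Qed.

(** The inversions are pulled out of the integral, which becomes [T] convolved with a correlation.
    There the operator factors cancel the averages up to [Qz], and [Cprod] undoes [Qz]; at the point
    0 only the correlation with the tail density survives. *)
Lemma pairing_identity phi r N : 0 < r -> real_test M phi -> suppR r phi ->
  weighted (fun t => RtoC (psiR M h N phi t)) (Cprod lam N (FN N)) r 0 =
  TR T (cv (rhoN N) (- radius N) (radius N) phi).
Proof.
intros r0 Hphi Hp; pose proof Hphi as [Sp _].
pose proof (psiR_smooth M h N phi Sp) as Sps; pose proof (psiR_supp M h N r phi Hp) as Hps.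
assert (cps : forall t, continuous (psiR M h N phi) t) by (intros t; exact (smoothR_continuous _ 0 t Sps)).
destruct (continuous_supp_bounded _ r cps Hps) as [k [k0 Hk]].
destruct (FN_lipschitz N) as [L [L0 HL]].
rewrite <- (weighted_Cprod _ (FN N) r k L lam N r0 (continuousC_RtoC _ cps) k0).
2:{ intros t; rewrite Cmod_R; apply Hk. }
2:{ apply (tconv_bounded M Mpos T h K h0 HK), rtN. }
2:{ exact HL. }
assert (E : weighted (fun t => RtoC (psiR M h N phi t)) (FN N) r =
  tconv T (Qz lam N (cv phi (- r) r (rhoN N)))).
{ extensionality c; unfold FN.
  rewrite (weighted_tconv M Mpos T HT h K h0 K0 HK _ cps _ r c (rtN N)).
  f_equal; rewrite phiN_factor; apply cv_psiR; [apply slam|exact r0|exact Sp|exact Hp|apply rhoN_continuous]. }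
assert (rt : real_test M (cv (rhoN N) (- radius N) (radius N) phi)).
{ apply real_test_cv; [apply rhoN_continuous|exact Mpos|exact Hphi]. }
assert (Ec : cv phi (- r) r (rhoN N) = fun z => cv (rhoN N) (- radius N) (radius N) phi (0 - z)).
{ extensionality z; rewrite correlation_swap by assumption; f_equal; ring. }
rewrite E, (Cprod_tconv_Qz M Mpos T HT h K h0 HK).
- rewrite Ec; unfold tconv; f_equal; extensionality y; f_equal; ring.
- rewrite Ec; apply (real_test_reflect M Mpos), rt.
Qed.

(* [rhoN N] is a probability density concentrating at 0. *)
Lemma pairing_limit phi : real_test M phi -> forall eps, 0 < eps -> exists N0, forall N, (N0 <= N)%nat ->
  norm (minus (TR T (cv (rhoN N) (- radius N) (radius N) phi)) (TR T phi)) <= eps.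
Proof.
intros Hphi eps e0; pose proof Hphi as [Sp [[r [r0 Hr]] _]].
set (Q := K * (2 * (r + 2))).
assert (Q0 : 0 <= Q) by (unfold Q; apply Rmult_le_pos; lra).
assert (e1 : 0 < eps / (Q + 1)) by (apply Rdiv_lt_0_compat; lra).
destruct (real_translation_modulus M Mpos phi h h0 Hphi _ e1) as [dl [dl0 Hdl]].
pose proof (radius_lim M Mpos HM3' h h0 d Hd) as RL; apply is_lim_seq_spec in RL.
assert (m0 : 0 < Rmin 1 dl) by (apply Rmin_glb_lt; lra).
destruct (RL (mkposreal _ m0)) as [N0 HN0]; simpl in HN0; exists N0; intros N HN.
specialize (HN0 N HN); rewrite Rminus_0_r in HN0.
pose proof (radius_pos N) as s0; rewrite (Rabs_pos_eq _ (Rlt_le _ _ s0)) in HN0.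
pose proof (Rmin_l 1 dl); pose proof (Rmin_r 1 dl).
destruct (tail_supp M Mpos HM3' h h0 d Hd N N (Nat.le_refl N)) as [_ mass].
change (Phi (base N) (shift N (scales N))) with (rhoN N) in mass.
set (s := radius N) in *.
assert (cr : forall t, continuous (rhoN N) t) by (intros; apply rhoN_continuous).
assert (rt : real_test M (cv (rhoN N) (- s) s phi)) by (apply real_test_cv; assumption).
replace (minus (TR T (cv (rhoN N) (- s) s phi)) (TR T phi))
  with (TR T (fun t => 1 * cv (rhoN N) (- s) s phi t + -1 * phi t)).
2:{ rewrite (TR_lincomb M Mpos T HT) by assumption.
    apply rs_minus_eq. }
pose proof (real_test_lincomb M Mpos 1 (-1) _ _ rt Hphi) as rtd.
(* The correlation is supported in radius [r + 2 s], and [s < 1]. *)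
eapply Rle_trans; [apply (TR_sup_bound M Mpos T h K h0 HK _ (r + 2) (eps / (Q + 1)));
  [lra| |lra|exact rtd|]|].
- intros t Ht; rewrite (Hr t) by lra.
  rewrite (cv_supp (rhoN N) (- s) s r phi Hr t); [ring|].
  rewrite Rabs_Ropp, (Rabs_pos_eq s) by lra; lra.
- intros p y; rewrite (Derive_n_lincomb 1 (-1) _ _ p y (proj1 rt) Sp), Derive_n_cv by assumption.
  assert (cD : forall t, continuous (Derive_n phi p) t) by (intros; apply smoothR_continuous, Sp).
  assert (ex : ex_RInt (fun u => rhoN N u * Derive_n phi p (y + u)) (- s) s) by (apply cv_ex_RInt; assumption).
  assert (exr : ex_RInt (rhoN N) (- s) s) by (apply ex_RInt_cont, cr).
  (* Since [rhoN N] has mass 1, the constant [Derive_n phi p y] can be taken under the integral. *)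
  assert (E : is_RInt (fun u => rhoN N u * (Derive_n phi p (y + u) - Derive_n phi p y)) (- s) s
     (1 * cv (rhoN N) (- s) s (Derive_n phi p) y + -1 * Derive_n phi p y)).
  { pose proof (is_RInt_minus (V := R_NormedModule) _ _ _ _ _ _ (RInt_correct (V := R_CompleteNormedModule) _ _ _ ex)
      (is_RInt_scal (V := R_NormedModule) _ _ _ (Derive_n phi p y) _ (RInt_correct (V := R_CompleteNormedModule) _ _ _ exr))) as I.
    rewrite mass in I.
    replace (1 * cv (rhoN N) (- s) s (Derive_n phi p) y + -1 * Derive_n phi p y)
      with (minus (cv (rhoN N) (- s) s (Derive_n phi p) y) (scal (Derive_n phi p y) 1)).
    2:{ unfold minus, plus, opp, scal; simpl; unfold mult; simpl; ring. }
    refine (is_RInt_ext (V := R_NormedModule) _ _ _ _ _ _ I); intros u _.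
    unfold minus, plus, opp, scal; simpl; unfold mult; simpl; ring. }
  assert (hp : 0 < h ^ p) by (apply pow_lt, h0).
  set (e2 := eps / (Q + 1) * M p / h ^ p).
  assert (I : Rabs (1 * cv (rhoN N) (- s) s (Derive_n phi p) y + -1 * Derive_n phi p y) <= e2 * 1).
  { replace (e2 * 1) with (e2 * RInt (rhoN N) (- s) s) by (rewrite mass; reflexivity).
    refine (norm_RInt_le (V := R_NormedModule)
      (fun u => rhoN N u * (Derive_n phi p (y + u) - Derive_n phi p y)) (fun u => e2 * rhoN N u)
      (- s) s _ _ ltac:(lra) _ E (is_RInt_scal (V := R_NormedModule) _ _ _ e2 _
        (RInt_correct (V := R_CompleteNormedModule) _ _ _ exr))).
    intros u Hu; change (Rabs (rhoN N u * (Derive_n phi p (y + u) - Derive_n phi p y)) <= e2 * rhoN N u).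
    rewrite Rabs_mult, (Rabs_pos_eq _ (rhoN_nonneg N u)), Rmult_comm.
    apply Rmult_le_compat_r; [apply rhoN_nonneg|]; unfold e2.
    apply Rle_div_r; [exact hp|]; rewrite Rmult_comm; apply Hdl.
    apply Rle_lt_trans with s; [apply Rabs_le; lra|lra]. }
  apply (Rmult_le_compat_l (h ^ p)) in I; [|lra].
  eapply Rle_trans; [exact I|]; unfold e2; apply Req_le; field; lra.
- replace (K * (2 * (r + 2) * (eps / (Q + 1)))) with (Q * (eps / (Q + 1))) by (unfold Q; ring).
  apply Rle_trans with ((Q + 1) * (eps / (Q + 1))); [|apply Req_le; field; lra].
  apply Rmult_le_compat_r; lra.
Qed.

End Representation.

Lemma weighted_minus {X : CompleteNormedModule C_AbsRing} (W : R -> C) (f g : R -> X) r c k e :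
  0 < r -> continuousC W -> 0 <= k -> (forall t, Cmod (W t) <= k) ->
  (forall t, continuous f t) -> (forall t, continuous g t) ->
  (forall t, norm (minus (f t) (g t)) <= e) ->
  norm (minus (weighted W f r c) (weighted W g r c)) <= 2 * r * (k * e).
Proof.
intros r0 cW k0 Hk cf cg He.
rewrite <- rs_minus_eq, <- (weighted_lincomb W f g) by assumption.
apply norm_weighted; try assumption; intros t; [apply continuous_rs_plus; auto|].
rewrite rs_minus_eq; apply He.
Qed.

Lemma weighted_weight_minus {X : CompleteNormedModule C_AbsRing} (W1 W2 : R -> R) (f : R -> X) r c e B :
  0 < r -> (forall t, continuous W1 t) -> (forall t, continuous W2 t) -> 0 <= e ->
  (forall t, Rabs (W1 t - W2 t) <= e) ->
  (forall t, continuous f t) -> (forall t, norm (f t) <= B) ->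
  norm (minus (weighted (fun t => RtoC (W1 t)) f r c) (weighted (fun t => RtoC (W2 t)) f r c)) <= 2 * r * (e * B).
Proof.
intros r0 c1 c2 e0 He cf HB.
assert (E : forall t, RtoC (W1 t - W2 t) = (1 * RtoC (W1 t) + (- RtoC 1) * RtoC (W2 t))%C).
{ intros t; rewrite RtoC_minus; ring. }
pose proof (weighted_weight_lincomb (fun t => RtoC (W1 t - W2 t)) _ _ 1%C (- RtoC 1)%C f r c
  (continuousC_RtoC _ c1) (continuousC_RtoC _ c2) cf E) as H.
rewrite scal_C1, scal_Copp1 in H.
refine (Rle_trans _ _ _ (Req_le _ _ (f_equal norm (eq_sym H))) _).
apply norm_weighted; try assumption.
- apply (continuousC_RtoC (fun t => W1 t - W2 t)); intros t; apply continuous_Rminus; auto.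
- intros t; rewrite Cmod_R; apply He.
Qed.

Lemma almost_automorphic_zero {X : CompleteNormedModule C_AbsRing} :
  almost_automorphic (fun _ : R => zero : X).
Proof.
split; [intros t; apply (continuous_const (V := X))|].
intros b; exists b; split; [exists (fun n => n); split; [lia|reflexivity]|].
exists (fun _ => zero); intros t; split; apply (filterlim_const (zero : X)).
Qed.

Lemma regular_zero {X : CompleteNormedModule C_AbsRing} (W : R -> C) r : 0 < r ->
  continuousC W -> supported r W -> regular (fun _ : R => zero : X) W = zero.
Proof.
intros r0 cW HW.
assert (c : forall t, continuous (fun _ : R => zero : X) t) by (intros t; apply (continuous_const (V := X))).
rewrite (regular_weighted W _ r r0 cW HW c).
unfold weighted; apply (is_RInt_unique (V := realify X)).
refine (is_RInt_ext (V := realify X) (fun _ => zero) _ _ _ _ _ _).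
- intros t _; symmetry; exact (scal_zero_r (W t : C_AbsRing)).
- pose proof (is_RInt_const (V := realify X) (- r) r zero) as H.
  rewrite (scal_zero_r (V := realify X)) in H; exact H.
Qed.

(** * The implication (iv) -> (i) in the Beurling case *)

Section Converse.

Context {X : CompleteNormedModule C_AbsRing} (M : nat -> R) (Mpos : forall p, 0 < M p) (M0 : M 0%nat = 1).
Context (HM1 : condM1 M) (HM3' : condM3' M) (HM3 : condM3 M) (h : R) (h0 : 0 < h).

Lemma psi_supp r f : suppR r f -> suppR r (psi M h f).
Proof.
intros Hf t Ht; unfold psi; rewrite (Series_ext _ (fun _ => 0 * 0)).
- rewrite Series_scal_l; ring.
- intros p; rewrite (Derive_n_suppR r f p Hf t Ht); ring.
Qed.

Lemma psi_continuous f t : real_test M f -> continuous (psi M h f) t.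
Proof.
intros Hf; apply continuous_uniform_limit; intros eps e0.
destruct (psiR_limit M Mpos M0 HM1 HM3' HM3 h h0 f Hf eps e0) as [N HN].
exists (psiR M h N f); split.
- exact (smoothR_continuous _ 0 t (psiR_smooth M h N f (proj1 Hf))).
- intros s; rewrite Rabs_minus_sym; apply HN, Nat.le_refl.
Qed.

(** Three limits are taken at a common [N]: the inverted convolutions tend to [f], [psiR] of [phi]
    to [psi] of [phi], and [T] of the correlation with the tail density to [T] of [phi].
    [pairing_identity] links them at each finite stage. *)
Lemma assertion_iv_i (T : (R -> C) -> X) : continuous_linear (DL1 Beurling M) T ->
  forall K, 0 <= K ->
  (forall f B, carrier (Dspace Beurling M) f -> L1bound M h f B -> norm (T f) <= K * B) ->
  assertion_iv Beurling M T -> assertion_i Beurling M T.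
Proof.
intros HT K K0 HK Hiv.
assert (slam : summable_scales (lam M h)) by exact (summable_lam M Mpos HM3' h h0).
destruct (slower_summable (fun j => M j / M (S j))) as [d [d1 [d2 [dgeom dfast]]]].
{ intros j; apply Rdiv_lt_0_compat; apply Mpos. }
{ exact HM3'. }
assert (Hd : summable_scales d) by (split; assumption).
set (F := FN M T h d).
assert (FL : forall N, exists L, 0 <= L /\ lipschitzX L (F N)).
{ intros N; apply (FN_lipschitz M Mpos M0 HM3' T HT h K h0 K0 HK d Hd dgeom dfast). }
assert (FAA : forall N, almost_automorphic (F N)).
{ intros N; exact (Hiv _ (real_test_carrier M Mpos _ (phiN_real_test M Mpos HM3' h h0 d Hd dfast N))). }
destruct (Cprod_limit (lam M h) F slam FAA FL) as [f [fAA Hf]].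
{ intros eps e0; exact (FN_cauchy M Mpos M0 HM3' T HT h K h0 K0 HK d Hd dfast eps e0). }
destruct (AA_bounded f fAA) as [Bf HBf].
assert (Bf0 : 0 <= Bf) by exact (Rle_trans _ _ _ (norm_ge_0 _) (HBf 0)).
pose proof (proj1 fAA) as cf.
assert (cG : forall N t, continuous (Cprod (lam M h) N (F N)) t).
{ intros N; destruct (FL N) as [L [_ HL]]; apply (lipschitzX_continuous L), Cprod_lipschitz; [|exact HL].
  apply AA_bounded, FAA. }
assert (main : forall phi r, 0 < r -> real_test M phi -> suppR r phi ->
  weighted (fun t => RtoC (psi M h phi t)) f r 0 = TR T phi).
{ intros phi r r0 Hphi Hr; apply norm_minus_zero_eq, le_epsilon; intros eps e0; rewrite Rplus_0_l.
  assert (cp : forall t, continuous (psi M h phi) t) by (intros; apply psi_continuous, Hphi).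
  destruct (continuous_supp_bounded _ r cp (psi_supp r phi Hr)) as [k [k0 Hk]].
  set (Q := 2 * r * (k + Bf + 1)).
  assert (Q0 : 0 <= Q) by (unfold Q; apply Rmult_le_pos; lra).
  (* With [e <= 1], the approximant [G] is bounded by [Bf + 1], as it differs from [f] by at most
     [e]. *)
  set (e := Rmin 1 (eps / (2 * (Q + 1)))).
  assert (e1 : 0 < e) by (apply Rmin_glb_lt; [lra|apply Rdiv_lt_0_compat; lra]).
  assert (e2 : Q * e <= eps / 2).
  { apply Rle_trans with ((Q + 1) * (eps / (2 * (Q + 1)))); [|apply Req_le; field; lra].
    pose proof (Rmin_r 1 (eps / (2 * (Q + 1)))) as U; fold e in U.
    apply Rmult_le_compat; lra. }
  assert (e3 : 0 < eps / 2) by lra.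
  pose proof (Rmin_l 1 (eps / (2 * (Q + 1)))) as el; fold e in el.
  destruct (Hf e e1) as [N1 HN1].
  destruct (psiR_limit M Mpos M0 HM1 HM3' HM3 h h0 phi Hphi e e1) as [N2 HN2].
  destruct (pairing_limit M Mpos HM3' T HT h K h0 K0 HK d Hd phi Hphi _ e3) as [N3 HN3].
  set (N := (N1 + N2 + N3)%nat).
  specialize (HN1 N ltac:(lia)); specialize (HN2 N ltac:(lia)); specialize (HN3 N ltac:(lia)).
  rewrite <- (pairing_identity M Mpos M0 HM3' T HT h K h0 K0 HK d Hd dgeom dfast phi r N r0 Hphi Hr) in HN3.
  fold F in HN3.
  set (G := Cprod (lam M h) N (F N)) in *.
  assert (cps : forall t, continuous (psiR M h N phi) t).
  { intros t; exact (smoothR_continuous _ 0 t (psiR_smooth M h N phi (proj1 Hphi))). }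
  assert (I1 : norm (minus (weighted (fun t => RtoC (psi M h phi t)) f r 0)
     (weighted (fun t => RtoC (psi M h phi t)) G r 0)) <= 2 * r * (k * e)).
  { apply weighted_minus; try assumption.
    - apply continuousC_RtoC, cp.
    - intros t; rewrite Cmod_R; apply Hk.
    - apply cG.
    - intros t; rewrite norm_minus_sym; apply HN1. }
  assert (I2 : norm (minus (weighted (fun t => RtoC (psi M h phi t)) G r 0)
     (weighted (fun t => RtoC (psiR M h N phi t)) G r 0)) <= 2 * r * (e * (Bf + 1))).
  { apply weighted_weight_minus; try assumption; [lra| |apply cG|].
    - intros t; rewrite Rabs_minus_sym; apply HN2.
    - intros t; eapply Rle_trans; [apply (norm_le_minus (G t) (f t))|].
      specialize (HN1 t); specialize (HBf t); lra. }
  eapply Rle_trans; [apply (norm_minus_triangle (weighted (fun t => RtoC (psi M h phi t)) G r 0))|].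
  eapply Rle_trans; [apply Rplus_le_compat_l,
    (norm_minus_triangle (weighted (fun t => RtoC (psiR M h N phi t)) G r 0))|].
  unfold Q in e2; lra. }
pose proof (udo_coef_class M Mpos M0 HM1 HM3' HM3 h h0) as cls.
(* The second function of the representation is taken to be 0: the operator alone reproduces [T]. *)
exists (udo_coef M h), f, (fun _ => zero).
split; [exact cls|split; [exact fAA|split; [apply almost_automorphic_zero|]]].
intros phi Hphi.
pose proof (proj1 (carrier_Dspace Beurling M Mpos phi) Hphi) as [Sphi [[r [r0 Hr]] _]].
destruct (carrier_real_test M Mpos phi Hphi) as [Hre Him].
set (u := fun s => Re (phi s)) in *; set (v := fun s => Im (phi s)) in *.
assert (Hru : suppR r u) by (intros t Ht; unfold u; rewrite (Hr t Ht); reflexivity).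
assert (Hrv : suppR r v) by (intros t Ht; unfold v; rewrite (Hr t Ht); reflexivity).
assert (cu : forall t, continuous (psi M h u) t) by (intros; apply psi_continuous, Hre).
assert (cv' : forall t, continuous (psi M h v) t) by (intros; apply psi_continuous, Him).
assert (cW : continuousC (udo_test (udo_coef M h) phi)).
{ intros t; split.
  - apply (continuous_ext (psi M h u)); [intros s; rewrite udo_test_coef; reflexivity|apply cu].
  - apply (continuous_ext (psi M h v)); [intros s; rewrite udo_test_coef; reflexivity|apply cv']. }
(* [main] concerns real test functions; complex linearity of both sides extends it to [u + i v]. *)
assert (decomp : forall a b : R, (a, b) = (1 * RtoC a + Ci * RtoC b)%C).
{ intros a b; unfold RtoC, Ci, Cmult, Cplus; simpl; f_equal; ring. }
rewrite (regular_zero phi r r0 (smooth_continuousC phi Sphi) Hr).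
refine (eq_trans _ (eq_sym (plus_zero_r _))).
change (T phi = regular f (udo_test (udo_coef M h) phi)).
rewrite (regular_weighted _ f r r0 cW (udo_test_supported _ phi r Hr) cf).
rewrite (weighted_weight_lincomb _ (fun t => RtoC (psi M h u t)) (fun t => RtoC (psi M h v t)) 1%C Ci f r 0
  (continuousC_RtoC _ cu) (continuousC_RtoC _ cv') cf).
2:{ intros t; rewrite udo_test_coef; apply decomp. }
rewrite (main u r r0 Hre Hru), (main v r r0 Him Hrv).
unfold TR; rewrite <- (proj1 HT) by (apply carrier_DL1, real_test_carrier; assumption).
f_equal; extensionality t; unfold lincomb, u, v; rewrite <- decomp; apply surjective_pairing.
Qed.

End Converse.

Theorem theorem3p4 (X : CompleteNormedModule C_AbsRing) (M : nat -> R)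
  (Mpos : forall p, 0 < M p) (M0 : M 0%nat = 1)
  (HM1 : condM1 M) (HM2 : condM2 M) (HM3' : condM3' M)
  (s : udtype) (T : (R -> C) -> X) (HT : continuous_linear (DL1 s M) T) :
  (assertion_i s M T -> assertion_ii s M T) /\
  (assertion_ii s M T -> assertion_iii s M T) /\
  (assertion_iii s M T -> assertion_iv s M T) /\
  (condM3 M -> s = Beurling ->
     (assertion_i s M T <-> assertion_ii s M T) /\
     (assertion_ii s M T <-> assertion_iii s M T) /\
     (assertion_iii s M T <-> assertion_iv s M T)).
Proof.
pose proof (assertion_i_ii M Mpos s T HT) as H12.
pose proof (assertion_ii_iii M Mpos s T) as H23.
pose proof (assertion_iii_iv M Mpos s T HT) as H34.
split; [exact H12|split; [exact H23|split; [exact H34|]]].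
intros HM3 Es; subst s.
(* The scale [h] at which [T] is bounded fixes the [lam j], hence the operator [P(D)]. *)
destruct (beurling_operator_bound M Mpos T HT) as [h [K [h0 [K0 HK]]]].
pose proof (assertion_iv_i M Mpos M0 HM1 HM3' HM3 h h0 T HT K K0 HK) as H41.
tauto.
Qed.
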